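(* Let $k\ge1$ be a fixed integer and $P_0$ a probability distribution on $\mathbb{R}^k$ with finite second moment. For every $\lambda>0$, $$\lim_{n\to\infty}\frac1nI(\mathbf X,\mathbf Y)=\frac{\lambda\,\|\mathbb{E}_{P_0}(\mathbf X\mathbf X^{\intercal})\|^2}{4}-\sup_{\mathbf q\in S_k^+}\mathcal F(\lambda,\mathbf q).$$ For almost all $\lambda>0$, all the maximizers $\mathbf q$ of $\mathbf q\in S_k^+\mapsto\mathcal F(\lambda,\mathbf q)$ have the same norm $\|\mathbf q\|^2=q^*(\lambda)^2$, and $$\mathrm{MMSE}_n(\lambda)\xrightarrow[n\to\infty]{}\|\mathbb{E}_{P_0}\mathbf X\mathbf X^{\intercal}\|^2-q^*(\lambda)^2.$$
   Context: For $\lambda>0$ and $n\ge1$, consider $Y_{i,j}=\sqrt{\lambda/n}\,\mathbf X_i^{\intercal}\mathbf X_j+Z_{i,j}$ for $1\le i<j\le n$, where $\mathbf X_i\overset{i.i.d.}{\sim}P_0$ (vectors in $\mathbb{R}^k$) and $Z_{i,j}\overset{i.i.d.}{\sim}\mathcal N(0,1)$ are independent. In $I(\mathbf X,\mathbf Y)$ (mutual information, natural logarithm), $\mathbf X=(\mathbf X_1,\dots,\mathbf X_n)$ and $\mathbf Y=(Y_{i,j})_{i<j}$; in $\mathbb{E}_{P_0}(\mathbf X\mathbf X^\intercal)$, $\mathbf X\sim P_0$ is a single vector. $\|A\|=\sqrt{\mathrm{Tr}(A^{\intercal}A)}$ for $k\times k$ matrices. $$\mathrm{MMSE}_n(\lambda)=\min_{\hat\theta}\frac{2}{n(n-1)}\sum_{i<j}\mathbb{E}\big[(\mathbf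 X_i^{\intercal}\mathbf X_j-\hat\theta_{i,j}(\mathbf Y))^2\big]=\frac{2}{n(n-1)}\sum_{i<j}\mathbb{E}\big[(\mathbf X_i^{\intercal}\mathbf X_j-\mathbb{E}[\mathbf X_i^{\intercal}\mathbf X_j|\mathbf Y])^2\big],$$ the minimum being over measurable functions of $\mathbf Y$. $S_k^+$ is the set of $k\times k$ symmetric positive-semidefinite matrices and, for $\mathbf q\in S_k^+$, $$\mathcal F(\lambda,\mathbf q)=-\frac{\lambda}{4}\|\mathbf q\|^2+\mathbb{E}\log\left[\int dP_0(\mathbf x)\exp\Big(\sqrt{\lambda}\,\mathbf Z^{\intercal}\mathbf q^{1/2}\mathbf x+\lambda\,\mathbf x^{\intercal}\mathbf q\mathbf X-\frac{\lambda}{2}\mathbf x^{\intercal}\mathbf q\mathbf x\Big)\right],$$ with $\mathbf Z\sim\mathcal N(0,I_k)$ and $\mathbf X\sim P_0$ independent. *)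

(* Defs.v *)
From HB Require Import structures.
From mathcomp Require Import all_boot all_order all_algebra.
From mathcomp Require Import all_classical all_reals all_analysis.
From mathcomp Require Import measurable_realfun.

Set Implicit Arguments.
Unset Strict Implicit.
Unset Printing Implicit Defensive.

Import Order.TTheory GRing.Theory Num.Theory.
Import numFieldNormedType.Exports.

Local Open Scope classical_set_scope.
Local Open Scope ring_scope.

(* R^k is k.-tuple R, which carries the library's product (= Borel)
   sigma-algebra; linear algebra is done on the associated column vectors. *)
Definition colvec (R : realType) (k : nat) (x : k.-tuple R) : 'cV[R]_k :=
  \col_i tnth x i.

Definition dotp (R : realType) (k : nat) (x y : k.-tuple R) : R :=
  ((colvec x)^T *m colvec y) 0 0.

Definition bilin (R : realType) (k : nat) (A : 'M[R]_k) (x y : k.-tuple R) : R :=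
  ((colvec x)^T *m A *m colvec y) 0 0.

Definition mxnorm (R : realType) (k : nat) (A : 'M[R]_k) : R :=
  Num.sqrt (\tr (A^T *m A)).

Definition psd (R : realType) (k : nat) : set 'M[R]_k :=
  [set q | q^T = q /\ forall v : 'cV[R]_k, 0 <= (v^T *m q *m v) 0 0].

(* The positive semidefinite square root is unique, so that xget returns it;
   the default value 0 is only used when q is not in psd. *)
Definition sqrtmx (R : realType) (k : nat) (q : 'M[R]_k) : 'M[R]_k :=
  xget 0 [set s | psd s /\ s *m s = q].

Definition finite_second_moment (R : realType) (k : nat)
    (P0 : probability (k.-tuple R) R) : Prop :=
  (\int[P0]_x (dotp x x)%:E < +oo)%E.

Definition second_moment (R : realType) (k : nat)
    (P0 : probability (k.-tuple R) R) : 'M[R]_k :=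
  \matrix_(a, b) (\int[P0]_x (tnth x a * tnth x b))%R.

Section iid_law.
Context {R : realType} {d : measure_display} {T : measurableType d}.

Definition tcons (n : nat) (u : T * n.-tuple T) : n.+1.-tuple T :=
  [the n.+1.-tuple T of u.1 :: u.2].

Lemma measurable_tcons n : measurable_fun [set: T * n.-tuple T] (@tcons n).
Proof. exact: (measurable_cons measurable_fst measurable_snd). Qed.

HB.instance Definition _ n :=
  isMeasurableFun.Build _ _ _ _ (@tcons n) (@measurable_tcons n).

(* The n-fold product of P, i.e. the law of n i.i.d. samples of P. *)
Fixpoint iid_law (P : probability T R) (n : nat) : probability (n.-tuple T) R :=
  match n with
  | 0 => \d_ ([tuple] : 0.-tuple T)
  | n'.+1 => distribution (P \x iid_law P n')%E (@tcons n')
  end.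
End iid_law.

(* normal_prob lives on measurableTypeR R, whose sigma-algebra is that of R but
   whose display is not: it is transported along the identity. *)
Definition of_measurableTypeR (R : realType) : measurableTypeR R -> R := idfun.

HB.instance Definition _ (R : realType) :=
  isMeasurableFun.Build _ _ _ _ (@of_measurableTypeR R)
    (@measurable_id _ (measurableTypeR R) setT).

Definition std_normal (R : realType) : probability R R :=
  distribution (normal_prob (0 : R) 1) (@of_measurableTypeR R).

Definition std_gaussian (R : realType) (k : nat) : probability (k.-tuple R) R :=
  iid_law (std_normal R) k.

(* Mutual independence of a family of sigma-algebras F i. *)
Definition mutually_independent (R : realType) (d : measure_display)
    (T : measurableType d) (P : probability T R) (I : eqType)
    (F : I -> set (set T)) : Prop :=
  forall (s : seq I) (A : I -> set T), uniq s ->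
    (forall i, i \in s -> F i (A i)) ->
    P (\bigcap_(i in [set` s]) A i) = (\prod_(i <- s) P (A i))%E.

(* The pairs i < j. *)
Definition edge (n : nat) := {p : 'I_n * 'I_n | (p.1 < p.2)%N}.

(* The sources of randomness of the model of size n. The signal-to-noise ratio l
   only enters through the observations obs below. *)
Record spiked_model (R : realType) (k : nat)
    (P0 : probability (k.-tuple R) R) (n : nat) := SpikedModel {
  sm_display : measure_display ;
  sm_space : measurableType sm_display ;
  sm_prob : probability sm_space R ;
  sm_X : 'I_n -> {mfun sm_space >-> k.-tuple R} ;
  sm_Z : edge n -> {mfun sm_space >-> R} ;
  sm_X_law : forall i (A : set (k.-tuple R)), measurable A ->
    distribution sm_prob (sm_X i) A = P0 A ;
  sm_Z_law : forall e (A : set R), measurable A ->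
    distribution sm_prob (sm_Z e) A = std_normal R A ;
  sm_indep : mutually_independent sm_prob
    (fun v : 'I_n + edge n =>
       match v with
       | inl i => preimage_set_system setT (sm_X i) measurable
       | inr e => preimage_set_system setT (sm_Z e) measurable
       end)
}.

Section observation.
Context {R : realType} {k : nat} {P0 : probability (k.-tuple R) R} {n : nat}.
Variables (M : spiked_model P0 n) (l : R).

Definition overlap (e : edge n) (w : sm_space M) : R :=
  dotp (sm_X M (val e).1 w) (sm_X M (val e).2 w).

Definition obs (e : edge n) (w : sm_space M) : R :=
  Num.sqrt (l / n%:R) * overlap e w + sm_Z M e w.

Definition Xvec (w : sm_space M) : n.-tuple (k.-tuple R) :=
  [tuple sm_X M i w | i < n].

(* The family (Y_{i,j})_{i<j}, listed along the enumeration of the pairs. *)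
Definition Yvec (w : sm_space M) : #|{: edge n}|.-tuple R :=
  [tuple obs (enum_val a) w | a < #|{: edge n}|].

Lemma measurable_overlap e : measurable_fun [set: sm_space M] (overlap e).
Proof.
have mX i a : measurable_fun [set: sm_space M] (fun w => tnth (sm_X M i w) a).
  by apply: (measurableT_comp (@measurable_tnth _ _ _ a)).
rewrite (_ : overlap e = fun w => \sum_(a < k)
    tnth (sm_X M (val e).1 w) a * tnth (sm_X M (val e).2 w) a); last first.
  by apply/funext => w; rewrite /overlap /dotp mxE; apply: eq_bigr => a _;
     rewrite !mxE.
apply: measurable_sum => a.
by apply: measurable_funM; exact: mX.
Qed.

Lemma measurable_Xvec : measurable_fun [set: sm_space M] Xvec.
Proof.
apply/measurable_fun_tnthP => i.
rewrite (_ : _ \o _ = sm_X M i) //.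
by apply/funext => w /=; rewrite tnth_mktuple.
Qed.

Lemma measurable_Yvec : measurable_fun [set: sm_space M] Yvec.
Proof.
apply/measurable_fun_tnthP => a.
rewrite (_ : _ \o _ = obs (enum_val a)); last first.
  by apply/funext => w /=; rewrite tnth_mktuple.
apply: measurable_funD => //.
by apply: measurable_funM => //; exact: measurable_overlap.
Qed.

HB.instance Definition _ := isMeasurableFun.Build _ _ _ _ Xvec measurable_Xvec.
HB.instance Definition _ := isMeasurableFun.Build _ _ _ _ Yvec measurable_Yvec.
End observation.

(* Kullback-Leibler divergence in nats. When it is absolutely continuous, the
   negative part of the log-density is mu-integrable, hence the integral is
   well defined in ]-oo, +oo]. *)
Definition kl_divergence (R : realType) (d : measure_display)
    (T : measurableType d) (mu nu : probability T R) : \bar R :=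
  if `[< mu `<< nu >]
  then (\int[mu]_x lne (Radon_Nikodym (charge_of_finite_measure mu) nu x))%E
  else +oo%E.

Section mutual_information.
Context {R : realType} {d d1 d2 : measure_display}.
Context {T : measurableType d} {T1 : measurableType d1} {T2 : measurableType d2}.
Variables (P : probability T R) (U : {mfun T >-> T1}) (V : {mfun T >-> T2}).

Definition pair_rv (w : T) : T1 * T2 := (U w, V w).

Lemma measurable_pair_rv : measurable_fun [set: T] pair_rv.
Proof. by apply: measurable_fun_pair; exact: measurable_funP. Qed.

HB.instance Definition _ :=
  isMeasurableFun.Build _ _ _ _ pair_rv measurable_pair_rv.

Definition mutual_information : \bar R :=
  kl_divergence (distribution P pair_rv)
    (distribution P U \x distribution P V)%E.
End mutual_information.

Definition MI (R : realType) (k : nat) (P0 : probability (k.-tuple R) R)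
    (n : nat) (M : spiked_model P0 n) (l : R) : \bar R :=
  mutual_information (sm_prob M) (@Xvec R k P0 n M) (@Yvec R k P0 n M l).

(* The minimum over measurable estimators, attained by the conditional
   expectation, is expressed as an infimum. *)
Definition MMSE (R : realType) (k : nat) (P0 : probability (k.-tuple R) R)
    (n : nat) (M : spiked_model P0 n) (l : R) : \bar R :=
  ereal_inf [set (2 / (n * n.-1)%:R)%:E * \sum_(e : edge n)
      'E_(sm_prob M)[fun w => ((overlap e w - theta e (Yvec l w)) ^+ 2)%R]
    | theta in [set: edge n -> {mfun #|{: edge n}|.-tuple R >-> R}]]%E.

(* The outer integration variable is u = (Z, X), with Z and X independent. *)
Definition free_energy (R : realType) (k : nat)
    (P0 : probability (k.-tuple R) R) (l : R) (q : 'M[R]_k) : \bar R :=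
  ((- (l / 4 * mxnorm q ^+ 2))%:E +
   \int[std_gaussian R k \x P0]_u
     lne (\int[P0]_x
       (expR (Num.sqrt l * bilin (sqrtmx q) u.1 x
              + l * bilin q x u.2
              - l / 2 * bilin q x x))%:E))%E.

Definition is_maximizer (R : realType) (k : nat)
    (P0 : probability (k.-tuple R) R) (l : R) (q : 'M[R]_k) : Prop :=
  psd q /\ forall q', psd q' -> (free_energy P0 l q' <= free_energy P0 l q)%E.

(* Main.v *)
(** Y is an additive Gaussian channel with signal S_ij = sqrt (l / n) X_i . X_j, so
    I(X, Y) = E |S|^2 / 2 - D_n(l), where D_n(l) = E ln zeta(Y) and zeta is the density of
    the law of Y with respect to the law of the noise. Since E |S|^2 is explicit, the
    first claim says that D_n(l) / n converges to max_fe(l) = sup_q F(l, q).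

    Lower bound: interpolate between the n-body channel and n scalar channels with
    signal B x, where q = B^T B. Upper bound: condition on the overlap of a
    replica with the planted signal lying near a point m of a finite net, write
    m = B1^T B2 by polar decomposition with |B1^T B1| = |B2^T B2| = |m|, and interpolate towards
    scalar channels observed through B2 but decoded with B1; Gibbs' inequality replaces
    B1 by B2, and the net and the fluctuations cost o(n). Instead of
    differentiating along the interpolation, one compares many small channel steps.
    Both bounds are proved for finitely supported priors; rounding the prior and the
    finite second moment give the general case, uniformly in n.

    For the error, D_n satisfies one-sided forms of the I-MMSE relation: its increments
    on either side of l bound the second moment of the posterior mean. As F(l, q) depends on q
    through l q up to a quadratic term, l^2 |q|^2 is monotone in l over the
    maximizers q at l. Outside its countably many jumps all maximizers have the same norm and
    max_fe has derivative |q|^2 / 4, which determines the limit of the error. *)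

Require Import Defs.
From HB Require Import structures.
From mathcomp Require Import all_boot all_order all_algebra.
From mathcomp Require Import all_classical all_reals all_analysis.
From mathcomp Require Import measurable_realfun ring lra.
From mathcomp Require complex sesquilinear spectral.
Import Order.TTheory GRing.Theory Num.Theory.
Import numFieldNormedType.Exports.
Set Implicit Arguments.
Unset Strict Implicit.
Unset Printing Implicit Defensive.
Local Open Scope classical_set_scope.
Local Open Scope ring_scope.

(** * Gaussian integrals *)

(** Once the prior is finite, every quantity is a function of a Hamiltonian H on finitely many
    configurations, and a Gaussian observation acts on such functions by an averaging operator.
    These operators commute and form semigroups, so two channels can be compared through their
    generators at each fixed H: exchanging a step of length d costs an error O(d sqrt d), and t / d
    steps cost O(t sqrt d). No concentration of the overlap is required.

    The obstacle in the upper bound is that the overlap matrix m of a replica with the signal need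
    be neither symmetric nor positive semidefinite, hence need not be a Gram matrix B^T B. Writing m
    = B1^T B2 keeps the term linear in the overlap exact. Two quadratic terms remain: - |m|^2 / 2
    from linearizing |overlap|^2 around m, and + |B1^T B1|^2 / 4 from the replicas. They add up to
    the penalty - |q|^2 / 4 of F at q = B2^T B2 because the three norms agree, and this is what
    polar decomposition is for. The net is made of invertible matrices so that the orthogonal factor
    can be written down. *)

Section density.
Import HBNNSimple.
Context d (T : measurableType d) (R : realType).
Variables (mu nu : {measure set T -> \bar R}) (p : T -> R).
Hypotheses (mp : measurable_fun setT p) (p0 : forall x, 0 <= p x).
Hypothesis nuE : forall A, measurable A -> nu A = (\int[mu]_(x in A) (p x)%:E)%E.

Lemma ge0_integral_density (f : T -> \bar R) :
  measurable_fun setT f -> (forall x, 0 <= f x)%E ->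
  (\int[nu]_x f x = \int[mu]_x (f x * (p x)%:E))%E.
Proof.
move=> mf f0; pose g := nnsfun_approx measurableT mf.
have gf x : (g n x)%:E @[n --> \oo] --> f x.
  by apply: cvg_nnsfun_approx => //.
have nd x : nondecreasing_seq (fun n => g n x).
  by move=> a b ab; exact/lefP/nd_nnsfun_approx.
transitivity (limn (fun n => \int[nu]_x (g n x)%:E))%E.
  rewrite -monotone_convergence//.
  - by apply: eq_integral => x _; apply/esym/cvg_lim => //; exact: gf.
  - by move=> n; exact/measurable_EFinP.
  - by move=> n x _; rewrite lee_fin.
  - by move=> x _ a b ab; rewrite lee_fin; exact: nd.
transitivity (limn (fun n => \int[mu]_x ((g n x)%:E * (p x)%:E)))%E; last first.
  rewrite -monotone_convergence//.
  - apply: eq_integral => x _; apply/cvg_lim => //.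
    apply: cvgeZr => //; exact: gf.
  - move=> n; apply: emeasurable_funM; exact/measurable_EFinP.
  - by move=> n x _; rewrite mule_ge0// lee_fin.
  - move=> x _ a b ab; apply: lee_wpmul2r; first by rewrite lee_fin.
    by rewrite lee_fin; exact: nd.
congr (limn _); apply/funext => n.
under eq_integral do rewrite fimfunE -fsumEFin//.
rewrite ge0_integral_fsum//; last 2 first.
- by move=> r; exact/measurable_EFinP/measurableT_comp.
- by move=> r x _ /=; rewrite EFinM nnfun_muleindic_ge0.
under [RHS]eq_integral => x _.
  rewrite fimfunE -fsumEFin// ge0_mule_fsuml; last first.
    by move=> r; rewrite EFinM nnfun_muleindic_ge0.
  over.
rewrite ge0_integral_fsum//; last 2 first.
- move=> r; apply: emeasurable_funM; last exact/measurable_EFinP.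
  by apply/measurable_EFinP/measurable_funM => //.
- by move=> r x _; apply: mule_ge0; [rewrite EFinM nnfun_muleindic_ge0|rewrite lee_fin].
apply: eq_fsbigr => r _.
rewrite (integralZl_indic measurableT (fun k => g n @^-1` [set k]))//; last first.
  by move=> r0; rewrite preimage_nnfun0.
rewrite integral_indic// setIT nuE//.
under [RHS]eq_integral do rewrite EFinM -muleA.
have [r0|r0] := leP 0 r; last first.
  rewrite preimage_nnfun0// integral_set0 mule0.
  under eq_integral do rewrite indic0 mul0e mule0.
  by rewrite integral0.
rewrite ge0_integralZl_EFin//; last 2 first.
- by move=> x _; rewrite mule_ge0// lee_fin.
- apply: emeasurable_funM; exact/measurable_EFinP.
congr (_ * _)%E; rewrite [LHS]integral_mkcond; apply: eq_integral => x _.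
rewrite patchE indicE muleC /=.
by case: ifP => _; rewrite /= ?mule1 ?mule0.
Qed.

End density.

Section gaussian.
Context (R : realType).
Local Notation leb := (@lebesgue_measure R).
Local Notation gam := (std_normal R).
Implicit Types (a b c : R).

(** Lebesgue measure is determined by half-open intervals, and on these its image under x -> a x +
    b, multiplied by a, agrees with it. *)
Lemma ge0_integral_affine a b (f : R -> \bar R) : 0 < a ->
  measurable_fun setT f -> (forall x, 0 <= f x)%E ->
  (\int[leb]_x f x = a%:E * \int[leb]_x f (a * x + b)%R)%E.
Proof.
move=> a0 mf f0.
pose F : R -> measurableTypeR R := fun x => a * x + b.
have mF : measurable_fun [set: measurableTypeR R] F.
  by apply: measurable_funD => //; exact: measurable_funM.
have a0' : 0 <= a by exact: ltW.
pose m' := mscale (NngNum a0') (pushforward leb F).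
have mE A : measurable A -> leb A = m' mF A.
  move=> mA; apply: lebesgue_measure_unique => // _ [[u v]] _ <-.
  transitivity (a%:E * leb (F @^-1` `]u, v]))%E; last by [].
  have -> : F @^-1` `]u, v] = `](u - b) / a, (v - b) / a]%classic.
    apply/seteqP; split => x /=; rewrite !in_itv/= /F.
      by rewrite ltr_pdivrMr// ler_pdivlMr// ltrBlDr lerBrDr mulrC.
    by rewrite ltr_pdivrMr// ler_pdivlMr// ltrBlDr lerBrDr mulrC.
  rewrite !lebesgue_measure_itv/= !lte_fin ltr_pM2r ?invr_gt0// ltrD2r.
  case: ifPn => _; last by rewrite mule0.
  by rewrite -!EFinB -EFinM; congr EFin; field; rewrite gt_eqF.
rewrite (@eq_measure_integral _ _ _ _ (m' mF)); last by move=> A mA _; exact: mE.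
rewrite ge0_integral_mscale//=.
by rewrite ge0_integral_pushforward.
Qed.

Lemma ge0_integral_gauss (f : R -> \bar R) :
  measurable_fun setT f -> (forall x, 0 <= f x)%E ->
  (\int[gam]_x f x = \int[leb]_x (f x * (normal_pdf 0 1 x)%:E))%E.
Proof.
move=> mf f0; rewrite ge0_integral_distribution//.
rewrite (@ge0_integral_density _ _ _ leb _ (normal_pdf 0 1))//.
- exact: measurable_normal_pdf.
- by move=> x; exact: normal_pdf_ge0.
Qed.

Lemma std_normal_pdfE (x : R) :
  normal_pdf 0 1 x = normal_peak 1 * expR (- x ^+ 2 / 2).
Proof.
by rewrite normal_pdfE ?oner_neq0// /normal_fun subr0 expr1n.
Qed.

(** Completing the square: exp (c g - c^2 / 2) is the density of N(c, 1) with respect to N(0, 1).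
    All changes of measure below come from this one. *)
Lemma gauss_shift c (f : R -> \bar R) :
  measurable_fun setT f -> (forall x, 0 <= f x)%E ->
  (\int[gam]_g f (g + c)%R = \int[gam]_g ((expR (c * g - c ^+ 2 / 2))%:E * f g))%E.
Proof.
move=> mf f0.
have m1 : measurable_fun [set: R] (fun g => (expR (c * g - c ^+ 2 / 2))%:E).
  apply/measurable_EFinP; apply: measurableT_comp => //.
  by apply: measurable_funB => //; exact: measurable_funM.
rewrite ge0_integral_gauss//; last first.
  by apply: (@measurableT_comp _ _ _ _ _ _ f) => //; exact: measurable_funD.
rewrite ge0_integral_gauss//; last 2 first.
- exact: emeasurable_funM.
- by move=> x; rewrite mule_ge0// lee_fin expR_ge0.
rewrite [RHS](@ge0_integral_affine 1 c)//; last 2 first.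
- apply: emeasurable_funM; first exact: emeasurable_funM.
  by apply/measurable_EFinP; exact: measurable_normal_pdf.
- by move=> x; rewrite !mule_ge0// lee_fin ?expR_ge0// normal_pdf_ge0.
rewrite mul1e; apply: eq_integral => x _; rewrite mul1r.
rewrite [in RHS]muleC muleA -EFinM muleC; congr (_%:E * _)%E.
rewrite !std_normal_pdfE -mulrA -expRD; congr (_ * expR _).
by field.
Qed.

Lemma gauss_expR c : (\int[gam]_g (expR (c * g))%:E = (expR (c ^+ 2 / 2))%:E)%E.
Proof.
have := @gauss_shift c (cst 1%E) (@measurable_cst _ _ _ _ _ _) (fun=> lee01).
have -> : (\int[gam]_g cst 1%E (g + c)%R = 1)%E.
  by rewrite integral_cst// mul1e; exact: (@probability_setT _ _ _ gam).
move/esym.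
under eq_integral do rewrite mule1 expRD EFinM muleC.
rewrite ge0_integralZl//; last by apply/measurable_EFinP; apply: measurableT_comp.
move=> /(congr1 (fun x => (expR (c ^+ 2 / 2))%:E * x)%E).
by rewrite muleA -EFinM -expRD subrr expR0 mul1e mule1.
Qed.

(** Both sides are the joint density of two standard Gaussians of correlation b, disintegrated along
    one variable or along the other. *)
Lemma normal_pdf_rotation a b u v : 0 < a -> a ^+ 2 + b ^+ 2 = 1 ->
  normal_pdf (b * v) a u * normal_pdf 0 1 v =
  normal_pdf 0 1 u * normal_pdf (b * u) a v.
Proof.
move=> a0 ab; have a1 : a != 0 by rewrite gt_eqF.
rewrite !std_normal_pdfE !normal_pdfE// /normal_fun.
rewrite mulrACA -expRD [RHS]mulrACA -expRD mulrC (mulrC (normal_peak 1)).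
rewrite [RHS]mulrC; congr (expR _ * _).
have b2 : b ^+ 2 = 1 - a ^+ 2 by rewrite -ab; ring.
have e (x y : R) : (x - b * y) ^+ 2 = x ^+ 2 - 2 * b * x * y + b ^+ 2 * y ^+ 2.
  by ring.
by rewrite !e b2; field.
Qed.


Lemma normal_peak_scale a : 0 < a -> normal_peak a = a^-1 * normal_peak 1.
Proof.
move=> a0; rewrite /normal_peak expr1n mul1r -mulrnAr sqrtrM ?sqr_ge0//.
by rewrite sqrtr_sqr gtr0_norm// invfM.
Qed.

(** Given v, the variable a u + b v is Gaussian of mean b v and deviation a. After the integrals are
    exchanged, [normal_pdf_rotation] turns the inner one into the integral of a density in v, which
    is 1. *)
Lemma gauss_stable a b (f : R -> \bar R) : 0 < a -> a ^+ 2 + b ^+ 2 = 1 ->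
  measurable_fun setT f -> (forall x, 0 <= f x)%E ->
  (\int[gam]_v \int[gam]_u f (a * u + b * v)%R = \int[gam]_x f x)%E.
Proof.
move=> a0 ab mf f0; have a1 : a != 0 by rewrite gt_eqF.
have maff c1 c2 : measurable_fun [set: R] (fun x : R => c1 * x + c2).
  by apply: measurable_funD => //; exact: measurable_funM.
have mn m s : measurable_fun setT (fun x : R => (normal_pdf m s x)%:E).
  by apply/measurable_EFinP; exact: measurable_normal_pdf.
have n0 m s (x : R) : (0 <= (normal_pdf m s x)%:E)%E.
  by rewrite lee_fin normal_pdf_ge0.
have mfab v : measurable_fun [set: R] (fun u => f (a * u + b * v)).
  apply: (measurableT_comp mf); exact: maff.
have inner v : (\int[gam]_u f (a * u + b * v)%R =
    \int[leb]_x (f x * (normal_pdf (b * v) a x)%:E))%E.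
  rewrite ge0_integral_gauss; [|exact: mfab|by move=> ?; exact: f0].
  rewrite [RHS](@ge0_integral_affine a (b * v))//; last 2 first.
  - exact: emeasurable_funM.
  - by move=> x; rewrite mule_ge0.
  rewrite -ge0_integralZl//; last 3 first.
  - exact: (measurableT_comp (emeasurable_funM mf (mn (b * v) a)) (maff a (b * v))).
  - by move=> x _; rewrite mule_ge0.
  - by rewrite lee_fin ltW.
  apply: eq_integral => x _; rewrite muleCA -EFinM; congr (_ * _%:E)%E.
  have -> : normal_pdf (b * v) a (a * x + b * v) =
      normal_peak a * expR (- (a * x + b * v - b * v) ^+ 2 / (a ^+ 2 *+ 2)).
    by rewrite normal_pdfE.
  rewrite std_normal_pdfE (normal_peak_scale a0) 2!mulrA divff// mul1r.
  by congr (_ * expR _); field.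
under eq_integral do rewrite inner.
pose Rm := measurableTypeR R.
pose h (xv : Rm * Rm) := (f xv.1 * (normal_pdf (b * xv.2) a xv.1)%:E)%E.
have mf' : measurable_fun [set: Rm] f by exact: mf.
have m1 : measurable_fun [set: Rm * Rm] (fun xv : Rm * Rm => (xv.1 : R)).
  exact: (measurable_fst : measurable_fun [set: Rm * Rm] fst).
have m2 : measurable_fun [set: Rm * Rm] (fun xv : Rm * Rm => (xv.2 : R)).
  exact: (measurable_snd : measurable_fun [set: Rm * Rm] snd).
have mf2 : measurable_fun [set: Rm * Rm] h.
  apply: emeasurable_funM; first exact: (measurableT_comp mf' (@measurable_fst _ _ Rm Rm)).
  apply/measurable_EFinP.
  rewrite (_ : (fun x => _) = (fun xv : Rm * Rm => normal_peak a *
      expR (- (xv.1 - b * xv.2) ^+ 2 / (a ^+ 2 *+ 2)))); last first.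
    by apply/funext => -[x v]; rewrite normal_pdfE.
  apply: measurable_funM => //; apply: measurableT_comp => //.
  apply: measurable_funM => //; apply: measurableT_comp => //.
  by apply: measurable_funX; apply: measurable_funB => //; exact: measurable_funM.
have f20 x v : (0 <= f x * (normal_pdf (b * v) a x)%:E)%E by rewrite mule_ge0.
have mG : measurable_fun [set: R]
    (fun v => \int[leb]_x (f x * (normal_pdf (b * v) a x)%:E))%E.
  exact: (@measurable_fun_fubini_tonelli_G _ _ Rm Rm R leb h mf2
    (fun xv => f20 xv.1 xv.2)).
rewrite [LHS]ge0_integral_gauss; [|exact: mG|by move=> v; exact: integral_ge0].
transitivity (\int[leb]_v \int[leb]_x
    (f x * (normal_pdf (b * v) a x)%:E * (normal_pdf 0 1 v)%:E))%E.
  apply: eq_integral => v _; rewrite ge0_integralZr//.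
  exact: (emeasurable_funM mf (mn (b * v) a)).
pose h2 (xv : Rm * Rm) := (h xv * (normal_pdf 0 1 xv.2)%:E)%E.
have mh2 : measurable_fun [set: Rm * Rm] h2.
  apply: emeasurable_funM => //.
  exact: (measurableT_comp (mn 0 1) m2).
have h20 xv : (0 <= h2 xv)%E by rewrite mule_ge0// f20.
rewrite -(@fubini_tonelli _ _ Rm Rm R leb leb h2 mh2 h20)/=.
rewrite [RHS]ge0_integral_gauss; [|exact: mf|exact: f0].
apply: eq_integral => x _; rewrite /h2 /h/=.
under eq_integral.
  move=> v _; rewrite -muleA -EFinM normal_pdf_rotation// EFinM muleA; over.
rewrite ge0_integralZl; [|by []|exact: mn|by move=> v _; exact: n0|by rewrite mule_ge0].
by rewrite integral_normal_pdf mule1.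
Qed.

(** The bound exp (c |x|) <= exp (c x) + exp (- c x) reduces exponential growth to the moment
    generating function [gauss_expR]. *)
Lemma gauss_integrable (f : R -> R) C c : measurable_fun setT f ->
  (forall x, `|f x| <= C * expR (c * `|x|)) ->
  gam.-integrable setT (EFin \o f).
Proof.
move=> mf fC.
have mc k : measurable_fun [set: R] (fun x : R => (expR (k * x))%:E).
  by apply/measurable_EFinP; apply: measurableT_comp => //; exact: measurable_funM.
apply: (@le_integrable _ _ _ gam _ _ _
    (fun x => C%:E * ((expR (c * x))%:E + (expR (- c * x))%:E))%E) => //.
- exact/measurable_EFinP.
- move=> x _ /=; rewrite lee_fin (le_trans (fC x))//.
  have C0 : 0 <= C.
    have := le_trans (normr_ge0 _) (fC 0).
    by rewrite normr0 mulr0 expR0 mulr1.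
  rewrite [leRHS]ger0_norm ?mulr_ge0// ?addr_ge0 ?expR_ge0//.
  apply: ler_wpM2l => //.
  by case: (ler0P x) => _; rewrite ?mulrN ?mulNr ?lerDr ?lerDl expR_ge0.
- apply: integrableZl => //; apply: integrableD => //.
    apply/integrableP; split => //.
    under eq_integral do rewrite gee0_abs ?lee_fin ?expR_ge0//.
    by rewrite gauss_expR ltry.
  apply/integrableP; split => //.
  under eq_integral do rewrite gee0_abs ?lee_fin ?expR_ge0//.
  by rewrite gauss_expR ltry.
Qed.

End gaussian.

Section expR_taylor.
Context (R : realType).
Implicit Types x : R.

Lemma expR_sub1_le x : `|expR x - 1| <= `|x| * expR `|x|.
Proof.
have h (y : R) : 1 - y <= expR (- y) by exact: expR_ge1Dx.
have h2 (y : R) : expR y - 1 <= y * expR y.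
  rewrite -[leLHS]opprB -[leRHS]opprK lerN2.
  have := ler_wpM2r (expR_ge0 y) (h y).
  by rewrite -expRD addNr expR0 mulrBl mul1r; lra.
have [x0|x0] := ler0P x.
  rewrite ler0_norm; last by rewrite subr_le0 expR_le1.
  have := expR_ge1Dx x; have : 1 <= expR (- x) by rewrite -expR0 ler_expR oppr_ge0.
  nra.
by rewrite ger0_norm ?h2// subr_ge0 -expR0 ler_expR ltW.
Qed.

Lemma expR_taylor2 x : 0 <= expR x - 1 - x <= x ^+ 2 * expR `|x|.
Proof.
have := expR_ge1Dx x => e1.
have := expR_sub1_le x; have e0 := expR_gt0 `|x|.
have h : 1 - x <= expR (- x) by exact: expR_ge1Dx.
have h2 := ler_wpM2r (expR_ge0 x) h.
rewrite -expRD addNr expR0 in h2.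
move=> h0; apply/andP; split; first lra.
have [x0|x0] := ler0P x; last first.
  have h4 : expR x - 1 <= x * expR x by lra.
  nra.
have h3 : 1 <= expR (- x) by rewrite -expR0 ler_expR oppr_ge0.
nra.
Qed.

(** The remainder E has derivative exp y - 1 - y, which [expR_taylor2] bounds on both sides. So E is
    nondecreasing, and comparison of derivatives gives E y <= y^3 exp y for y >= 0 and y^3 <= E y
    for y <= 0. *)
Lemma expR_taylor3 x :
  `|expR x - 1 - x - x ^+ 2 / 2| <= `|x| ^+ 3 * expR `|x|.
Proof.
pose E (x : R) : R := expR x - 1 - x - x ^+ 2 / 2.
have dE (y : R) : is_derive y 1 E (expR y - 1 - y).
  rewrite /E; apply: is_derive_eq.
  by rewrite /= !scaler0 /GRing.scale/=; field.
have E0 : E 0 = 0 by rewrite /E expR0; lra.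
have cE : continuous E.
  by move=> y; apply/differentiable_continuous/derivable1_diffP; case: (dE y).
have nd y z : y <= z -> E y <= E z.
  move=> yz; apply: (@ger0_derive1_ndecr _ E y z) => //.
  - move=> u _; rewrite derive1E (@derive_val _ _ _ _ _ _ _ (dE u)).
    by have /andP[] := expR_taylor2 u.
  - exact: continuous_subspaceT.
have [x0|x0] := leP 0 x.
  rewrite -/(E x) !ger0_norm//; last by rewrite -E0 nd.
  pose F (y : R) : R := y ^+ 3 * expR y - E y.
  have dF (y : R) : is_derive y 1 F
      (3 * y ^+ 2 * expR y + y ^+ 3 * expR y - (expR y - 1 - y)).
    rewrite /F; apply: is_derive_eq.
    by rewrite /= ?scaler0 /GRing.scale/=; field.
  have : F 0 <= F x; last by rewrite /F E0 expr0n/= mul0r; lra.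
  apply: (@ger0_derive1_ndecr _ F 0 x) => //.
  - move=> u /[!in_itv]/= /andP[u0 _].
    rewrite derive1E (@derive_val _ _ _ _ _ _ _ (dF u)).
    have /andP[_] := expR_taylor2 u; rewrite gtr0_norm// => h.
    have : 0 <= u ^+ 3 * expR u by rewrite mulr_ge0 ?expR_ge0// exprn_ge0// ltW.
    have : 0 <= u ^+ 2 * expR u by rewrite mulr_ge0 ?expR_ge0// exprn_ge0// ltW.
    lra.
  - apply: continuous_subspaceT => y.
    by apply/differentiable_continuous/derivable1_diffP; case: (dF y).
rewrite -/(E x) !ler0_norm ?(ltW x0)//; last by rewrite -E0 nd// ltW.
pose F (y : R) : R := E y - y ^+ 3.
have dF (y : R) : is_derive y 1 F ((expR y - 1 - y) - 3 * y ^+ 2).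
  rewrite /F; apply: is_derive_eq.
  by rewrite /= ?scaler0 /GRing.scale/=; field.
have : F 0 <= F x.
  apply: (@ler0_derive1_nincr _ F x 0) => //; last exact: ltW.
  - move=> u /[!in_itv]/= /andP[_ u0].
    rewrite derive1E (@derive_val _ _ _ _ _ _ _ (dF u)).
    have : expR u - 1 <= u * expR u.
      have h : 1 - u <= expR (- u) by exact: expR_ge1Dx.
      have := ler_wpM2r (expR_ge0 u) h.
      rewrite -expRD addNr expR0; lra.
    have := expR_ge1Dx u; nra.
  - apply: continuous_subspaceT => y.
    by apply/differentiable_continuous/derivable1_diffP; case: (dF y).
rewrite /F E0 expr0n/= subr0 => h.
have e1 : 1 <= expR (- x) by rewrite -expR0 ler_expR oppr_ge0 ltW.
have x3 : 0 <= (- x) ^+ 3 by rewrite exprn_ge0// oppr_ge0 ltW.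
apply: (@le_trans _ _ ((- x) ^+ 3)); last by rewrite ler_peMr.
by move: h; rewrite !exprS expr0; lra.
Qed.

End expR_taylor.

Lemma Rintegral_prob_cst d (T : measurableType d) (R : realType)
  (P : probability T R) (r : R) : \int[P]_x r = r.
Proof. by rewrite Rintegral_cst//= probability_setT mulr1. Qed.

Section gaussian_moments.
Context (R : realType).
Local Notation gam := (std_normal R).
Local Notation gint f := (gam.-integrable setT (EFin \o f)).

Lemma gauss_integrableX n : gint (fun g : R => g ^+ n).
Proof.
apply: (@gauss_integrable _ _ (n`!)%:R 1); first exact: measurable_funX.
move=> x; rewrite mul1r normrX; case: n => [|n].
  by rewrite expr0 mul1r -expR0 ler_expR.
have := expR_ge1Dxn n (normr_ge0 x) => h.
have f0 : 0 < n.+1`!%:R :> R by rewrite ltr0n fact_gt0.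
rewrite -ler_pdivrMl// mulrC; lra.
Qed.

Lemma gauss_integrable_expR (c : R) : gint (fun g : R => expR (c * g)).
Proof.
apply: (@gauss_integrable _ _ 1 `|c|).
  by apply: measurableT_comp => //; exact: measurable_funM.
by move=> x; rewrite mul1r ger0_norm ?expR_ge0// ler_expR -normrM ler_norm.
Qed.

Lemma gauss_integrable_abs_exp (C c : R) (n : nat) :
  gint (fun g : R => C * `|g| ^+ n * expR (c * `|g|)).
Proof.
apply: (@gauss_integrable _ _ (`|C| * (n`!)%:R) (1 + c)).
  apply: measurable_funM => //.
    by apply: measurable_funM => //; exact: measurable_funX.
  by apply: measurableT_comp => //; apply: measurable_funM.
move=> x; rewrite !normrM (ger0_norm (expR_ge0 _)) mulrDl expRD mul1r.
rewrite -!mulrA ler_wpM2l// mulrA ler_wpM2r ?expR_ge0// normrX normr_id.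
case: n => [|n]; first by rewrite expr0 mul1r -expR0 ler_expR.
have := expR_ge1Dxn n (normr_ge0 x) => h.
have f0 : 0 < n.+1`!%:R :> R by rewrite ltr0n fact_gt0.
rewrite -ler_pdivrMl// mulrC; lra.
Qed.

(* The first two moments are read off the Taylor expansion at c = 0 of the
   moment generating function exp (c ^ 2 / 2). *)
Lemma gauss_mean_var :
  \int[gam]_g g = 0 /\ \int[gam]_g (g ^+ 2) = 1 :> R.
Proof.
set m := \int[gam]_g g; set v := \int[gam]_g (g ^+ 2).
have i1 : gint (fun g : R => g) by exact: (gauss_integrableX 1).
have i2 := gauss_integrableX 2.
have i0 (r : R) : gint (fun=> r) by exact: finite_measure_integrable_cst.
pose M := \int[gam]_g (1 * `|g| ^+ 3 * expR (1 * `|g|)).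
have iM := gauss_integrable_abs_exp 1 1 3.
have M0 : 0 <= M.
  by apply: Rintegral_ge0 => x _; rewrite !mulr_ge0// ?exprn_ge0// expR_ge0.
have key (c : R) : 0 < c <= 1 ->
    `|expR (c ^+ 2 / 2) - 1 - c * m - c ^+ 2 / 2 * v| <= c ^+ 3 * M.
  move=> /andP[c0 c1].
  pose f (g : R) := expR (c * g) - 1 - c * g - (c * g) ^+ 2 / 2.
  have ic : gint (fun g => c * g).
    by apply: (eq_integrable measurableT _ _ _ (integrableZl measurableT c i1)).
  have ic2 : gint (fun g => c ^+ 2 / 2 * g ^+ 2).
    by apply: (eq_integrable measurableT _ _ _ (integrableZl measurableT _ i2)).
  have fE : f = (fun g => expR (c * g) - 1 - c * g - c ^+ 2 / 2 * g ^+ 2).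
    by apply/funext => g; rewrite /f; ring.
  have ie := gauss_integrable_expR c.
  have j1 : gint (fun g => expR (c * g) - 1).
    exact: (integrableB measurableT ie (i0 1)).
  have j2 : gint (fun g => expR (c * g) - 1 - c * g).
    exact: (integrableB measurableT j1 ic).
  have jf : gint f by rewrite fE; exact: (integrableB measurableT j2 ic2).
  have -> : expR (c ^+ 2 / 2) - 1 - c * m - c ^+ 2 / 2 * v = \int[gam]_g f g.
    rewrite fE RintegralB// RintegralB// RintegralB//.
    rewrite Rintegral_prob_cst !RintegralZl//.
    by congr (_ - _ - _ - _); rewrite /Rintegral gauss_expR.
  apply: (le_trans (le_normr_Rintegral measurableT jf)).
  have iM' : gint (fun g => c ^+ 3 * (1 * `|g| ^+ 3 * expR (1 * `|g|))).
    exact: (integrableZl measurableT (c ^+ 3) iM).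
  rewrite -RintegralZl//; apply: le_Rintegral => //; first exact: integrable_norm.
  move=> g _; apply: (le_trans (expR_taylor3 (c * g))).
  rewrite normrM (gtr0_norm c0) exprMn !mul1r -mulrA.
  rewrite ler_wpM2l ?exprn_ge0 ?(ltW c0)// ler_wpM2l ?exprn_ge0//.
  by rewrite ler_expR ler_piMl.
(* Replacing exp (c^2 / 2) by 1 + c^2 / 2 costs at most c^3. Dividing by c and letting c tend to 0
   gives m = 0; then dividing by c^2 gives v = 1. *)
have key2 (c : R) : 0 < c <= 1 -> `|c * m + c ^+ 2 / 2 * (v - 1)| <= c ^+ 3 * (M + 1).
  move=> c01; have := key c c01; case/andP: c01 => c0 c1.
  have /andP[t0 t1] := expR_taylor2 (c ^+ 2 / 2).
  have c20 : 0 <= c ^+ 2 / 2 by rewrite divr_ge0// exprn_ge0// ltW.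
  have c21 : c ^+ 2 / 2 <= 1 / 2 by rewrite ler_pM2r// exprn_ile1// ltW.
  rewrite ger0_norm// in t1.
  have e4 : expR (c ^+ 2 / 2) <= 4.
    have h : 1 - c ^+ 2 / 2 <= expR (- (c ^+ 2 / 2)) by exact: expR_ge1Dx.
    have := ler_wpM2r (expR_ge0 (c ^+ 2 / 2)) h.
    rewrite -expRD addNr expR0; have := expR_gt0 (c ^+ 2 / 2); nra.
  have t2 : (c ^+ 2 / 2) ^+ 2 * expR (c ^+ 2 / 2) <= c ^+ 3.
    have -> : (c ^+ 2 / 2) ^+ 2 * expR (c ^+ 2 / 2) = c ^+ 3 * (c * expR (c ^+ 2 / 2) / 4).
      by field.
    rewrite ler_piMr ?exprn_ge0 ?(ltW c0)//.
    have := expR_gt0 (c ^+ 2 / 2); nra.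
  have c3 : 0 <= c ^+ 3 by rewrite exprn_ge0// ltW.
  rewrite !ler_norml => /andP[k1 k2]; apply/andP; split; nra.
have m0 : m = 0.
  apply/eqP; rewrite -normr_le0; apply/ler_addgt0Pl => e e0.
  pose K := M + 1 + `|v - 1| + 1.
  have K0 : 0 < K by rewrite /K; have := normr_ge0 (v - 1); lra.
  pose c := Num.min 1 (e / K).
  have c0 : 0 < c by rewrite lt_min ltr01 divr_gt0.
  have c1 : c <= 1 by rewrite ge_min lexx.
  have cK : c * K <= e by rewrite -ler_pdivlMr// ge_min lexx orbT.
  have := key2 c; rewrite c0 c1 => /(_ isT) h.
  have h2 : c * `|m| <= c ^+ 3 * (M + 1) + c ^+ 2 / 2 * `|v - 1|.
    rewrite -{1}(gtr0_norm c0) -normrM.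
    have -> : c * m = (c * m + c ^+ 2 / 2 * (v - 1)) - c ^+ 2 / 2 * (v - 1) by ring.
    rewrite (le_trans (ler_normB _ _))// lerD// normrM ger0_norm//.
    by rewrite divr_ge0// exprn_ge0// ltW.
  have h3 : `|m| <= c ^+ 2 * (M + 1) + c / 2 * `|v - 1|.
    rewrite -(ler_pM2l c0) (le_trans h2)// le_eqVlt; apply/orP; left; apply/eqP.
    by field.
  have w0 := normr_ge0 (v - 1); rewrite ?addr0 ?add0r; move: cK; rewrite /K.
  have : c ^+ 2 * (M + 1) <= c * (M + 1).
    rewrite ler_wpM2r//; first lra.
    by rewrite expr2 ler_piMl// ltW.
  have : 0 <= c * `|v - 1| by rewrite mulr_ge0// ltW.
  by rewrite !mulrDr !mulr1; lra.
split => //; apply/eqP; rewrite -subr_eq0 -normr_le0; apply/ler_addgt0Pl => e e0.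
have K0 : 0 < M + 1 by lra.
pose c := Num.min 1 (e / (M + 1) / 2).
have c0 : 0 < c by rewrite lt_min ltr01 !divr_gt0.
have c1 : c <= 1 by rewrite ge_min lexx.
have cK : c * (M + 1) <= e / 2.
  by rewrite -ler_pdivlMr// mulrAC ge_min lexx orbT.
have := key2 c; rewrite c0 c1 m0 mulr0 add0r => /(_ isT).
rewrite normrM ger0_norm; last by rewrite divr_ge0// exprn_ge0// ltW.
have -> : c ^+ 3 * (M + 1) = c ^+ 2 / 2 * (2 * (c * (M + 1))) by field.
rewrite ler_pM2l; last by rewrite divr_gt0// exprn_gt0.
lra.
Qed.

End gaussian_moments.

(** * Finite Gibbs measures driven by Gaussian channels *)

Lemma measurable_Rintegral d1 d2 (T1 : measurableType d1) (T2 : measurableType d2)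
    (R : realType) (mu : {sigma_finite_measure set T2 -> \bar R})
    (f : T1 * T2 -> R) :
  measurable_fun setT f -> measurable_fun setT (fun x => \int[mu]_y f (x, y)).
Proof.
move=> mf; have mf' : measurable_fun setT (EFin \o f) by exact/measurable_EFinP.
apply: measurableT_comp; first exact: fine_measurable.
rewrite (_ : (fun x => _) = (fun x => (\int[mu]_y (EFin \o f)^\+ (x, y)) -
   (\int[mu]_y (EFin \o f)^\- (x, y)))%E).
  apply: emeasurable_funB.
    exact: (@measurable_fun_fubini_tonelli_F _ _ T1 T2 R mu _
      (measurable_funepos mf') (funepos_ge0 _)).
  exact: (@measurable_fun_fubini_tonelli_F _ _ T1 T2 R mu _
    (measurable_funeneg mf') (funeneg_ge0 _)).
apply/funext => x; rewrite integralE.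
by congr (_ - _)%E; apply: eq_integral => y _; rewrite ?funeposE ?funenegE.
Qed.

Lemma integral_transfer d1 d2 (T1 : measurableType d1) (T2 : measurableType d2)
    (R : realType) (mu : {measure set T1 -> \bar R})
    (nu : {measure set T2 -> \bar R}) (phi : T1 -> T2) :
  (forall f : T2 -> \bar R, measurable_fun setT f -> (forall x, 0 <= f x)%E ->
    (\int[mu]_x f (phi x) = \int[nu]_x f x)%E) ->
  forall f : T2 -> \bar R, measurable_fun setT f ->
    (\int[mu]_x f (phi x) = \int[nu]_x f x)%E.
Proof.
move=> H f mf; rewrite integralE [RHS]integralE.
congr (_ - _)%E.
  rewrite -(H _ (measurable_funepos mf)); last by move=> x; exact: funepos_ge0.
  by apply: eq_integral => x _; rewrite !funeposE.
rewrite -(H _ (measurable_funeneg mf)); last by move=> x; exact: funeneg_ge0.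
by apply: eq_integral => x _; rewrite !funenegE.
Qed.

Section gauss2.
Context (R : realType).
Local Notation gam := (std_normal R).
Variables (f : R * R -> R) (C c : R).
Hypothesis mf : measurable_fun setT f.
Hypothesis fC : forall g h, `|f (g, h)| <= C * expR (c * `|g|) * expR (c * `|h|).

Let mE : measurable_fun setT (fun g : R => expR (c * `|g|)).
Proof. by apply: measurableT_comp => //; exact: measurable_funM. Qed.

Let mf1 g : measurable_fun setT (fun h => f (g, h)).
Proof. exact: measurableT_comp. Qed.

Let mf2 h : measurable_fun setT (fun g => f (g, h)).
Proof. exact: measurableT_comp. Qed.

Let C0 : 0 <= C.
Proof.
by have := le_trans (normr_ge0 _) (fC 0 0); rewrite normr0 mulr0 expR0 !mulr1.
Qed.

Let J := \int[gam]_g expR (c * `|g|).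

Let intE : gam.-integrable setT (EFin \o (fun g : R => expR (c * `|g|))).
Proof.
by apply: (gauss_integrable (C := 1) (c := c)) => // x; rewrite mul1r ger0_norm// expR_ge0.
Qed.

Lemma gauss2_integrable1 g : gam.-integrable setT (EFin \o (fun h => f (g, h))).
Proof. exact: (gauss_integrable (C := C * expR (c * `|g|)) (c := c)). Qed.

Lemma gauss2_integrable2 h : gam.-integrable setT (EFin \o (fun g => f (g, h))).
Proof.
apply: (gauss_integrable (C := C * expR (c * `|h|)) (c := c)) => // g.
by rewrite mulrAC.
Qed.

(** Exponential growth in each variable supplies the absolute integrability that Fubini's theorem
    asks of a signed function. *)
Lemma gauss2_integrable : (gam \x gam)%E.-integrable setT (EFin \o f).
Proof.
apply/integrable12ltyP; first exact/measurable_EFinP.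
apply: (@le_lt_trans _ _ (\int[gam]_g ((C * J)%:E * (expR (c * `|g|))%:E))%E).
  apply: ge0_le_integral => //.
  - by move=> g _; exact: integral_ge0.
  - apply: (@measurable_fun_fubini_tonelli_F _ _ _ _ R gam (fun x => `|(f x)%:E|%E)) => //.
    by apply: measurableT_comp => //; exact/measurable_EFinP.
  - by apply: emeasurable_funM => //; exact/measurable_EFinP.
  - move=> g _.
    apply: (@le_trans _ _ (\int[gam]_h ((C * expR (c * `|g|))%:E * (expR (c * `|h|))%:E))%E).
      apply: ge0_le_integral => //.
      - by apply: measurableT_comp => //; exact/measurable_EFinP.
      - by apply: emeasurable_funM => //; exact/measurable_EFinP.
      - by move=> h _; rewrite /= lee_fin.
    rewrite ge0_integralZl_EFin//; last 2 first.
    - exact/measurable_EFinP.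
    - by rewrite mulr_ge0// expR_ge0.
    rewrite -(fineK (integrable_fin_num measurableT intE)) -/(Rintegral _ _ _) -/J.
    by rewrite -!EFinM lee_fin mulrAC.
rewrite ge0_integralZl_EFin//; last 2 first.
- exact/measurable_EFinP.
- by rewrite mulr_ge0// Rintegral_ge0// => x _; exact: expR_ge0.
rewrite -(fineK (integrable_fin_num measurableT intE)) -EFinM; exact: ltry.
Qed.

Lemma gauss2_prod1 : \int[gam]_g \int[gam]_h f (g, h) = \int[(gam \x gam)%E]_x f x.
Proof.
rewrite {3}/Rintegral -(integral12_prod_meas1 gauss2_integrable)/=; congr fine.
apply: eq_integral => g _; rewrite fineK//.
exact: (integrable_fin_num measurableT (gauss2_integrable1 g)).
Qed.

Lemma gauss2_prod2 : \int[gam]_h \int[gam]_g f (g, h) = \int[(gam \x gam)%E]_x f x.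
Proof.
rewrite {3}/Rintegral -(integral21_prod_meas1 gauss2_integrable)/=; congr fine.
apply: eq_integral => h _; rewrite fineK//.
exact: (integrable_fin_num measurableT (gauss2_integrable2 h)).
Qed.

Lemma gauss2_swap :
  \int[gam]_g \int[gam]_h f (g, h) = \int[gam]_h \int[gam]_g f (g, h).
Proof. by rewrite gauss2_prod1 gauss2_prod2. Qed.

End gauss2.

Lemma gauss_stable_Rintegral (R : realType) (a b C c : R) (f : R -> R) :
  0 < a -> a ^+ 2 + b ^+ 2 = 1 -> measurable_fun setT f ->
  (forall x, `|f x| <= C * expR (c * `|x|)) ->
  \int[std_normal R]_v \int[std_normal R]_u f (a * u + b * v) =
  \int[std_normal R]_x f x.
Proof.
move=> a0 ab mf fC; set gam := std_normal R.
pose phi (x : R * R) := a * x.2 + b * x.1.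
have mphi : measurable_fun setT phi.
  by apply: measurable_funD; exact: measurable_funM.
have C0 : 0 <= C.
  by have := le_trans (normr_ge0 _) (fC 0); rewrite normr0 mulr0 expR0 mulr1.
have fC2 (g h : R) : `|f (phi (g, h))| <=
    C * expR (`|c| * (`|a| + `|b|) * `|g|) * expR (`|c| * (`|a| + `|b|) * `|h|).
  rewrite (le_trans (fC _))// -mulrA ler_wpM2l// -expRD ler_expR -mulrDr.
  apply: (@le_trans _ _ (`|c| * `|phi (g, h)|)).
    by rewrite ler_wpM2r// ler_norm.
  rewrite -mulrA ler_wpM2l// /phi/= (le_trans (ler_normD _ _))// !normrM.
  have := mulr_ge0 (normr_ge0 a) (normr_ge0 g).
  have := mulr_ge0 (normr_ge0 b) (normr_ge0 h).
  by rewrite mulrDr !mulrDl; lra.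
have mfp : measurable_fun setT (f \o phi) by exact: measurableT_comp.
rewrite (gauss2_prod1 mfp fC2).
have int2 := gauss2_integrable mfp fC2.
rewrite /Rintegral; congr fine.
have H (h : R -> \bar R) : measurable_fun setT h -> (forall x, 0 <= h x)%E ->
    (\int[(gam \x gam)%E]_x h (phi x) = \int[gam]_x h x)%E.
  move=> mh h0; rewrite -(gauss_stable a0 ab mh h0).
  by rewrite (fubini_tonelli1 _ (measurableT_comp mh mphi) (fun x => h0 _)).
by apply: (integral_transfer H); exact/measurable_EFinP.
Qed.

Section tame.
Context (R : realType) (I : finType).
Local Notation gam := (std_normal R).
Implicit Types (H a v : I -> R) (Phi Psi : (I -> R) -> R).

Definition nrm H : R := \sum_i `|H i|.

Lemma nrm_ge0 H : 0 <= nrm H. Proof. exact: sumr_ge0. Qed.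

Lemma le_nrm H i : `|H i| <= nrm H.
Proof. by rewrite /nrm (bigD1 i)//= lerDl sumr_ge0. Qed.

Lemma nrmD H a : nrm (fun i => H i + a i) <= nrm H + nrm a.
Proof. by rewrite /nrm -big_split; apply: ler_sum => i _; exact: ler_normD. Qed.

Lemma nrmZ (g : R) a : nrm (fun i => g * a i) = `|g| * nrm a.
Proof. by rewrite /nrm mulr_sumr; apply: eq_bigr => i _; rewrite normrM. Qed.

(* Since I -> R carries no sigma-algebra, measurability of Phi is tested along
   all measurable families. *)
Definition tame Phi : Prop :=
  (forall d (T : measurableType d) (h : I -> T -> R),
     (forall i, measurable_fun setT (h i)) ->
     measurable_fun setT (fun t => Phi (fun i => h i t))) /\
  exists C c : R, [/\ 0 <= C, 0 <= c & forall H, `|Phi H| <= C * expR (c * nrm H)].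

(** A Gaussian observation moves the log-likelihood H by g a + v with g standard; averaging over g
    makes it an operator on functions of H, a heat semigroup with drift. *)
Definition gop a v Phi H : R := \int[gam]_g Phi (fun i => H i + g * a i + v i).

Lemma tame_cst (r : R) : tame (fun=> r).
Proof.
split; first by move=> *; exact: measurable_cst.
exists `|r|, 0; split=> // H; by rewrite mul0r expR0 mulr1.
Qed.

Lemma tameD Phi Psi : tame Phi -> tame Psi -> tame (fun H => Phi H + Psi H).
Proof.
move=> [mP [C [c [C0 c0 hC]]]] [mQ [D [e [D0 e0 hD]]]]; split.
  by move=> d T h mh; apply: measurable_funD; [exact: mP|exact: mQ].
exists (C + D), (c + e); split; [exact: addr_ge0|exact: addr_ge0|] => H.
rewrite (le_trans (ler_normD _ _))// mulrDl lerD//.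
  rewrite (le_trans (hC H))// ler_wpM2l// ler_expR mulrDl lerDl.
  by rewrite mulr_ge0// nrm_ge0.
rewrite (le_trans (hD H))// ler_wpM2l// ler_expR mulrDl lerDr.
by rewrite mulr_ge0// nrm_ge0.
Qed.

Lemma tameM Phi Psi : tame Phi -> tame Psi -> tame (fun H => Phi H * Psi H).
Proof.
move=> [mP [C [c [C0 c0 hC]]]] [mQ [D [e [D0 e0 hD]]]]; split.
  by move=> d T h mh; apply: measurable_funM; [exact: mP|exact: mQ].
exists (C * D), (c + e); split; [exact: mulr_ge0|exact: addr_ge0|] => H.
by rewrite normrM mulrDl expRD mulrACA ler_pM.
Qed.

Lemma tameZ (r : R) Phi : tame Phi -> tame (fun H => r * Phi H).
Proof. exact: (tameM (tame_cst r)). Qed.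

Lemma tameB Phi Psi : tame Phi -> tame Psi -> tame (fun H => Phi H - Psi H).
Proof.
move=> tP tQ; have := tameD tP (tameZ (-1) tQ).
by congr tame; apply/funext => H; rewrite mulN1r.
Qed.

Lemma tame_sum (J : Type) (s : seq J) (F : J -> (I -> R) -> R) :
  (forall j, tame (F j)) -> tame (fun H => \sum_(j <- s) F j H).
Proof.
move=> tF; elim: s => [|j s IH].
  by rewrite (_ : (fun H => _) = fun=> 0); [exact: tame_cst|
    apply/funext => H; rewrite big_nil].
rewrite (_ : (fun H => _) = fun H => F j H + \sum_(j <- s) F j H).
  exact: tameD.
by apply/funext => H; rewrite big_cons.
Qed.

Lemma tame_expR i : tame (fun H => expR (H i)).
Proof.
split; first by move=> d T h mh; apply: measurableT_comp.
exists 1, 1; split=> // H; rewrite !mul1r ger0_norm ?expR_ge0// ler_expR.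
by rewrite (le_trans (ler_norm _))// le_nrm.
Qed.

Lemma tame_lineP Phi a v : tame Phi -> exists C c : R, [/\ 0 <= C, 0 <= c &
  forall H g, `|Phi (fun i => H i + g * a i + v i)| <=
    C * expR (c * nrm H) * expR (c * nrm a * `|g|)].
Proof.
move=> [_ [C [c [C0 c0 hC]]]]; exists (C * expR (c * nrm v)), c; split=> //.
  by rewrite mulr_ge0// expR_ge0.
move=> H g; rewrite (le_trans (hC _))// -!mulrA ler_wpM2l// -!expRD ler_expR.
rewrite -?mulrA -!mulrDr ler_wpM2l//.
apply: (le_trans (nrmD (fun i => H i + g * a i) v)).
rewrite addrC lerD2l (le_trans (nrmD H _))// lerD2l nrmZ.
by rewrite mulrC.
Qed.

Lemma tame_measurable_line Phi H a v : tame Phi ->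
  measurable_fun setT (fun g : R => Phi (fun i => H i + g * a i + v i)).
Proof.
move=> [mP _]; apply: (mP _ _ (fun i (g : R) => H i + g * a i + v i)) => i.
by apply: measurable_funD => //; apply: measurable_funD => //; exact: measurable_funM.
Qed.

Lemma tame_integrable Phi H a v : tame Phi ->
  gam.-integrable setT (EFin \o (fun g => Phi (fun i => H i + g * a i + v i))).
Proof.
move=> tP; have [C [c [C0 c0 hC]]] := tame_lineP a v tP.
apply: (gauss_integrable (C := C * expR (c * nrm H)) (c := c * nrm a)) => //.
exact: tame_measurable_line.
Qed.

(** Averaging keeps the exponential rate c and only enlarges the constant, by a factor for the drift
    and by the finite mean of exp (c nrm a |g|). Steps can therefore be iterated freely. *)
Lemma tame_gop a v Phi : tame Phi -> tame (gop a v Phi).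
Proof.
move=> tP; have [C [c [C0 c0 hC]]] := tame_lineP a v tP; split.
  move=> d T h mh.
  have := @measurable_Rintegral _ _ T R R gam
    (fun tg => Phi (fun i => h i tg.1 + tg.2 * a i + v i)).
  apply; case: tP => mP _.
  apply: (mP _ _ (fun i (tg : T * R) => h i tg.1 + tg.2 * a i + v i)) => i.
  apply: measurable_funD => //; apply: measurable_funD => //.
    exact: (measurableT_comp (mh i)).
  exact: measurable_funM.
pose J := \int[gam]_g (expR (c * nrm a * `|g|)).
have iJ : gam.-integrable setT (EFin \o (fun g : R => expR (c * nrm a * `|g|))).
  apply: (gauss_integrable (C := 1) (c := c * nrm a)).
    by apply: measurableT_comp => //; apply: measurable_funM => //.
  by move=> g; rewrite mul1r ger0_norm// expR_ge0.
have J0 : 0 <= J by apply: Rintegral_ge0 => x _; exact: expR_ge0.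
exists (C * J), c; split=> //; first exact: mulr_ge0.
move=> H; rewrite /gop.
apply: (le_trans (le_normr_Rintegral measurableT (tame_integrable H a v tP))).
rewrite mulrAC -RintegralZl//; apply: le_Rintegral => //.
- by apply: integrable_norm; exact: tame_integrable.
- exact: (integrableZl measurableT (C * expR (c * nrm H)) iJ).
Qed.

Lemma gop_cst a v (r : R) H : gop a v (fun=> r) H = r.
Proof. exact: Rintegral_prob_cst. Qed.

Lemma gopD a v Phi Psi H : tame Phi -> tame Psi ->
  gop a v (fun H => Phi H + Psi H) H = gop a v Phi H + gop a v Psi H.
Proof. by move=> tP tQ; rewrite /gop RintegralD//; exact: tame_integrable. Qed.

Lemma gopB a v Phi Psi H : tame Phi -> tame Psi ->
  gop a v (fun H => Phi H - Psi H) H = gop a v Phi H - gop a v Psi H.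
Proof. by move=> tP tQ; rewrite /gop RintegralB//; exact: tame_integrable. Qed.

Lemma gopZ a v (r : R) Phi H : tame Phi ->
  gop a v (fun H => r * Phi H) H = r * gop a v Phi H.
Proof. by move=> tP; rewrite /gop RintegralZl//; exact: tame_integrable. Qed.

Lemma gop_sum a v (J : Type) (s : seq J) (F : J -> (I -> R) -> R) H :
  (forall j, tame (F j)) ->
  gop a v (fun H => \sum_(j <- s) F j H) H = \sum_(j <- s) gop a v (F j) H.
Proof.
move=> tF; elim: s => [|j s IH].
  rewrite big_nil -[RHS](gop_cst a v 0 H); congr gop.
  by apply/funext => ?; rewrite big_nil.
rewrite big_cons -IH -gopD//; last exact: tame_sum.
by congr gop; apply/funext => ?; rewrite big_cons.
Qed.

Lemma le_gop a v Phi Psi H : tame Phi -> tame Psi ->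
  (forall H, Phi H <= Psi H) -> gop a v Phi H <= gop a v Psi H.
Proof. by move=> tP tQ le; apply: le_Rintegral => //; exact: tame_integrable. Qed.

Lemma gop0 Phi H : gop (fun=> 0) (fun=> 0) Phi H = Phi H.
Proof.
rewrite -[RHS](Rintegral_prob_cst gam); congr fine; apply: eq_integral => g _.
by congr (Phi _)%:E; apply/funext => i; rewrite mulr0 !addr0.
Qed.

(** The increments of H add up in either order, so commutation is Fubini's theorem for the two
    Gaussians. *)
Lemma gop_comm a v b w Phi H : tame Phi ->
  gop a v (gop b w Phi) H = gop b w (gop a v Phi) H.
Proof.
move=> tP; have [C [c [C0 c0 hC]]] := tame_lineP b w tP.
pose f (gh : R * R) := Phi (fun i => H i + gh.1 * a i + v i + gh.2 * b i + w i).
pose K := C * expR (c * nrm H) * expR (c * nrm v).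
pose k := c * (nrm a + nrm b).
have K0 : 0 <= K by rewrite !mulr_ge0// expR_ge0.
have fC g h : `|f (g, h)| <= K * expR (k * `|g|) * expR (k * `|h|).
  apply: (le_trans (hC _ _)).
  rewrite /K /k -!mulrA ler_wpM2l// -!expRD ler_expR -?mulrA -!mulrDr ler_wpM2l//.
  have -> : (fun i => H i + g * a i + v i) = (fun i => (H i + g * a i) + v i) by [].
  have := nrmD (fun i => H i + g * a i) v.
  have := nrmD H (fun i => g * a i); rewrite nrmZ.
  have := mulr_ge0 (normr_ge0 g) (nrm_ge0 b).
  have := mulr_ge0 (normr_ge0 h) (nrm_ge0 a).
  by rewrite ![(nrm a + nrm b) * _]mulrDl; lra.
have mf : measurable_fun setT f.
  case: tP => mP _.
  apply: (mP _ _ (fun i (gh : R * R) => H i + gh.1 * a i + v i + gh.2 * b i + w i)) => i.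
  apply: measurable_funD => //; apply: measurable_funD; last exact: measurable_funM.
  apply: measurable_funD => //; apply: measurable_funD => //; exact: measurable_funM.
rewrite {1}/gop /gop (gauss2_swap mf fC).
congr fine; apply: eq_integral => h _; congr (_%:E); congr fine.
apply: eq_integral => g _; congr (Phi _)%:E; apply/funext => i /=; ring.
Qed.

(** Independent Gaussians of variances s and t add up to one of variance s + t, and drifts are
    additive in time: [gauss_stable] with coefficients sqrt (t / (s + t)) and sqrt (s / (s + t)). *)
Lemma gop_semigroup (s t : R) a v Phi H : 0 <= s -> 0 <= t -> tame Phi ->
  gop (fun i => Num.sqrt s * a i) (fun i => s * v i)
    (gop (fun i => Num.sqrt t * a i) (fun i => t * v i) Phi) H =
  gop (fun i => Num.sqrt (s + t) * a i) (fun i => (s + t) * v i) Phi H.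
Proof.
(* The case t = 0 is separate because [gauss_stable_Rintegral] asks for a positive first
   coefficient, here sqrt t / r. *)
move=> s0; rewrite le_eqVlt => /predU1P[<- _|t0 tP].
  rewrite addr0; congr gop; apply/funext => K; rewrite -[RHS]gop0 sqrtr0.
  by congr (gop _ _ Phi K); apply/funext => i; rewrite mul0r.
pose r := Num.sqrt (s + t).
have st0 : 0 < s + t by rewrite ltr_wpDl.
have r0 : 0 < r by rewrite sqrtr_gt0.
have r2 : r ^+ 2 = s + t by rewrite sqr_sqrtr// ltW.
pose a' i := r * a i; pose v' i := (s + t) * v i.
have [C [c [C0 c0 hC]]] := tame_lineP a' v' tP.
have mf := tame_measurable_line H a' v' tP.
have q1 : (Num.sqrt t / r) ^+ 2 + (Num.sqrt s / r) ^+ 2 = 1.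
  rewrite !exprMn !sqr_sqrtr ?(ltW t0)// exprVn r2 -mulrDl [t + s]addrC.
  by rewrite divff// gt_eqF.
have q0 : 0 < Num.sqrt t / r by rewrite divr_gt0 ?sqrtr_gt0.
have E := gauss_stable_Rintegral q0 q1 mf (hC H).
transitivity (\int[gam]_x Phi (fun i => H i + x * a' i + v' i)); last by [].
rewrite -E {1}/gop /gop.
congr fine; apply: eq_integral => g _; congr (_%:E); congr fine.
apply: eq_integral => h _; congr (Phi _)%:E; apply/funext => i /=.
by rewrite /a' /v'; field; rewrite gt_eqF.
Qed.

End tame.

Section gops.
Context (R : realType) (I : finType).
Local Notation gam := (std_normal R).
Implicit Types (H : I -> R) (Phi Psi : (I -> R) -> R).
Implicit Types (l : seq ((I -> R) * (I -> R))) (s t : R).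

(* A step of time t in the channel l: a covariance t * sum_a a (x) a and a drift
   t * sum_v v are added to the Hamiltonian. *)
Definition gops l t Phi : (I -> R) -> R :=
  foldr (fun av F => gop (fun i => Num.sqrt t * av.1 i) (fun i => t * av.2 i) F)
    Phi l.

Lemma tame_gops l t Phi : tame Phi -> tame (gops l t Phi).
Proof. by move=> tP; elim: l => //= av l IH; exact: tame_gop. Qed.

Lemma gops_cst l t (r : R) : gops l t (fun=> r) = fun=> r.
Proof.
by elim: l => //= av l ->; apply/funext => H; rewrite gop_cst.
Qed.

Lemma gopsD l t Phi Psi : tame Phi -> tame Psi ->
  gops l t (fun H => Phi H + Psi H) = fun H => gops l t Phi H + gops l t Psi H.
Proof.
move=> tP tQ; elim: l => //= av l ->; apply/funext => H.
by rewrite gopD//; exact: tame_gops.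
Qed.

Lemma gopsZ l t (r : R) Phi : tame Phi ->
  gops l t (fun H => r * Phi H) = fun H => r * gops l t Phi H.
Proof.
move=> tP; elim: l => //= av l ->; apply/funext => H.
by rewrite gopZ//; exact: tame_gops.
Qed.

Lemma gopsB l t Phi Psi : tame Phi -> tame Psi ->
  gops l t (fun H => Phi H - Psi H) = fun H => gops l t Phi H - gops l t Psi H.
Proof.
move=> tP tQ; elim: l => //= av l ->; apply/funext => H.
by rewrite gopB//; exact: tame_gops.
Qed.

Lemma gops_sum l t (J : Type) (s : seq J) (F : J -> (I -> R) -> R) :
  (forall j, tame (F j)) ->
  gops l t (fun H => \sum_(j <- s) F j H) = fun H => \sum_(j <- s) gops l t (F j) H.
Proof.
move=> tF; elim: l => //= av l ->; apply/funext => H.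
by rewrite gop_sum// => j; exact: tame_gops.
Qed.

Lemma le_gops l t Phi Psi : tame Phi -> tame Psi ->
  (forall H, Phi H <= Psi H) -> forall H, gops l t Phi H <= gops l t Psi H.
Proof.
move=> tP tQ le; elim: l => //= av l IH H.
by apply: le_gop => //; exact: tame_gops.
Qed.

Lemma gops0 l Phi : gops l 0 Phi = Phi.
Proof.
elim: l => //= av l ->; apply/funext => H; rewrite -[RHS]gop0 sqrtr0.
by congr (gop _ _ Phi H); apply/funext => i; rewrite mul0r.
Qed.

Lemma gop_gops_comm a v l t Phi : tame Phi ->
  gop a v (gops l t Phi) = gops l t (gop a v Phi).
Proof.
move=> tP; elim: l => //= av l <-; apply/funext => H.
by rewrite gop_comm//; exact: tame_gops.
Qed.

Lemma gops_comm l l' s t Phi : tame Phi ->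
  gops l s (gops l' t Phi) = gops l' t (gops l s Phi).
Proof.
move=> tP; elim: l => //= av l ->.
by rewrite gop_gops_comm//; exact: tame_gops.
Qed.

Lemma gops_semigroup l s t Phi : 0 <= s -> 0 <= t -> tame Phi ->
  gops l s (gops l t Phi) = gops l (s + t) Phi.
Proof.
move=> s0 t0 tP; elim: l => //= av l <-.
rewrite -gop_gops_comm; last exact: tame_gops.
apply/funext => H; rewrite -gop_semigroup//.
by do 2 apply: tame_gops.
Qed.

Lemma gops_nat l (d : R) n Phi : 0 <= d -> tame Phi ->
  gops l (n.+1%:R * d) Phi = gops l d (gops l (n%:R * d) Phi).
Proof.
by move=> d0 tP; rewrite gops_semigroup ?mulr_ge0// -natr1 mulrDl mul1r addrC.
Qed.

End gops.

(** * Comparison of channels by many small steps *)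

Section telescoping.
Context (R : realType) (I : finType).
Implicit Types (H : I -> R) (Phi Th : (I -> R) -> R).
Variables (q l : seq ((I -> R) * (I -> R))).

(** After N + 1 steps of length d = t / (N + 1), errors of size d sqrt d accumulate to t sqrt (t /
    (N + 1)). The condition t <= N + 1 says that d <= 1, where the one-step bounds hold. *)
Lemma le_lim_invsqrt (x y C t : R) : 0 <= t ->
  (forall N : nat, t <= N.+1%:R -> x <= y + C * (t * Num.sqrt (t / N.+1%:R))) ->
  x <= y.
Proof.
move=> t0 h; apply/ler_addgt0Pl => e e0; rewrite addrC.
pose B := `|C| * t.
have B0 : 0 <= B by rewrite mulr_ge0.
(* For N + 1 >= t (B / e)^2 the error B sqrt (t / (N + 1)) is at most e; the summand t secures t <=
   N + 1. *)
pose K : R := t * (B / e) ^+ 2 + t.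
have K0 : 0 <= K by rewrite addr_ge0// mulr_ge0// sqr_ge0.
have [N NK] : exists N : nat, K <= N.+1%:R.
  exists (Num.truncn K); apply: ltW; rewrite -natr1.
  by have := truncnS_gt K; rewrite -natr1.
have tN : t <= N.+1%:R.
  by rewrite (le_trans _ NK)// lerDr mulr_ge0// sqr_ge0.
apply: (le_trans (h N tN)); rewrite lerD2l mulrA.
have N0 : 0 < N.+1%:R :> R by [].
apply: (@le_trans _ _ (B * Num.sqrt (t / N.+1%:R))).
  by rewrite ler_wpM2r ?sqrtr_ge0// ler_wpM2r// ler_norm.
have [B00|B00] := eqVneq B 0; first by rewrite B00 mul0r ltW.
have Bp : 0 < B by rewrite lt_neqAle eq_sym B00.
rewrite -ler_pdivlMl// [B^-1 * e]mulrC -(ger0_norm (divr_ge0 (ltW e0) B0)) -sqrtr_sqr.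
rewrite ler_wsqrtr// ler_pdivrMr//.
have -> : t = (e / B) ^+ 2 * (t * (B / e) ^+ 2).
  by field; rewrite B00 gt_eqF.
rewrite ler_wpM2l ?sqr_ge0// (le_trans _ NK)// lerDl//.
Qed.

(** A hybrid argument: steps of [q] are exchanged for steps of [l] one at a time. By commutation the
    step to be exchanged can be applied to [Phi] directly, where the one-step bound holds. As [Th1]
    and [Th2] are invariant under both channels, the costs of the exchanges simply add up. *)
Lemma gops_telescope Phi Th1 Th2 (K t : R) :
  tame Phi -> tame Th1 -> tame Th2 -> 0 <= t ->
  (forall s, 0 <= s -> gops q s Th1 = Th1) ->
  (forall s, 0 <= s -> gops l s Th1 = Th1) ->
  (forall s, 0 <= s -> gops q s Th2 = Th2) ->
  (forall s, 0 <= s -> gops l s Th2 = Th2) ->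
  (forall d H, 0 <= d <= 1 -> gops q d Phi H <=
     gops l d Phi H + d * Th1 H + K * (d * Num.sqrt d) * Th2 H) ->
  forall H, gops q t Phi H <= gops l t Phi H + t * Th1 H.
Proof.
move=> tP t1 t2 t0 q1 l1 q2 l2 step H.
apply: (@le_lim_invsqrt _ _ (K * Th2 H) t) => // N tN.
pose d := t / N.+1%:R.
have N0 : 0 < N.+1%:R :> R by [].
have d0 : 0 <= d by rewrite divr_ge0.
have d1 : d <= 1 by rewrite ler_pdivrMr// mul1r.
pose eps H := d * Th1 H + K * (d * Num.sqrt d) * Th2 H.
have te : tame eps by apply: tameD; exact: tameZ.
have qe : gops q d eps = eps.
  by rewrite /eps gopsD ?gopsZ ?q1 ?q2//; exact: tameZ.
have le s : 0 <= s -> gops l s eps = eps.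
  by move=> s0; rewrite /eps gopsD ?gopsZ ?l1 ?l2//; exact: tameZ.
have ind j : forall H, gops q (j%:R * d) Phi H <=
    gops l (j%:R * d) Phi H + j%:R * eps H.
  elim: j => [|j IH] H'; first by rewrite !mul0r !gops0 addr0.
  rewrite gops_nat//.
  have tl : tame (gops l (j%:R * d) Phi) by exact: tame_gops.
  apply: (le_trans (le_gops _ _ (tame_gops _ _ tP) _ IH H')).
    by apply: tameD => //; exact: tameZ.
  rewrite gopsD//; last exact: tameZ.
  rewrite gopsZ// qe gops_comm//.
  have -> : gops l (j.+1%:R * d) Phi = gops l (j%:R * d) (gops l d Phi).
    by rewrite gops_nat// gops_comm.
  rewrite -natr1 mulrDl mul1r [_ * _ + eps _]addrC addrA lerD2r.
  have jd : 0 <= j%:R * d by rewrite mulr_ge0.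
  rewrite -[X in _ + X](congr1 (fun F => F H') (le _ jd)).
  have -> : gops l (j%:R * d) (gops l d Phi) H' + gops l (j%:R * d) eps H' =
      gops l (j%:R * d) (fun H => gops l d Phi H + eps H) H'.
    by rewrite gopsD//; exact: tame_gops.
  apply: le_gops; first exact: tame_gops.
    by apply: tameD => //; exact: tame_gops.
  move=> H''; rewrite /eps addrA; apply: step.
  by rewrite d0.
have dN : N.+1%:R * d = t by rewrite /d mulrC divfK// gt_eqF.
have := ind N.+1 H; rewrite dN /eps.
have -> : N.+1%:R * (d * Th1 H + K * (d * Num.sqrt d) * Th2 H) =
   (N.+1%:R * d) * Th1 H + K * Th2 H * ((N.+1%:R * d) * Num.sqrt d) by ring.
by rewrite dN addrA.
Qed.

(* Here Th1 is only a submartingale along the channel. *)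
Lemma gops_telescope_sub Phi Th1 Th2 (K t : R) :
  tame Phi -> tame Th1 -> tame Th2 -> 0 <= t ->
  (forall s H, 0 <= s -> Th1 H <= gops q s Th1 H) ->
  (forall s, 0 <= s -> gops q s Th2 = Th2) ->
  (forall d H, 0 <= d <= 1 -> gops q d Phi H <=
     Phi H + d * Th1 H + K * (d * Num.sqrt d) * Th2 H) ->
  forall H, gops q t Phi H <= Phi H + t * gops q t Th1 H.
Proof.
move=> tP t1 t2 t0 q1 q2 step H.
apply: (@le_lim_invsqrt _ _ (K * Th2 H) t) => // N tN.
pose d := t / N.+1%:R.
have N0 : 0 < N.+1%:R :> R by [].
have d0 : 0 <= d by rewrite divr_ge0.
have d1 : d <= 1 by rewrite ler_pdivrMr// mul1r.
have dN : N.+1%:R * d = t by rewrite /d mulrC divfK// gt_eqF.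
have ind j : (j <= N.+1)%N -> gops q (j%:R * d) Phi H <=
    Phi H + j%:R * (d * gops q t Th1 H + K * (d * Num.sqrt d) * Th2 H).
  elim: j => [|j IH] jN; first by rewrite !mul0r !gops0 addr0.
  rewrite gops_nat// -gops_comm//.
  have jd : 0 <= j%:R * d by rewrite mulr_ge0.
  apply: (@le_trans _ _ (gops q (j%:R * d)
      (fun H => Phi H + d * Th1 H + K * (d * Num.sqrt d) * Th2 H) H)).
    apply: le_gops; first exact: tame_gops.
      by apply: tameD; [apply: tameD => //|]; exact: tameZ.
    by move=> H''; apply: step; rewrite d0.
  rewrite gopsD; [|by apply: tameD => //; exact: tameZ|exact: tameZ].
  rewrite gopsD//; last exact: tameZ.
  rewrite !gopsZ// q2// -natr1 mulrDl mul1r.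
  have b : gops q (j%:R * d) Th1 H <= gops q t Th1 H.
    have tj : 0 <= t - j%:R * d.
      by rewrite subr_ge0 -dN ler_wpM2r// ler_nat ltnW.
    rewrite -[t in leRHS](subrK (j%:R * d)) [_ - _ + _]addrC -gops_semigroup//.
    apply: le_gops => //; first exact: tame_gops.
    by move=> H'; exact: q1.
  have := ler_wpM2l d0 b; have := IH (ltnW jN); lra.
have := ind N.+1 (leqnn _); rewrite dN.
have -> : N.+1%:R * (d * gops q t Th1 H + K * (d * Num.sqrt d) * Th2 H) =
   (N.+1%:R * d) * gops q t Th1 H + K * Th2 H * ((N.+1%:R * d) * Num.sqrt d).
  by ring.
by rewrite dN addrA.
Qed.

(** Since [Th1] grows in mean along the channel, its value at the start bounds the gain of every
    step from below, just as its mean at the end bounds it from above in [gops_telescope_sub]. *)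
Lemma gops_telescope_sub_ge Phi Th1 Th2 (K t : R) :
  tame Phi -> tame Th1 -> tame Th2 -> 0 <= t ->
  (forall s H, 0 <= s -> Th1 H <= gops q s Th1 H) ->
  (forall s, 0 <= s -> gops q s Th2 = Th2) ->
  (forall d H, 0 <= d <= 1 -> Phi H + d * Th1 H <=
     gops q d Phi H + K * (d * Num.sqrt d) * Th2 H) ->
  forall H, Phi H + t * Th1 H <= gops q t Phi H.
Proof.
move=> tP t1 t2 t0 q1 q2 step H.
apply: (@le_lim_invsqrt _ _ (K * Th2 H) t) => // N tN.
pose d := t / N.+1%:R.
have N0 : 0 < N.+1%:R :> R by [].
have d0 : 0 <= d by rewrite divr_ge0.
have d1 : d <= 1 by rewrite ler_pdivrMr// mul1r.
have dN : N.+1%:R * d = t by rewrite /d mulrC divfK// gt_eqF.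
have ind j : Phi H + j%:R * (d * Th1 H) <= gops q (j%:R * d) Phi H +
    j%:R * (K * (d * Num.sqrt d) * Th2 H).
  elim: j => [|j IH]; first by rewrite !mul0r !gops0.
  rewrite gops_nat// -gops_comm//.
  have jd : 0 <= j%:R * d by rewrite mulr_ge0.
  have : gops q (j%:R * d)
      (fun H => Phi H + d * Th1 H - K * (d * Num.sqrt d) * Th2 H) H <=
      gops q (j%:R * d) (gops q d Phi) H.
    apply: le_gops; last by move=> H''; rewrite lerBlDr; apply: step; rewrite d0.
      by apply: tameB; [apply: tameD => //|]; exact: tameZ.
    exact: tame_gops.
  rewrite gopsB; [|by apply: tameD => //; exact: tameZ|exact: tameZ].
  rewrite gopsD//; last exact: tameZ.
  rewrite !gopsZ// q2// -natr1 !mulrDl !mul1r => h.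
  have := ler_wpM2l d0 (q1 _ H jd); lra.
have := ind N.+1; rewrite dN.
have -> : N.+1%:R * (d * Th1 H) = (N.+1%:R * d) * Th1 H by ring.
have -> : N.+1%:R * (K * (d * Num.sqrt d) * Th2 H) =
   K * Th2 H * ((N.+1%:R * d) * Num.sqrt d) by ring.
by rewrite dN.
Qed.

End telescoping.

Section ln_bounds.
Context (R : realType).

Lemma ln_le_sub1 (x : R) : 0 < x -> ln x <= x - 1.
Proof.
move=> x0; have := @le_ln1Dx R (x - 1).
by rewrite subrKC; apply; lra.
Qed.

Lemma ln1D_approx (y : R) : 0 <= y -> y - y ^+ 2 <= ln (1 + y) <= y.
Proof.
move=> y0; have y1 : 0 < 1 + y by rewrite ltr_pwDl.
apply/andP; split; last by have := ln_le_sub1 y1; lra.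
have i0 : 0 < (1 + y)^-1 by rewrite invr_gt0.
have := ln_le_sub1 i0; rewrite lnV ?posrE// => h.
have e : (1 + y)^-1 = 1 - y / (1 + y) by field; rewrite gt_eqF.
have : y - y ^+ 2 <= y / (1 + y).
  by rewrite ler_pdivlMr//; have := exprn_ge0 3 y0; nra.
lra.
Qed.

End ln_bounds.

(** * Gibbs measures and the cumulant expansion *)

Section gibbs.
Context (R : realType) (I : finType).
Variable W : I -> R.
Hypothesis W0 : forall i, 0 <= W i.
Variable i0 : I.
Hypothesis Wi0 : 0 < W i0.
Implicit Types (H f g h : I -> R).

(** Partition function, its logarithm and the Gibbs mean. With W a prior and H a log-likelihood,
    [Zf] is the likelihood ratio of the observation and [gibbs f H] the posterior mean of f. *)
Definition Zf H : R := \sum_i W i * expR (H i).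
Definition lnZ H : R := ln (Zf H).
Definition gibbs f H : R := (\sum_i W i * f i * expR (H i)) / Zf H.

Lemma Zf_gt0 H : 0 < Zf H.
Proof.
rewrite /Zf (bigD1 i0)//= ltr_pwDl ?mulr_gt0 ?expR_gt0//.
by apply: sumr_ge0 => i _; rewrite mulr_ge0 ?expR_ge0.
Qed.

Let Z0 H : Zf H != 0. Proof. by rewrite gt_eqF ?Zf_gt0. Qed.

Lemma gibbsE f H : Zf H * gibbs f H = \sum_i W i * f i * expR (H i).
Proof. by rewrite /gibbs mulrC divfK. Qed.

Lemma gibbs_cst (r : R) H : gibbs (fun=> r) H = r.
Proof.
rewrite /gibbs; apply: (canLR (mulfK (Z0 H))); rewrite mulr_sumr.
by apply: eq_bigr => i _; rewrite mulrAC mulrC.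
Qed.

Lemma gibbsD f g H : gibbs (fun i => f i + g i) H = gibbs f H + gibbs g H.
Proof.
rewrite /gibbs -mulrDl -big_split; congr (_ / _); apply: eq_bigr => i _ /=; ring.
Qed.

Lemma gibbsZ (r : R) f H : gibbs (fun i => r * f i) H = r * gibbs f H.
Proof.
rewrite /gibbs mulrA mulr_sumr; congr (_ / _); apply: eq_bigr => i _ /=; ring.
Qed.

Lemma gibbsB f g H : gibbs (fun i => f i - g i) H = gibbs f H - gibbs g H.
Proof.
rewrite -[- gibbs g H]mulN1r -gibbsZ -gibbsD; congr (gibbs _ H).
by apply/funext => i; rewrite mulN1r.
Qed.

Lemma gibbs_sum (J : Type) (s : seq J) (F : J -> I -> R) H :
  gibbs (fun i => \sum_(j <- s) F j i) H = \sum_(j <- s) gibbs (F j) H.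
Proof.
elim: s => [|j s IH].
  rewrite big_nil -[RHS](gibbs_cst 0 H); congr (gibbs _ H).
  by apply/funext => i; rewrite big_nil.
rewrite big_cons -IH -gibbsD; congr (gibbs _ H).
by apply/funext => i; rewrite big_cons.
Qed.

Lemma le_gibbs f g H : (forall i, f i <= g i) -> gibbs f H <= gibbs g H.
Proof.
move=> fg; rewrite /gibbs ler_pM2r ?invr_gt0 ?Zf_gt0//.
by apply: ler_sum => i _; rewrite ler_wpM2r ?expR_ge0// ler_wpM2l.
Qed.

Lemma gibbs_bound f (K : R) H : (forall i, `|f i| <= K) -> `|gibbs f H| <= K.
Proof.
move=> fK; rewrite ler_norml -{1}(gibbs_cst (- K) H) -{2}(gibbs_cst K H).
by rewrite !le_gibbs// => i; have := fK i; rewrite ler_norml => /andP[].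
Qed.

Lemma gibbs_ge0 f H : (forall i, 0 <= f i) -> 0 <= gibbs f H.
Proof. by move=> f0; rewrite -(gibbs_cst 0 H); exact: le_gibbs. Qed.

Lemma gibbs_sqr_le f H : gibbs f H ^+ 2 <= gibbs (fun i => f i ^+ 2) H.
Proof.
set m := gibbs f H; rewrite -subr_ge0.
have -> : gibbs (fun i => f i ^+ 2) H - m ^+ 2 = gibbs (fun i => (f i - m) ^+ 2) H.
  transitivity (gibbs (fun i => f i ^+ 2 - (2 * m) * f i + m ^+ 2) H).
    by rewrite gibbsD gibbsB gibbs_cst gibbsZ -/m; ring.
  by congr (gibbs _ H); apply/funext => i; ring.
by apply: gibbs_ge0 => i; exact: sqr_ge0.
Qed.

Lemma Zf_shift H h : Zf (fun i => H i + h i) = Zf H * gibbs (fun i => expR (h i)) H.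
Proof.
rewrite gibbsE; apply: eq_bigr => i _; rewrite expRD; ring.
Qed.

Lemma gibbs_expR_gt0 H h : 0 < gibbs (fun i => expR (h i)) H.
Proof. by rewrite -(pmulr_rgt0 _ (Zf_gt0 H)) -Zf_shift Zf_gt0. Qed.

Lemma lnZ_shift H h :
  lnZ (fun i => H i + h i) = lnZ H + ln (gibbs (fun i => expR (h i)) H).
Proof. by rewrite /lnZ Zf_shift lnM// posrE ?Zf_gt0 ?gibbs_expR_gt0. Qed.

Lemma ln_gibbs_bound H h (c : R) : (forall i, `|h i| <= c) ->
  `|ln (gibbs (fun i => expR (h i)) H)| <= c.
Proof.
move=> hc; have g0 := gibbs_expR_gt0 H h.
have hc1 i : - c <= h i by have := hc i; rewrite ler_norml => /andP[].
have hc2 i : h i <= c by have := hc i; rewrite ler_norml => /andP[].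
rewrite ler_norml -{1}[- c]expRK -{2}[c]expRK !ler_ln ?posrE ?expR_gt0//.
rewrite -(gibbs_cst (expR (- c)) H) -(gibbs_cst (expR c) H).
by rewrite !le_gibbs// => i; rewrite ler_expR.
Qed.

Lemma lnZ_lip H h (c : R) : (forall i, `|h i| <= c) ->
  `|lnZ (fun i => H i + h i) - lnZ H| <= c.
Proof. by move=> hc; rewrite lnZ_shift addrC addrA addNr add0r ln_gibbs_bound. Qed.

Lemma tame_Zf : tame Zf.
Proof.
by apply: tame_sum => i; apply: tameZ; exact: tame_expR.
Qed.

Lemma tame_sumW f : tame (fun H => \sum_i W i * f i * expR (H i)).
Proof. by apply: tame_sum => i; apply: tameZ; exact: tame_expR. Qed.

(** A single positive weight prevents [Zf] from decaying faster than exp (- nrm H); this is what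
    makes 1 / [Zf], and so all Gibbs means, [tame]. *)
Lemma Zf_lb H : W i0 * expR (- nrm H) <= Zf H.
Proof.
rewrite /Zf (bigD1 i0)//= -[leLHS]addr0 lerD//; last first.
  by apply: sumr_ge0 => i _; rewrite mulr_ge0 ?expR_ge0.
rewrite ler_wpM2l// ler_expR lerNl (le_trans (ler_norm _))// normrN.
exact: le_nrm.
Qed.

Lemma tame_invZ : tame (fun H => (Zf H)^-1).
Proof.
split.
  move=> d T h mh; case: tame_Zf => mZ _.
  rewrite (_ : (fun t => _) = (fun t => expR (- ln (Zf (h^~ t))))).
    apply: measurableT_comp => //; apply: measurableT_comp => //.
    by apply: measurableT_comp => //; exact: mZ.
  by apply/funext => t; rewrite expRN lnK// posrE Zf_gt0.
exists (W i0)^-1, 1; split=> //; first by rewrite invr_ge0 ltW.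
move=> H; rewrite gtr0_norm ?invr_gt0 ?Zf_gt0//.
rewrite -[X in _ <= _ * X]invrK -expRN -invfM mul1r lef_pV2 ?posrE ?Zf_gt0 ?mulr_gt0 ?expR_gt0//.
exact: Zf_lb.
Qed.

Lemma tame_gibbs f : tame (gibbs f).
Proof. by apply: tameM; [exact: tame_sumW|exact: tame_invZ]. Qed.

Lemma tame_lnZ : tame lnZ.
Proof.
split.
  move=> d T h mh; case: tame_Zf => mZ _.
  by apply: measurableT_comp => //; exact: mZ.
exists (`|lnZ (fun=> 0)| + 1), 1; split=> //.
move=> H; rewrite mul1r.
have := @lnZ_lip (fun=> 0) H _ (le_nrm H).
have -> : (fun i => 0 + H i) = H by apply/funext => i; rewrite add0r.
move=> h; have e1 := expR_ge1Dx (nrm H); have n0 := nrm_ge0 H.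
have := ler_normB (lnZ H - lnZ (fun=> 0)) (- lnZ (fun=> 0)).
rewrite opprK subrK normrN => h2.
have := normr_ge0 (lnZ (fun=> 0)); nra.
Qed.

(** The square bounds y^2 in ln (1 + y) = y + O(y^2), the term 8 exp 2 bounds the third-order Taylor
    remainder, and 3 covers the trivial range M > 1. *)
Definition cumulant_const : R := (2 + 8 * expR 2) ^+ 2 + 8 * expR 2 + 3.

(** Centre h at its Gibbs mean to get w with mean 0. Then exp w has mean 1 + y, where y is half the
    variance up to O(M^3), and the logarithm is expanded at 1. For M > 1 each term is separately
    O(M^3). *)
Lemma cumulant_expansion H h (M : R) : (forall i, `|h i| <= M) ->
  `|ln (gibbs (fun i => expR (h i)) H) - gibbs h H
     - (gibbs (fun i => h i ^+ 2) H - gibbs h H ^+ 2) / 2|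
  <= cumulant_const * M ^+ 3.
Proof.
move=> hM; have M0 : 0 <= M by rewrite (le_trans _ (hM i0)).
set m := gibbs h H; set s := gibbs (fun i => h i ^+ 2) H - m ^+ 2.
have mM : `|m| <= M by exact: gibbs_bound.
have s0 : 0 <= s by rewrite subr_ge0 gibbs_sqr_le.
have sM : s <= M ^+ 2.
  have : gibbs (fun i => h i ^+ 2) H <= M ^+ 2.
    rewrite -(gibbs_cst (M ^+ 2) H); apply: le_gibbs => i.
    by rewrite -real_normK ?num_real// lerXn2r// nnegrE.
  by have := sqr_ge0 m; rewrite /s; lra.
have e2 : 1 <= expR 2 :> R by rewrite -[leLHS]expR0 ler_expR.
have [M1|M1] := leP M 1; last first.
  have := ln_gibbs_bound H hM; have M3 : M ^+ 3 = M * M ^+ 2 by rewrite -exprS.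
  rewrite -/m; move: mM; rewrite !ler_norml /cumulant_const => /andP[a1 a2] /andP[b1 b2].
  have M2 : M <= M ^+ 2 by rewrite expr2 ler_peMl// ltW.
  have M32 : M ^+ 2 <= M ^+ 3 by rewrite M3 ler_peMl ?sqr_ge0// ltW.
  have k0 : 0 <= (2 + 8 * expR 2) ^+ 2 + 8 * expR 2 :> R.
    by rewrite addr_ge0 ?sqr_ge0//; lra.
  have M30 : 0 <= M ^+ 3 by rewrite exprn_ge0.
  have k1 := mulr_ge0 k0 M30.
  by rewrite mulrDl; apply/andP; split; lra.
pose w i := h i - m.
have wM i : `|w i| <= 2 * M.
  by rewrite (le_trans (ler_normB _ _))//; have := hM i; lra.
have -> : gibbs (fun i => expR (h i)) H = expR m * gibbs (fun i => expR (w i)) H.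
  rewrite -gibbsZ; congr (gibbs _ H); apply/funext => i.
  by rewrite -expRD /w subrKC.
rewrite lnM ?posrE ?expR_gt0 ?gibbs_expR_gt0// expRK.
pose r i := expR (w i) - 1 - w i - w i ^+ 2 / 2.
have rM i : `|r i| <= 8 * expR 2 * M ^+ 3.
  apply: (le_trans (expR_taylor3 _)).
  have w3 : `|w i| ^+ 3 <= 8 * M ^+ 3.
    have -> : 8 * M ^+ 3 = (2 * M) ^+ 3 by ring.
    by rewrite lerXn2r// ?nnegrE ?mulr_ge0.
  rewrite [leRHS]mulrAC; apply: ler_pM => //; rewrite ?exprn_ge0 ?expR_ge0//.
  by rewrite ler_expR (le_trans (wM i))//; lra.
have gw : gibbs w H = 0 by rewrite gibbsB gibbs_cst subrr.
have gw2 : gibbs (fun i => w i ^+ 2) H = s.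
  transitivity (gibbs (fun i => h i ^+ 2 - (2 * m) * h i + m ^+ 2) H).
    by congr (gibbs _ H); apply/funext => i; rewrite /w; ring.
  by rewrite gibbsD gibbsB gibbs_cst gibbsZ -/m /s; ring.
pose y := s / 2 + gibbs r H.
have yE : gibbs (fun i => expR (w i)) H = 1 + y.
  transitivity (gibbs (fun i => 1 + w i + 2^-1 * w i ^+ 2 + r i) H).
    by congr (gibbs _ H); apply/funext => i; rewrite /r; field.
  by rewrite 3!gibbsD gibbs_cst gw gibbsZ gw2 /y; field.
(* As exp w >= 1 + w and w has mean 0, the mean 1 + y is at least 1, which is the range of
   [ln1D_approx]. *)
have y0 : 0 <= y.
  have : 1 <= gibbs (fun i => expR (w i)) H.
    have -> : 1 = gibbs (fun i => 1 + w i) H by rewrite gibbsD gibbs_cst gw addr0.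
    by apply: le_gibbs => i; exact: expR_ge1Dx.
  by rewrite yE; lra.
have grM : `|gibbs r H| <= 8 * expR 2 * M ^+ 3 by exact: gibbs_bound.
have M32 : M ^+ 3 <= M ^+ 2 by rewrite exprS ler_piMl// sqr_ge0.
have M20 : 0 <= M ^+ 2 by exact: sqr_ge0.
have yM : y <= (2 + 8 * expR 2) * M ^+ 2.
  have := ler_norm (gibbs r H); rewrite /y.
  have : 8 * expR 2 * M ^+ 3 <= 8 * expR 2 * M ^+ 2 by rewrite ler_wpM2l//; lra.
  by rewrite mulrDl; lra.
have y2 : y ^+ 2 <= (2 + 8 * expR 2) ^+ 2 * M ^+ 3.
  apply: (@le_trans _ _ ((2 + 8 * expR 2) ^+ 2 * (M ^+ 2) ^+ 2)).
    by rewrite -exprMn lerXn2r// nnegrE ?(le_trans y0).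
  rewrite ler_wpM2l ?sqr_ge0//.
  have -> : (M ^+ 2) ^+ 2 = M * M ^+ 3 by ring.
  by rewrite ler_piMl// exprn_ge0.
have /andP[l1 l2] := ln1D_approx y0.
rewrite yE /cumulant_const.
have M30 : 0 <= M ^+ 3 by rewrite exprn_ge0.
move: grM; rewrite !ler_norml => /andP[g1 g2].
have -> : m + ln (1 + y) - m - s / 2 = ln (1 + y) - y + gibbs r H.
  by rewrite /y; ring.
by apply/andP; split; lra.
Qed.

(** The difference is the covariance ratio gibbs ((f - a) (exp h - 1)) / gibbs (exp h), with a the
    Gibbs mean of f: for c <= 1 the numerator is at most 2 F c exp 1 and the denominator at least
    exp (- 1). For c > 1 the bound 2 F is already enough. *)
Lemma gibbs_lip f H h (F c : R) : (forall i, `|f i| <= F) -> (forall i, `|h i| <= c) ->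
  `|gibbs f (fun i => H i + h i) - gibbs f H| <= 2 * F * expR 2 * c.
Proof.
move=> fF hc; have F0 : 0 <= F by rewrite (le_trans _ (fF i0)).
have c0 : 0 <= c by rewrite (le_trans _ (hc i0)).
have e2 : 1 <= expR 2 :> R by rewrite -[leLHS]expR0 ler_expR.
set a := gibbs f H.
have aF : `|a| <= F by exact: gibbs_bound.
have [c1|c1] := leP c 1; last first.
  apply: (@le_trans _ _ (2 * F)).
    have a'F : `|gibbs f (fun i => H i + h i)| <= F by exact: gibbs_bound.
    by rewrite (le_trans (ler_normB _ _))//; lra.
  by rewrite -mulrA ler_peMr ?mulr_ge0//; nra.
have E : gibbs f (fun i => H i + h i) - a =
    gibbs (fun i => (f i - a) * (expR (h i) - 1)) H / gibbs (fun i => expR (h i)) H.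
  have ge0 := gibbs_expR_gt0 H h.
  apply: (canRL (mulfK _)); first by rewrite gt_eqF.
  have -> : gibbs f (fun i => H i + h i) =
      gibbs (fun i => f i * expR (h i)) H / gibbs (fun i => expR (h i)) H.
    rewrite {1}/gibbs Zf_shift invfM mulrA; congr (_ / _).
    by rewrite /gibbs; congr (_ / _); apply: eq_bigr => i _; rewrite expRD; ring.
  rewrite mulrBl divfK ?gt_eqF//.
  transitivity (gibbs (fun i => f i * expR (h i) - a * expR (h i) - f i + a) H); last first.
    by congr (gibbs _ H); apply/funext => i; ring.
  by rewrite gibbsD !gibbsB gibbs_cst gibbsZ -/a; ring.
rewrite E normrM normfV (gtr0_norm (gibbs_expR_gt0 H h)).
have gc : expR (- 1) <= gibbs (fun i => expR (h i)) H.
  rewrite -(gibbs_cst (expR (- 1)) H); apply: le_gibbs => i; rewrite ler_expR.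
  by have := hc i; rewrite ler_norml => /andP[]; lra.
rewrite ler_pdivrMr ?gibbs_expR_gt0//.
apply: (@le_trans _ _ (2 * F * (expR 1 * c))).
  apply: gibbs_bound => i; rewrite normrM ler_pM//.
    by rewrite (le_trans (ler_normB _ _))//; have := fF i; lra.
  apply: (le_trans (expR_sub1_le _)); rewrite mulrC.
  by apply: ler_pM => //; rewrite ?expR_ge0// ler_expR (le_trans (hc i)).
apply: (@le_trans _ _ (2 * F * expR 2 * c * expR (- 1))).
  have -> : expR 2 = expR 1 * expR 1 :> R by rewrite -expRD; congr expR; lra.
  have -> : 2 * F * (expR 1 * expR 1) * c * expR (-1) =
    2 * F * (expR 1 * c) * (expR 1 * expR (- 1)) by ring.
  by rewrite expRxMexpNx_1 mulr1.
by rewrite ler_wpM2l// !mulr_ge0// expR_ge0.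
Qed.

End gibbs.

Section gauss_poly.
Context (R : realType).
Local Notation gam := (std_normal R).
Local Notation gint f := (gam.-integrable setT (EFin \o f)).

Lemma gauss_integrable_poly2 (c0 c1 c2 : R) :
  gint (fun g : R => c0 + g * c1 + g ^+ 2 * c2).
Proof.
have i1 : gint (fun g : R => g * c1).
  exact: (integrableZr measurableT c1 (gauss_integrableX R 1)).
have i2 : gint (fun g : R => g ^+ 2 * c2).
  exact: (integrableZr measurableT c2 (gauss_integrableX R 2)).
have i0 : gint (fun=> c0) by exact: finite_measure_integrable_cst.
exact: (integrableD measurableT (integrableD measurableT i0 i1) i2).
Qed.

Lemma Rintegral_gauss_poly2 (c0 c1 c2 : R) :
  \int[gam]_g (c0 + g * c1 + g ^+ 2 * c2) = c0 + c2.
Proof.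
have i1' := gauss_integrableX R 1; have i2' := gauss_integrableX R 2.
have i1 : gint (fun g : R => g * c1) by exact: (integrableZr measurableT c1 i1').
have i2 : gint (fun g : R => g ^+ 2 * c2) by exact: (integrableZr measurableT c2 i2').
have i0 : gint (fun=> c0) by exact: finite_measure_integrable_cst.
have i01 : gint (fun g : R => c0 + g * c1) by exact: (integrableD measurableT i0 i1).
have [m0 m1] := gauss_mean_var R.
rewrite RintegralD// RintegralD// Rintegral_prob_cst RintegralZr// RintegralZr//.
by rewrite m0 m1 mul0r addr0 mul1r.
Qed.

Definition absmom (n : nat) : R := \int[gam]_g (1 * (`|g| + 1) ^+ n).

Lemma gauss_integrable_absmom n (C : R) : gint (fun g : R => C * (`|g| + 1) ^+ n).
Proof.
apply: (@gauss_integrable _ _ (`|C| * (n`!)%:R * expR 1) 1).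
  apply: measurable_funM => //; apply: measurable_funX.
  by apply: measurable_funD => //; exact: normr_measurable.
move=> x; rewrite normrM -!mulrA ler_wpM2l// -expRD mul1r.
have x0 : 0 <= `|x| + 1 by rewrite addr_ge0.
rewrite normrX ger0_norm// addrC.
case: n => [|n].
  by rewrite expr0 fact0 mul1r -[leLHS]expR0 ler_expR addr_ge0.
have := expR_ge1Dxn n (addr_ge0 ler01 (normr_ge0 x)) => h.
have f0 : 0 < n.+1`!%:R :> R by rewrite ltr0n fact_gt0.
rewrite -ler_pdivrMl// mulrC; lra.
Qed.

Lemma absmom_ge0 n : 0 <= absmom n.
Proof. by apply: Rintegral_ge0 => x _; rewrite mul1r exprn_ge0// addr_ge0. Qed.

Lemma Rintegral_absmom n (C : R) : \int[gam]_g (C * (`|g| + 1) ^+ n) = C * absmom n.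
Proof.
rewrite /absmom RintegralZl; last 2 first.
- exact: measurableT.
- by have := gauss_integrable_absmom n 1; under [X in _ _ X]eq_fun do rewrite mul1r.
by under [in RHS]eq_Rintegral do rewrite mul1r.
Qed.

Lemma Rintegral_gauss_close (f h : R -> R) n (C : R) : gint f -> gint h ->
  (forall g, `|f g - h g| <= C * (`|g| + 1) ^+ n) ->
  `|\int[gam]_g f g - \int[gam]_g h g| <= C * absmom n.
Proof.
move=> jf jh fh; rewrite -RintegralB// -Rintegral_absmom.
have ifh : gint (fun g => f g - h g) by exact: (integrableB measurableT jf jh).
apply: (le_trans (le_normr_Rintegral measurableT ifh)).
apply: le_Rintegral => //; first exact: integrable_norm.
exact: gauss_integrable_absmom.
Qed.

End gauss_poly.

Section one_step.
Context (R : realType) (I : finType).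
Variable W : I -> R.
Hypothesis W0 : forall i, 0 <= W i.
Variable i0 : I.
Hypothesis Wi0 : 0 < W i0.
Implicit Types (H a v : I -> R).
Local Notation gam := (std_normal R).
Local Notation gibbs := (gibbs W).
Local Notation lnZ := (lnZ W).
Local Notation Zf := (Zf W).

(* Generator of the channel step: the derivative in t of
   E lnZ (H + sqrt t g a + t v) at t = 0. *)
Definition phi a v H : R :=
  gibbs v H + (gibbs (fun i => a i ^+ 2) H - gibbs a H ^+ 2) / 2.

Fixpoint bnd (K : R) (l : seq ((I -> R) * (I -> R))) : Prop :=
  if l is av :: l' then
    (forall i, `|av.1 i| <= K) /\ (forall i, `|av.2 i| <= K) /\ bnd K l'
  else True.

Lemma tame_phi a v : tame (phi a v).
Proof.
apply: tameD; first exact: (tame_gibbs W0 Wi0).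
rewrite (_ : (fun H => _) = (fun H => 2^-1 *
    (gibbs (fun i => a i ^+ 2) H - gibbs a H * gibbs a H))); last first.
  by apply/funext => H; rewrite expr2 mulrC.
apply: tameZ; apply: tameB; first exact: (tame_gibbs W0 Wi0).
by apply: tameM; exact: (tame_gibbs W0 Wi0).
Qed.

Definition phi_const (K : R) : R := (2 * K + 3 * K ^+ 2) * expR 2.

Lemma phi_lip a v H h (K c : R) : (forall i, `|a i| <= K) -> (forall i, `|v i| <= K) ->
  (forall i, `|h i| <= c) ->
  `|phi a v (fun i => H i + h i) - phi a v H| <= phi_const K * c.
Proof.
move=> aK vK hc; have K0 : 0 <= K by rewrite (le_trans _ (aK i0)).
have a2K i : `|a i ^+ 2| <= K ^+ 2 by rewrite normrX lerXn2r// nnegrE.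
have lv := gibbs_lip W0 Wi0 H vK hc.
have la := gibbs_lip W0 Wi0 H aK hc.
have la2 := gibbs_lip W0 Wi0 H a2K hc.
set A := gibbs a H in la *; set A' := gibbs a (fun i => H i + h i) in la *.
have AK : `|A| <= K by exact: (gibbs_bound W0 Wi0).
have AK' : `|A'| <= K by exact: (gibbs_bound W0 Wi0).
have lAA : `|A' ^+ 2 - A ^+ 2| <= 2 * K * expR 2 * c * (2 * K).
  rewrite subr_sqr normrM ler_pM// (le_trans (ler_normD _ _))//; lra.
rewrite /phi; move: lv la2 lAA; rewrite !ler_norml /phi_const.
rewrite -/A -/A'.
by move=> /andP[p1 p2] /andP[p3 p4] /andP[p5 p6]; apply/andP; split; lra.
Qed.

(** The increment h = g sqrt d a + d v has size sqrt d K (|g| + 1), so the cumulant expansion leaves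
    a quadratic polynomial in g up to an error O(d sqrt d). In its Gaussian mean the linear term
    vanishes, the term of order d is [phi], and the term of order d^2 goes into the summand K^2 of
    the constant. *)
Lemma gop_one_step a v H (K d : R) :
  (forall i, `|a i| <= K) -> (forall i, `|v i| <= K) -> 0 <= d <= 1 ->
  `|gop (fun i => Num.sqrt d * a i) (fun i => d * v i) lnZ H - lnZ H - d * phi a v H|
  <= (cumulant_const R * K ^+ 3 * absmom R 3 + K ^+ 2) * (d * Num.sqrt d).
Proof.
move=> aK vK /andP[d0 d1]; have K0 : 0 <= K by rewrite (le_trans _ (aK i0)).
set u := Num.sqrt d.
have u0 : 0 <= u by exact: sqrtr_ge0.
have u2 : u ^+ 2 = d by rewrite sqr_sqrtr.
have u1 : u <= 1 by rewrite -sqrtr1 ler_wsqrtr.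
pose h (g : R) i := g * (u * a i) + d * v i.
have hM g i : `|h g i| <= u * K * (`|g| + 1).
  rewrite (le_trans (ler_normD _ _))// !normrM (ger0_norm u0) (ger0_norm d0).
  have e1 : `|g| * (u * `|a i|) <= `|g| * (u * K) by rewrite !ler_wpM2l.
  have e2 : d * `|v i| <= u * K.
    by rewrite -u2 expr2 -mulrA ler_wpM2l// -[leRHS]mul1r ler_pM.
  by rewrite mulrDr mulr1 [u * K * `|g|]mulrC lerD.
set A := gibbs a H; set V := gibbs v H.
set A2 := gibbs (fun i => a i ^+ 2) H; set V2 := gibbs (fun i => v i ^+ 2) H.
set AV := gibbs (fun i => a i * v i) H.
pose c0 := lnZ H + d * V + d ^+ 2 * (V2 - V ^+ 2) / 2.
pose c1 := u * A + u * d * (AV - A * V).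
pose c2 := d * (A2 - A ^+ 2) / 2.
have gh g : gibbs (h g) H = g * u * A + d * V.
  rewrite gibbsD; congr (_ + _); last by rewrite gibbsZ.
  by rewrite -gibbsZ; congr (gibbs _ H); apply/funext => i; rewrite mulrA.
have gh2 g : gibbs (fun i => h g i ^+ 2) H =
    (g * u) ^+ 2 * A2 + 2 * (g * u * d) * AV + d ^+ 2 * V2.
  rewrite -!gibbsZ -!gibbsD; congr (gibbs _ H); apply/funext => i; rewrite /h; ring.
have close g : `|lnZ (fun i => H i + g * (u * a i) + d * v i)
     - (c0 + g * c1 + g ^+ 2 * c2)| <= cumulant_const R * (u * K) ^+ 3 * (`|g| + 1) ^+ 3.
  have -> : (fun i => H i + g * (u * a i) + d * v i) = (fun i => H i + h g i).
    by apply/funext => i; rewrite /h addrA.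
  rewrite (lnZ_shift W0 Wi0) -mulrA -exprMn.
  apply: le_trans (cumulant_expansion W0 Wi0 H (hM g)).
  rewrite gh gh2 le_eqVlt; apply/orP; left; apply/eqP; congr (`| _ |).
  by rewrite /c0 /c1 /c2 -u2; field.
have iP := gauss_integrable_poly2 c0 c1 c2.
have iF := tame_integrable H (fun i => u * a i) (fun i => d * v i) (tame_lnZ W0 Wi0).
have := Rintegral_gauss_close iF iP close.
rewrite Rintegral_gauss_poly2 -/(gop _ _ _ _).
have V20 : 0 <= V2 - V ^+ 2 by rewrite subr_ge0; exact: (gibbs_sqr_le W0 Wi0).
have V2K : V2 - V ^+ 2 <= K ^+ 2.
  have : V2 <= K ^+ 2.
    rewrite -(gibbs_cst W0 Wi0 (K ^+ 2) H); apply: (le_gibbs W0 Wi0) => i.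
    by rewrite -real_normK ?num_real// lerXn2r// nnegrE.
  by have := sqr_ge0 V; lra.
have du : d ^+ 2 <= d * u by rewrite expr2 ler_wpM2l// -u2 expr2 ler_piMl.
have p1 : d ^+ 2 * (V2 - V ^+ 2) <= d * u * K ^+ 2.
  by rewrite ler_pM// sqr_ge0.
have p0 : 0 <= d ^+ 2 * (V2 - V ^+ 2) by rewrite mulr_ge0// sqr_ge0.
have -> : cumulant_const R * (u * K) ^+ 3 * absmom R 3 =
  cumulant_const R * K ^+ 3 * absmom R 3 * (d * u) by rewrite -u2; ring.
rewrite mulrDl /phi -/A -/V -/A2 !ler_norml /c0 /c2 => /andP[q1 q2].
by apply/andP; split; lra.
Qed.

Lemma gop_close a v F G H (e : R) : tame F -> tame G ->
  (forall H, `|F H - G H| <= e) -> `|gop a v F H - gop a v G H| <= e.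
Proof.
move=> tF tG FG; rewrite -gopB// ler_norml; apply/andP; split.
  rewrite -[leLHS](gop_cst a v _ H); apply: le_gop => [||K].
  - exact: tame_cst.
  - exact: tameB.
  - by have := FG K; rewrite ler_norml => /andP[].
rewrite -[leRHS](gop_cst a v _ H); apply: le_gop => [||K].
- exact: tameB.
- exact: tame_cst.
- by have := FG K; rewrite ler_norml => /andP[].
Qed.

Lemma gop_lip_close a v F H (K L d : R) : tame F -> 0 <= L ->
  (forall i, `|a i| <= K) -> (forall i, `|v i| <= K) -> 0 <= d <= 1 ->
  (forall H h c, (forall i, `|h i| <= c) -> `|F (fun i => H i + h i) - F H| <= L * c) ->
  `|gop (fun i => Num.sqrt d * a i) (fun i => d * v i) F H - F H|
    <= L * K * absmom R 1 * Num.sqrt d.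
Proof.
move=> tF L0 aK vK /andP[d0 d1] FL.
have K0 : 0 <= K by rewrite (le_trans _ (aK i0)).
set u := Num.sqrt d.
have u0 : 0 <= u by exact: sqrtr_ge0.
have u2 : u ^+ 2 = d by rewrite sqr_sqrtr.
have u1 : u <= 1 by rewrite -sqrtr1 ler_wsqrtr.
have iF := tame_integrable H (fun i => u * a i) (fun i => d * v i) tF.
have iC : gam.-integrable setT (EFin \o (fun=> F H)) by exact: finite_measure_integrable_cst.
have := Rintegral_gauss_close (n := 1) (C := L * (u * K)) iF iC.
rewrite Rintegral_prob_cst -/(gop _ _ _ _) => h.
have -> : L * K * absmom R 1 * u = L * (u * K) * absmom R 1 by ring.
apply: h => g; rewrite expr1.
have -> : (fun i => H i + g * (u * a i) + d * v i) =
   (fun i => H i + (g * (u * a i) + d * v i)) by apply/funext => i; rewrite addrA.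
rewrite -mulrA; apply: FL => i.
rewrite (le_trans (ler_normD _ _))// !normrM (ger0_norm u0) (ger0_norm d0).
have e1 : `|g| * (u * `|a i|) <= `|g| * (u * K) by rewrite !ler_wpM2l.
have e2 : d * `|v i| <= u * K.
  by rewrite -u2 expr2 -mulrA ler_wpM2l// -[leRHS]mul1r ler_pM.
by rewrite mulrDr mulr1 [u * K * `|g|]mulrC lerD.
Qed.

(** Induction on the directions. The sum of the later generators is Lipschitz in H, so the step
    along the first direction changes it by O(sqrt d) only; multiplied by d this is again O(d sqrt
    d). *)
Lemma gops_step (K : R) l : 0 <= K -> bnd K l -> exists C : R, 0 <= C /\
  forall d H, 0 <= d <= 1 ->
  `|gops l d lnZ H - lnZ H - d * \sum_(av <- l) phi av.1 av.2 H| <= C * (d * Num.sqrt d).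
Proof.
move=> K0; elim: l => [_|[a v] l IH /= [aK [vK bl]]].
  exists 0; split=> // d H _; rewrite big_nil mulr0 mul0r /= subr0 subrr normr0.
  by [].
have [C [C0 hC]] := IH bl.
pose L := phi_const K * (size l)%:R.
have pc0 : 0 <= phi_const K.
  by rewrite mulr_ge0 ?expR_ge0// addr_ge0 ?mulr_ge0 ?sqr_ge0.
have L0 : 0 <= L by rewrite mulr_ge0.
pose C1 := cumulant_const R * K ^+ 3 * absmom R 3 + K ^+ 2.
have C10 : 0 <= C1.
  rewrite addr_ge0 ?sqr_ge0// !mulr_ge0 ?absmom_ge0 ?exprn_ge0//.
  by rewrite /cumulant_const !addr_ge0 ?sqr_ge0// mulr_ge0// expR_ge0.
pose C2 := L * K * absmom R 1.
have C20 : 0 <= C2 by apply: mulr_ge0; [exact: mulr_ge0|exact: absmom_ge0].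
exists (C + C1 + C2); split; first by apply: addr_ge0 => //; exact: addr_ge0.
move=> d H d01; have /andP[d0 d1] := d01.
pose S H := \sum_(av <- l) phi av.1 av.2 H.
have tS : tame S by apply: tame_sum => av; exact: tame_phi.
have SL H' h c : (forall i, `|h i| <= c) -> `|S (fun i => H' i + h i) - S H'| <= L * c.
  move=> hc; rewrite /S /L mulrAC -sumrB; apply: (le_trans (ler_norm_sum _ _ _)).
  elim: (l) bl => [_|[b w] l' IHl /= [bK [wK bl']]].
    by rewrite big_nil mulr0.
  by rewrite big_cons -natr1 mulrDr mulr1 addrC lerD ?IHl//; exact: phi_lip.
pose F := gops l d lnZ; pose G H := lnZ H + d * S H.
have tl := tame_lnZ W0 Wi0.
have tF : tame F by exact: tame_gops.
have tG : tame G by apply: tameD => //; exact: tameZ.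
have FG H' : `|F H' - G H'| <= C * (d * Num.sqrt d).
  by rewrite /G opprD addrA; exact: hC.
have c1 := gop_close (fun i => Num.sqrt d * a i) (fun i => d * v i) H tF tG FG.
have c2 := gop_one_step H aK vK d01.
have c3 := gop_lip_close H tS L0 aK vK d01 SL.
have Gd : gop (fun i => Num.sqrt d * a i) (fun i => d * v i) G H =
  gop (fun i => Num.sqrt d * a i) (fun i => d * v i) lnZ H +
  d * gop (fun i => Num.sqrt d * a i) (fun i => d * v i) S H.
  by rewrite gopD ?gopZ//; exact: tameZ.
rewrite big_cons -/(S H) -/F -/C1 -/C2 in c1 c2 c3 *.
rewrite Gd in c1.
have c3' : d * `|gop (fun i => Num.sqrt d * a i) (fun i => d * v i) S H - S H| <=
   C2 * (d * Num.sqrt d).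
  by rewrite mulrCA ler_wpM2l.
have c3'' : `|d * gop (fun i => Num.sqrt d * a i) (fun i => d * v i) S H - d * S H| <=
   C2 * (d * Num.sqrt d).
  by rewrite -mulrBr normrM (ger0_norm d0).
clearbody C1 C2; move: c1 c2 c3''; rewrite /=.
set X := gop _ _ F H; set Y := gop _ _ lnZ H; set T := d * gop _ _ S H.
rewrite !ler_norml => /andP[p1 p2] /andP[p3 p4] /andP[p5 p6].
by apply/andP; split; lra.
Qed.

End one_step.

Lemma gauss_shift_Rintegral (R : realType) (c : R) (f : R -> R) :
  measurable_fun setT f ->
  \int[std_normal R]_g (expR (c * g - c ^+ 2 / 2) * f g) =
  \int[std_normal R]_g f (g + c).
Proof.
move=> mf; rewrite /Rintegral; congr fine.
rewrite integralE [RHS]integralE.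
have mpos : measurable_fun setT (fun g => (Num.max (f g) 0)%:E : \bar R).
  by apply/measurable_EFinP; exact: measurable_maxr.
have mneg : measurable_fun setT (fun g => (Num.max (- f g) 0)%:E : \bar R).
  by apply/measurable_EFinP; apply: measurable_maxr => //; exact: measurable_funN.
have p0 (h : R -> R) g : (0 <= (Num.max (h g) 0)%:E :> \bar R)%E.
  by rewrite lee_fin le_max lexx orbT.
have /= Ep := gauss_shift c mpos (p0 f).
have /= En := gauss_shift c mneg (p0 (fun g => - f g)).
congr (_ - _)%E.
  transitivity (\int[std_normal R]_g ((expR (c * g - c ^+ 2 / 2))%:E *
      (Num.max (f g) 0)%:E))%E.
    apply: eq_integral => g _; rewrite funeposE -EFinM -EFin_max.
    by rewrite maxr_pMr ?expR_ge0// mulr0.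
  by rewrite -Ep; apply: eq_integral => g _; rewrite funeposE -EFin_max.
transitivity (\int[std_normal R]_g ((expR (c * g - c ^+ 2 / 2))%:E *
    (Num.max (- f g) 0)%:E))%E.
  apply: eq_integral => g _; rewrite funenegE -EFinM -EFinN -EFin_max.
  by rewrite maxr_pMr ?expR_ge0// mulr0 mulrN.
by rewrite -En; apply: eq_integral => g _; rewrite funenegE -EFinN -EFin_max.
Qed.

(** * Null and planted channels *)

Section planted.
Context (R : realType) (I : finType).
Variable W : I -> R.
Hypothesis W0 : forall i, 0 <= W i.
Variable i0 : I.
Hypothesis Wi0 : 0 < W i0.
Implicit Types (H a : I -> R) (l : seq (I -> R)).
Local Notation gibbs := (gibbs W).
Local Notation lnZ := (lnZ W).
Local Notation Zf := (Zf W).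

(* Channels fed by noise only, resp. by noise and the signal of the configuration s,
   with the matching log-likelihood drift. *)
Definition null l : seq ((I -> R) * (I -> R)) :=
  [seq (a, fun i => - (a i ^+ 2 / 2)) | a <- l].

Definition planted (s : I) l : seq ((I -> R) * (I -> R)) :=
  [seq (a, fun i => a i * a s - a i ^+ 2 / 2) | a <- l].

(* Cameron-Martin: reweighting the noise by exp (H s) plants the signal a s. *)
Lemma gop_cameron_martin (s : I) a t Phi H : 0 <= t -> tame Phi ->
  gop (fun i => Num.sqrt t * a i) (fun i => t * - (a i ^+ 2 / 2))
    (fun H => expR (H s) * Phi H) H =
  expR (H s) * gop (fun i => Num.sqrt t * a i)
    (fun i => t * (a i * a s - a i ^+ 2 / 2)) Phi H.
Proof.
move=> t0 tP; set u := Num.sqrt t; have u2 : u ^+ 2 = t by rewrite sqr_sqrtr.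
rewrite /gop; set c := u * a s.
pose f g := Phi (fun i => H i + g * (u * a i) + t * - (a i ^+ 2 / 2)).
have mf : measurable_fun setT f.
  exact: (tame_measurable_line H (fun i => u * a i) (fun i => t * - (a i ^+ 2 / 2)) tP).
have fc g : f (g + c) =
    Phi (fun i => H i + g * (u * a i) + t * (a i * a s - a i ^+ 2 / 2)).
  by congr (Phi _); apply/funext => i; rewrite /c -u2; ring.
rewrite -RintegralZl//; last first.
  exact: (tame_integrable H _ _ tP).
transitivity (\int[std_normal R]_g (expR (c * g - c ^+ 2 / 2) * (expR (H s) * f g))).
  apply: eq_Rintegral => g _; rewrite mulrA -expRD; congr (expR _ * _).
  by rewrite /c -u2; field.
rewrite gauss_shift_Rintegral; last exact: measurable_funM.
by apply: eq_Rintegral => g _; rewrite fc.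
Qed.

Lemma gops_cameron_martin (s : I) l t Phi : 0 <= t -> tame Phi ->
  gops (null l) t (fun H => expR (H s) * Phi H) =
  fun H => expR (H s) * gops (planted s l) t Phi H.
Proof.
move=> t0 tP; elim: l => //= a l ->; apply/funext => H.
by rewrite gop_cameron_martin//; exact: tame_gops.
Qed.

Lemma tame_expM s Phi : tame Phi -> tame (fun H : I -> R => expR (H s) * Phi H).
Proof. by move=> tP; apply: tameM => //; exact: tame_expR. Qed.

(** The tilt is linear in the exp (H i), so Cameron-Martin applies to each i separately. With f = W,
    the null law tilted by [Zf] is the mixture of the planted laws. *)
Lemma gops_null_sum (f : I -> R) l t Phi : 0 <= t -> tame Phi ->
  gops (null l) t (fun H => (\sum_i f i * expR (H i)) * Phi H) =
  fun H => \sum_i f i * expR (H i) * gops (planted i l) t Phi H.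
Proof.
move=> t0 tP.
rewrite (_ : (fun H => _ * _) = (fun H => \sum_i f i * (expR (H i) * Phi H))); last first.
  by apply/funext => H; rewrite mulr_suml; apply: eq_bigr => i _; rewrite mulrA.
rewrite gops_sum; last by move=> i; apply: tameZ; exact: tame_expM.
apply/funext => H; apply: eq_bigr => i _.
rewrite gopsZ; last exact: tame_expM.
by rewrite gops_cameron_martin// mulrA.
Qed.

(** The likelihoods exp (H i) are martingales under pure noise: take [Phi] = 1 above. *)
Lemma gops_null_inv (f : I -> R) l t : 0 <= t ->
  gops (null l) t (fun H => \sum_i f i * expR (H i)) =
  fun H => \sum_i f i * expR (H i).
Proof.
move=> t0; have := @gops_null_sum f l t (fun=> 1) t0 (tame_cst _ 1).
rewrite (_ : (fun H => _ * 1) = (fun H => \sum_i f i * expR (H i))); last first.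
  by apply/funext => H; rewrite mulr1.
by move=> ->; apply/funext => H; apply: eq_bigr => i _; rewrite gops_cst mulr1.
Qed.

Lemma gops_null_Z l t : 0 <= t -> gops (null l) t Zf = Zf.
Proof. exact: gops_null_inv. Qed.

(** Its mean under the null channel is the planted mean of [lnZ], that is, the relative entropy of
    the observation with respect to the noise when H starts at 0 and W sums to 1. *)
Definition ZlnZ H : R := Zf H * lnZ H.

Lemma tame_ZlnZ : tame ZlnZ.
Proof. by apply: tameM; [exact: tame_Zf|exact: (tame_lnZ W0 Wi0)]. Qed.

Lemma gops_null_ZlnZ l t : 0 <= t -> gops (null l) t ZlnZ =
  fun H => \sum_i W i * expR (H i) * gops (planted i l) t lnZ H.
Proof. by move=> t0; rewrite -gops_null_sum//; exact: (tame_lnZ W0 Wi0). Qed.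

(** Squared norm of the posterior mean of the signal. Per unit of [Zf], it is twice the rate at
    which [ZlnZ] grows along the null channel: the infinitesimal I-MMSE relation. *)
Definition energy l H : R := \sum_(a <- l) gibbs a H ^+ 2.

Lemma tame_energy l : tame (energy l).
Proof.
rewrite /energy; apply: tame_sum => a.
rewrite (_ : (fun H => _) = (fun H => gibbs a H * gibbs a H)).
  by apply: tameM; exact: (tame_gibbs W0 Wi0).
by apply/funext => H; rewrite expr2.
Qed.

Lemma bnd_planted l : exists K : R, 0 <= K /\ forall s, bnd K (planted s l).
Proof.
elim: l => [|a l [K [K0 hK]]]; first by exists 0.
pose A := nrm a; have A0 : 0 <= A by exact: nrm_ge0.
have aA i : `|a i| <= A by exact: le_nrm.
exists (K + A + 2 * A ^+ 2); split.
  by rewrite !addr_ge0 ?mulr_ge0 ?sqr_ge0.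
move=> s /=; split; first by move=> i; rewrite (le_trans (aA i))//; have := sqr_ge0 A; lra.
split.
  move=> i; rewrite (le_trans (ler_normB _ _))// normrM.
  have h1 : `|a i| * `|a s| <= A ^+ 2 by rewrite expr2 ler_pM.
  have h2 : `|a i ^+ 2 / 2| <= A ^+ 2.
    rewrite normrM normrX (ger0_norm (_ : 0 <= 2^-1))//.
    have : `|a i| ^+ 2 <= A ^+ 2 by rewrite lerXn2r// nnegrE.
    have := sqr_ge0 `|a i|; lra.
  lra.
elim: (planted s l) (hK s) => //= av l' IH [h1 [h2 h3]].
have KK : K <= K + A + 2 * A ^+ 2 by have := sqr_ge0 A; lra.
by split; [move=> i; exact: le_trans KK|split; [move=> i; exact: le_trans KK|exact: IH]].
Qed.

(** The second-order term gibbs (a^2) / 2 of the generator is cancelled by the drift - a^2 / 2 of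
    the log-likelihood. *)
Lemma phi_planted s a H :
  phi W a (fun i => a i * a s - a i ^+ 2 / 2) H = a s * gibbs a H - gibbs a H ^+ 2 / 2.
Proof.
rewrite /phi gibbsB (_ : gibbs (fun i => a i * a s) H = a s * gibbs a H); last first.
  by rewrite -gibbsZ; congr (gibbs _ H); apply/funext => i; rewrite mulrC.
rewrite (_ : gibbs (fun i => a i ^+ 2 / 2) H = 2^-1 * gibbs (fun i => a i ^+ 2) H).
  by field.
by rewrite -gibbsZ; congr (gibbs _ H); apply/funext => i; rewrite mulrC.
Qed.

Lemma gops_planted_step l : exists C : R, 0 <= C /\ forall s d H, 0 <= d <= 1 ->
  `|gops (planted s l) d lnZ H - lnZ H
    - d * \sum_(a <- l) (a s * gibbs a H - gibbs a H ^+ 2 / 2)| <= C * (d * Num.sqrt d).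
Proof.
have [K [K0 hK]] := bnd_planted l.
have h s : exists C : R, 0 <= C /\ forall d H, 0 <= d <= 1 ->
  `|gops (planted s l) d lnZ H - lnZ H
    - d * \sum_(a <- l) (a s * gibbs a H - gibbs a H ^+ 2 / 2)| <= C * (d * Num.sqrt d).
  have [C [C0 hC]] := gops_step W0 Wi0 K0 (hK s).
  exists C; split=> // d H d01; have := hC d H d01; rewrite big_map/=.
  by under eq_bigr do rewrite phi_planted.
have /choice[C hC] := h.
(* Summing the constants over the finitely many configurations makes the bound uniform in the
   planted one. *)
exists (\sum_s C s); split; first by apply: sumr_ge0 => s _; case: (hC s).
move=> s d H d01; have [_ /(_ d H d01) hs] := hC s; apply: (le_trans hs).
have /andP[d0 _] := d01; rewrite ler_wpM2r ?mulr_ge0 ?sqrtr_ge0//.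
by rewrite (bigD1 s)//= lerDl sumr_ge0// => s' _; case: (hC s').
Qed.

(** This is the planted expansion averaged over s with weights W s exp (H s): a s then averages to
    gibbs a, and gibbs a^2 - gibbs a^2 / 2 leaves half the energy. *)
Lemma gops_null_step l : exists C : R, 0 <= C /\ forall d H, 0 <= d <= 1 ->
  `|gops (null l) d ZlnZ H - ZlnZ H - d * (Zf H * (energy l H / 2))|
  <= C * (d * Num.sqrt d) * Zf H.
Proof.
have [C [C0 hC]] := gops_planted_step l; exists C; split=> // d H d01.
have /andP[d0 d1] := d01.
rewrite gops_null_ZlnZ//.
have -> : Zf H * (energy l H / 2) = \sum_i W i * expR (H i) *
    \sum_(a <- l) (a i * gibbs a H - gibbs a H ^+ 2 / 2).
  transitivity (\sum_(a <- l) \sum_i W i * expR (H i) * (a i * gibbs a H - gibbs a H ^+ 2 / 2)).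
    rewrite /energy mulr_suml mulr_sumr; apply: eq_bigr => a _.
    transitivity (Zf H * gibbs a H * gibbs a H - Zf H * (gibbs a H ^+ 2 / 2)).
      by field.
    rewrite (gibbsE W0 Wi0) /Zf !mulr_suml -sumrB; apply: eq_bigr => i _; ring.
  by rewrite exchange_big; apply: eq_bigr => i _; rewrite mulr_sumr.
rewrite /ZlnZ {1 2}/Zf mulr_suml -sumrB [d * _]mulr_sumr -sumrB [leRHS]mulr_sumr.
apply: (le_trans (ler_norm_sum _ _ _)); apply: ler_sum => i _.
rewrite (_ : _ - _ - _ = W i * (expR (H i) * (gops (planted i l) d lnZ H - lnZ H
    - d * \sum_(a <- l) (a i * gibbs a H - gibbs a H ^+ 2 / 2)))); last by ring.
rewrite !normrM (ger0_norm (W0 i)) (ger0_norm (expR_ge0 _)).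
rewrite (_ : C * (d * Num.sqrt d) * (W i * expR (H i)) =
  W i * (expR (H i) * (C * (d * Num.sqrt d)))); last by ring.
by rewrite ler_wpM2l// ler_wpM2l ?expR_ge0// hC.
Qed.

(** An inequality between energies is one between generators on [ZlnZ]. The correction Zf gibbs c is
    a combination of the exp (H i), hence invariant under both channels, and enters with exactly t
    times its initial value; the factor 2 offsets the half in the generator. *)
Lemma null_comparison l l' (c : I -> R) t : 0 <= t ->
  (forall H, energy l H <= energy l' H + 2 * gibbs c H) ->
  forall H, gops (null l) t ZlnZ H <=
    gops (null l') t ZlnZ H + t * \sum_i W i * c i * expR (H i).
Proof.
move=> t0 le; have [C [C0 hC]] := gops_null_step l.
have [C' [C'0 hC']] := gops_null_step l'.
apply: (@gops_telescope _ _ _ _ _ _ Zf (C + C')) => //.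
- exact: tame_ZlnZ.
- exact: tame_sumW.
- exact: tame_Zf.
- by move=> s s0; rewrite (gops_null_inv (fun i => W i * c i)).
- by move=> s s0; rewrite (gops_null_inv (fun i => W i * c i)).
- by move=> s s0; rewrite gops_null_Z.
- by move=> s s0; rewrite gops_null_Z.
move=> d H d01; have := hC d H d01; have := hC' d H d01.
have /andP[d0 d1] := d01.
rewrite !ler_norml => /andP[p1 p2] /andP[p3 p4].
have : d * (Zf H * (energy l H / 2)) <=
    d * (Zf H * (energy l' H / 2)) + d * (Zf H * gibbs c H).
  rewrite -mulrDr ler_wpM2l// -mulrDr ler_wpM2l ?(ltW (Zf_gt0 W0 Wi0 H))//.
  by have := le H; lra.
rewrite (gibbsE W0 Wi0); lra.
Qed.

(** With u = Zf gibbs a, the function u^2 / Zf is convex in (u, Zf) and lies above its tangent 2 c u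
    - c^2 Zf at the starting point; u and [Zf] are martingales. *)
Lemma energy_submartingale a l t H : 0 <= t ->
  Zf H * gibbs a H ^+ 2 <= gops (null l) t (fun H => Zf H * gibbs a H ^+ 2) H.
Proof.
move=> t0; set c := gibbs a H.
pose u (H : I -> R) := \sum_i W i * a i * expR (H i).
have tu : tame u by exact: tame_sumW.
have tZ : tame Zf by exact: tame_Zf.
have tF : tame (fun H => Zf H * gibbs a H ^+ 2).
  rewrite (_ : (fun H => _) = (fun H => u H * gibbs a H)).
    by apply: tameM => //; exact: (tame_gibbs W0 Wi0).
  by apply/funext => K; rewrite /u -(gibbsE W0 Wi0) expr2 mulrA.
pose G H' := 2 * c * u H' - c ^+ 2 * Zf H'.
have tG : tame G by apply: tameB; exact: tameZ.
have -> : Zf H * c ^+ 2 = gops (null l) t G H.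
  rewrite /G gopsB; [|exact: tameZ|exact: tameZ].
  rewrite !gopsZ// gops_null_Z// (gops_null_inv (fun i => W i * a i))//.
  by rewrite -/(u H) /u -(gibbsE W0 Wi0) -/c; ring.
apply: le_gops => // K; rewrite /G /u -(gibbsE W0 Wi0) -subr_ge0.
have -> : Zf K * gibbs a K ^+ 2 - (2 * c * (Zf K * gibbs a K) - c ^+ 2 * Zf K) =
  Zf K * (gibbs a K - c) ^+ 2 by ring.
by rewrite mulr_ge0 ?sqr_ge0// (ltW (Zf_gt0 W0 Wi0 K)).
Qed.

(** The energy grows in mean, so the I-MMSE relation integrates to two inequalities: the rate at the
    end of the interval bounds the increment from above, and in [null_ge_energy] the rate at the
    start bounds it from below. *)
Lemma null_le_energy l t : 0 <= t -> forall H,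
  gops (null l) t ZlnZ H <=
  ZlnZ H + t * gops (null l) t (fun H => Zf H * (energy l H / 2)) H.
Proof.
move=> t0; have [C [C0 hC]] := gops_null_step l.
have tZ : tame Zf by exact: tame_Zf.
have t1 a : tame (fun H => Zf H * gibbs a H ^+ 2).
  rewrite (_ : (fun H => _) = (fun H => Zf H * (gibbs a H * gibbs a H))).
    apply: tameM => //; apply: tameM; exact: (tame_gibbs W0 Wi0).
  by apply/funext => H; rewrite expr2.
have E : (fun H => Zf H * (energy l H / 2)) =
    (fun H => 2^-1 * \sum_(a <- l) Zf H * gibbs a H ^+ 2).
  by apply/funext => H; rewrite -mulr_sumr -/(energy l H); field.
have tE : tame (fun H => Zf H * (energy l H / 2)).
  by rewrite E; apply: tameZ; exact: tame_sum.
apply: (@gops_telescope_sub _ _ (null l) _ _ Zf C) => //.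
- exact: tame_ZlnZ.
- move=> s H s0; rewrite [leLHS](congr1 (fun F => F H) E) E gopsZ; last exact: tame_sum.
  rewrite ler_wpM2l// gops_sum// ler_sum// => a _.
  exact: energy_submartingale.
- by move=> s s0; rewrite gops_null_Z.
move=> d H d01; have := hC d H d01; rewrite !ler_norml => /andP[p1 p2]; lra.
Qed.

Lemma null_ge_energy l t : 0 <= t -> forall H,
  ZlnZ H + t * (Zf H * (energy l H / 2)) <= gops (null l) t ZlnZ H.
Proof.
move=> t0; have [C [C0 hC]] := gops_null_step l.
have tZ : tame Zf by exact: tame_Zf.
have t1 a : tame (fun H => Zf H * gibbs a H ^+ 2).
  rewrite (_ : (fun H => _) = (fun H => Zf H * (gibbs a H * gibbs a H))).
    apply: tameM => //; apply: tameM; exact: (tame_gibbs W0 Wi0).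
  by apply/funext => H; rewrite expr2.
have E : (fun H => Zf H * (energy l H / 2)) =
    (fun H => 2^-1 * \sum_(a <- l) Zf H * gibbs a H ^+ 2).
  by apply/funext => H; rewrite -mulr_sumr -/(energy l H); field.
have tE : tame (fun H => Zf H * (energy l H / 2)).
  by rewrite E; apply: tameZ; exact: tame_sum.
apply: (@gops_telescope_sub_ge _ _ (null l) _
  (fun H => Zf H * (energy l H / 2)) Zf C) => //.
- exact: tame_ZlnZ.
- move=> s H s0; rewrite [leLHS](congr1 (fun F => F H) E) E gopsZ; last exact: tame_sum.
  rewrite ler_wpM2l// gops_sum// ler_sum// => a _.
  exact: energy_submartingale.
- by move=> s s0; rewrite gops_null_Z.
move=> d H d01; have := hC d H d01; rewrite !ler_norml => /andP[p1 p2]; lra.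
Qed.

End planted.

(** * Additive Gaussian channels with a general signal *)

Section iid.
Context d (T : measurableType d) (R : realType) (P : probability T R).

Lemma ge0_integral_iid0 (f : 0.-tuple T -> \bar R) : measurable_fun setT f ->
  (\int[iid_law P 0]_x f x = f [tuple])%E.
Proof. by move=> mf; rewrite /= integral_dirac// diracT mul1e. Qed.

Lemma ge0_integral_iidS n (f : n.+1.-tuple T -> \bar R) :
  measurable_fun setT f -> (forall x, 0 <= f x)%E ->
  (\int[iid_law P n.+1]_x f x =
   \int[P]_x \int[iid_law P n]_t f [the n.+1.-tuple T of x :: t])%E.
Proof.
move=> mf f0 /=; rewrite ge0_integral_distribution//.
rewrite (@fubini_tonelli1 _ _ _ _ _ P (iid_law P n) (f \o @tcons _ _ n))//.
  by apply: (measurableT_comp mf); exact: measurable_tcons.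
by move=> x; exact: f0.
Qed.

Lemma ge0_integral_iid_prod n (f : 'I_n -> T -> \bar R) :
  (forall i, measurable_fun setT (f i)) -> (forall i x, 0 <= f i x)%E ->
  (\int[iid_law P n]_t \prod_(i < n) f i (tnth t i) = \prod_(i < n) \int[P]_x f i x)%E.
Proof.
have mprod m (g : 'I_m -> T -> \bar R) : (forall i, measurable_fun setT (g i)) ->
    measurable_fun setT (fun t : m.-tuple T => \prod_(i < m) g i (tnth t i))%E.
  move=> mg; elim: m g mg => [|m IH] g mg.
    rewrite (_ : (fun t => _) = cst 1%E)//.
    by apply/funext => t; rewrite big_ord0.
  rewrite (_ : (fun t => _) = (fun t : m.+1.-tuple T => g ord0 (tnth t ord0) *
     (\prod_(i < m) g (lift ord0 i) (tnth [tuple of behead t] i)))%E).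
    apply: emeasurable_funM; first by apply: measurableT_comp => //; exact: measurable_tnth.
    apply: (measurableT_comp (IH (fun i => g (lift ord0 i)) (fun i => mg _))).
    exact: measurable_behead.
  apply/funext => t; rewrite big_ord_recl; congr (_ * _)%E; apply: eq_bigr => i _.
  by congr (g _ _); rewrite [in LHS](tuple_eta t) tnthS.
elim: n f => [|n IH] f mf f0.
  rewrite ge0_integral_iid0 ?big_ord0//; exact: mprod.
have p0 m (g : 'I_m -> T -> \bar R) (t : m.-tuple T) : (forall i x, 0 <= g i x)%E ->
   (0 <= \prod_(i < m) g i (tnth t i))%E by move=> g0; apply: prode_ge0.
rewrite ge0_integral_iidS; [|exact: (mprod _ f)|by move=> t; exact: (p0 _ f)].
pose g i := f (lift ord0 i).
have g0 i x : (0 <= g i x)%E by exact: f0.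
have mg i : measurable_fun setT (g i) by exact: mf.
rewrite big_ord_recl -(IH g)//.
rewrite -ge0_integralZr//; last by apply: integral_ge0 => t _; exact: (p0 _ g).
apply: eq_integral => x _.
transitivity (\int[iid_law P n]_t (f ord0 x * \prod_(i < n) g i (tnth t i)))%E.
  apply: eq_integral => t _; rewrite big_ord_recl tnth0; congr (_ * _)%E.
  by apply: eq_bigr => i _; rewrite tnthS.
rewrite ge0_integralZl//; first exact: (mprod _ g).
by move=> t _; exact: (p0 _ g).
Qed.

Lemma ge0_integral_iid_tnth n (i : 'I_n) (f : T -> \bar R) :
  measurable_fun setT f -> (forall x, 0 <= f x)%E ->
  (\int[iid_law P n]_t f (tnth t i) = \int[P]_x f x)%E.
Proof.
move=> mf f0; pose g j := if j == i then f else cst 1%E.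
have mg j : measurable_fun setT (g j) by rewrite /g; case: ifP.
have g0 j x : (0 <= g j x)%E by rewrite /g; case: ifP.
have gi : g i = f by rewrite /g eqxx.
have gj j : j != i -> g j = cst 1%E by rewrite /g => /negPf ->.
have := ge0_integral_iid_prod mg g0.
rewrite (bigD1 i)//= gi [X in (_ * X)%E]big1 ?mule1; last first.
  by move=> j ji; rewrite (gj _ ji) integral_cst//= probability_setT mule1.
move=> <-; apply: eq_integral => t _; rewrite (bigD1 i)//= gi big1 ?mule1//.
by move=> j ji; rewrite (gj _ ji).
Qed.

Lemma ge0_integral_iid_tnth2 n (i j : 'I_n) (f h : T -> \bar R) : i != j ->
  measurable_fun setT f -> (forall x, 0 <= f x)%E ->
  measurable_fun setT h -> (forall x, 0 <= h x)%E ->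
  (\int[iid_law P n]_t (f (tnth t i) * h (tnth t j)) =
   (\int[P]_x f x) * \int[P]_x h x)%E.
Proof.
move=> ij mf f0 mh h0; have ji : j != i by rewrite eq_sym.
pose g l := if l == i then f else if l == j then h else cst 1%E.
have mg l : measurable_fun setT (g l) by rewrite /g; do 2 case: ifP => // _.
have g0 l x : (0 <= g l x)%E by rewrite /g; do 2 case: ifP => // _.
have gi : g i = f by rewrite /g eqxx.
have gj : g j = h by rewrite /g (negPf ji) eqxx.
have gl l : (l != i) && (l != j) -> g l = cst 1%E.
  by rewrite /g => /andP[/negPf -> /negPf ->].
have := ge0_integral_iid_prod mg g0.
rewrite (bigD1 i)//= (bigD1 j)//= gi gj [X in (_ * (_ * X))%E]big1 ?mule1; last first.
  by move=> l lij; rewrite (gl _ lij) integral_cst//= probability_setT mule1.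
move=> <-; apply: eq_integral => t _; rewrite (bigD1 i)//= (bigD1 j)//= gi gj.
by rewrite big1 ?mule1// => l lij; rewrite (gl _ lij).
Qed.

End iid.

Section gauss_vec.
Context (R : realType).
Local Notation gam n := (std_gaussian R n).

Definition addt n (y : n.-tuple R) (c : 'I_n -> R) : n.-tuple R :=
  [tuple tnth y r + c r | r < n].

Lemma measurable_addt d (T : measurableType d) n (y : T -> n.-tuple R) (c : 'I_n -> T -> R) :
  measurable_fun setT y -> (forall r, measurable_fun setT (c r)) ->
  measurable_fun setT (fun t => addt (y t) (c^~ t)).
Proof.
move=> my mc; apply/measurable_fun_tnthP => r.
rewrite (_ : _ \o _ = fun t => tnth (y t) r + c r t).
  apply: measurable_funD => //.
  exact: (measurableT_comp (measurable_tnth r) my).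
by apply/funext => t /=; rewrite tnth_mktuple.
Qed.

Lemma gauss_vec_shift n (c : 'I_n -> R) (f : n.-tuple R -> \bar R) :
  measurable_fun setT f -> (forall x, 0 <= f x)%E ->
  (\int[gam n]_y f (addt y c) =
   \int[gam n]_y ((expR (\sum_r (c r * tnth y r - c r ^+ 2 / 2)))%:E * f y))%E.
Proof.
have mexp m (e : 'I_m -> R) :
    measurable_fun setT (fun y : m.-tuple R =>
      (expR (\sum_r (e r * tnth y r - e r ^+ 2 / 2)))%:E).
  apply/measurable_EFinP; apply: measurableT_comp => //.
  apply: measurable_sum => r; apply: measurable_funB => //.
  by apply: measurable_funM => //; exact: measurable_tnth.
have maddt m (e : 'I_m -> R) : measurable_fun setT (fun y : m.-tuple R => addt y e).
  by apply: measurable_addt.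
elim: n c f => [|n IH] c f mf f0.
  rewrite !ge0_integral_iid0//.
  - by rewrite big_ord0 expR0 mul1e; congr f; exact: tuple0.
  - exact: (emeasurable_funM (mexp _ c) mf).
  - exact: (measurableT_comp mf (maddt _ c)).
rewrite /std_gaussian ge0_integral_iidS//; last exact: (measurableT_comp mf (maddt _ c)).
rewrite ge0_integral_iidS; last 2 first.
- exact: (emeasurable_funM (mexp _ c) mf).
- by move=> y; rewrite mule_ge0// lee_fin expR_ge0.
pose f' x := fun t : n.-tuple R => f [the n.+1.-tuple R of x :: t].
have mf' x : measurable_fun setT (f' x).
  apply: (measurableT_comp mf).
  exact: (measurable_cons (measurable_cst x) (@measurable_id _ _ setT)).
have addtE x (t : n.-tuple R) : addt [the n.+1.-tuple R of x :: t] c =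
    [the n.+1.-tuple R of x + c ord0 :: addt t (fun r => c (lift ord0 r))].
  apply: eq_from_tnth => r; rewrite tnth_mktuple.
  have [->|[r' ->]] : r = ord0 \/ exists r', r = lift ord0 r'.
    by case: (unliftP ord0 r) => [r' ->|->]; [right; exists r'|left].
    by rewrite !tnth0.
  by rewrite !tnthS tnth_mktuple.
pose G x := (\int[gam n]_t f' x (addt t (fun r => c (lift ord0 r))))%E.
have mG : measurable_fun setT G.
  apply: (@measurable_fun_fubini_tonelli_F _ _ R (n.-tuple R) R (gam n)
    (fun xt => f [the n.+1.-tuple R of xt.1 :: addt xt.2 (fun r => c (lift ord0 r))])).
    apply: (measurableT_comp mf).
    apply: (measurable_cons measurable_fst).
    apply: (@measurable_addt _ _ n snd (fun r _ => c (lift ord0 r))) => //.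
  by move=> xt; exact: f0.
transitivity (\int[std_normal R]_x G (x + c ord0)%R)%E.
  by apply: eq_integral => x _; apply: eq_integral => t _; rewrite addtE.
rewrite (gauss_shift (c ord0) mG); last by move=> x; apply: integral_ge0 => t _; exact: f0.
apply: eq_integral => x _.
rewrite /G (IH (fun r => c (lift ord0 r)) (f' x) (mf' x))//; last by move=> t; exact: f0.
rewrite -ge0_integralZl//; last 2 first.
- exact: (emeasurable_funM (mexp _ _) (mf' x)).
- by move=> t _; rewrite mule_ge0// ?lee_fin ?expR_ge0//; exact: f0.
apply: eq_integral => t _; rewrite muleA -EFinM -expRD big_ord_recl tnth0.
by congr ((expR (_ + _))%:E * _)%E; apply: eq_bigr => r _; rewrite tnthS.
Qed.

End gauss_vec.

Lemma probability_integral_gt0 d (T : measurableType d) (R : realType)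
    (P : probability T R) (f : T -> R) : measurable_fun setT f ->
  (forall x, 0 < f x) -> (0 < \int[P]_x (f x)%:E)%E.
Proof.
move=> mf f0; rewrite lt0e; apply/andP; split; last first.
  by apply: integral_ge0 => x _; rewrite lee_fin ltW.
apply/negP => /eqP I0.
have mfE : measurable_fun setT (EFin \o f) by exact/measurable_EFinP.
have /(ae_eq_integral_abs _ measurableT mfE) [N [mN N0 sub]] :
    (\int[P]_x `|(EFin \o f) x| = 0)%E.
  rewrite -[RHS]I0; apply: eq_integral => x _.
  by rewrite gee0_abs// lee_fin ltW.
have NT : N = setT.
  apply/seteqP; split => // x _; apply: sub => /(_ I) /= [] fx0.
  by have := f0 x; rewrite fx0 ltxx.
have := @probability_setT _ _ _ P; rewrite -NT N0 => -[] /eqP; rewrite eq_sym.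
by rewrite oner_eq0.
Qed.

Lemma sqrD_le (R : realDomainType) (x y : R) : (x + y) ^+ 2 <= 2 * x ^+ 2 + 2 * y ^+ 2.
Proof. have := sqr_ge0 (x - y); rewrite sqrrB sqrrD; lra. Qed.

Lemma sqrB_le (R : realDomainType) (x y : R) : (x - y) ^+ 2 <= 2 * x ^+ 2 + 2 * y ^+ 2.
Proof. by have := sqrD_le x (- y); rewrite sqrrN. Qed.

Section rintegrable.
Context d (T : measurableType d) (R : realType) (mu : {measure set T -> \bar R}).
Local Notation rint f := (mu.-integrable setT (EFin \o f)).

Lemma rintegrableZ (c : R) f : rint f -> rint (fun x => c * f x).
Proof.
move=> fi; rewrite (_ : _ \o _ = fun w => (c%:E * (EFin \o f) w)%E)//.
exact: integrableZl.
Qed.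

Lemma rintegrableD f g : rint f -> rint g -> rint (fun x => f x + g x).
Proof.
move=> fi gi; rewrite (_ : _ \o _ = ((EFin \o f) \+ (EFin \o g))%E)//.
exact: integrableD.
Qed.

Lemma rintegrableB f g : rint f -> rint g -> rint (fun x => f x - g x).
Proof.
move=> fi gi; rewrite (_ : _ \o _ = ((EFin \o f) \- (EFin \o g))%E)//.
exact: integrableB.
Qed.

Lemma rintegrable_sum (J : eqType) (s : seq J) (f : J -> T -> R) :
  (forall j, rint (f j)) -> rint (fun x => \sum_(j <- s) f j x).
Proof.
move=> fi; rewrite (_ : _ \o _ = fun w => (\sum_(j <- s) (EFin \o f j) w)%E).
  by apply: integrable_sum.
by apply/funext => w /=; rewrite sumEFin.
Qed.

Lemma rintegrableM1 f : rint (fun x => f x ^+ 2) -> measurable_fun setT f ->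
  mu setT = 1%E -> rint f.
Proof.
move=> fi mf m1.
apply: (@le_integrable _ _ _ _ _ measurableT _ (EFin \o (fun x => 1 + f x ^+ 2))).
- exact/measurable_EFinP.
- move=> x _; rewrite /= lee_fin [leRHS]ger0_norm; last by rewrite addr_ge0 ?sqr_ge0.
  by rewrite -(real_normK (num_real (f x))); have := sqr_ge0 (`|f x| - 1); nra.
- apply: rintegrableD => //; apply/integrableP; split; first exact: measurable_cst.
  rewrite (eq_integral (cst 1%E)); first by rewrite integral_cst// m1 mule1 ltry.
  by move=> x _ /=; rewrite normr1.
Qed.

Lemma le_rintegrable (f g : T -> R) : measurable_fun setT f -> (forall x, `|f x| <= g x) ->
  rint g -> rint f.
Proof.
move=> mf fg; apply: le_integrable => //; first exact/measurable_EFinP.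
by move=> x _; rewrite lee_fin; apply: le_trans (fg x) (ler_norm _).
Qed.

Lemma rintegrable_cst (c : R) : mu setT = 1%E -> rint (fun=> c).
Proof.
move=> m1; apply/integrableP; split; first exact: measurable_cst.
by rewrite (_ : (fun x => _) = cst `|c|%:E)// integral_cst//= m1 mule1 ltry.
Qed.

Lemma Rintegral_cst1 (c : R) : mu setT = 1%E -> \int[mu]_x c = c.
Proof. by move=> m1; rewrite Rintegral_cst//= m1 mulr1. Qed.

Lemma le_rint (f g : T -> R) : rint f -> rint g -> (forall x, f x <= g x) ->
  \int[mu]_x f x <= \int[mu]_x g x.
Proof. by move=> fi gi fg; apply: le_Rintegral. Qed.

Lemma rintD (f g : T -> R) : rint f -> rint g ->
  \int[mu]_x (f x + g x) = \int[mu]_x f x + \int[mu]_x g x.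
Proof. by move=> fi gi; rewrite RintegralD. Qed.

Lemma rintB (f g : T -> R) : rint f -> rint g ->
  \int[mu]_x (f x - g x) = \int[mu]_x f x - \int[mu]_x g x.
Proof. by move=> fi gi; rewrite RintegralB. Qed.

Lemma rintZ (c : R) (f : T -> R) : rint f ->
  \int[mu]_x (c * f x) = c * \int[mu]_x f x.
Proof. by move=> fi; rewrite RintegralZl. Qed.

Lemma rintegralE f : rint f -> (\int[mu]_x (f x)%:E = (\int[mu]_x f x)%R%:E)%E.
Proof. by move=> fi; rewrite /Rintegral fineK//; exact: integrable_fin_num. Qed.

Lemma Rintegral_sum (J : eqType) (s : seq J) (f : J -> T -> R) :
  (forall j, rint (f j)) ->
  \int[mu]_x (\sum_(j <- s) f j x) = \sum_(j <- s) \int[mu]_x f j x.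
Proof.
move=> fi; elim: s => [|j s IH].
  under eq_Rintegral do rewrite big_nil.
  by rewrite big_nil /Rintegral integral0.
under eq_Rintegral do rewrite big_cons.
by rewrite big_cons RintegralD//; [rewrite IH|exact: rintegrable_sum].
Qed.

End rintegrable.

Lemma le_lnW (R : realType) (x y : R) : 0 < x -> x <= y -> ln x <= ln y.
Proof.
by move=> x0 xy; rewrite ler_ln// posrE//; exact: lt_le_trans xy.
Qed.

Lemma lnM_expR (R : realType) (x s : R) : 0 < x -> ln (x * expR s) = ln x + s.
Proof. by move=> x0; rewrite lnM ?posrE ?expRK ?expR_gt0. Qed.

Section channel.
Context (R : realType) d (Om : measurableType d) (P : probability Om R) (n : nat).
Variable a : 'I_n -> Om -> R.
Hypothesis ma : forall r, measurable_fun setT (a r).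
Local Notation gam := (std_gaussian R n).
Implicit Types (y : n.-tuple R) (w : Om).

(* lik w is the density of the law of a w + Z with respect to that of the noise Z,
   zeta that of the law of the observation, and post the posterior mean. *)
Definition lik w y := expR (\sum_r (a r w * tnth y r - a r w ^+ 2 / 2)).
Definition zeta y := \int[P]_w lik w y.
Definition post r y := (\int[P]_w (a r w * lik w y)) / zeta y.
Definition Yof (u : n.-tuple R * Om) := addt u.1 (a^~ u.2).

Definition sq y : R := \sum_r tnth y r ^+ 2.

Lemma lik_ge0 w y : 0 <= lik w y. Proof. exact: expR_ge0. Qed.
Lemma lik_gt0 w y : 0 < lik w y. Proof. exact: expR_gt0. Qed.

Lemma measurable_likT d' (T : measurableType d') (f : T -> Om) (g : T -> n.-tuple R) :
  measurable_fun setT f -> measurable_fun setT g ->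
  measurable_fun setT (fun t => lik (f t) (g t)).
Proof.
move=> mf mg; apply: measurableT_comp => //; apply: measurable_sum => r.
have maf : measurable_fun setT (fun t => a r (f t)) by exact: (measurableT_comp (ma r) mf).
apply: measurable_funB.
  by apply: measurable_funM => //; exact: (measurableT_comp (measurable_tnth r) mg).
by apply: measurable_funM => //; exact: measurable_funX.
Qed.

Lemma measurable_lik y : measurable_fun setT (lik^~ y).
Proof. by apply: measurable_likT => //; exact: measurable_cst. Qed.

Lemma measurable_lik2 : measurable_fun setT (fun u : n.-tuple R * Om => lik u.2 u.1).
Proof. exact: measurable_likT. Qed.

(** Completing the square gives a bound uniform in the signal. Hence [zeta] is finite, and dominated
    convergence applies to it, whatever the moments of the signal. *)
Lemma lik_le w y : lik w y <= expR (sq y / 2).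
Proof.
rewrite ler_expR /sq mulr_suml; apply: ler_sum => r _.
have := sqr_ge0 (tnth y r - a r w); rewrite sqrrB; nra.
Qed.

Lemma lik_integrable y : P.-integrable setT (EFin \o (lik^~ y)).
Proof.
apply: (@le_integrable _ _ _ _ _ measurableT _ (cst (expR (sq y / 2))%:E)).
- by apply/measurable_EFinP; exact: measurable_lik.
- move=> w _; rewrite /= lee_fin !ger0_norm ?expR_ge0//; exact: lik_le.
- exact: finite_measure_integrable_cst.
Qed.

Lemma zetaE y : (\int[P]_w (lik w y)%:E = (zeta y)%:E)%E.
Proof.
by rewrite /zeta /Rintegral fineK//; apply: integrable_fin_num => //; exact: lik_integrable.
Qed.

Lemma zeta_gt0 y : 0 < zeta y.
Proof.
rewrite -lte_fin -zetaE; apply: probability_integral_gt0; first exact: measurable_lik.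
by move=> w; exact: lik_gt0.
Qed.

Lemma zeta_le y : zeta y <= expR (sq y / 2).
Proof.
rewrite -[leRHS](Rintegral_prob_cst P); apply: le_Rintegral => //.
- exact: lik_integrable.
- exact: finite_measure_integrable_cst.
- by move=> w _; exact: lik_le.
Qed.

Lemma measurable_zeta : measurable_fun setT zeta.
Proof. exact: (measurable_Rintegral P measurable_lik2). Qed.

Lemma measurable_post r : measurable_fun setT (post r).
Proof.
apply: measurable_funM; last first.
  rewrite (_ : (fun x => _) = fun y => expR (- ln (zeta y))).
    apply: measurableT_comp => //; apply: measurable_funN.
    exact: (measurableT_comp (@measurable_ln R) measurable_zeta).
  by apply/funext => y; rewrite expRN lnK// posrE zeta_gt0.
apply: (@measurable_Rintegral _ _ _ _ _ P (fun u : n.-tuple R * Om => a r u.2 * lik u.2 u.1)).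
apply: measurable_funM; last exact: measurable_lik2.
exact: (measurableT_comp (ma r) measurable_snd).
Qed.

Lemma measurable_Yof : measurable_fun setT Yof.
Proof.
apply: (measurable_addt measurable_fst (c := fun r u => a r u.2)) => r.
exact: (measurableT_comp (ma r) measurable_snd).
Qed.

(** At fixed signal this is the Gaussian shift, with [lik] as density; Fubini then exchanges signal
    and observation. *)
Lemma planted_joint (f : n.-tuple R * Om -> \bar R) :
  measurable_fun setT f -> (forall u, 0 <= f u)%E ->
  (\int[(gam \x P)%E]_u f (Yof u, u.2) =
   \int[gam]_y \int[P]_w ((lik w y)%:E * f (y, w)))%E.
Proof.
move=> mf f0.
have mY2 : measurable_fun setT (fun u : n.-tuple R * Om => (Yof u, u.2)).
  by apply: measurable_fun_pair => //; exact: measurable_Yof.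
have mL : measurable_fun setT (fun u : n.-tuple R * Om => ((lik u.2 u.1)%:E * f u)%E).
  by apply: (emeasurable_funM _ mf); apply/measurable_EFinP; exact: measurable_lik2.
have L0 u : (0 <= (lik u.2 u.1)%:E * f u)%E by rewrite mule_ge0// lee_fin lik_ge0.
rewrite (@fubini_tonelli2 _ _ _ _ _ gam P (fun u => f (Yof u, u.2)))//; last first.
  exact: (measurableT_comp mf mY2).
rewrite /fubini_G.
transitivity (\int[P]_w \int[gam]_y ((lik w y)%:E * f (y, w)))%E.
  apply: eq_integral => w _.
  rewrite -(@gauss_vec_shift R n (a^~ w) (fun y => f (y, w)))//.
  exact: (measurableT_comp mf (pair2_measurable w)).
exact: (esym (@fubini_tonelli _ _ _ _ _ gam P _ mL L0)).
Qed.

Lemma plantedY (f : n.-tuple R -> \bar R) :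
  measurable_fun setT f -> (forall y, 0 <= f y)%E ->
  (\int[(gam \x P)%E]_u f (Yof u) = \int[gam]_y ((zeta y)%:E * f y))%E.
Proof.
move=> mf f0; rewrite (@planted_joint (f \o fst)); last 2 first.
- exact: (measurableT_comp mf measurable_fst).
- by move=> u; exact: f0.
apply: eq_integral => y _ /=; rewrite ge0_integralZr//.
- by rewrite zetaE.
- by apply/measurable_EFinP; exact: measurable_lik.
- by move=> w _; rewrite lee_fin lik_ge0.
Qed.

Lemma gam_zeta : (\int[gam]_y (zeta y)%:E = 1)%E.
Proof.
have := @plantedY (cst 1%E) (measurable_cst _) (fun=> lee01).
rewrite integral_cst//= probability_setT mule1 => ->.
by apply: eq_integral => y _; rewrite mule1.
Qed.

(** The upper bound is [zeta_le]. For the lower one, a y - a^2 / 2 >= - y^2 / 2 - a^2, and the mean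
    k of exp (- sum a^2) is positive for any signal. *)
Lemma zeta_ge : exists2 c, 0 <= c & forall y, `|ln (zeta y)| <= sq y / 2 + c.
Proof.
pose s w := expR (- \sum_r a r w ^+ 2).
have ms : measurable_fun setT s.
  apply: measurableT_comp => //; apply: measurable_funN.
  by apply: measurable_sum => r; exact: measurable_funX.
have si : P.-integrable setT (EFin \o s).
  apply: (@le_integrable _ _ _ _ _ measurableT _ (cst 1%E)).
  - exact/measurable_EFinP.
  - move=> w _; rewrite /= lee_fin normr1 ger0_norm ?expR_ge0// -expR0 ler_expR.
    by rewrite oppr_le0; apply: sumr_ge0 => r _; exact: sqr_ge0.
  - exact: finite_measure_integrable_cst.
pose k := \int[P]_w s w.
have k0 : 0 < k.
  rewrite -lte_fin /k /Rintegral fineK; last exact: integrable_fin_num.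
  by apply: probability_integral_gt0 => // w; exact: expR_gt0.
have kz y : expR (- (sq y / 2)) * k <= zeta y.
  rewrite /k -RintegralZl//; apply: le_Rintegral => //.
  - by rewrite (_ : _ \o _ = fun w => (expR (- (sq y / 2)))%:E * (EFin \o s) w)%E//;
      exact: integrableZl.
  - exact: lik_integrable.
  - move=> w _; rewrite /s -expRD ler_expR /sq mulr_suml -!sumrN -big_split /=.
    apply: ler_sum => r _.
    have := sqr_ge0 (tnth y r + a r w); rewrite sqrrD; nra.
exists `|ln k| => // y; rewrite ler_norml; apply/andP; split.
  have : ln (expR (- (sq y / 2)) * k) <= ln (zeta y).
    by apply: le_lnW (kz y); rewrite mulr_gt0// expR_gt0.
  rewrite lnM ?posrE ?expR_gt0// expRK => /(le_trans _); apply.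
  by rewrite opprD lerD2l lerNl -normrN ler_norm.
have : ln (zeta y) <= ln (expR (sq y / 2)).
  by apply: le_lnW (zeta_le y); exact: zeta_gt0.
by rewrite expRK => /le_trans; apply; rewrite lerDl.
Qed.

Hypothesis a2 : forall r, P.-integrable setT (EFin \o (fun w => a r w ^+ 2)).

Lemma a_integrable r : P.-integrable setT (EFin \o a r).
Proof. by apply: rintegrableM1 => //; exact: probability_setT. Qed.

Lemma lik_rintegrable (f : Om -> R) y : measurable_fun setT f ->
  P.-integrable setT (EFin \o f) ->
  P.-integrable setT (EFin \o (fun w => f w * lik w y)).
Proof.
move=> mf fi; have nf := integrable_norm fi.
apply: (@le_rintegrable _ _ _ _ _ (fun w => expR (sq y / 2) * `|f w|)).
- by apply: measurable_funM => //; exact: measurable_lik.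
- by move=> w; rewrite normrM (ger0_norm (lik_ge0 _ _)) mulrC ler_wpM2r//; exact: lik_le.
- exact: rintegrableZ.
Qed.

Lemma a_lik_integrable r y : P.-integrable setT (EFin \o (fun w => a r w * lik w y)).
Proof. by apply: lik_rintegrable => //; exact: a_integrable. Qed.

Lemma a2_lik_integrable r y : P.-integrable setT (EFin \o (fun w => a r w ^+ 2 * lik w y)).
Proof. by apply: lik_rintegrable => //; exact: measurable_funX. Qed.

Lemma postM r y : \int[P]_w (a r w * lik w y) = post r y * zeta y.
Proof. by rewrite /post divfK// gt_eqF// zeta_gt0. Qed.

Lemma post_variance r y (t : R) :
  \int[P]_w ((a r w - t) ^+ 2 * lik w y) =
  \int[P]_w (a r w ^+ 2 * lik w y) - 2 * t * (post r y * zeta y) + t ^+ 2 * zeta y.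
Proof.
have i1 := a_lik_integrable r y; have i2 := a2_lik_integrable r y.
have i0 := lik_integrable y.
rewrite -postM /zeta.
transitivity (\int[P]_w ((a r w ^+ 2 * lik w y - 2 * t * (a r w * lik w y))
   + t ^+ 2 * lik w y)).
  by apply: eq_Rintegral => w _; ring.
have i1' := rintegrableZ (2 * t) i1; have i0' := rintegrableZ (t ^+ 2) i0.
by rewrite RintegralD//; [rewrite RintegralB// !RintegralZl|exact: rintegrableB].
Qed.

Lemma post_sqr_le r y : post r y ^+ 2 * zeta y <= \int[P]_w (a r w ^+ 2 * lik w y).
Proof.
have := post_variance r y (post r y).
have : 0 <= \int[P]_w ((a r w - post r y) ^+ 2 * lik w y).
  by apply: Rintegral_ge0 => w _; rewrite mulr_ge0 ?sqr_ge0 ?lik_ge0.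
set A := \int[P]_w _; set B := \int[P]_w _; rewrite expr2; lra.
Qed.

(** As a function of y, ln zeta is a logarithmic moment generating function up to a change of
    weight, so it is convex with gradient [post]; the tangent inequality comes from exp x >= 1 + x
    under the posterior. *)
Lemma ln_zeta_convex y (h : 'I_n -> R) :
  ln (zeta y) + \sum_r h r * post r y <= ln (zeta (addt y h)).
Proof.
set s := \sum_r _.
have zy := zeta_gt0 y; have zh := zeta_gt0 (addt y h).
have likD w : lik w (addt y h) = lik w y * expR (\sum_r h r * a r w).
  rewrite /lik -expRD -big_split; congr expR; apply: eq_bigr => r _.
  by rewrite tnth_mktuple /=; ring.
have iS : P.-integrable setT (EFin \o (fun w => \sum_r h r * (a r w * lik w y))).
  by apply: rintegrable_sum => r; apply: rintegrableZ; exact: a_lik_integrable.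
have iL : P.-integrable setT (EFin \o (fun w => (1 - s) * lik w y)).
  by apply: rintegrableZ; exact: lik_integrable.
have iDL := rintegrableD iL iS.
have E : zeta y * expR s = \int[P]_w (expR s *
    ((1 - s) * lik w y + \sum_r h r * (a r w * lik w y))).
  rewrite RintegralZl// RintegralD// RintegralZl//; last exact: lik_integrable.
  have -> : \int[P]_w (\sum_r h r * (a r w * lik w y)) = s * zeta y.
    rewrite Rintegral_sum//; last first.
      by move=> r; apply: rintegrableZ; exact: a_lik_integrable.
    rewrite /s mulr_suml; apply: eq_bigr => r _.
    by rewrite RintegralZl//; [rewrite postM mulrA|exact: a_lik_integrable].
  by rewrite -/(zeta y); ring.
have le : zeta y * expR s <= zeta (addt y h).
  rewrite E; apply: le_Rintegral => //.
  - exact: rintegrableZ.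
  - exact: lik_integrable.
  move=> w _; rewrite likD.
  have -> : \sum_r h r * (a r w * lik w y) = (\sum_r h r * a r w) * lik w y.
    by rewrite mulr_suml; apply: eq_bigr => r _; rewrite mulrA.
  set e := \sum_r h r * a r w.
  have le : expR s * (1 + (e - s)) <= expR e.
    have -> : expR e = expR s * expR (e - s) by rewrite -expRD subrKC.
    by rewrite ler_wpM2l ?expR_ge0//; exact: expR_ge1Dx.
  have L0 := lik_ge0 w y.
  have -> : expR s * ((1 - s) * lik w y + e * lik w y) =
    lik w y * (expR s * (1 + (e - s))) by ring.
  exact: ler_wpM2l.
have zs := lnM_expR s zy; rewrite -zs.
by apply: le_lnW le; exact: (mulr_gt0 zy (expR_gt0 s)).
Qed.

End channel.

Section marginals.
Context d1 d2 (T1 : measurableType d1) (T2 : measurableType d2) (R : realType).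
Variables (m1 : probability T1 R) (m2 : probability T2 R).

Lemma ge0_integral_marg1 (f : T1 -> \bar R) : measurable_fun setT f ->
  (forall x, 0 <= f x)%E -> (\int[(m1 \x m2)%E]_u f u.1 = \int[m1]_x f x)%E.
Proof.
move=> mf f0; rewrite (@fubini_tonelli1 _ _ _ _ _ m1 m2 (f \o fst))//.
  apply: eq_integral => x _ /=; rewrite /fubini_F /= integral_cst//=.
  by rewrite probability_setT mule1.
  exact: (measurableT_comp mf measurable_fst).
by move=> u; exact: f0.
Qed.

Lemma ge0_integral_marg2 (f : T2 -> \bar R) : measurable_fun setT f ->
  (forall x, 0 <= f x)%E -> (\int[(m1 \x m2)%E]_u f u.2 = \int[m2]_x f x)%E.
Proof.
move=> mf f0; rewrite (@fubini_tonelli2 _ _ _ _ _ m1 m2 (f \o snd))//.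
  apply: eq_integral => x _ /=; rewrite /fubini_G /= integral_cst//=.
  by rewrite probability_setT mule1.
  exact: (measurableT_comp mf measurable_snd).
by move=> u; exact: f0.
Qed.

Lemma prod_setT : (m1 \x m2)%E setT = 1%E.
Proof.
have := @ge0_integral_marg1 (cst 1%E) (measurable_cst _) (fun=> lee01).
by rewrite !integral_cst//= probability_setT !mul1e.
Qed.

Lemma rintegrable_marg1 (f : T1 -> R) : measurable_fun setT f ->
  m1.-integrable setT (EFin \o f) ->
  (m1 \x m2)%E.-integrable setT (EFin \o (fun u => f u.1)).
Proof.
move=> mf /integrableP[mfE fi]; apply/integrableP; split.
  by apply/measurable_EFinP; exact: (measurableT_comp mf measurable_fst).
rewrite (@ge0_integral_marg1 (fun x => `|(EFin \o f) x|)%E)//.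
exact: measurableT_comp.
Qed.

Lemma rintegrable_marg2 (f : T2 -> R) : measurable_fun setT f ->
  m2.-integrable setT (EFin \o f) ->
  (m1 \x m2)%E.-integrable setT (EFin \o (fun u => f u.2)).
Proof.
move=> mf /integrableP[mfE fi]; apply/integrableP; split.
  by apply/measurable_EFinP; exact: (measurableT_comp mf measurable_snd).
rewrite (@ge0_integral_marg2 (fun x => `|(EFin \o f) x|)%E)//.
exact: measurableT_comp.
Qed.

Lemma Rintegral_marg2 (f : T2 -> R) : measurable_fun setT f ->
  \int[(m1 \x m2)%E]_u f u.2 = \int[m2]_x f x.
Proof.
move=> mf; congr fine; apply: (@integral_transfer _ _ _ _ _ (m1 \x m2)%E m2 snd) => //.
  by move=> g mg g0; exact: ge0_integral_marg2.
exact/measurable_EFinP.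
Qed.

End marginals.

Section channel_pair.
Context (R : realType) d (Om : measurableType d) (P : probability Om R) (n : nat).
Local Notation gam := (std_gaussian R n).
Local Notation Q := (gam \x P)%E.
Implicit Types (a b : 'I_n -> Om -> R).
Local Notation sqint a := (forall r, P.-integrable setT (EFin \o (fun w => a r w ^+ 2))).
Local Notation meas a := (forall r, measurable_fun setT (a r)).

(* Relative entropy of the law of the observation with respect to the noise. *)
Definition Dch a := \int[Q]_u ln (zeta P a (Yof a u)).

Lemma tnth_sqr_integrable r : gam.-integrable setT (EFin \o (fun y => tnth y r ^+ 2)).
Proof.
apply/integrableP; split.
  by apply/measurable_EFinP; apply: measurable_funX; exact: measurable_tnth.
rewrite (@ge0_integral_iid_tnth _ _ _ _ n r (fun x : R => `|((x ^+ 2)%R)%:E|%E))//.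
  have /integrableP[_] := gauss_integrableX R 2; exact.
by apply: measurableT_comp => //; apply/measurable_EFinP; exact: measurable_funX.
Qed.

Lemma tnth_marg_sqr r : Q.-integrable setT (EFin \o (fun u => tnth u.1 r ^+ 2)).
Proof.
apply: (@rintegrable_marg1 _ _ _ _ _ _ _ (fun y : n.-tuple R => tnth y r ^+ 2)).
  by apply: measurable_funX; exact: measurable_tnth.
exact: tnth_sqr_integrable.
Qed.

Lemma marg_sqr (f : Om -> R) : measurable_fun setT f ->
  P.-integrable setT (EFin \o (fun w => f w ^+ 2)) ->
  Q.-integrable setT (EFin \o (fun u => f u.2 ^+ 2)).
Proof.
move=> mf fi; apply: (@rintegrable_marg2 _ _ _ _ _ _ _ (fun w => f w ^+ 2)) => //.
exact: measurable_funX.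
Qed.

Lemma sqYof_integrable b : meas b -> sqint b ->
  Q.-integrable setT (EFin \o (fun u => sq (Yof b u))).
Proof.
move=> mb b2; apply: rintegrable_sum => r.
apply: (@le_rintegrable _ _ _ _ _ (fun u : n.-tuple R * Om => 2 * tnth u.1 r ^+ 2 + 2 * b r u.2 ^+ 2)).
- apply: measurable_funX; exact: (measurableT_comp (measurable_tnth r) (measurable_Yof mb)).
- move=> u; rewrite ger0_norm ?sqr_ge0// tnth_mktuple /=.
  exact: sqrD_le.
- by apply: rintegrableD; apply: rintegrableZ; [exact: tnth_marg_sqr|exact: marg_sqr].
Qed.

Lemma measurable_lnzetaY a b : meas a -> meas b ->
  measurable_fun setT (fun u => ln (zeta P a (Yof b u))).
Proof.
move=> ma mb; apply: (measurableT_comp (@measurable_ln R)).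
exact: (measurableT_comp (measurable_zeta P ma) (measurable_Yof mb)).
Qed.

Lemma lnzeta_integrable a b : meas a -> meas b -> sqint b ->
  Q.-integrable setT (EFin \o (fun u => ln (zeta P a (Yof b u)))).
Proof.
move=> ma mb b2; have [c c0 H] := zeta_ge P ma.
apply: (@le_rintegrable _ _ _ _ _ (fun u => 2^-1 * sq (Yof b u) + c)).
- exact: measurable_lnzetaY.
- by move=> u; rewrite mulrC; exact: H.
- apply: rintegrableD; last by apply: rintegrable_cst; exact: prod_setT.
  by apply: rintegrableZ; exact: sqYof_integrable.
Qed.

(** Gibbs' inequality: the ratio rho of the two densities has mean 1 under the true law of the
    observation, and ln rho <= rho - 1. *)
Lemma mismatched_le a b : meas a -> meas b -> sqint b ->
  \int[Q]_u ln (zeta P a (Yof b u)) <= Dch b.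
Proof.
move=> ma mb b2.
have ia := lnzeta_integrable ma mb b2; have ib := lnzeta_integrable mb mb b2.
pose rho y := zeta P a y / zeta P b y.
have rho0 y : 0 < rho y by rewrite divr_gt0 ?zeta_gt0.
have mrho : measurable_fun setT rho.
  rewrite (_ : rho = fun y => zeta P a y * expR (- ln (zeta P b y))).
    apply: measurable_funM; first exact: measurable_zeta.
    apply: measurableT_comp => //; apply: measurable_funN.
    exact: (measurableT_comp (@measurable_ln R) (measurable_zeta P mb)).
  by apply/funext => y; rewrite expRN lnK// posrE; exact: zeta_gt0.
have Irho : (\int[Q]_u (rho (Yof b u))%:E = 1)%E.
  rewrite (@plantedY _ _ _ _ _ _ mb (EFin \o rho)); last 2 first.
  - exact/measurable_EFinP.
  - by move=> y; rewrite lee_fin ltW.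
  rewrite -(gam_zeta P ma); apply: eq_integral => y _ /=.
  by rewrite -EFinM mulrC divfK// gt_eqF// zeta_gt0.
have irho : Q.-integrable setT (EFin \o (rho \o Yof b)).
  apply/integrableP; split.
    by apply/measurable_EFinP; exact: (measurableT_comp mrho (measurable_Yof mb)).
  rewrite (eq_integral (fun u => (rho (Yof b u))%:E)); first by rewrite Irho ltry.
  by move=> u _ /=; rewrite gtr0_norm.
have ic : Q.-integrable setT (EFin \o (fun=> 1 : R)) := rintegrable_cst 1 (prod_setT gam P).
have i1 := rintegrableB irho ic.
have R1 : \int[Q]_u (rho (Yof b u) - 1) = 0.
  rewrite (rintB irho ic) (Rintegral_cst1 1 (prod_setT gam P)).
  by rewrite [X in X - _](_ : _ = 1) ?subrr// /Rintegral Irho.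
rewrite -[leRHS]addr0 -R1 /Dch -(rintD ib i1).
apply: (le_rint ia (rintegrableD ib i1)) => u; have za := zeta_gt0 P ma (Yof b u); have zb := zeta_gt0 P mb (Yof b u).
have -> : ln (zeta P a (Yof b u)) = ln (zeta P b (Yof b u)) + ln (rho (Yof b u)).
  by rewrite /rho (ln_div za zb) addrC subrK.
rewrite lerD2l; exact: ln_le_sub1.
Qed.

Lemma post_sqr_integral a r : meas a -> sqint a ->
  (\int[Q]_u (post P a r (Yof a u) ^+ 2)%:E <= \int[P]_w (a r w ^+ 2)%:E)%E.
Proof.
move=> ma a2.
have mp := measurable_post P ma r.
have mp2 : measurable_fun setT (fun y => post P a r y ^+ 2) by exact: measurable_funX.
rewrite (@plantedY _ _ _ _ _ _ ma (fun y => (post P a r y ^+ 2)%:E)); last 2 first.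
- exact/measurable_EFinP.
- by move=> y; rewrite lee_fin sqr_ge0.
have ma2 : measurable_fun setT (fun w => a r w ^+ 2) by exact: measurable_funX.
have -> : (\int[P]_w (a r w ^+ 2)%:E = \int[gam]_y \int[P]_w ((lik a w y)%:E * (a r w ^+ 2)%:E))%E.
  rewrite -(@planted_joint _ _ _ P _ _ ma (fun u => (a r u.2 ^+ 2)%:E)).
  - rewrite (@ge0_integral_marg2 _ _ _ _ _ gam P (fun w => (a r w ^+ 2)%:E))//.
    + exact/measurable_EFinP.
    + by move=> w; rewrite lee_fin sqr_ge0.
  - by apply/measurable_EFinP; exact: (measurableT_comp ma2 measurable_snd).
  - by move=> w; rewrite lee_fin sqr_ge0.
apply: ge0_le_integral => //.
- by move=> y _; rewrite -EFinM lee_fin mulr_ge0 ?sqr_ge0// ltW// zeta_gt0.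
- by apply/measurable_EFinP; apply: measurable_funM => //; exact: measurable_zeta.
- apply: (@measurable_fun_fubini_tonelli_F _ _ _ _ _ P
    (fun u => ((lik a u.2 u.1)%:E * (a r u.2 ^+ 2)%:E)%E)).
    apply: emeasurable_funM; first by apply/measurable_EFinP; exact: measurable_lik2.
    by apply/measurable_EFinP; exact: (measurableT_comp ma2 measurable_snd).
  by move=> u; rewrite -EFinM lee_fin mulr_ge0 ?sqr_ge0// lik_ge0.
- move=> y _.
  rewrite [leRHS](_ : _ = (\int[P]_w (a r w ^+ 2 * lik a w y)%R%:E)%E); last first.
    by apply: eq_integral => w _; rewrite -EFinM mulrC.
  rewrite rintegralE; last exact: a2_lik_integrable.
  by rewrite -EFinM lee_fin mulrC; exact: post_sqr_le.
Qed.

(** Decoding [b] with the likelihood of [a] can only lose, by [mismatched_le]. With the noise kept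
    fixed, the observation through [b] is that through [a] displaced by b - a, and convexity of ln
    zeta bounds the change below by the product of this displacement with the posterior mean.
    Young's inequality with weight c separates the two factors; c will be taken large when a and b
    are close. *)
Lemma Dch_ge a b (c : R) : meas a -> sqint a -> meas b -> sqint b -> 0 < c ->
  Dch a - 2^-1 * \sum_r (c * \int[P]_w (b r w - a r w) ^+ 2 + c^-1 * \int[P]_w a r w ^+ 2)
  <= Dch b.
Proof.
move=> ma a2 mb b2 c0; apply: le_trans (mismatched_le ma mb b2).
have ia := lnzeta_integrable ma ma a2; have iab := lnzeta_integrable ma mb b2.
have mp r : measurable_fun setT (fun u => post P a r (Yof a u)).
  exact: (measurableT_comp (measurable_post P ma r) (measurable_Yof ma)).
have mp2 r : measurable_fun setT (fun u => post P a r (Yof a u) ^+ 2).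
  by apply: measurable_funX.
have ma2 r : measurable_fun setT (fun w => a r w ^+ 2) by exact: measurable_funX.
have a2E r := rintegralE (a2 r).
have ip r : Q.-integrable setT (EFin \o (fun u => post P a r (Yof a u) ^+ 2)).
  apply/integrableP; split; first exact/measurable_EFinP.
  rewrite (eq_integral (fun u => (post P a r (Yof a u) ^+ 2)%:E)); last first.
    by move=> u _ /=; rewrite ger0_norm ?sqr_ge0.
  apply: le_lt_trans (post_sqr_integral r ma a2) _.
  by rewrite a2E ltry.
have Ep r : \int[Q]_u (post P a r (Yof a u) ^+ 2) <= \int[P]_w (a r w ^+ 2).
  by rewrite -lee_fin -!rintegralE//; exact: post_sqr_integral.
have mD r : measurable_fun setT (fun w => b r w - a r w) by exact: measurable_funB.
have iD r : P.-integrable setT (EFin \o (fun w => (b r w - a r w) ^+ 2)).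
  apply: (@le_rintegrable _ _ _ _ _ (fun w => 2 * b r w ^+ 2 + 2 * a r w ^+ 2)).
  - exact: measurable_funX.
  - move=> w; rewrite ger0_norm ?sqr_ge0//; exact: sqrB_le.
  - by apply: rintegrableD; exact: rintegrableZ.
have iDQ r := marg_sqr (mD r) (iD r).
pose q r u := c * (b r u.2 - a r u.2) ^+ 2 + c^-1 * post P a r (Yof a u) ^+ 2.
have iq r : Q.-integrable setT (EFin \o q r).
  by apply: rintegrableD; exact: rintegrableZ.
have iqs : Q.-integrable setT (EFin \o (fun u => \sum_r q r u)) by exact: rintegrable_sum.
have iqs' := rintegrableZ 2^-1 iqs.
apply: (@le_trans _ _ (\int[Q]_u (ln (zeta P a (Yof a u)) - 2^-1 * \sum_r q r u))).
  rewrite (rintB ia iqs') lerD2l lerN2 (rintZ _ iqs) ler_wpM2l ?invr_ge0//.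
  rewrite Rintegral_sum//; apply: ler_sum => r _.
  rewrite (rintD (rintegrableZ c (iDQ r)) (rintegrableZ c^-1 (ip r))).
  rewrite (rintZ c (iDQ r)) (rintZ c^-1 (ip r)); apply: lerD.
    rewrite (@Rintegral_marg2 _ _ _ _ _ _ _ (fun w => (b r w - a r w) ^+ 2))//.
    exact: measurable_funX.
  by apply: ler_wpM2l (Ep r); rewrite invr_ge0 ltW.
apply: (le_rint (rintegrableB ia iqs') iab) => u.
have -> : Yof b u = addt (Yof a u) (fun r => b r u.2 - a r u.2).
  by apply: eq_from_tnth => r; rewrite !tnth_mktuple addrA [_ + a r _ + _]addrAC addrK.
apply: le_trans (ln_zeta_convex ma a2 _ _).
rewrite lerD2l mulr_sumr -sumrN; apply: ler_sum => r _; rewrite /q.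
set x := b r u.2 - a r u.2; set y := post _ _ _ _; clearbody x y.
have ci : c * c^-1 = 1 by rewrite divff// gt_eqF.
have ci0 : 0 < c^-1 by rewrite invr_gt0.
have := mulr_ge0 (ltW ci0) (sqr_ge0 (c * x + y)).
have -> : c^-1 * (c * x + y) ^+ 2 = c * x ^+ 2 * (c * c^-1) + 2 * (c * c^-1) * x * y + c^-1 * y ^+ 2.
  by rewrite sqrrD exprMn; ring.
rewrite ci; lra.
Qed.

End channel_pair.

(** * Discretization and the I-MMSE inequalities *)

(** Both |f| and f + |f| are nonnegative and integrable, which reduces a signed f to the nonnegative
    case. *)
Lemma Rintegral_density d1 d2 (T1 : measurableType d1) (T2 : measurableType d2)
    (R : realType) (mu : {measure set T1 -> \bar R}) (nu : {measure set T2 -> \bar R})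
    (phi : T1 -> T2) (z : T2 -> R) :
  measurable_fun setT z -> (forall x, 0 <= z x) ->
  (forall f : T2 -> \bar R, measurable_fun setT f -> (forall x, 0 <= f x)%E ->
    (\int[mu]_x f (phi x) = \int[nu]_x ((z x)%:E * f x))%E) ->
  forall f : T2 -> R, measurable_fun setT f ->
    mu.-integrable setT (EFin \o (fun x => f (phi x))) ->
    nu.-integrable setT (EFin \o (fun x => z x * f x)) /\
    \int[mu]_x f (phi x) = \int[nu]_x (z x * f x).
Proof.
move=> mz z0 H f mf fi.
have nonneg (g : T2 -> R) : measurable_fun setT g -> (forall x, 0 <= g x) ->
    mu.-integrable setT (EFin \o (fun x => g (phi x))) ->
    nu.-integrable setT (EFin \o (fun x => z x * g x)) /\
    \int[mu]_x g (phi x) = \int[nu]_x (z x * g x).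
  move=> mg g0 gi.
  have mgE : measurable_fun setT (EFin \o g) by exact/measurable_EFinP.
  have E : (\int[nu]_x (z x * g x)%:E = \int[mu]_x (g (phi x))%:E)%E.
    rewrite (H (EFin \o g))//.
  split; last by rewrite /Rintegral E.
  apply/integrableP; split; first by apply/measurable_EFinP; exact: measurable_funM.
  rewrite (eq_integral (fun x => (z x * g x)%:E)); last first.
    by move=> x _ /=; rewrite ger0_norm// mulr_ge0.
  rewrite E; have /integrableP[_] := gi.
  by congr (_ < _)%E; apply: eq_integral => x _ /=; rewrite ger0_norm.
have mn : measurable_fun setT (fun x => `|f x|) by exact: measurableT_comp.
have ni : mu.-integrable setT (EFin \o (fun x => `|f (phi x)|)) := integrable_norm fi.
have [i1 e1] := nonneg _ mn (fun x => normr_ge0 (f x)) ni.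
have [|i2 e2] := nonneg (fun x => f x + `|f x|) (measurable_funD mf mn) _ (rintegrableD fi ni).
  by move=> x; rewrite -lerBlDl sub0r -normrN ler_norm.
have E x : z x * f x = z x * (f x + `|f x|) - z x * `|f x| by rewrite -mulrBr addrK.
split.
  by rewrite (_ : (fun x => z x * f x) = fun x => z x * (f x + `|f x|) - z x * `|f x|);
    [exact: rintegrableB|apply/funext].
under [RHS]eq_Rintegral do rewrite E.
by rewrite (rintB i2 i1) -e1 -e2 (rintD fi ni) addrK.
Qed.

Section link.
Context (R : realType) (I : finType).
Implicit Types (H : I -> R) (Phi : (I -> R) -> R).
Local Notation gam n := (std_gaussian R n).

Definition ham n (a v : 'I_n -> I -> R) (t : R) H (y : n.-tuple R) (i : I) : R :=
  H i + \sum_r (tnth y r * (Num.sqrt t * a r i) + t * v r i).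

Lemma measurable_ham n (a v : 'I_n -> I -> R) t H Phi : tame Phi ->
  measurable_fun setT (fun y => Phi (ham a v t H y)).
Proof.
move=> [mP _]; apply: mP => i; apply: measurable_funD => //.
apply: measurable_sum => r; apply: measurable_funD => //.
by apply: measurable_funM => //; exact: measurable_tnth.
Qed.

(** The successive averages of [gops] become one integral over the vector of all Gaussians. This
    links the channel steps to the integrals over observations that define [Dch]. *)
Lemma ge0_gauss_gops n (a v : 'I_n -> I -> R) (t : R) Phi : tame Phi ->
  (forall H, 0 <= Phi H) -> forall H,
  (\int[gam n]_y (Phi (ham a v t H y))%:E =
   (gops [seq (a r, v r) | r <- enum 'I_n] t Phi H)%:E)%E.
Proof.
move=> tP P0; elim: n a v => [|n IH] a v H.
  rewrite ge0_integral_iid0; last by apply/measurable_EFinP; exact: measurable_ham.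
  rewrite enum_ord0 /=; congr (Phi _)%:E; apply/funext => i.
  by rewrite /ham big_ord0 addr0.
rewrite enum_ordSl /= /std_gaussian ge0_integral_iidS; last 2 first.
- by apply/measurable_EFinP; exact: measurable_ham.
- by move=> y; rewrite lee_fin.
pose a' r := a (lift ord0 r); pose v' r := v (lift ord0 r).
pose l' := [seq (a r, v r) | r <- [seq lift ord0 i | i <- enum 'I_n]].
have l'E : l' = [seq (a' r, v' r) | r <- enum 'I_n] by rewrite /l' -map_comp.
have tl : tame (gops l' t Phi) by exact: tame_gops.
rewrite -/l' /gop -rintegralE; last first.
  have := tame_integrable H (fun i => Num.sqrt t * a ord0 i) (fun i => t * v ord0 i) tl.
  exact.
apply: eq_integral => x _; rewrite l'E -IH; apply: eq_integral => y _.
congr (Phi _)%:E; apply/funext => i; rewrite /ham big_ord_recl tnth0.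
rewrite !addrA; congr (_ + _ + _ + _); apply: eq_bigr => r _.
by rewrite tnthS.
Qed.

Lemma gauss_gops n (a v : 'I_n -> I -> R) (t : R) Phi H : tame Phi ->
  (gam n).-integrable setT (EFin \o (fun y => Phi (ham a v t H y))) /\
  \int[gam n]_y Phi (ham a v t H y) = gops [seq (a r, v r) | r <- enum 'I_n] t Phi H.
Proof.
move=> tP.
have tN : tame (fun H => `|Phi H|).
  have [mP [C [c [C0 c0 hC]]]] := tP; split.
    by move=> d T h mh; apply: measurableT_comp => //; exact: mP.
  by exists C, c; split => // G; rewrite normr_id.
have tS := tameD tP tN.
have nonneg Psi : tame Psi -> (forall H, 0 <= Psi H) ->
    (gam n).-integrable setT (EFin \o (fun y => Psi (ham a v t H y))) /\
    \int[gam n]_y Psi (ham a v t H y) = gops [seq (a r, v r) | r <- enum 'I_n] t Psi H.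
  move=> tQ Q0; have E := ge0_gauss_gops a v t tQ Q0 H.
  split; last by rewrite /Rintegral E.
  apply/integrableP; split; first by apply/measurable_EFinP; exact: measurable_ham.
  rewrite (eq_integral (fun y => (Psi (ham a v t H y))%:E)); first by rewrite E ltry.
  by move=> y _ /=; rewrite ger0_norm.
have [i1 e1] := nonneg _ tN (fun H => normr_ge0 _).
have [|i2 e2] := nonneg _ tS.
  by move=> G; rewrite -lerBlDl sub0r -normrN ler_norm.
have E : Phi = fun H => (Phi H + `|Phi H|) - `|Phi H| by apply/funext => G; rewrite addrK.
split.
  rewrite (_ : (fun y => _) = fun y => (Phi (ham a v t H y) + `|Phi (ham a v t H y)|)
     - `|Phi (ham a v t H y)|); first exact: (rintegrableB i2 i1).
  by apply/funext => y; rewrite addrK.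
rewrite [RHS](_ : _ = gops [seq (a r, v r) | r <- enum 'I_n] t
   (fun H => (Phi H + `|Phi H|) - `|Phi H|) H); last by rewrite -E.
rewrite gopsB// -e1 -e2 -(rintB i2 i1); apply: eq_Rintegral => y _.
by rewrite addrK.
Qed.

End link.

Section finite_channel.
Context (R : realType) d (Om : measurableType d) (P : probability Om R) (n : nat).
Context (I : finType) (F : Om -> I).
Hypothesis mF : forall i, measurable (F @^-1` [set i]).
Local Notation gam := (std_gaussian R n).

(** The law of the finite-valued variable F, through which a signal b (F w) becomes a finite Gibbs
    system. *)
Definition fiber_weight i : R := fine (P (F @^-1` [set i])).
Local Notation W := fiber_weight.

Lemma fiber_weight_ge0 i : 0 <= W i. Proof. by rewrite fine_ge0. Qed.

Lemma measurable_fibers (f : I -> R) : measurable_fun setT (fun w => f (F w)).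
Proof.
rewrite (_ : (fun w => _) = fun w => \sum_i f i * \1_(F @^-1` [set i]) w).
  by apply: measurable_sum => i; apply: measurable_funM => //; exact: measurable_indic.
apply/funext => w; rewrite (bigD1 (F w))//= big1 ?addr0; last first.
  by move=> i ni; rewrite indicE memNset ?mulr0// => /= e; move: ni; rewrite e eqxx.
by rewrite indicE mem_set ?mulr1.
Qed.

Lemma fiber_integrable (f : I -> R) : P.-integrable setT (EFin \o (fun w => f (F w))).
Proof.
apply: (@le_rintegrable _ _ _ _ _ (fun=> \sum_i `|f i|)).
- exact: measurable_fibers.
- by move=> w; rewrite (bigD1 (F w))//= lerDl sumr_ge0.
- exact: finite_measure_integrable_cst.
Qed.

Lemma Rintegral_fibers (f : I -> R) : \int[P]_w f (F w) = \sum_i W i * f i.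
Proof.
transitivity (\int[P]_w \sum_i (f i * \1_(F @^-1` [set i]) w)).
  apply: eq_Rintegral => w _; rewrite (bigD1 (F w))//= big1 ?addr0; last first.
    by move=> i ni; rewrite indicE memNset ?mulr0// => /= e; move: ni; rewrite e eqxx.
  by rewrite indicE mem_set ?mulr1.
have ii i : P.-integrable setT (EFin \o (\1_(F @^-1` [set i]) : Om -> R)).
  exact: integrable_indic.
rewrite Rintegral_sum; last by move=> i; exact: rintegrableZ.
apply: eq_bigr => i _; rewrite rintZ// mulrC; congr (_ * _).
by rewrite /Rintegral integral_indic// setIT.
Qed.

Lemma fiber_weight_sum : \sum_i W i = 1.
Proof.
have := Rintegral_fibers (fun=> 1); rewrite Rintegral_prob_cst => ->.
by apply: eq_bigr => i _; rewrite mulr1.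
Qed.

Lemma fiber_weight_gt0 : exists i, 0 < W i.
Proof.
apply: contrapT => H.
have : \sum_i W i = 0.
  apply: big1 => i _; apply/eqP; rewrite eq_le fiber_weight_ge0 andbT leNgt.
  by apply/negP => Wi; apply: H; exists i.
by rewrite fiber_weight_sum => /eqP; rewrite oner_eq0.
Qed.

Variable b : 'I_n -> I -> R.
Variable t : R.
Hypothesis t0 : 0 <= t.
Let a r w := Num.sqrt t * b r (F w).
Let v r i := - (b r i ^+ 2 / 2).
Let H0 : I -> R := fun=> 0.
Let hy := ham b v t H0.
Let l := [seq b r | r <- enum 'I_n].

Let W0 := fiber_weight_ge0.

Lemma measurable_fiber_signal r : measurable_fun setT (a r).
Proof. by apply: measurable_funM => //; exact: (measurable_fibers (b r)). Qed.
Let ma := measurable_fiber_signal.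

Lemma fiber_signal_sqr r : P.-integrable setT (EFin \o (fun w => a r w ^+ 2)).
Proof. exact: (fiber_integrable (fun i => (Num.sqrt t * b r i) ^+ 2)). Qed.
Let a2 := fiber_signal_sqr.

Lemma lik_fiber w y : lik a w y = expR (hy y (F w)).
Proof.
rewrite /lik /hy /ham add0r; congr expR; apply: eq_bigr => r _.
rewrite mulrC; congr (_ + _); rewrite /v mulrN exprMn sqr_sqrtr//; ring.
Qed.

Lemma zeta_fiber y : zeta P a y = Zf W (hy y).
Proof.
transitivity (\int[P]_w expR (hy y (F w))).
  by apply: eq_Rintegral => w _; exact: lik_fiber.
by rewrite (Rintegral_fibers (fun i => expR (hy y i))).
Qed.

Lemma post_fiber r y : post P a r y = Num.sqrt t * gibbs W (b r) (hy y).
Proof.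
rewrite /post zeta_fiber /gibbs mulrA; congr (_ / _).
transitivity (\int[P]_w (Num.sqrt t * b r (F w) * expR (hy y (F w)))).
  by apply: eq_Rintegral => w _; rewrite lik_fiber.
rewrite (Rintegral_fibers (fun i => Num.sqrt t * b r i * expR (hy y i))) mulr_sumr.
by apply: eq_bigr => i _; ring.
Qed.

Lemma null_enum : null l = [seq (b r, v r) | r <- enum 'I_n].
Proof. by rewrite /null /l -map_comp. Qed.

(** Under the noise law the entropy is the mean of zeta ln zeta, and for a finite signal [zeta] is
    the partition function at the Hamiltonian reached by the null channel. *)
Lemma Dch_fiber : Dch P a = gops (null l) t (ZlnZ W) H0.
Proof.
have [i0 Wi0] := fiber_weight_gt0.
have mz := measurable_zeta P ma.
have z0 y : 0 <= zeta P a y by apply: ltW; exact: zeta_gt0.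
have mlz : measurable_fun setT (fun y => ln (zeta P a y)).
  exact: (measurableT_comp (@measurable_ln R) mz).
have H f (mf : measurable_fun setT f) f0 := @plantedY _ _ _ P n a ma f mf f0.
have [_ e] := @Rintegral_density _ _ _ _ R _ _ (Yof a) (zeta P a) mz z0 H _ mlz
  (lnzeta_integrable ma ma a2).
rewrite /Dch e null_enum.
have [_ <-] := gauss_gops b v t H0 (tame_ZlnZ W0 Wi0).
by apply: eq_Rintegral => y _; rewrite /ZlnZ /lnZ -zeta_fiber.
Qed.

Lemma post_fiber_sqr r :
  \int[gam]_y (zeta P a y * post P a r y ^+ 2) =
  t * gops (null l) t (fun H => Zf W H * gibbs W (b r) H ^+ 2) H0.
Proof.
have [i0 Wi0] := fiber_weight_gt0.
have tZ : tame (Zf W) by exact: tame_Zf.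
have tF : tame (fun H => Zf W H * gibbs W (b r) H ^+ 2).
  rewrite (_ : (fun H => _) = fun H => Zf W H * (gibbs W (b r) H * gibbs W (b r) H)).
    by apply: tameM => //; apply: tameM; exact: (tame_gibbs W0 Wi0).
  by apply/funext => H; rewrite expr2.
rewrite null_enum; have [i <-] := gauss_gops b v t H0 tF.
rewrite -rintZ//; apply: eq_Rintegral => y _.
rewrite post_fiber zeta_fiber exprMn sqr_sqrtr//; rewrite /hy; ring.
Qed.

End finite_channel.

Lemma ler_sqr_abs (R : realDomainType) (x y : R) : `|x| <= `|y| -> x ^+ 2 <= y ^+ 2.
Proof. by move=> xy; rewrite -(real_normK (num_real x)) -(real_normK (num_real y)) lerXn2r ?nnegrE. Qed.

Lemma rcvg_sum (R : realType) (J : Type) (s : seq J) (f : J -> nat -> R) (l : J -> R) :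
  (forall j, f j N @[N --> \oo] --> l j) ->
  \sum_(j <- s) f j N @[N --> \oo] --> \sum_(j <- s) l j.
Proof.
move=> fl; elim: s => [|j s IH].
  by under eq_fun do rewrite big_nil; rewrite big_nil; exact: cvg_cst.
by under eq_fun do rewrite big_cons; rewrite big_cons; exact: cvgD.
Qed.

Section rounding.
Context (R : realType) (N : nat).
Implicit Types x : R.

(* Rounding towards 0 to a multiple of 1 / (N + 1), truncated at N + 1. *)
Definition rcode := (bool * 'I_(N.+1 * N.+1).+1)%type.
Definition rval (c : rcode) : R := (-1) ^+ c.1 * (c.2%:R / N.+1%:R).
Definition ridx x : rcode :=
  if `|x| <= N.+1%:R then (x < 0, inord (Num.truncn (`|x| * N.+1%:R)))
  else (false, ord0).
Definition rnd x := rval (ridx x).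

Let K0 : 0 < N.+1%:R :> R. Proof. by rewrite ltr0n. Qed.

Lemma truncn_grid x : `|x| <= N.+1%:R -> (Num.truncn (`|x| * N.+1%:R) < (N.+1 * N.+1).+1)%N.
Proof.
move=> xK; rewrite ltnS -(ler_nat R).
have /truncn_itv /andP[h _] : 0 <= `|x| * N.+1%:R by rewrite mulr_ge0.
by apply: le_trans h _; rewrite natrM ler_wpM2r.
Qed.

Lemma rndE x : `|x| <= N.+1%:R ->
  rnd x = (-1) ^+ (x < 0)%R * ((Num.truncn (`|x| * N.+1%:R))%:R / N.+1%:R).
Proof. by move=> xK; rewrite /rnd /ridx xK /rval /= inordK//; exact: truncn_grid. Qed.

Lemma rnd_big x : ~~ (`|x| <= N.+1%:R) -> rnd x = 0.
Proof. by rewrite /rnd /ridx => /negPf ->; rewrite /rval /= mul0r mulr0. Qed.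

Lemma rnd_bounds x : `|x| <= N.+1%:R ->
  (Num.truncn (`|x| * N.+1%:R))%:R / N.+1%:R <= `|x| <=
  (Num.truncn (`|x| * N.+1%:R))%:R / N.+1%:R + N.+1%:R^-1.
Proof.
move=> xK; have /truncn_itv /andP[h1 h2] : 0 <= `|x| * N.+1%:R by rewrite mulr_ge0.
rewrite ler_pdivrMr// h1 /= -[X in _ + X]mul1r -mulrDl ler_pdivlMr//.
by apply: le_trans (ltW h2) _; rewrite -natr1.
Qed.

Lemma le_rnd x : `|rnd x| <= `|x|.
Proof.
have [xK|xK] := boolP (`|x| <= N.+1%:R); last by rewrite rnd_big// normr0.
rewrite rndE// normrM normrX normrN1 expr1n mul1r ger0_norm ?divr_ge0//.
by have /andP[] := rnd_bounds xK.
Qed.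

Lemma rnd_close x : `|x| <= N.+1%:R -> `|x - rnd x| <= N.+1%:R^-1.
Proof.
move=> xK; rewrite rndE// {1}(realEsign (num_real x)) -mulrBr normrM normrX normrN1.
rewrite expr1n mul1r; have /andP[h1 h2] := rnd_bounds xK.
by rewrite ger0_norm ?subr_ge0// lerBlDl.
Qed.

Lemma measurable_ridx (c : rcode) : measurable (ridx @^-1` [set c]).
Proof.
have mK : measurable_fun setT (fun x : R => `|x| * N.+1%:R) by exact: measurable_funM.
have : measurable_fun setT (fun x => if `|x| <= N.+1%:R then
    ((c.2%:R <= `|x| * N.+1%:R) && (`|x| * N.+1%:R < c.2.+1%:R)) &&
    (if x < 0 then c.1 else ~~ c.1)
  else c == (false, ord0)).
  apply: measurable_fun_ifT => //; first exact: measurable_fun_ler.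
  apply: measurable_and; last first.
    by apply: measurable_fun_ifT => //; exact: measurable_fun_ltr.
  apply: measurable_and; first exact: measurable_fun_ler.
  exact: measurable_fun_ltr.
move=> /(_ measurableT [set true] I); rewrite setTI; congr measurable.
apply/seteqP; split => x /=; rewrite /ridx; case: ifPn => xK.
- move=> /andP[h s]; case: c h s => s i /= h sE; congr pair.
    by case: (x < 0) sE; case: s.
  have : Num.truncn (`|x| * N.+1%:R) == i by rewrite truncn_eq ?h// mulr_ge0.
  by move=> /eqP ->; rewrite inord_val.
- by move/eqP.
- move=> <- /=; rewrite inordK; last exact: truncn_grid.
  by rewrite truncn_itv ?mulr_ge0//=; case: (x < 0).
- by move=> <-; rewrite eqxx.
Qed.

End rounding.

Lemma rnd_cvg (R : realType) (x : R) : rnd N x @[N --> \oo] --> x.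
Proof.
apply/cvgrPdist_le => e e0.
exists (Num.truncn (`|x| + e^-1)) => // N /= hN.
have h : `|x| + e^-1 <= N.+1%:R.
  apply: (@le_trans _ _ (Num.truncn (`|x| + e^-1)).+1%:R); last by rewrite ler_nat ltnS.
  have /truncn_itv /andP[_ /ltW//] : 0 <= `|x| + e^-1 by rewrite addr_ge0// invr_ge0 ltW.
apply: le_trans (rnd_close _) _.
  by apply: le_trans h; rewrite lerDl invr_ge0 ltW.
rewrite invf_ple ?posrE ?ltr0n//; by apply: le_trans h; rewrite lerDr.
Qed.

Section limits.
Context d (T : measurableType d) (R : realType) (mu : {measure set T -> \bar R}).
Local Notation rint f := (mu.-integrable setT (EFin \o f)).

Lemma rint_dominated (f_ : nat -> T -> R) (f g : T -> R) :
  (forall n, measurable_fun setT (f_ n)) -> measurable_fun setT f ->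
  (forall x, f_ n x @[n --> \oo] --> f x) -> rint g ->
  (forall n x, `|f_ n x| <= g x) ->
  \int[mu]_x f_ n x @[n --> \oo] --> \int[mu]_x f x.
Proof.
move=> mf_ mf ff gi fg.
have [|||||fi _ cv] := @dominated_convergence _ _ _ mu setT measurableT
  (fun n => EFin \o f_ n) (EFin \o f) (EFin \o g).
- by move=> n; exact/measurable_EFinP.
- exact/measurable_EFinP.
- by apply: aeW => x _; apply: cvg_EFin; [exact: nearW|exact: ff].
- exact: gi.
- by apply: aeW => x n _ /=; rewrite lee_fin.
have fi_ n : rint (f_ n) by exact: le_rintegrable gi.
by apply: fine_cvg; move: cv; rewrite (rintegralE fi).
Qed.

Lemma limn_einf_le (u v : nat -> \bar R) : (forall n, u n <= v n)%E ->
  (limn_einf u <= limn_einf v)%E.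
Proof.
move=> uv; rewrite !limn_einf_lim; apply: lee_lim; [exact: is_cvg_einfs..|].
apply: nearW => n; apply: le_ereal_inf_tmp => _ [p /= np <-].
by apply: le_trans (uv p); apply: ereal_inf_lbound; exists p.
Qed.

Lemma fatou_le (f_ : nat -> T -> R) (f : T -> R) (x_ : nat -> R) (x : R) :
  (forall n, measurable_fun setT (f_ n)) -> (forall n y, 0 <= f_ n y) ->
  (forall y, f_ n y @[n --> \oo] --> f y) ->
  (forall n, \int[mu]_y (f_ n y)%:E <= (x_ n)%:E)%E ->
  x_ n @[n --> \oo] --> x -> (\int[mu]_y (f y)%:E <= x%:E)%E.
Proof.
move=> mf_ f0 ff le xx.
have := @fatou _ _ _ mu setT measurableT (fun n => EFin \o f_ n)
  (fun n => (measurable_EFinP _ _).2 (mf_ n)) (fun n y _ => f0 n y).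
rewrite (eq_integral (fun y => (f y)%:E)); last first.
  move=> y _; apply: (cvg_limn_einf_sup _).1.
  by apply: cvg_EFin; [exact: nearW|exact: ff].
move=> /le_trans; apply; apply: le_trans (limn_einf_le le) _.
have ce : (x_ n)%:E @[n --> \oo] --> x%:E by apply: cvg_EFin; [exact: nearW|exact: xx].
by rewrite (cvg_limn_einf_sup ce).1.
Qed.

End limits.

Section mmse_limit.
Context (R : realType) d (Om : measurableType d) (P : probability Om R) (n : nat).
Local Notation gam := (std_gaussian R n).
Local Notation Q := (gam \x P)%E.
Implicit Types (a b : 'I_n -> Om -> R).
Local Notation sqint a := (forall r, P.-integrable setT (EFin \o (fun w => a r w ^+ 2))).
Local Notation meas a := (forall r, measurable_fun setT (a r)).

(* Second moment of the posterior mean: the factor zeta turns the noise y into the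
   observation. *)
Definition Mch a r := \int[gam]_y (zeta P a y * post P a r y ^+ 2).

Lemma measurable_Mch a r : meas a ->
  measurable_fun setT (fun y => zeta P a y * post P a r y ^+ 2).
Proof.
move=> ma; apply: measurable_funM; first exact: measurable_zeta.
by apply: measurable_funX; exact: measurable_post.
Qed.

Lemma Mch_ge0 a r y : meas a -> 0 <= zeta P a y * post P a r y ^+ 2.
Proof. by move=> ma; rewrite mulr_ge0 ?sqr_ge0// ltW// zeta_gt0. Qed.

Lemma post_sqr_joint a r : meas a -> sqint a ->
  (\int[gam]_y \int[P]_w ((lik a w y)%:E * (a r w ^+ 2)%:E) = (\int[P]_w a r w ^+ 2)%:E)%E.
Proof.
move=> ma a2; have ma2 : measurable_fun setT (fun w => a r w ^+ 2) by exact: measurable_funX.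
rewrite -(@planted_joint _ _ _ P _ _ ma (fun u => (a r u.2 ^+ 2)%:E)).
- rewrite (@ge0_integral_marg2 _ _ _ _ _ gam P (fun w => (a r w ^+ 2)%:E)).
  + exact: rintegralE.
  + exact/measurable_EFinP.
  + by move=> w; rewrite lee_fin sqr_ge0.
- by apply/measurable_EFinP; exact: (measurableT_comp ma2 measurable_snd).
- by move=> w; rewrite lee_fin sqr_ge0.
Qed.

Lemma Mch_integrable a r : meas a -> sqint a ->
  gam.-integrable setT (EFin \o (fun y => zeta P a y * post P a r y ^+ 2)).
Proof.
move=> ma a2; apply/integrableP; split; first by apply/measurable_EFinP; exact: measurable_Mch.
rewrite (eq_integral (fun y => ((zeta P a y)%:E * (post P a r y ^+ 2)%:E)%E)); last first.
  by move=> y _ /=; rewrite ger0_norm ?EFinM//; exact: Mch_ge0.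
rewrite -(@plantedY _ _ _ P _ _ ma (fun y => (post P a r y ^+ 2)%:E)); last 2 first.
- by apply/measurable_EFinP; apply: measurable_funX; exact: measurable_post.
- by move=> y; rewrite lee_fin sqr_ge0.
by apply: le_lt_trans (post_sqr_integral r ma a2) _; rewrite rintegralE// ltry.
Qed.

Lemma variance_integral a r : meas a -> sqint a ->
  (\int[gam]_y \int[P]_w ((a r w - post P a r y) ^+ 2 * lik a w y)%:E =
   (\int[P]_w a r w ^+ 2 - Mch a r)%:E)%E.
Proof.
move=> ma a2.
pose A y := \int[P]_w (a r w ^+ 2 * lik a w y).
have AE y : (\int[P]_w ((lik a w y)%:E * (a r w ^+ 2)%:E) = (A y)%:E)%E.
  rewrite -rintegralE; last exact: a2_lik_integrable.
  by apply: eq_integral => w _; rewrite -EFinM mulrC.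
have mA : measurable_fun setT A.
  apply: (@measurable_Rintegral _ _ _ _ _ P (fun u : n.-tuple R * Om => a r u.2 ^+ 2 * lik a u.2 u.1)).
  apply: measurable_funM; last exact: measurable_lik2.
  by apply: measurable_funX; exact: (measurableT_comp (ma r) measurable_snd).
have iA0 : (\int[gam]_y (A y)%:E = (\int[P]_w a r w ^+ 2)%:E)%E.
  by rewrite -(post_sqr_joint r ma a2); apply: eq_integral => y _; rewrite AE.
have A0 y : 0 <= A y by apply: Rintegral_ge0 => w _; rewrite mulr_ge0 ?sqr_ge0 ?lik_ge0.
have iA : gam.-integrable setT (EFin \o A).
  apply/integrableP; split; first exact/measurable_EFinP.
  rewrite (eq_integral (fun y => (A y)%:E)); first by rewrite iA0 ltry.
  by move=> y _ /=; rewrite ger0_norm.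
have iM := Mch_integrable r ma a2.
have E y : (\int[P]_w ((a r w - post P a r y) ^+ 2 * lik a w y)%:E =
    (A y - zeta P a y * post P a r y ^+ 2)%:E)%E.
  rewrite rintegralE.
    by rewrite (post_variance ma a2); congr EFin; rewrite /A; ring.
  apply: (@lik_rintegrable _ _ _ _ _ _ ma).
    by apply: measurable_funX; exact: measurable_funB.
  apply: (@le_rintegrable _ _ _ _ _ (fun w => 2 * a r w ^+ 2 + 2 * post P a r y ^+ 2)).
  - by apply: measurable_funX; exact: measurable_funB.
  - by move=> w; rewrite ger0_norm ?sqr_ge0//; exact: sqrB_le.
  - apply: rintegrableD; first exact: rintegrableZ.
    exact: finite_measure_integrable_cst.
under eq_integral do rewrite E.
rewrite rintegralE; last exact: rintegrableB.
by rewrite (rintB iA iM) /Mch /Rintegral iA0.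
Qed.

Section sequence.
Variables (a_ : nat -> 'I_n -> Om -> R) (a : 'I_n -> Om -> R).
Hypotheses (ma : meas a) (ma_ : forall N, meas (a_ N)) (a2 : sqint a).
Hypothesis le_a : forall N r w, `|a_ N r w| <= `|a r w|.
Hypothesis cva : forall r w, a_ N r w @[N --> \oo] --> a r w.

Lemma dominated_sqint N : sqint (a_ N).
Proof.
move=> r; apply: (le_rintegrable _ _ (a2 r)); first exact: measurable_funX.
by move=> w; rewrite ger0_norm ?sqr_ge0//; exact: ler_sqr_abs.
Qed.
Let a2_ := dominated_sqint.

Lemma cvg_lik w y : lik (a_ N) w y @[N --> \oo] --> lik a w y.
Proof.
rewrite /lik; apply: continuous_cvg; first exact: continuous_expR.
apply: rcvg_sum => r; apply: cvgB; first by apply: cvgM; [exact: cva|exact: cvg_cst].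
by apply: cvgM; [apply: cvgM; exact: cva|exact: cvg_cst].
Qed.

Lemma cvg_zeta y : zeta P (a_ N) y @[N --> \oo] --> zeta P a y.
Proof.
apply: (@rint_dominated _ _ _ _ _ _ (fun=> expR (sq y / 2))).
- by move=> N; exact: measurable_lik.
- exact: measurable_lik.
- by move=> w; exact: cvg_lik.
- exact: finite_measure_integrable_cst.
- by move=> N w; rewrite ger0_norm ?lik_ge0//; exact: lik_le.
Qed.

Lemma cvg_post r y : post P (a_ N) r y @[N --> \oo] --> post P a r y.
Proof.
apply: cvgM; last first.
  by apply: cvgV; [rewrite gt_eqF// zeta_gt0|exact: cvg_zeta].
apply: (@rint_dominated _ _ _ _ _ _ (fun w => expR (sq y / 2) * `|a r w|)).
- by move=> N; apply: measurable_funM => //; exact: measurable_lik.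
- by apply: measurable_funM => //; exact: measurable_lik.
- by move=> w; apply: cvgM; [exact: cva|exact: cvg_lik].
- apply: rintegrableZ; exact: (integrable_norm (a_integrable ma a2 r)).
- move=> N w; rewrite normrM mulrC ler_pM//.
  by rewrite ger0_norm ?lik_ge0//; exact: lik_le.
Qed.

Lemma cvg_sqr_integral r : \int[P]_w a_ N r w ^+ 2 @[N --> \oo] --> \int[P]_w a r w ^+ 2.
Proof.
apply: (@rint_dominated _ _ _ _ _ _ (fun w => a r w ^+ 2)) => //.
- by move=> N; exact: measurable_funX.
- exact: measurable_funX.
- by move=> w; apply: cvgM; exact: cva.
- by move=> N w; rewrite ger0_norm ?sqr_ge0//; exact: ler_sqr_abs.
Qed.

(** Fatou's lemma on the squared posterior means gives this inequality only. The converse,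
    [Mch_ge_lim], applies it to the posterior variance, whose integral is the second moment of the
    signal, which converges, minus [Mch]. *)
Lemma Mch_le_lim (x_ : nat -> R) x : (forall N, \sum_r Mch (a_ N) r <= x_ N) ->
  x_ N @[N --> \oo] --> x -> \sum_r Mch a r <= x.
Proof.
move=> le cx.
have E b : meas b -> sqint b ->
    (\int[gam]_y (\sum_r zeta P b y * post P b r y ^+ 2)%:E = (\sum_r Mch b r)%:E)%E.
  move=> mb b2; have i r := Mch_integrable r mb b2.
  by rewrite (rintegralE (rintegrable_sum _ i)) (Rintegral_sum _ i).
rewrite -lee_fin -E//.
apply: (@fatou_le _ _ _ gam (fun N y => \sum_r zeta P (a_ N) y * post P (a_ N) r y ^+ 2) _ x_) => //.
- by move=> N; apply: measurable_sum => r; exact: measurable_Mch.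
- by move=> N y; apply: sumr_ge0 => r _; exact: Mch_ge0.
- move=> y; apply: rcvg_sum => r; apply: cvgM; first exact: cvg_zeta.
  by apply: cvgM; exact: cvg_post.
- by move=> N; rewrite E// lee_fin.
Qed.

Lemma Mch_ge_lim (x_ : nat -> R) x : (forall N, x_ N <= \sum_r Mch (a_ N) r) ->
  x_ N @[N --> \oo] --> x -> x <= \sum_r Mch a r.
Proof.
move=> le cx.
pose f b r (u : n.-tuple R * Om) := (b r u.2 - post P b r u.1) ^+ 2 * lik b u.2 u.1.
have mf b r : meas b -> measurable_fun setT (f b r).
  move=> mb; apply: measurable_funM; last exact: measurable_lik2.
  apply: measurable_funX; apply: measurable_funB.
    exact: (measurableT_comp (mb r) measurable_snd).
  exact: (measurableT_comp (measurable_post P mb r) measurable_fst).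
have f0 b r u : 0 <= f b r u by rewrite mulr_ge0 ?sqr_ge0 ?lik_ge0.
have fE b : meas b -> sqint b -> (\int[Q]_u (\sum_r f b r u)%:E =
    (\sum_r \int[P]_w b r w ^+ 2 - \sum_r Mch b r)%:E)%E.
  move=> mb b2; under eq_integral do rewrite -sumEFin.
  rewrite ge0_integral_sum//; last first.
  - by move=> r u _; rewrite lee_fin.
  - by move=> r; apply/measurable_EFinP; exact: mf.
  rewrite -sumrB -sumEFin; apply: eq_bigr => r _; rewrite -variance_integral//.
  rewrite (@fubini_tonelli1 _ _ _ _ _ gam P (EFin \o f b r))//.
    by apply/measurable_EFinP; exact: mf.
  by move=> u; rewrite lee_fin.
suff : \sum_r \int[P]_w a r w ^+ 2 - \sum_r Mch a r <= \sum_r \int[P]_w a r w ^+ 2 - x.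
  by rewrite lerD2l lerN2.
rewrite -lee_fin -fE//.
apply: (@fatou_le _ _ _ Q (fun N u => \sum_r f (a_ N) r u) _
  (fun N => \sum_r \int[P]_w a_ N r w ^+ 2 - x_ N)).
- by move=> N; apply: measurable_sum => r; exact: mf.
- by move=> N u; apply: sumr_ge0 => r _; exact: f0.
- move=> u; apply: rcvg_sum => r; apply: cvgM; last exact: cvg_lik.
  by apply: cvgM; apply: cvgB; [exact: cva|exact: cvg_post|exact: cva|exact: cvg_post].
- by move=> N; rewrite fE// lee_fin lerD2l lerN2.
- by apply: cvgB => //; apply: rcvg_sum => r; exact: cvg_sqr_integral.
Qed.

End sequence.
End mmse_limit.

Lemma Dch_close (R : realType) d (Om : measurableType d) (P : probability Om R) n
    (a b : 'I_n -> Om -> R) (c : R) :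
  (forall r, measurable_fun setT (a r)) -> (forall r, measurable_fun setT (b r)) ->
  (forall r, P.-integrable setT (EFin \o (fun w => a r w ^+ 2))) ->
  (forall r, P.-integrable setT (EFin \o (fun w => b r w ^+ 2))) -> 0 < c ->
  `|Dch P a - Dch P b| <= c / 2 * \sum_r \int[P]_w (a r w - b r w) ^+ 2 +
    (\sum_r \int[P]_w a r w ^+ 2 + \sum_r \int[P]_w b r w ^+ 2) / (2 * c).
Proof.
move=> ma mb a2 b2 c0.
have h1 := Dch_ge ma a2 mb b2 c0; have h2 := Dch_ge mb b2 ma a2 c0.
have sym : \sum_r \int[P]_w (b r w - a r w) ^+ 2 = \sum_r \int[P]_w (a r w - b r w) ^+ 2.
  by apply: eq_bigr => r _; apply: eq_Rintegral => w _; rewrite -sqrrN opprB.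
move: h1 h2; rewrite !big_split /= -!mulr_sumr sym invfM.
set E := \sum_r _; set A := \sum_r _; set B := \sum_r _.
have A0 : 0 <= A by apply: sumr_ge0 => r _; apply: Rintegral_ge0 => w _; exact: sqr_ge0.
have B0 : 0 <= B by apply: sumr_ge0 => r _; apply: Rintegral_ge0 => w _; exact: sqr_ge0.
have C0 : 0 < c^-1 by rewrite invr_gt0.
have := mulr_ge0 (ltW C0) A0; have := mulr_ge0 (ltW C0) B0.
set p := c^-1; clearbody A B E p; move: (Dch P a) (Dch P b) => Da Db pA pB h1 h2; rewrite ler_norml.
apply/andP; split; lra.
Qed.

Section cvg_Dch.
Context (R : realType) d (Om : measurableType d) (P : probability Om R) (n : nat).
Variables (a_ : nat -> 'I_n -> Om -> R) (a g : 'I_n -> Om -> R).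
Hypotheses (ma : forall r, measurable_fun setT (a r)).
Hypotheses (ma_ : forall N r, measurable_fun setT (a_ N r)).
Hypothesis g2 : forall r, P.-integrable setT (EFin \o (fun w => g r w ^+ 2)).
Hypothesis le_a_ : forall N r w, `|a_ N r w| <= `|g r w|.
Hypothesis le_a : forall r w, `|a r w| <= `|g r w|.
Hypothesis cva : forall r w, a_ N r w @[N --> \oo] --> a r w.

Let a2_ N r : P.-integrable setT (EFin \o (fun w => a_ N r w ^+ 2)).
Proof.
apply: (le_rintegrable _ _ (g2 r)); first exact: measurable_funX.
by move=> w; rewrite ger0_norm ?sqr_ge0//; exact: ler_sqr_abs.
Qed.

Let a2 r : P.-integrable setT (EFin \o (fun w => a r w ^+ 2)).
Proof.
apply: (le_rintegrable _ _ (g2 r)); first exact: measurable_funX.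
by move=> w; rewrite ger0_norm ?sqr_ge0//; exact: ler_sqr_abs.
Qed.

Lemma cvg_sqr_dist : \sum_r \int[P]_w (a_ N r w - a r w) ^+ 2 @[N --> \oo] --> (0 : R).
Proof.
rewrite -[X in _ --> X](_ : \sum_(r < n) (0 : R) = 0); last by rewrite big1.
apply: rcvg_sum => r; rewrite -(Rintegral_prob_cst P 0).
apply: (@rint_dominated _ _ _ _ _ _ (fun w => 4 * g r w ^+ 2)).
- by move=> N; apply: measurable_funX; exact: measurable_funB.
- exact: measurable_cst.
- move=> w; rewrite [X in _ --> X](_ : _ = (a r w - a r w) * (a r w - a r w)); last by rewrite subrr mulr0.
  by apply: cvgM; apply: cvgB; [exact: cva|exact: cvg_cst|exact: cva|exact: cvg_cst].
- exact: rintegrableZ.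
- move=> N w; rewrite ger0_norm ?sqr_ge0//; apply: le_trans (sqrB_le _ _) _.
  have := ler_sqr_abs (le_a_ N r w); have := ler_sqr_abs (le_a r w); lra.
Qed.

Lemma cvg_Dch : Dch P (a_ N) @[N --> \oo] --> Dch P a.
Proof.
set A := \sum_r \int[P]_w g r w ^+ 2.
have A0 : 0 <= A by apply: sumr_ge0 => r _; apply: Rintegral_ge0 => w _; exact: sqr_ge0.
apply/cvgrPdist_le => e e0.
(* This weight makes the second-moment term of [Dch_close] at most e / 2 for every N; the distance
   term, weighted by c, is then made small by N. *)
pose c := 2 * (A + 1) / e.
have c0 : 0 < c by rewrite !mulr_gt0 ?invr_gt0//; lra.
move/cvgrPdist_le : cvg_sqr_dist => /(_ (e / c)) [|N0 _ HN]; first by rewrite divr_gt0.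
exists N0 => // N hN; have := HN N hN; rewrite sub0r normrN => hE.
rewrite distrC; apply: le_trans (Dch_close (ma_ N) ma (a2_ N) a2 c0) _.
have leA_ : \sum_r \int[P]_w a_ N r w ^+ 2 <= A.
  by apply: ler_sum => r _; apply: le_rint => // w; exact: ler_sqr_abs.
have leA : \sum_r \int[P]_w a r w ^+ 2 <= A.
  by apply: ler_sum => r _; apply: le_rint => // w; exact: ler_sqr_abs.
have E1 : c / 2 * \sum_r \int[P]_w (a_ N r w - a r w) ^+ 2 <= e / 2.
  have -> : e / 2 = c / 2 * (e / c) by field; rewrite gt_eqF.
  apply: ler_wpM2l; first exact: divr_ge0 (ltW c0) (ler0n _ 2).
  by apply: le_trans hE; exact: ler_norm.
have E2 : (\sum_r \int[P]_w a_ N r w ^+ 2 + \sum_r \int[P]_w a r w ^+ 2) / (2 * c) <= e / 2.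
  rewrite ler_pdivrMr; last exact: mulr_gt0 (ltr0Sn _ 1) c0.
  have -> : e / 2 * (2 * c) = 2 * (A + 1) by rewrite /c; field; rewrite gt_eqF.
  lra.
lra.
Qed.

End cvg_Dch.

Section null_increment.
Context (R : realType) (I : finType) (W : I -> R) (W0 : forall i, 0 <= W i).
Context (i0 : I) (Wi0 : 0 < W i0) (l : seq (I -> R)) (t e : R).
Hypotheses (t0 : 0 <= t) (e0 : 0 <= e).
Let H0 : I -> R := fun=> 0.

Let tZZ := tame_ZlnZ W0 Wi0.
Let tE : tame (fun H => Zf W H * energy W l H).
Proof. by apply: tameM; [exact: tame_Zf|exact: (tame_energy W0 Wi0)]. Qed.
Let E2 : (fun H => Zf W H * (energy W l H / 2)) = (fun H => 2^-1 * (Zf W H * energy W l H)).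
Proof. by apply/funext => H; rewrite mulrA mulrC. Qed.

(** By the semigroup property the increment is the mean, over the first t units of time, of what the
    last e units add to [ZlnZ]; [null_ge_energy] applies at the Hamiltonian reached at time t. *)
Lemma null_increment_ge :
  e / 2 * gops (null l) t (fun H => Zf W H * energy W l H) H0 <=
  gops (null l) (t + e) (ZlnZ W) H0 - gops (null l) t (ZlnZ W) H0.
Proof.
have tG : tame (gops (null l) e (ZlnZ W)) by exact: tame_gops.
rewrite -gops_semigroup// -[leRHS](congr1 (fun f => f H0) (gopsB (null l) t tG tZZ)).
rewrite -[leLHS](congr1 (fun f => f H0) (gopsZ (null l) t (e / 2) tE)).
apply: le_gops; [exact: tameZ|exact: tameB|].
move=> H; rewrite lerBrDl; apply: le_trans (null_ge_energy W0 Wi0 l e0 H).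
by rewrite lerD2l le_eqVlt; apply/orP; left; apply/eqP; ring.
Qed.

Lemma null_increment_le :
  gops (null l) (t + e) (ZlnZ W) H0 - gops (null l) t (ZlnZ W) H0 <=
  e / 2 * gops (null l) (t + e) (fun H => Zf W H * energy W l H) H0.
Proof.
have tG : tame (gops (null l) e (ZlnZ W)) by exact: tame_gops.
have tGE : tame (gops (null l) e (fun H => Zf W H * energy W l H)) by exact: tame_gops.
rewrite -!gops_semigroup// -[leLHS](congr1 (fun f => f H0) (gopsB (null l) t tG tZZ)).
rewrite -[leRHS](congr1 (fun f => f H0) (gopsZ (null l) t (e / 2) tGE)).
apply: le_gops; [exact: tameB|exact: tameZ|].
move=> H; rewrite lerBlDl; apply: le_trans (null_le_energy W0 Wi0 l e0 H) _.
by rewrite E2 gopsZ// mulrA.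
Qed.

End null_increment.

Section signal.
Context (R : realType) d (Om : measurableType d) (P : probability Om R) (n : nat).
Variable s : 'I_n -> Om -> R.
Hypothesis ms : forall r, measurable_fun setT (s r).
Hypothesis s2 : forall r, P.-integrable setT (EFin \o (fun w => s r w ^+ 2)).

Definition scaled (t : R) r w := Num.sqrt t * s r w.

Lemma measurable_scaled t r : measurable_fun setT (scaled t r).
Proof. exact: measurable_funM. Qed.

Lemma scaled_sqint t r : P.-integrable setT (EFin \o (fun w => scaled t r w ^+ 2)).
Proof.
rewrite (_ : (fun w => _) = fun w => Num.sqrt t ^+ 2 * s r w ^+ 2); first exact: rintegrableZ.
by apply/funext => w; rewrite exprMn.
Qed.

Section finite_approximation.
Variable N : nat.

Definition code w : {ffun 'I_n -> rcode N} := [ffun r => @ridx R N (s r w)].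
Definition decode (r : 'I_n) (c : {ffun 'I_n -> rcode N}) : R := rval R (c r).

Lemma measurable_code c : measurable (code @^-1` [set c]).
Proof.
rewrite (_ : _ @^-1` _ = \big[setI/setT]_r (s r @^-1` (@ridx R N @^-1` [set c r]))).
  apply: bigsetI_measurable => r _; rewrite -[X in measurable X]setTI.
  by apply: ms => //; exact: measurable_ridx.
apply/seteqP; split => w.
  by move=> /= <-; rewrite -bigcap_seq => r _ /=; rewrite ffunE.
rewrite -bigcap_seq => H /=; apply/ffunP => r; rewrite ffunE.
by have := H r; rewrite /= mem_index_enum => /(_ isT).
Qed.

Lemma decodeE r w : decode r (code w) = rnd N (s r w).
Proof. by rewrite /decode /code ffunE. Qed.

End finite_approximation.

Let sN N t r w := Num.sqrt t * decode r (code N w).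

Let msN N t r : measurable_fun setT (sN N t r).
Proof. by apply: measurable_funM => //; apply: measurable_fibers; exact: measurable_code. Qed.

Let le_sN N t r w : `|sN N t r w| <= `|scaled t r w|.
Proof. rewrite /sN /scaled [leLHS]normrM [leRHS]normrM; apply: ler_wpM2l => //.
by have := le_rnd N (s r w); rewrite -decodeE. Qed.

Let cvg_sN t r w : sN N t r w @[N --> \oo] --> scaled t r w.
Proof.
rewrite /sN; apply: cvgM; first exact: cvg_cst.
by under eq_fun do rewrite decodeE; exact: rnd_cvg.
Qed.

Lemma cvg_Dch_approx t : Dch P (sN N t) @[N --> \oo] --> Dch P (scaled t).
Proof.
apply: (cvg_Dch (g := scaled t) (measurable_scaled t) (fun N => msN N t)
  (scaled_sqint t)) => //.
Qed.

Local Notation W N := (fiber_weight P (code N)).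
Let l N := [seq @decode N r | r <- enum 'I_n].
Let W0 N : forall i, 0 <= W N i := fiber_weight_ge0 P (code N).
Let DN N t (t0 : 0 <= t) : Dch P (sN N t) = gops (null (l N)) t (ZlnZ (W N)) (fun=> 0) :=
  Dch_fiber P (@measurable_code N) (@decode N) t0.

Let MN N t (t0 : 0 <= t) : \sum_r Mch P (sN N t) r =
  t * gops (null (l N)) t (fun H => Zf (W N) H * energy (W N) (l N) H) (fun=> 0).
Proof.
have [i0 Wi0] := fiber_weight_gt0 P (@measurable_code N).
have tZ : tame (Zf (W N)) by exact: tame_Zf.
have tF r : tame (fun H => Zf (W N) H * gibbs (W N) (@decode N r) H ^+ 2).
  rewrite (_ : (fun H => _) = fun H => Zf (W N) H * (gibbs (W N) (@decode N r) H * gibbs (W N) (@decode N r) H)).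
    by apply: tameM => //; apply: tameM; exact: (tame_gibbs (@W0 N) Wi0).
  by apply/funext => H; rewrite expr2.
under eq_bigr do rewrite /Mch (post_fiber_sqr P (@measurable_code N) (@decode N) t0).
rewrite -mulr_sumr; congr (_ * _).
rewrite (_ : (fun H => Zf (W N) H * energy (W N) (l N) H) =
   fun H => \sum_r Zf (W N) H * gibbs (W N) (@decode N r) H ^+ 2); last first.
  by apply/funext => H; rewrite /energy /l big_map big_enum mulr_sumr.
by rewrite gops_sum.
Qed.

(** The factor t is a matter of scaling: the signal sqrt t s has a posterior mean whose second
    moment is t times the mean energy of s. The inequality is proved for rounded signals and passes
    to the limit by [Mch_le_lim]. *)
Lemma Dch_increment_ge t e : 0 <= t -> 0 <= e ->
  e / 2 * \sum_r Mch P (scaled t) r <= t * (Dch P (scaled (t + e)) - Dch P (scaled t)).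
Proof.
move=> t0 e0.
have [->|en0] := eqVneq e 0; first by rewrite addr0 subrr !mul0r mulr0.
have {}e0 : 0 < e by rewrite lt_neqAle eq_sym en0.
have te0 : 0 <= t + e by rewrite addr_ge0// ltW.
have e2 : 0 < e / 2 by rewrite divr_gt0.
rewrite -ler_pdivlMl//.
apply: (Mch_le_lim (measurable_scaled t) (fun N => msN N t) (scaled_sqint t)
  (fun N => @le_sN N t) (@cvg_sN t)
  (x_ := fun N => (e / 2)^-1 * (t * (Dch P (sN N (t + e)) - Dch P (sN N t))))); last first.
  apply: cvgM; first exact: cvg_cst.
  apply: cvgM; first exact: cvg_cst.
  by apply: cvgB; exact: cvg_Dch_approx.
move=> N; rewrite ler_pdivlMl// MN// !DN// mulrCA ler_wpM2l//.
have [i0 Wi0] := fiber_weight_gt0 P (@measurable_code N).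
exact: (null_increment_ge (@W0 N) Wi0 (l N) t0 (ltW e0)).
Qed.

Lemma Dch_increment_le t e : 0 <= e <= t ->
  t * (Dch P (scaled t) - Dch P (scaled (t - e))) <= e / 2 * \sum_r Mch P (scaled t) r.
Proof.
move=> /andP[e0 et]; have t0 := le_trans e0 et.
have [->|en0] := eqVneq e 0; first by rewrite subr0 subrr !mul0r mulr0.
have {}e0 : 0 < e by rewrite lt_neqAle eq_sym en0.
have te0 : 0 <= t - e by rewrite subr_ge0.
have e2 : 0 < e / 2 by rewrite divr_gt0.
rewrite -ler_pdivrMl//.
apply: (Mch_ge_lim (measurable_scaled t) (fun N => msN N t) (scaled_sqint t)
  (fun N => @le_sN N t) (@cvg_sN t)
  (x_ := fun N => (e / 2)^-1 * (t * (Dch P (sN N t) - Dch P (sN N (t - e)))))); last first.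
  apply: cvgM; first exact: cvg_cst.
  apply: cvgM; first exact: cvg_cst.
  by apply: cvgB; exact: cvg_Dch_approx.
move=> N; rewrite ler_pdivrMl// MN// !DN// [leRHS]mulrCA ler_wpM2l//.
have [i0 Wi0] := fiber_weight_gt0 P (@measurable_code N).
have := null_increment_le (@W0 N) Wi0 (l N) te0 (ltW e0).
by rewrite subrK.
Qed.

End signal.

(** * Free energy of finite spin systems *)

Section lnZ_comparison.
Context (R : realType) (I : finType) (W : I -> R) (W0 : forall i, 0 <= W i).
Context (i0 : I) (Wi0 : 0 < W i0).

Lemma bnd_exists (l : seq ((I -> R) * (I -> R))) : exists K : R, 0 <= K /\ bnd K l.
Proof.
exists (\sum_(av <- l) (\sum_i (`|av.1 i| + `|av.2 i|))).
have p0 (av : (I -> R) * (I -> R)) : 0 <= \sum_i (`|av.1 i| + `|av.2 i|).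
  by apply: sumr_ge0 => i _; rewrite addr_ge0.
split; first by apply: sumr_ge0 => av _.
have mono K K' l' : K <= K' -> bnd K l' -> bnd K' (l' : seq ((I -> R) * (I -> R))).
  move=> KK; elim: l' => //= av l' IH [h1 [h2 h3]]; split; last split; last exact: IH.
    by move=> i; apply: le_trans KK.
  by move=> i; apply: le_trans KK.
elim: l => //= av l IH; rewrite big_cons; set K := \sum_(j <- l) _.
have K0 : 0 <= K by apply: sumr_ge0 => av' _.
have le1 i : `|av.1 i| + `|av.2 i| <= \sum_i (`|av.1 i| + `|av.2 i|).
  by rewrite (bigD1 i)//= lerDl sumr_ge0// => j _; rewrite addr_ge0.
have n1 i := normr_ge0 (av.1 i); have n2 i := normr_ge0 (av.2 i).
split; first by move=> i; have := le1 i; have := n2 i; lra.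
split; first by move=> i; have := le1 i; have := n1 i; lra.
by apply: mono IH; rewrite lerDr.
Qed.

(** Unlike [null_comparison], this acts on [lnZ] with arbitrary drifts, so that decoders that do not
    match the observation are covered; the correction is then a constant, which every channel leaves
    invariant. *)
Lemma lnZ_comparison q l (c t : R) : 0 <= t ->
  (forall H, \sum_(av <- q) phi W av.1 av.2 H <= \sum_(av <- l) phi W av.1 av.2 H + c) ->
  forall H, gops q t (lnZ W) H <= gops l t (lnZ W) H + t * c.
Proof.
move=> t0 le.
have [Kq [Kq0 bq]] := bnd_exists q; have [Kl [Kl0 bl]] := bnd_exists l.
have [C [C0 hC]] := gops_step W0 Wi0 Kq0 bq.
have [C' [C'0 hC']] := gops_step W0 Wi0 Kl0 bl.
apply: (@gops_telescope _ _ q l (lnZ W) (fun=> c) (fun=> 1) (C + C')) => //.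
- exact: (tame_lnZ W0 Wi0).
- exact: tame_cst.
- exact: tame_cst.
- by move=> s _; rewrite gops_cst.
- by move=> s _; rewrite gops_cst.
- by move=> s _; rewrite gops_cst.
- by move=> s _; rewrite gops_cst.
move=> d H d01; have := hC d H d01; have := hC' d H d01.
have := le H; have d0 : 0 <= d by case/andP: d01.
move=> /(ler_wpM2l d0); rewrite !ler_norml => h /andP[h1 h2] /andP[h3 h4]; lra.
Qed.

(** An observation of the number beta decoded as if the signal were a; the planted channel is the
    case beta = a s. *)
Definition mixed (beta : R) (a : I -> R) : (I -> R) * (I -> R) :=
  (a, fun i => a i * beta - a i ^+ 2 / 2).

Lemma phi_mixed beta a H :
  phi W (mixed beta a).1 (mixed beta a).2 H = beta * gibbs W a H - gibbs W a H ^+ 2 / 2.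
Proof.
rewrite /phi /= gibbsB.
rewrite (_ : gibbs W (fun i => a i * beta) H = beta * gibbs W a H); last first.
  by rewrite -gibbsZ; congr (gibbs _ _ H); apply/funext => i; rewrite mulrC.
rewrite (_ : gibbs W (fun i => a i ^+ 2 / 2) H = 2^-1 * gibbs W (fun i => a i ^+ 2) H).
  by field.
by rewrite -gibbsZ; congr (gibbs _ _ H); apply/funext => i; rewrite mulrC.
Qed.

End lnZ_comparison.

Lemma sum_edges (R : realType) n (f : 'I_n -> 'I_n -> R) :
  \sum_i \sum_j f i j =
  \sum_(e : edge n) (f (val e).1 (val e).2 + f (val e).2 (val e).1) + \sum_i f i i.
Proof.
have sube (g : 'I_n * 'I_n -> R) :
    \sum_(e : edge n) g (val e) = \sum_(p : 'I_n * 'I_n | (p.1 < p.2)%N) g p.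
  rewrite [RHS](reindex_omap (val : edge n -> 'I_n * 'I_n) insub) /=; last first.
    by move=> p Pp; rewrite insubT.
  by apply: eq_bigl => e; rewrite valK eqxx (valP e).
rewrite (sube (fun p => f p.1 p.2 + f p.2 p.1)) big_split /=.
have -> : \sum_(p : 'I_n * 'I_n | (p.1 < p.2)%N) f p.2 p.1 =
    \sum_(p : 'I_n * 'I_n | (p.2 < p.1)%N) f p.1 p.2.
  have swK : involutive (fun p : 'I_n * 'I_n => (p.2, p.1)) by case.
  by rewrite (reindex_inj (inv_inj swK)) /=; apply: eq_big => -[].
have -> : \sum_i f i i = \sum_(p : 'I_n * 'I_n | p.1 == p.2) f p.1 p.2.
  rewrite (eq_bigr (fun i => \sum_(j | i == j) f i j)).
    by rewrite pair_big_dep /=; apply: eq_big => -[].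
  by move=> i _; rewrite (big_pred1 i)// => j; rewrite eq_sym.
rewrite pair_bigA /= (bigID (fun p : 'I_n * 'I_n => (p.1 < p.2)%N)) /= -addrA; congr (_ + _).
rewrite (bigID (fun p : 'I_n * 'I_n => (p.2 < p.1)%N)) /=; congr (_ + _).
  by apply: eq_bigl => p; case: ltngtP.
by apply: eq_bigl => p; rewrite -val_eqE /=; case: ltngtP.
Qed.

Section spins.
Context (R : realType) (S : finType) (w : S -> R) (n k : nat).
Hypothesis w0 : forall s, 0 <= w s.
Hypothesis w1 : \sum_s w s = 1.
Variable x : S -> 'I_k -> R.
Local Notation I := {ffun 'I_n -> S}.
Implicit Types (i j : 'I_n) (c d : 'I_k) (B : 'M[R]_k).

Definition prodw (s : I) : R := \prod_i w (s i).
Definition site i (f : S -> R) (s : I) := f (s i).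
Definition siteav i (av : (S -> R) * (S -> R)) := (site i av.1, site i av.2).
Definition dotx s s' : R := \sum_c x s c * x s' c.
Definition edot (e : edge n) (s : I) : R :=
  (Num.sqrt n%:R)^-1 * dotx (s (val e).1) (s (val e).2).
Definition edges := [seq edot (enum_val r) | r <- enum 'I_#|{: edge n}|].
Definition Bx B r s : R := \sum_c B r c * x s c.
Definition lin B := [seq Bx B r | r <- enum 'I_k].
Definition lin_n B := flatten [seq [seq site i a | a <- lin B] | i <- enum 'I_n].

Lemma w_pos : exists s, 0 < w s.
Proof.
apply: contrapT => H; have : \sum_i w i = 0.
  apply: big1 => s _; apply/eqP; rewrite eq_le w0 andbT leNgt.
  by apply/negP => ws; apply: H; exists s.
by rewrite w1 => /eqP; rewrite oner_eq0.
Qed.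

Lemma prodw_ge0 s : 0 <= prodw s. Proof. by apply: prodr_ge0. Qed.

Lemma prodw_pos : exists s, 0 < prodw s.
Proof. by have [s ws] := w_pos; exists [ffun=> s]; apply: prodr_gt0 => i _; rewrite ffunE. Qed.

Lemma prodw_prod (F : 'I_n -> S -> R) :
  \sum_s prodw s * \prod_i F i (s i) = \prod_i \sum_s w s * F i s.
Proof.
rewrite bigA_distr_bigA /=; apply: eq_bigr => s _.
by rewrite -big_split.
Qed.

Lemma prodw_site i (f : S -> R) : \sum_s prodw s * f (s i) = \sum_s w s * f s.
Proof.
pose F j := if j == i then f else fun=> 1.
have := prodw_prod F; rewrite [RHS](bigD1 i)//= [F i]/F eqxx [X in _ * X]big1 ?mulr1; last first.
  by move=> j ji; rewrite /F (negPf ji); under eq_bigr do rewrite mulr1; rewrite w1.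
move=> <-; apply: eq_bigr => s _; congr (_ * _).
by rewrite (bigD1 i)//= /F eqxx big1 ?mulr1// => j ji; rewrite (negPf ji).
Qed.

Lemma prodw_site2 i j (f g : S -> R) : i != j ->
  \sum_s prodw s * (f (s i) * g (s j)) = (\sum_s w s * f s) * \sum_s w s * g s.
Proof.
move=> ij; have ji : j != i by rewrite eq_sym.
pose F l := if l == i then f else if l == j then g else fun=> 1.
have Fi : F i = f by rewrite /F eqxx.
have Fj : F j = g by rewrite /F eqxx (negPf ji).
have Fl l : (l != i) && (l != j) -> F l = fun=> 1.
  by rewrite /F => /andP[/negPf -> /negPf ->].
have := prodw_prod F; rewrite [RHS](bigD1 i)//= (bigD1 j)//= Fi Fj.
rewrite [X in _ * (_ * X)]big1 ?mulr1; last first.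
  by move=> l /Fl ->; under eq_bigr do rewrite mulr1; rewrite w1.
move=> <-; apply: eq_bigr => s _; congr (_ * _).
by rewrite (bigD1 i)//= (bigD1 j)//= Fi Fj big1 ?mulr1// => l /Fl ->.
Qed.

(** Only additive Hamiltonians are tested: there the partition function of a product prior
    factorizes, and observations of single sites keep the Hamiltonian additive. *)
Definition splits (Phi : (I -> R) -> R) (phi_ : 'I_n -> (S -> R) -> R) :=
  forall h : 'I_n -> S -> R, Phi (fun s => \sum_i h i (s i)) = \sum_i phi_ i (h i).

Lemma splits_lnZ : splits (lnZ prodw) (fun=> lnZ w).
Proof.
have [s0 ws0] := w_pos.
move=> h; rewrite /lnZ.
have -> : Zf prodw (fun s => \sum_i h i (s i)) = \prod_i Zf w (h i).
  rewrite /Zf -(prodw_prod (fun i s => expR (h i s))).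
  by apply: eq_bigr => s _; rewrite expR_sum.
rewrite -[RHS]expRK expR_sum; congr ln; apply: eq_bigr => i _.
by rewrite lnK// posrE (Zf_gt0 w0 ws0).
Qed.

Lemma splits_gop i a v Phi phi_ : (forall j, tame (phi_ j)) -> splits Phi phi_ ->
  splits (gop (site i a) (site i v) Phi)
    (fun j => if j == i then gop a v (phi_ i) else phi_ j).
Proof.
move=> tp sP h; rewrite (bigD1 i)//= eqxx /gop.
pose h' g j := if j == i then fun s => h i s + g * a s + v s else h j.
transitivity (\int[std_normal R]_g (phi_ i (fun s => h i s + g * a s + v s) +
    \sum_(j | j != i) phi_ j (h j))).
  apply: eq_Rintegral => g _.
  rewrite (_ : (fun s => _) = fun s : I => \sum_j h' g j (s j)).
    rewrite (sP (h' g)) (bigD1 i)//= /h' eqxx; congr (_ + _).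
    by apply: eq_bigr => j /negPf ->.
  apply/funext => s; rewrite (bigD1 i)//= [RHS](bigD1 i)//= /h' eqxx /site.
  rewrite [X in _ = _ + X](eq_bigr (fun j => h j (s j))); first by ring.
  by move=> j /negPf ->.
rewrite RintegralD//; last 2 first.
- exact: tame_integrable.
- exact: finite_measure_integrable_cst.
rewrite Rintegral_prob_cst; congr (_ + _).
by apply: eq_bigr => j /negPf ->.
Qed.

Lemma splits_gops i L t Phi phi_ : (forall j, tame (phi_ j)) -> splits Phi phi_ ->
  splits (gops (map (siteav i) L) t Phi)
    (fun j => if j == i then gops L t (phi_ i) else phi_ j).
Proof.
move=> tp sP; elim: L => [|av L IH].
  by move=> h; rewrite /= sP; apply: eq_bigr => j _; case: eqP => [->|].
have tp' j : tame (if j == i then gops L t (phi_ i) else phi_ j).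
  by case: eqP => // _; exact: tame_gops.
have := @splits_gop i (fun s => Num.sqrt t * av.1 s) (fun s => t * av.2 s) _ _ tp' IH.
move=> H h; rewrite /= [LHS](H h); apply: eq_bigr => j _.
by case: eqP => // _; rewrite eqxx.
Qed.

Lemma splits_flatten (L : 'I_n -> seq ((S -> R) * (S -> R))) t Phi phi_ :
  (forall j, tame (phi_ j)) -> splits Phi phi_ ->
  splits (gops (flatten [seq map (siteav i) (L i) | i <- enum 'I_n]) t Phi)
    (fun j => gops (L j) t (phi_ j)).
Proof.
move=> tp sP.
suff H (s : seq 'I_n) : uniq s ->
    splits (gops (flatten [seq map (siteav i) (L i) | i <- s]) t Phi)
      (fun j => if j \in s then gops (L j) t (phi_ j) else phi_ j).
  by move=> h; rewrite (H _ (enum_uniq _)); apply: eq_bigr => j _; rewrite mem_enum.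
elim: s => [_|i s IH /= /andP[si us]] => //.
rewrite /gops foldr_cat -/(gops _ t Phi) -/(gops _ t (gops _ t Phi)).
have tp' j : tame (if j \in s then gops (L j) t (phi_ j) else phi_ j).
  by case: ifP => // _; exact: tame_gops.
move=> h; rewrite [LHS](splits_gops i (L i) t tp' (IH us)).
apply: eq_bigr => j _; rewrite inE; case: eqP => [->|//]; by rewrite (negPf si).
Qed.

Section replica.
Variables (W : I -> R) (W0 : forall s : I, 0 <= W s) (i0 : I) (Wi0 : 0 < W i0).
Hypothesis n0 : (0 < n)%N.
Local Notation gb f H := (gibbs W f H).

(** For two independent replicas let Y be the matrix sum_i x(s i) x(s' i)^T. The square (n q - Y)^2
    / (2 n) gives q . Y <= n |q|^2 / 2 + |Y|^2 / (2 n) before averaging. Averaged over both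
    replicas, q . Y becomes a sum of one-site terms and |Y|^2 the sum of squared means of all dot
    products. *)
Lemma replica_bound (q : 'M[R]_k) H :
  \sum_i \sum_c \sum_d q c d * (gb (site i (x^~ c)) H * gb (site i (x^~ d)) H) <=
  n%:R / 2 * \sum_c \sum_d q c d ^+ 2 +
  (2 * n%:R)^-1 * \sum_i \sum_j gb (fun s => dotx (s i) (s j)) H ^+ 2.
Proof.
have nR : 0 < n%:R :> R by rewrite ltr0n.
pose f (s s' : I) := \sum_c \sum_d q c d * \sum_i x (s i) c * x (s' i) d.
pose g (s s' : I) := n%:R / 2 * (\sum_c \sum_d q c d ^+ 2) +
  (2 * n%:R)^-1 * \sum_i \sum_j dotx (s i) (s j) * dotx (s' i) (s' j).
have fg s s' : f s s' <= g s s'.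
  rewrite /f /g.
  have -> : \sum_i \sum_j dotx (s i) (s j) * dotx (s' i) (s' j) =
      \sum_c \sum_d (\sum_i x (s i) c * x (s' i) d) ^+ 2.
    transitivity (\sum_i \sum_j \sum_c \sum_d
       ((x (s i) c * x (s' i) d) * (x (s j) c * x (s' j) d))).
      apply: eq_bigr => i _; apply: eq_bigr => j _; rewrite mulr_suml.
      apply: eq_bigr => c _; rewrite mulr_sumr; apply: eq_bigr => d _; ring.
    under eq_bigr do rewrite exchange_big /=; rewrite exchange_big /=.
    apply: eq_bigr => c _.
    under eq_bigr do rewrite exchange_big /=; rewrite exchange_big /=.
    apply: eq_bigr => d _; rewrite expr2 mulr_suml; apply: eq_bigr => i _.
    by rewrite mulr_sumr.
  rewrite !mulr_sumr -big_split /=; apply: ler_sum => c _.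
  rewrite !mulr_sumr -big_split /=; apply: ler_sum => d _.
  set Y := \sum_i _; set y := q c d; clearbody Y y.
  rewrite -subr_ge0.
  have -> : n%:R / 2 * y ^+ 2 + (2 * n%:R)^-1 * Y ^+ 2 - y * Y =
    (2 * n%:R)^-1 * (n%:R * y - Y) ^+ 2 by field; rewrite gt_eqF.
  by rewrite mulr_ge0 ?sqr_ge0// invr_ge0 mulr_ge0// ltW.
have := le_gibbs W0 Wi0 H (fun s => le_gibbs W0 Wi0 H (fun s' => fg s s')).
have -> : gb (fun s => gb (fun s' => f s s') H) H =
    \sum_i \sum_c \sum_d q c d * (gb (site i (x^~ c)) H * gb (site i (x^~ d)) H).
  rewrite (_ : (fun s => gb (f s) H) = fun s => \sum_c \sum_d \sum_i
      (q c d * gb (site i (x^~ d)) H) * x (s i) c); last first.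
    apply/funext => s; rewrite /f (gibbs_sum W0 Wi0); apply: eq_bigr => c _.
    rewrite (gibbs_sum W0 Wi0); apply: eq_bigr => d _.
    rewrite gibbsZ (gibbs_sum W0 Wi0) mulr_sumr; apply: eq_bigr => i _.
    by rewrite gibbsZ /site; ring.
  rewrite (gibbs_sum W0 Wi0) [RHS]exchange_big /=; apply: eq_bigr => c _.
  rewrite (gibbs_sum W0 Wi0) [RHS]exchange_big /=; apply: eq_bigr => d _.
  rewrite (gibbs_sum W0 Wi0); apply: eq_bigr => i _.
  by rewrite gibbsZ -[gb (fun s => x (s i) c) H]/(gb (site i (x^~ c)) H); ring.
have -> : gb (fun s => gb (fun s' => g s s') H) H = n%:R / 2 * \sum_c \sum_d q c d ^+ 2 +
  (2 * n%:R)^-1 * \sum_i \sum_j gb (fun s => dotx (s i) (s j)) H ^+ 2.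
  rewrite (_ : (fun s => gb (g s) H) = fun s => n%:R / 2 * (\sum_c \sum_d q c d ^+ 2) +
     (2 * n%:R)^-1 * \sum_i \sum_j gb (fun s => dotx (s i) (s j)) H * dotx (s i) (s j)).
    rewrite gibbsD (gibbs_cst W0 Wi0) gibbsZ; congr (_ + _ * _).
    rewrite (gibbs_sum W0 Wi0); apply: eq_bigr => i _.
    rewrite (gibbs_sum W0 Wi0); apply: eq_bigr => j _.
    by rewrite gibbsZ expr2.
  apply/funext => s; rewrite /g gibbsD (gibbs_cst W0 Wi0) gibbsZ.
  congr (_ + _ * _); rewrite (gibbs_sum W0 Wi0); apply: eq_bigr => i _.
  rewrite (gibbs_sum W0 Wi0); apply: eq_bigr => j _.
  by rewrite gibbsZ mulrC.
by [].
Qed.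

Lemma energy_lin B H : \sum_i \sum_(a <- lin B) gb (site i a) H ^+ 2 =
  \sum_i \sum_c \sum_d (B^T *m B) c d * (gb (site i (x^~ c)) H * gb (site i (x^~ d)) H).
Proof.
apply: eq_bigr => i _; rewrite big_map big_enum /=.
transitivity (\sum_r \sum_c \sum_d
    (B r c * B r d) * (gb (site i (x^~ c)) H * gb (site i (x^~ d)) H)).
  apply: eq_bigr => r _.
  have -> : gb (site i (Bx B r)) H = \sum_c B r c * gb (site i (x^~ c)) H.
    rewrite (_ : site i (Bx B r) = fun s => \sum_c B r c * site i (x^~ c) s)//.
    by rewrite (gibbs_sum W0 Wi0); apply: eq_bigr => c _; rewrite gibbsZ.
  rewrite expr2 mulr_suml; apply: eq_bigr => c _; rewrite mulr_sumr.
  by apply: eq_bigr => d _; ring.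
rewrite exchange_big /=; apply: eq_bigr => c _.
rewrite exchange_big /=; apply: eq_bigr => d _.
rewrite mxE mulr_suml; apply: eq_bigr => r _; rewrite mxE; ring.
Qed.

Lemma sum_edots (F : (I -> R) -> R) : \sum_(a <- edges) F a = \sum_e F (edot e).
Proof.
transitivity (\sum_(e in {: edge n}) F (edot e)); last exact: eq_bigl.
by rewrite big_map big_enum /= (big_enum_val (fun e => F (edot e))).
Qed.

(** Ordered pairs i <> j count each edge twice, which matches the scaling of [edot]. The n diagonal
    terms are not observed and cost n X^2 / (2 n). *)
Lemma energy_edges H (X : R) : (forall s, dotx s s <= X) ->
  (2 * n%:R)^-1 * \sum_i \sum_j gb (fun s => dotx (s i) (s j)) H ^+ 2 <=
  energy W edges H + X ^+ 2 / 2.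
Proof.
move=> hX; have nR : 0 < n%:R :> R by rewrite ltr0n.
rewrite sum_edges mulrDr; apply: lerD.
  rewrite /energy sum_edots mulr_sumr; apply: ler_sum => e _.
  have -> : gb (edot e) H = (Num.sqrt n%:R)^-1 * gb (fun s => dotx (s (val e).1) (s (val e).2)) H.
    by rewrite -gibbsZ.
  have -> : gb (fun s => dotx (s (val e).2) (s (val e).1)) H =
      gb (fun s => dotx (s (val e).1) (s (val e).2)) H.
    congr (gibbs _ _ H); apply/funext => s.
    by apply: eq_bigr => c _; rewrite mulrC.
  move: (gb _ H) => G; rewrite exprMn exprVn sqr_sqrtr; last exact: ltW.
  by rewrite le_eqVlt; apply/orP; left; apply/eqP; field; rewrite gt_eqF.
rewrite ler_pdivrMl ?mulr_gt0//.
have -> : 2 * n%:R * (X ^+ 2 / 2) = \sum_(i < n) X ^+ 2.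
  by rewrite sumr_const card_ord -mulr_natl; field.
apply: ler_sum => i _; apply: ler_sqr_abs.
have d0 s : 0 <= dotx s s by apply: sumr_ge0 => c _; rewrite -expr2 sqr_ge0.
rewrite (ger0_norm (gibbs_ge0 W0 Wi0 H (fun s => d0 (s i)))) (@le_trans _ _ X)//.
  by rewrite -[leRHS](gibbs_cst W0 Wi0 X H); apply: (le_gibbs W0 Wi0) => s.
exact: ler_norm.
Qed.

End replica.

End spins.

Lemma le_gibbs_supp (R : realType) (I : finType) (W : I -> R) (f g H : I -> R) i0 :
  (forall i, 0 <= W i) -> 0 < W i0 ->
  (forall i, 0 < W i -> f i <= g i) -> gibbs W f H <= gibbs W g H.
Proof.
move=> W0 Wi0 fg; rewrite /gibbs ler_pM2r ?invr_gt0 ?(Zf_gt0 W0 Wi0)//.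
apply: ler_sum => i _; rewrite ler_pM2r ?expR_gt0//.
have := W0 i; rewrite le_eqVlt => /orP[/eqP <-|Wi]; first by rewrite !mul0r.
by rewrite ler_pM2l//; exact: fg.
Qed.

Section bounds.
Context (R : realType) (S : finType) (w : S -> R) (n k : nat).
Hypothesis w0 : forall s, 0 <= w s.
Hypothesis w1 : \sum_s w s = 1.
Variable x : S -> 'I_k -> R.
Hypothesis n0 : (0 < n)%N.
Variables (X t : R).
Hypothesis hX : forall s, dotx x s s <= X.
Hypothesis t0 : 0 <= t.
Local Notation I := {ffun 'I_n -> S}.
Local Notation W := (@prodw R S w n).
Implicit Types (B : 'M[R]_k).

Definition fsq (q : 'M[R]_k) : R := \sum_c \sum_d q c d ^+ 2.
Definition Dn := gops (null (edges n x)) t (ZlnZ W) (fun=> 0).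
Definition D1 B := gops (null (lin x B)) t (ZlnZ w) (fun=> 0).

Let W0 : forall s : I, 0 <= W s := @prodw_ge0 R S w n w0.

Lemma prodw_sum : \sum_(s : I) W s = 1.
Proof.
have := @prodw_prod _ _ w n (fun=> fun=> 1).
rewrite [RHS]big1; last by move=> i _; under eq_bigr do rewrite mulr1.
by move=> <-; apply: eq_bigr => s _; rewrite big1 ?mulr1.
Qed.

Lemma D1_planted B : D1 B = \sum_s w s * gops (planted s (lin x B)) t (lnZ w) (fun=> 0).
Proof.
have [s0 ws0] := w_pos w0 w1.
rewrite /D1 (gops_null_ZlnZ w0 ws0)//; apply: eq_bigr => s _.
by rewrite expR0 mulr1.
Qed.

(** For a fixed planted configuration the scalar observations act site by site, so [lnZ] splits;
    averaging over the product prior gives the same value at every site. *)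
Lemma null_lin_n B : gops (null (lin_n n x B)) t (ZlnZ W) (fun=> 0) = n%:R * D1 B.
Proof.
have [s0 ws0] := w_pos w0 w1; have [i0 Wi0] := prodw_pos n w0 w1.
rewrite (gops_null_ZlnZ W0 Wi0)//.
pose h s := gops (planted s (lin x B)) t (lnZ w) (fun=> 0).
transitivity (\sum_s W s * \sum_i h (s i)).
  apply: eq_bigr => s _; rewrite expR0 mulr1; congr (_ * _).
  have -> : planted s (lin_n n x B) =
      flatten [seq map (@siteav R S n i) (planted (s i) (lin x B)) | i <- enum 'I_n].
    rewrite /planted /lin_n map_flatten -map_comp; congr flatten; apply: eq_map => i /=.
    by rewrite -!map_comp; apply: eq_map => a.
  have := splits_flatten (fun i => planted (s i) (lin x B)) t
    (fun=> tame_lnZ w0 ws0) (@splits_lnZ _ _ w n w0 w1) (fun=> fun=> 0).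
  rewrite /h => <-; congr (gops _ t _ _); apply/funext => s'.
  by rewrite big1.
under eq_bigr do rewrite mulr_sumr.
rewrite exchange_big /= (eq_bigr (fun=> D1 B)).
  by rewrite sumr_const card_ord mulr_natl.
by move=> i _; rewrite D1_planted (@prodw_site _ _ w n w1 i h).
Qed.

(** With q = B^T B, [replica_bound] and [energy_edges] bound the energy of the n scalar channels by
    that of the edges plus n |q|^2 / 2 + X^2 / 2; half of this excess is what [null_comparison]
    charges per unit of time. *)
Lemma Dn_lower B :
  n%:R * D1 B <= Dn + t * (n%:R * fsq (B^T *m B) / 4 + X ^+ 2 / 4).
Proof.
have [i0 Wi0] := prodw_pos n w0 w1.
set c := _ / 4 + _ / 4; rewrite -null_lin_n.
have le H : energy W (lin_n n x B) H <= energy W (edges n x) H + 2 * gibbs W (fun=> c) H.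
  rewrite (gibbs_cst W0 Wi0) {1}/energy big_flatten big_map big_enum /=.
  rewrite (eq_bigr (fun i => \sum_(a <- lin x B) gibbs W (site i a) H ^+ 2)); last first.
    by move=> i _; rewrite big_map.
  rewrite (energy_lin x W0 Wi0).
  have := replica_bound x W0 Wi0 n0 (B^T *m B) H.
  have := energy_edges W0 Wi0 n0 H hX; rewrite -/(fsq _) /c.
  set E := energy _ _ _; set Y := \sum_i \sum_j _; set U := \sum_i \sum_c _.
  set F := fsq _; clearbody E Y U F; lra.
apply: le_trans (null_comparison W0 Wi0 t0 le (fun=> 0)) _.
rewrite lerD2l ler_wpM2l//.
by under eq_bigr do rewrite expR0 mulr1; rewrite -mulr_suml prodw_sum mul1r.
Qed.

(* A spin observed through B2 but decoded with the signal matrix B1. *)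
Definition hmix B1 B2 s :=
  gops [seq mixed (Bx x B2 r s) (Bx x B1 r) | r <- enum 'I_k] t (lnZ w) (fun=> 0).

Definition ovl (s s' : I) c d : R := n%:R^-1 * \sum_i x (s i) c * x (s' i) d.

Lemma sum_ovl (s s' : I) : \sum_i \sum_j dotx x (s i) (s j) * dotx x (s' i) (s' j) =
  n%:R ^+ 2 * \sum_c \sum_d ovl s s' c d ^+ 2.
Proof.
have nR : n%:R != 0 :> R by rewrite pnatr_eq0 -lt0n.
transitivity (\sum_i \sum_j \sum_c \sum_d
   ((x (s i) c * x (s' i) d) * (x (s j) c * x (s' j) d))).
  apply: eq_bigr => i _; apply: eq_bigr => j _; rewrite mulr_suml.
  apply: eq_bigr => c _; rewrite mulr_sumr; apply: eq_bigr => d _; ring.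
under eq_bigr do rewrite exchange_big /=; rewrite exchange_big /= mulr_sumr.
apply: eq_bigr => c _.
under eq_bigr do rewrite exchange_big /=; rewrite exchange_big /= mulr_sumr.
apply: eq_bigr => d _; rewrite /ovl exprMn exprVn mulrA divff ?expf_neq0// mul1r.
by rewrite expr2 mulr_suml; apply: eq_bigr => i _; rewrite mulr_sumr.
Qed.

(** The planted gain of the edges is at most n |ovl|^2 / 2. On the bin, |ovl|^2 <= e + 2 m . ovl -
    |m|^2, and the linear part n m . ovl is the sum of the products (B1 x)(B2 x'), that is, the
    planted gain of scalar channels observed through B2 and decoded with B1. Their self-energy
    involves B1^T B1 and is compared with that of the edges by [replica_bound]. *)
Lemma planted_bin (A : pred I) (s' : I) (B1 B2 : 'M[R]_k) (e : R) i0 :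
  let m := B1^T *m B2 in
  0 < W i0 -> A i0 ->
  (forall s, A s -> \sum_c \sum_d (ovl s s' c d - m c d) ^+ 2 <= e) ->
  gops (planted s' (edges n x)) t (lnZ (fun s => W s * (A s)%:R)) (fun=> 0) <=
  \sum_i hmix B1 B2 (s' i) +
    t * (n%:R * (e / 2 - fsq m / 2 + fsq (B1^T *m B1) / 4) + X ^+ 2 / 4).
Proof.
move=> m Wi0 Ai0 hA; set WA := fun s : I => _.
have nR : 0 < n%:R :> R by rewrite ltr0n.
have WA0 s : 0 <= WA s by rewrite mulr_ge0.
have WAi0 : 0 < WA i0 by rewrite /WA Ai0 mulr1.
have [s0 ws0] := w_pos w0 w1.
pose L i := [seq mixed (Bx x B2 r (s' i)) (Bx x B1 r) | r <- enum 'I_k].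
pose l := flatten [seq map (@siteav R S n i) (L i) | i <- enum 'I_n].
set c := _ + X ^+ 2 / 4.
have <- : gops l t (lnZ W) (fun=> 0) = \sum_i hmix B1 B2 (s' i).
  have := splits_flatten L t (fun=> tame_lnZ w0 ws0) (@splits_lnZ _ _ w n w0 w1) (fun=> fun=> 0).
  by move=> <-; congr (gops _ t _ _); apply/funext => s; rewrite big1.
(* The restriction to the bin is dropped on the side of the scalar channels only, where the product
   prior lets [lnZ] split. *)
apply: (@le_trans _ _ (gops l t (lnZ WA) (fun=> 0) + t * c)); last first.
  rewrite lerD2r; apply: le_gops; [exact: (tame_lnZ WA0 WAi0)|exact: (tame_lnZ W0 Wi0)|].
  move=> H; apply: le_lnW; first exact: (Zf_gt0 WA0 WAi0).
  apply: ler_sum => s _; rewrite ler_wpM2r ?expR_ge0// /WA.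
  by case: (A s); rewrite ?mulr1// mulr0.
apply: (lnZ_comparison WA0 WAi0) => // H.
have -> : \sum_(av <- planted s' (edges n x)) phi WA av.1 av.2 H =
    gibbs WA (fun s => \sum_e edot x e s' * edot x e s) H - energy WA (edges n x) H / 2.
  rewrite /planted big_map.
  rewrite (eq_bigr (fun a => a s' * gibbs WA a H - gibbs WA a H ^+ 2 / 2)); last first.
    by move=> a _; exact: phi_mixed.
  rewrite big_split /= sumrN -mulr_suml; congr (_ - _).
  rewrite (sum_edots x (fun a => a s' * gibbs WA a H)) (gibbs_sum WA0 WAi0).
  by apply: eq_bigr => f _; rewrite gibbsZ.
have -> : \sum_(av <- l) phi WA av.1 av.2 H =
    gibbs WA (fun s => n%:R * \sum_c \sum_d m c d * ovl s s' c d) H -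
    (\sum_i \sum_(a <- lin x B1) gibbs WA (site i a) H ^+ 2) / 2.
  rewrite /l big_flatten big_map big_enum /=.
  transitivity (\sum_i \sum_r (Bx x B2 r (s' i) * gibbs WA (site i (Bx x B1 r)) H
     - gibbs WA (site i (Bx x B1 r)) H ^+ 2 / 2)).
    apply: eq_bigr => i _; rewrite /L big_map big_map big_enum /=; apply: eq_bigr => r _.
    exact: phi_mixed.
  rewrite (eq_bigr (fun i => \sum_r Bx x B2 r (s' i) * gibbs WA (site i (Bx x B1 r)) H
     - (\sum_(a <- lin x B1) gibbs WA (site i a) H ^+ 2) / 2)); last first.
    by move=> i _; rewrite big_split /= sumrN -mulr_suml big_map big_enum.
  rewrite big_split /= sumrN -mulr_suml; congr (_ - _ / 2).
  rewrite (_ : (fun s => n%:R * _) = fun s : I => \sum_i \sum_r Bx x B2 r (s' i) * site i (Bx x B1 r) s).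
    rewrite (gibbs_sum WA0 WAi0); apply: eq_bigr => i _.
    by rewrite (gibbs_sum WA0 WAi0); apply: eq_bigr => r _; rewrite gibbsZ.
  apply/funext => s.
  transitivity (\sum_c \sum_d \sum_i \sum_r (B1 r c * B2 r d * x (s i) c * x (s' i) d)).
    rewrite mulr_sumr; apply: eq_bigr => a _; rewrite mulr_sumr; apply: eq_bigr => b _.
    rewrite /ovl mulrCA [n%:R * _]mulrA divff ?gt_eqF// mul1r mulr_sumr.
    apply: eq_bigr => i _; rewrite /m mxE mulr_suml; apply: eq_bigr => r _; rewrite mxE; ring.
  under eq_bigr do rewrite exchange_big /=; rewrite exchange_big /=.
  apply: eq_bigr => i _; under eq_bigr do rewrite exchange_big /=; rewrite exchange_big /=.
  apply: eq_bigr => r _; rewrite mulr_suml exchange_big /=; apply: eq_bigr => b _.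
  by rewrite mulr_sumr; apply: eq_bigr => a _; rewrite /site; ring.
have h1 : gibbs WA (fun s => \sum_e edot x e s' * edot x e s) H <=
   gibbs WA (fun s => n%:R * (\sum_c \sum_d m c d * ovl s s' c d)) H +
     n%:R * (e / 2 - fsq m / 2).
  rewrite -[X in _ + X](gibbs_cst WA0 WAi0 _ H) -gibbsD.
  apply: (le_gibbs_supp _ WA0 WAi0) => s; rewrite /WA.
  case As: (A s); rewrite ?mulr0 ?ltxx// => _.
  have hs := hA s As.
  have E1 : \sum_e edot x e s' * edot x e s <= n%:R / 2 * \sum_c \sum_d ovl s s' c d ^+ 2.
    have := sum_edges (fun i j => dotx x (s i) (s j) * dotx x (s' i) (s' j)).
    rewrite sum_ovl.
    have -> : \sum_(e0 : edge n) (dotx x (s (val e0).1) (s (val e0).2) * dotx x (s' (val e0).1) (s' (val e0).2) +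
        dotx x (s (val e0).2) (s (val e0).1) * dotx x (s' (val e0).2) (s' (val e0).1)) =
        2 * n%:R * \sum_e edot x e s' * edot x e s.
      rewrite mulr_sumr; apply: eq_bigr => f _; rewrite /edot.
      have sy u v : dotx x u v = dotx x v u by apply: eq_bigr => a _; rewrite mulrC.
      rewrite [dotx x (s (val f).2) _]sy [dotx x (s' (val f).2) _]sy.
      have q2 : (Num.sqrt n%:R)^-1 * (Num.sqrt n%:R)^-1 = n%:R^-1 :> R.
        by rewrite -invfM -expr2 sqr_sqrtr// ltW.
      set u := dotx x (s _) _; set v := dotx x (s' _) _; clearbody u v.
      set p := (Num.sqrt n%:R)^-1 in q2 *.
      have -> : 2 * n%:R * (p * v * (p * u)) = 2 * (n%:R * (p * p)) * (u * v) by ring.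
      by rewrite q2 divff ?gt_eqF//; ring.
    set Z := \sum_c _; set Y := \sum_e _ => h.
    have d0 : 0 <= \sum_i dotx x (s i) (s i) * dotx x (s' i) (s' i).
      by apply: sumr_ge0 => i _; rewrite mulr_ge0//; apply: sumr_ge0 => a _; rewrite -expr2 sqr_ge0.
    have : 2 * n%:R * Y <= n%:R ^+ 2 * Z by lra.
    have -> : n%:R / 2 * Z = (2 * n%:R)^-1 * (n%:R ^+ 2 * Z) by field; rewrite gt_eqF.
    by rewrite ler_pdivlMl// mulr_gt0.
  have E2 : \sum_c \sum_d (ovl s s' c d - m c d) ^+ 2 =
      \sum_c \sum_d ovl s s' c d ^+ 2 - 2 * (\sum_c \sum_d m c d * ovl s s' c d) + fsq m.
    rewrite /fsq mulr_sumr -sumrN -!big_split /=; apply: eq_bigr => a _.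
    by rewrite mulr_sumr -sumrN -!big_split /=; apply: eq_bigr => b _; ring.
  move: hs; rewrite E2; set Z := \sum_c \sum_d ovl _ _ _ _ ^+ 2 in E1 *.
  set V := \sum_c _; clearbody V Z => hs.
  apply: le_trans E1 _; rewrite -mulrDr -mulrA ler_pM2l//; lra.
have := replica_bound x WA0 WAi0 n0 (B1^T *m B1) H.
rewrite -(energy_lin x WA0 WAi0).
have := energy_edges WA0 WAi0 n0 H hX; rewrite -/(fsq _) /c.
move: h1; set G1 := gibbs _ _ _; set G2 := gibbs _ _ _; set E := energy _ _ _.
set Y := \sum_i \sum_j _; set U := \sum_i \sum_(a <- _) _.
set F := fsq m; set F' := fsq _; clearbody G1 G2 E Y U F F'; lra.
Qed.

End bounds.

(** * Fluctuations and the upper bound *)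

Section variance.
Context (R : realType) (I : finType).
Implicit Types (H h a v : I -> R) (Phi : (I -> R) -> R).

Definition lip1 Phi := forall H h (c : R), (forall i, `|h i| <= c) ->
  `|Phi (fun i => H i + h i) - Phi H| <= c.

Lemma lip1_gop a v Phi : tame Phi -> lip1 Phi -> lip1 (gop a v Phi).
Proof.
move=> tP lP H h c hc; rewrite /gop.
have i1 := tame_integrable (fun i => H i + h i) a v tP.
have i2 := tame_integrable H a v tP.
rewrite -(rintB i1 i2); apply: le_trans (le_normr_Rintegral measurableT (rintegrableB i1 i2)) _.
rewrite -[leRHS](Rintegral_prob_cst (std_normal R)); apply: le_rint.
- exact: (integrable_norm (rintegrableB i1 i2)).
- exact: finite_measure_integrable_cst.
move=> g; have := lP (fun i => H i + g * a i + v i) h c hc.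
by congr (`|Phi _ - _| <= c); apply/funext => i; ring.
Qed.

(** The variance is at most the mean square distance to c, the value at g = 0, and the Lipschitz
    bound makes this at most t K^2 times the mean of g^2. *)
Lemma gop_variance a v Phi H (t K : R) : 0 <= t -> 0 <= K -> tame Phi -> lip1 Phi ->
  (forall i, `|a i| <= K) ->
  gop (fun i => Num.sqrt t * a i) v (fun H => Phi H * Phi H) H <=
  gop (fun i => Num.sqrt t * a i) v Phi H * gop (fun i => Num.sqrt t * a i) v Phi H
    + t * K ^+ 2.
Proof.
move=> t0 K0 tP lP aK; set b := fun i => _.
pose c := Phi (fun i => H i + v i).
have tc : tame (fun H => 2 * c * Phi H) by exact: tameZ.
have tPP := tameM tP tP.
have le : gop b v (fun H => Phi H * Phi H - 2 * c * Phi H) H + c ^+ 2 <= t * K ^+ 2.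
  have -> : t * K ^+ 2 = \int[std_normal R]_g (t * K ^+ 2 * g ^+ 2).
    have E := @Rintegral_gauss_poly2 R 0 0 (t * K ^+ 2); rewrite add0r in E.
    by rewrite -[LHS]E; apply: eq_Rintegral => g _; ring.
  rewrite -[c ^+ 2](Rintegral_prob_cst (std_normal R)) /gop.
  have i1 := tame_integrable H b v (tameB tPP tc).
  have i2 : (std_normal R).-integrable setT (EFin \o (fun=> c ^+ 2)) by exact: finite_measure_integrable_cst.
  rewrite -(rintD i1 i2); apply: le_rint.
  - exact: rintegrableD.
  - by apply: rintegrableZ; exact: gauss_integrableX.
  move=> g; rewrite (_ : _ + c ^+ 2 = (Phi (fun i => H i + g * b i + v i) - c) ^+ 2); last first.
    by rewrite sqrrB; ring.
  have -> : t * K ^+ 2 * g ^+ 2 = (Num.sqrt t * K * `|g|) ^+ 2.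
    by rewrite !exprMn sqr_sqrtr// real_normK// num_real.
  apply: ler_sqr_abs; rewrite [leRHS]ger0_norm; last first.
    by rewrite !mulr_ge0// sqrtr_ge0.
  rewrite /c (_ : (fun i => H i + g * b i + v i) = fun i => (H i + v i) + g * b i); last first.
    by apply/funext => i; ring.
  apply: lP => i; rewrite /b !normrM mulrC ler_wpM2r// ger0_norm ?sqrtr_ge0//.
  by rewrite ler_wpM2l ?sqrtr_ge0.
have := sqr_ge0 (gop b v Phi H - c); rewrite sqrrB.
move: le; rewrite gopB// gopZ//; lra.
Qed.


Lemma lip1_gops l t Phi : tame Phi -> lip1 Phi -> lip1 (gops l t Phi).
Proof.
move=> tP lP; elim: l => //= av l IH; apply: lip1_gop => //; exact: tame_gops.
Qed.

(** Total variance over the successive observations: the last average is Lipschitz again, so each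
    direction adds at most t K^2. For about n^2 edges with K of order 1 / sqrt n this is of order
    n. *)
Lemma gops_variance l (t K : R) Phi : 0 <= t -> 0 <= K -> tame Phi -> lip1 Phi ->
  (forall av i, List.In av l -> `|av.1 i| <= K) -> forall H,
  gops l t (fun H => Phi H * Phi H) H <=
  gops l t Phi H * gops l t Phi H + t * K ^+ 2 * (size l)%:R.
Proof.
move=> t0 K0 tP lP; elim: l => [|av l IH] aK H; first by rewrite mulr0 addr0.
have tG := @tame_gops _ _ l t _ tP; have tPP := tameM tP tP.
have {}IH : forall H, gops l t (fun H => Phi H * Phi H) H <=
    gops l t Phi H * gops l t Phi H + t * K ^+ 2 * (size l)%:R.
  by apply: IH => av' i h; apply: aK; right.
rewrite /= -/(gops l t Phi) -/(gops l t (fun H => Phi H * Phi H)).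
have tGG := tameM tG tG; have tc := @tame_cst R I (t * K ^+ 2 * (size l)%:R).
apply: le_trans (le_gop _ _ _ (tame_gops _ _ tPP) (tameD tGG tc) IH) _.
rewrite gopD// gop_cst -natr1 mulrDr mulr1 [X in _ <= _ + X]addrC addrA lerD2r.
apply: gop_variance => //; first exact: lip1_gops.
by move=> i; apply: aK; left.
Qed.

(** From |y| <= y^2 / (2 r) + r / 2; with a variance of order n the useful choice is r = sqrt n. *)
Lemma gops_abs_dev l (t K r : R) Phi H : 0 <= t -> 0 <= K -> 0 < r -> tame Phi -> lip1 Phi ->
  (forall av i, List.In av l -> `|av.1 i| <= K) ->
  gops l t (fun G => `|Phi G - gops l t Phi H|) H <=
  (t * K ^+ 2 * (size l)%:R / r + r) / 2.
Proof.
move=> t0 K0 r0 tP lP aK; set mu := gops l t Phi H.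
have tN : tame (fun G => `|Phi G - mu|).
  have [m1 [C [c [C0 c0 hC]]]] := tameB tP (tame_cst _ mu); split.
    by move=> d T h mh; apply: measurableT_comp => //; exact: m1.
  by exists C, c; split => // G; rewrite normr_id.
have tPP := tameM tP tP; have tmP := tameZ (2 * mu) tP.
have tQ := tameD (tameB tPP tmP) (tame_cst _ (mu ^+ 2)).
pose Q G := Phi G * Phi G - 2 * mu * Phi G + mu ^+ 2.
have QE G : Q G = (Phi G - mu) ^+ 2 by rewrite /Q; ring.
apply: (@le_trans _ _ (gops l t (fun G => (2 * r)^-1 * Q G + r / 2) H)).
  apply: le_gops => //.
    by apply: tameD; [exact: tameZ|exact: tame_cst].
  move=> G; rewrite QE -(real_normK (num_real (Phi G - mu))).
  set y := `|_|; rewrite -subr_ge0.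
  have -> : (2 * r)^-1 * y ^+ 2 + r / 2 - y = (2 * r)^-1 * (y - r) ^+ 2.
    by field; rewrite gt_eqF.
  by rewrite mulr_ge0 ?sqr_ge0// invr_ge0 mulr_ge0// ltW.
have tZ := tameZ (2 * r)^-1 tQ.
rewrite (gopsD l t tZ (tame_cst _ _)) gops_cst (gopsZ l t _ tQ).
rewrite (gopsD l t (tameB tPP tmP) (tame_cst _ _)) gops_cst (gopsB l t tPP tmP) (gopsZ l t _ tP).
rewrite [leRHS]mulrDl lerD2r -/mu.
have -> : t * K ^+ 2 * (size l)%:R / r / 2 = (2 * r)^-1 * (t * K ^+ 2 * (size l)%:R).
  by field; rewrite gt_eqF.
apply: ler_wpM2l; first by rewrite invr_ge0 mulr_ge0// ltW.
have := gops_variance t0 K0 tP lP aK H; rewrite -/mu; lra.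
Qed.

End variance.

Section upper.
Context (R : realType) (S : finType) (w : S -> R) (n k : nat).
Hypothesis w0 : forall s, 0 <= w s.
Hypothesis w1 : \sum_s w s = 1.
Variable x : S -> 'I_k -> R.
Hypothesis n0 : (0 < n)%N.
Variables (X t : R).
Hypothesis hX : forall s, dotx x s s <= X.
Hypothesis t0 : 0 <= t.
Local Notation I := {ffun 'I_n -> S}.
Local Notation W := (@prodw R S w n).

Let nR : 0 < n%:R :> R. Proof. by rewrite ltr0n. Qed.
Let W0 : forall s : I, 0 <= W s := @prodw_ge0 R S w n w0.

Lemma abs_dotx s s' : `|dotx x s s'| <= X.
Proof.
apply: (@le_trans _ _ ((dotx x s s + dotx x s' s') / 2)); last first.
  by have := hX s; have := hX s'; lra.
apply: le_trans (ler_norm_sum _ _ _) _.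
rewrite /dotx -big_split /= mulr_suml; apply: ler_sum => c _; rewrite ler_norml.
have h1 := sqr_ge0 (x s c + x s' c); have h2 := sqr_ge0 (x s c - x s' c).
by apply/andP; split; nra.
Qed.

Lemma X_ge0 (s : S) : 0 <= X.
Proof. exact: le_trans (normr_ge0 _) (abs_dotx s s). Qed.

Lemma card_edge_le : (#|{: edge n}| <= n * n)%N.
Proof.
by have := leq_card (val : edge n -> 'I_n * 'I_n) val_inj; rewrite card_prod card_ord.
Qed.

(* The variance of a function of n i.i.d. spins that is a sum over the spins. *)
Lemma site_sum_dev (g : S -> R) : \sum_s w s * g s = 0 ->
  \sum_(s : I) W s * `|\sum_i g (s i)| <=
  Num.sqrt n%:R * ((\sum_s w s * g s ^+ 2) + 1) / 2.
Proof.
move=> g0; set V := \sum_s w s * g s ^+ 2; set r := Num.sqrt n%:R.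
have r0 : 0 < r by rewrite sqrtr_gt0.
have rr : r * r = n%:R by rewrite -expr2 sqr_sqrtr// ltW.
have var : \sum_(s : I) W s * (\sum_i g (s i)) ^+ 2 = n%:R * V.
  transitivity (\sum_i \sum_j \sum_(s : I) W s * (g (s i) * g (s j))).
    rewrite exchange_big /=; under [RHS]eq_bigr do rewrite exchange_big /=.
    rewrite exchange_big /=; apply: eq_bigr => s _.
    rewrite expr2 mulr_suml mulr_sumr exchange_big /=; apply: eq_bigr => i _.
    by rewrite mulr_sumr mulr_sumr.
  rewrite (eq_bigr (fun=> V)); first by rewrite sumr_const card_ord mulr_natl.
  move=> i _; rewrite (bigD1 i)//= [X in _ + X]big1 ?addr0.
    by rewrite (@prodw_site _ _ w n w1 i (fun s => g s * g s)); apply: eq_bigr => s _; rewrite expr2.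
  by move=> j ji; rewrite (@prodw_site2 _ _ w n w1 i j) 1?eq_sym// g0 mul0r.
apply: (@le_trans _ _ (\sum_(s : I) W s * ((2 * r)^-1 * (\sum_i g (s i)) ^+ 2 + r / 2))).
  apply: ler_sum => s _; apply: ler_wpM2l => //.
  rewrite -(real_normK (num_real (\sum_i g (s i)))); set y := `|_|; rewrite -subr_ge0.
  have -> : (2 * r)^-1 * y ^+ 2 + r / 2 - y = (2 * r)^-1 * (y - r) ^+ 2.
    by field; rewrite gt_eqF.
  by rewrite mulr_ge0 ?sqr_ge0// invr_ge0 mulr_ge0// ltW.
under eq_bigr do rewrite mulrDr mulrCA.
rewrite big_split /= -mulr_sumr var -mulr_suml (prodw_sum n w1) mul1r -rr.
by rewrite le_eqVlt; apply/orP; left; apply/eqP; field; rewrite gt_eqF.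
Qed.

Variables (J : finType) (B1 B2 : J -> 'M[R]_k) (e : R).
Let m b := (B1 b)^T *m B2 b.
Hypothesis cover : forall s s' : I, exists b : J,
  \sum_c \sum_d (ovl x s s' c d - m b c d) ^+ 2 <= e.
Let h b s := hmix w x t (B1 b) (B2 b) s.
Let hbar b := \sum_s w s * h b s.
Variable U : R.
Hypothesis hU : forall b, n%:R * hbar b + t * (n%:R * (e / 2 - fsq (m b) / 2 +
  fsq ((B1 b)^T *m B1 b) / 4) + X ^+ 2 / 4) <= U.

(** Free of n: sqrt n times this bounds all fluctuations. For each bin, the first summand is for the
    noise and the second for the planted spins. *)
Definition dev_const := \sum_b ((t * X ^+ 2 + 1) / 2 +
  ((\sum_s w s * (h b s - hbar b) ^+ 2) + 1) / 2).

Let r := Num.sqrt n%:R : R.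
Let r0 : 0 < r. Proof. by rewrite sqrtr_gt0. Qed.
Let rr : r * r = n%:R. Proof. by rewrite -expr2 sqr_sqrtr// ltW. Qed.

(** The bins cover all configurations, so [Zf] is at most the number of bins times the largest
    partition function of a bin. The logarithm of the latter is at most the common bound on the
    means plus the sum of the deviations of all bins, which is what allows the maximum to be taken
    inside the average. *)
Lemma planted_upper (s' : I) :
  gops (planted s' (edges n x)) t (lnZ W) (fun=> 0) <=
  U + \sum_b `|\sum_i (h b (s' i) - hbar b)| + ln #|J|%:R +
  r * (\sum_(b : J) (t * X ^+ 2 + 1) / 2).
Proof.
have [i0 Wi0] := prodw_pos n w0 w1.
pose A b (s : I) := \sum_c \sum_d (ovl x s s' c d - m b c d) ^+ 2 <= e.
pose WA b (s : I) := W s * (A b s)%:R.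
have WA0 b s : 0 <= WA b s by rewrite mulr_ge0.
(* A bin without a configuration of positive weight has partition function 0 and no Gibbs measure;
   it is left out of the deviations. *)
pose ne b := [exists s : I, (0 < W s) && A b s].
pose l := planted s' (edges n x).
pose mu b := gops l t (lnZ (WA b)) (fun=> 0).
set M := U + _.
have J0 : 0 < #|J|%:R :> R.
  by have [b _] := cover i0 i0; rewrite ltr0n; apply/card_gt0P; exists b.
have neP b : ne b -> exists s, 0 < WA b s.
  by move=> /existsP[s /andP[Ws As]]; exists s; rewrite /WA As mulr1.
have tL b : ne b -> tame (lnZ (WA b)) by move=> /neP[s Ws]; exact: (tame_lnZ (WA0 b) Ws).
have muM b : ne b -> mu b <= M.
  move=> /existsP[s /andP[Ws As]].
  apply: le_trans (planted_bin w0 w1 n0 hX t0 Ws As (fun s h => h)) _.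
  have := hU b; rewrite -/(m b).
  have -> : \sum_i hmix w x t (B1 b) (B2 b) (s' i) = n%:R * hbar b + \sum_i (h b (s' i) - hbar b).
    rewrite big_split /= sumrN sumr_const card_ord mulr_natl addrCA subrr addr0//.
  have : \sum_i (h b (s' i) - hbar b) <= \sum_b `|\sum_i (h b (s' i) - hbar b)|.
    rewrite [leRHS](bigD1 b)//=; apply: le_trans (ler_norm _) _.
    by rewrite lerDl sumr_ge0.
  rewrite /M; set Y := \sum_i _; set Y' := \sum_b _; lra.
pose dv b H := `|lnZ (WA b) H - mu b|.
have tdv b : ne b -> tame (dv b).
  move=> nb; have [m1 [C [c [C0 c0 hC]]]] := tameB (tL b nb) (tame_cst _ (mu b)); split.
    by move=> d T g mg; apply: measurableT_comp => //; exact: m1.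
  by exists C, c; split => // G; rewrite normr_id.
have ptw H : lnZ W H <= M + ln #|J|%:R + \sum_(b | ne b) dv b H.
  set D := \sum_(b | _) _.
  have ZA b : Zf (WA b) H <= expR (M + D).
    have [nb|nb] := boolP (ne b).
      have [s Ws] := neP b nb.
      rewrite -[leLHS](lnK (x := Zf (WA b) H)) ?posrE ?(Zf_gt0 (WA0 b) Ws)// ler_expR.
      have : dv b H <= D.
        by rewrite /D (bigD1 b)//= lerDl; apply: sumr_ge0 => b' _; exact: normr_ge0.
      have := ler_norm (lnZ (WA b) H - mu b); rewrite -/(dv b H) /lnZ.
      have := muM b nb; lra.
    rewrite /Zf big1 ?expR_ge0// => s _; rewrite /WA.
    have := W0 s; rewrite le_eqVlt => /orP[/eqP <-|Ws]; first by rewrite !mul0r.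
    case As: (A b s); last by rewrite mulr0 mul0r.
    by move/existsP: nb => []; exists s; rewrite Ws As.
  have ZW : Zf W H <= #|J|%:R * expR (M + D).
    apply: (@le_trans _ _ (\sum_b Zf (WA b) H)).
      rewrite /Zf exchange_big /=; apply: ler_sum => s _.
      have [b Ab] := cover s s'; rewrite (bigD1 b)//= /WA /A Ab mulr1 lerDl sumr_ge0//.
      by move=> b' _; rewrite mulr_ge0 ?expR_ge0// mulr_ge0.
    rewrite mulr_natl -sumr_const; apply: ler_sum => b _; exact: ZA.
  apply: le_trans (le_lnW (Zf_gt0 W0 Wi0 H) ZW) _.
  by rewrite lnM_expR// addrC addrAC.
have tS : tame (fun H => \sum_(b | ne b) dv b H).
  rewrite (_ : (fun H => _) = fun H => \sum_b (if ne b then dv b H else 0)).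
    apply: tame_sum => b; case nb: (ne b); [exact: tdv|exact: tame_cst].
  by apply/funext => H; rewrite big_mkcond.
apply: le_trans (le_gops l t (tame_lnZ W0 Wi0) (tameD (tame_cst _ _) tS) ptw _) _.
rewrite (gopsD l t (tame_cst _ _) tS) gops_cst /= lerD2l.
rewrite (_ : (fun H => _) = fun H => \sum_b (if ne b then dv b H else 0)); last first.
  by apply/funext => H; rewrite big_mkcond.
have tif b : tame (fun H => if ne b then dv b H else 0).
  by case nb: (ne b); [exact: tdv|exact: tame_cst].
rewrite gops_sum// mulr_sumr; apply: ler_sum => b _.
have c0 : 0 <= r * ((t * X ^+ 2 + 1) / 2).
  apply: mulr_ge0; first exact: ltW.
  by apply: divr_ge0 => //; apply: addr_ge0 => //; apply: mulr_ge0 => //; exact: sqr_ge0.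
case nb: (ne b); last by rewrite gops_cst.
have [s Ws] := neP b nb.
have X0 : 0 <= X by have [z _] := w_pos w0 w1; exact: (X_ge0 z).
have K0 : 0 <= X / r by rewrite divr_ge0// ltW.
have lp : lip1 (lnZ (WA b)) by move=> H g c hc; exact: (lnZ_lip (WA0 b) Ws).
apply: le_trans (gops_abs_dev (fun=> 0) t0 K0 r0 (tL b nb) lp _) _.
  move=> av s2; rewrite /l /planted /edges -map_comp => /List.in_map_iff[f [<- _]] /=.
  rewrite /edot normrM [`|_^-1|]ger0_norm ?invr_ge0 ?sqrtr_ge0// mulrC.
  by apply: ler_wpM2r; [rewrite invr_ge0 sqrtr_ge0|exact: abs_dotx].
rewrite mulrA ler_pM2r ?invr_gt0// mulrDr mulr1 lerD2r.
have Ls : (size l)%:R <= (r * r) * (r * r).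
  have -> : size l = #|{: edge n}| by rewrite /l /planted /edges 2!size_map size_enum_ord.
  by rewrite rr -natrM ler_nat; exact: card_edge_le.
have -> : r * (t * X ^+ 2) = t * (X / r) ^+ 2 * ((r * r) * (r * r)) / r.
  by field; rewrite gt_eqF.
apply: ler_wpM2r; first by rewrite invr_ge0 ltW.
by apply: ler_wpM2l => //; apply: mulr_ge0 => //; exact: sqr_ge0.
Qed.

Lemma Dn_upper : Dn w n x t <= U + ln #|J|%:R + r * dev_const.
Proof.
have [i0 Wi0] := prodw_pos n w0 w1.
rewrite /Dn (gops_null_ZlnZ W0 Wi0)//.
apply: (@le_trans _ _ (\sum_s W s * (U + \sum_b `|\sum_i (h b (s i) - hbar b)| + ln #|J|%:R +
  r * (\sum_(b : J) (t * X ^+ 2 + 1) / 2)))).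
  apply: ler_sum => s _; rewrite expR0 mulr1; apply: ler_wpM2l => //.
  exact: planted_upper.
under eq_bigr do rewrite -addrA addrAC mulrDr.
rewrite big_split /= -mulr_suml (prodw_sum n w1) mul1r.
rewrite /dev_const big_split /= mulrDr !addrA lerD2l.
under eq_bigr do rewrite mulr_sumr.
rewrite exchange_big /= mulr_sumr; apply: ler_sum => b _.
rewrite mulrA; apply: site_sum_dev.
under eq_bigr do rewrite mulrBr.
by rewrite big_split /= sumrN -mulr_suml w1 mul1r subrr.
Qed.

End upper.

(** * Priors with a finite second moment *)

Lemma ler_lim2 (R : realType) (u v : nat -> R) (l m : R) :
  u N @[N --> \oo] --> l -> v N @[N --> \oo] --> m -> (forall N, u N <= v N) -> l <= m.
Proof.
move=> cu cv uv; rewrite -(cvg_lim _ cu)// -(cvg_lim _ cv)//.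
by apply: ler_lim; [exact: cvgP cu|exact: cvgP cv|exact: nearW].
Qed.

(** Lagrange's identity. *)
Lemma sum_CS (R : realFieldType) (I : finType) (u v : I -> R) :
  (\sum_c u c * v c) ^+ 2 <= (\sum_c u c ^+ 2) * \sum_c v c ^+ 2.
Proof.
rewrite -subr_ge0.
suff -> : (\sum_c u c ^+ 2) * \sum_c v c ^+ 2 - (\sum_c u c * v c) ^+ 2 =
    2^-1 * \sum_c \sum_d (u c * v d - u d * v c) ^+ 2.
  by rewrite mulr_ge0 ?invr_ge0//; do 2 (apply: sumr_ge0 => ? _); exact: sqr_ge0.
have -> : \sum_c \sum_d (u c * v d - u d * v c) ^+ 2 =
   \sum_c \sum_d (u c ^+ 2 * v d ^+ 2) + \sum_c \sum_d (u d ^+ 2 * v c ^+ 2)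
    - 2 * \sum_c \sum_d (u c * v c * (u d * v d)).
  rewrite mulr_sumr -sumrN -!big_split /=; apply: eq_bigr => c _.
  rewrite mulr_sumr -sumrN -!big_split /=; apply: eq_bigr => d _; ring.
have E1 : \sum_c \sum_d (u c ^+ 2 * v d ^+ 2) = (\sum_c u c ^+ 2) * \sum_c v c ^+ 2.
  by rewrite mulr_suml; apply: eq_bigr => c _; rewrite mulr_sumr.
have E2 : \sum_c \sum_d (u d ^+ 2 * v c ^+ 2) = (\sum_c u c ^+ 2) * \sum_c v c ^+ 2.
  by rewrite exchange_big /= E1.
have E3 : \sum_c \sum_d (u c * v c * (u d * v d)) = (\sum_c u c * v c) ^+ 2.
  by rewrite expr2 mulr_suml; apply: eq_bigr => c _; rewrite mulr_sumr.
by rewrite E1 E2 E3; field.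
Qed.

Section prior.
Context (R : realType) (k : nat) (P0 : probability (k.-tuple R) R).
Hypothesis P2 : forall c, P0.-integrable setT (EFin \o (fun x => tnth x c ^+ 2)).
Implicit Types (B : 'M[R]_k) (t : R).

Definition linS B r (x : k.-tuple R) : R := \sum_c B r c * tnth x c.
Definition DK t B := Dch P0 (scaled (linS B) t).
Definition mom2 : R := \sum_c \int[P0]_x (tnth x c ^+ 2).

Lemma mom2_ge0 : 0 <= mom2.
Proof. by apply: sumr_ge0 => c _; apply: Rintegral_ge0 => x _; exact: sqr_ge0. Qed.

Lemma measurable_linS B r : measurable_fun setT (linS B r).
Proof.
apply: measurable_sum => c; apply: measurable_funM => //; exact: measurable_tnth.
Qed.

(** Dominates the linear signal and, since rounding is towards 0, all its rounded versions at
    once. *)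
Definition absS B r (x : k.-tuple R) : R := \sum_c `|B r c| * `|tnth x c|.

Lemma absS_sqr B r x : absS B r x ^+ 2 <= (\sum_c B r c ^+ 2) * \sum_c tnth x c ^+ 2.
Proof.
apply: le_trans (sum_CS _ _) _.
rewrite le_eqVlt; apply/orP; left; apply/eqP; congr (_ * _); apply: eq_bigr => c _.
  by rewrite real_normK// num_real.
by rewrite real_normK// num_real.
Qed.

Lemma measurable_absS B r : measurable_fun setT (absS B r).
Proof.
apply: measurable_sum => c; apply: measurable_funM => //.
by apply: measurableT_comp => //; exact: measurable_tnth.
Qed.

Lemma absS_sqint B r : P0.-integrable setT (EFin \o (fun x => absS B r x ^+ 2)).
Proof.
apply: (@le_rintegrable _ _ _ _ _ (fun x : k.-tuple R => (\sum_c B r c ^+ 2) * \sum_c tnth x c ^+ 2)).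
- by apply: measurable_funX; exact: measurable_absS.
- by move=> x; rewrite ger0_norm ?sqr_ge0//; exact: absS_sqr.
- by apply: rintegrableZ; exact: rintegrable_sum.
Qed.

Lemma absS_ge0 B r x : 0 <= absS B r x.
Proof. by apply: sumr_ge0 => c _; rewrite mulr_ge0. Qed.

Lemma le_absS B r (x : k.-tuple R) (u : 'I_k -> R) : (forall c, `|u c| <= `|tnth x c|) ->
  `|\sum_c B r c * u c| <= absS B r x.
Proof.
move=> ux; apply: le_trans (ler_norm_sum _ _ _) _; apply: ler_sum => c _.
by rewrite normrM ler_wpM2l.
Qed.

Lemma linS_sqint B r : P0.-integrable setT (EFin \o (fun x => linS B r x ^+ 2)).
Proof.
apply: (le_rintegrable _ _ (absS_sqint B r)); first by apply: measurable_funX; exact: measurable_linS.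
move=> x; rewrite ger0_norm ?sqr_ge0//; apply: ler_sqr_abs.
by rewrite [leRHS]ger0_norm ?absS_ge0//; exact: le_absS.
Qed.

Section rounded.
Variable N : nat.
Definition codeX (x : k.-tuple R) : {ffun 'I_k -> rcode N} := [ffun c => @ridx R N (tnth x c)].
Definition xv (s : {ffun 'I_k -> rcode N}) (c : 'I_k) : R := rval R (s c).

Lemma xvE x c : xv (codeX x) c = rnd N (tnth x c).
Proof. by rewrite /xv /codeX ffunE. Qed.

Lemma measurable_codeX c : measurable (codeX @^-1` [set c]).
Proof.
rewrite (_ : _ @^-1` _ = \big[setI/setT]_r ((fun x : k.-tuple R => tnth x r) @^-1` (@ridx R N @^-1` [set c r]))).
  apply: bigsetI_measurable => r _; rewrite -[X in measurable X]setTI.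
  by apply: measurable_tnth => //; exact: measurable_ridx.
apply/seteqP; split => w.
  by move=> /= <-; rewrite -bigcap_seq => r _ /=; rewrite ffunE.
rewrite -bigcap_seq => H /=; apply/ffunP => r; rewrite ffunE.
by have := H r; rewrite /= mem_index_enum => /(_ isT).
Qed.

Definition wN := fiber_weight P0 codeX.

Lemma wN_ge0 s : 0 <= wN s. Proof. exact: fiber_weight_ge0. Qed.
Lemma wN_sum : \sum_s wN s = 1. Proof. exact: fiber_weight_sum measurable_codeX. Qed.

Definition linR B t r (x : k.-tuple R) : R := Num.sqrt t * Bx xv B r (codeX x).

Lemma DK_fiber t B : 0 <= t -> Dch P0 (linR B t) = D1 wN xv t B.
Proof. by move=> t0; rewrite (Dch_fiber P0 measurable_codeX (Bx xv B) t0). Qed.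

Lemma measurable_linR B t r : measurable_fun setT (linR B t r).
Proof. exact: (measurable_fiber_signal measurable_codeX (Bx xv B) t r). Qed.

Lemma linR_sqint B t r : P0.-integrable setT (EFin \o (fun x => linR B t r x ^+ 2)).
Proof. exact: (fiber_signal_sqr P0 measurable_codeX (Bx xv B) t r). Qed.

Lemma le_linR B t r x : `|linR B t r x| <= `|Num.sqrt t * absS B r x|.
Proof.
rewrite [leLHS]normrM [leRHS]normrM ler_wpM2l// [leRHS]ger0_norm ?absS_ge0//.
by apply: le_absS => c; rewrite xvE; exact: le_rnd.
Qed.

(** Averaged over the spin, [hmix] is the integral of ln zeta for the decoder B1 along the
    observation through B2, so this is an instance of [mismatched_le]. *)
Lemma hmix_le t B1 B2 : 0 <= t ->
  \sum_s wN s * hmix wN xv t B1 B2 s <= Dch P0 (linR B2 t).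
Proof.
move=> t0.
have m1 := measurable_linR B1 t; have m2 := measurable_linR B2 t.
have s2 := linR_sqint B2 t.
apply: le_trans (mismatched_le m1 m2 s2).
have [s0 ws0] := w_pos wN_ge0 wN_sum.
pose f (u : k.-tuple R * k.-tuple R) := ln (zeta P0 (linR B1 t) (Yof (linR B2 t) u)).
have fi : (std_gaussian R k \x P0)%E.-integrable setT (EFin \o f).
  exact: (lnzeta_integrable m1 m2 s2).
have inner x : (\int[std_gaussian R k]_y (f (y, x))%:E = (hmix wN xv t B1 B2 (codeX x))%:E)%E.
  pose v r s := Bx xv B1 r s * Bx xv B2 r (codeX x) - Bx xv B1 r s ^+ 2 / 2.
  have [i] := gauss_gops (Bx xv B1) v t (fun=> 0) (tame_lnZ wN_ge0 ws0).
  have -> : gops [seq (Bx xv B1 r, v r) | r <- enum 'I_k] t (lnZ wN) (fun=> 0) =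
    hmix wN xv t B1 B2 (codeX x) by [].
  move=> <-; rewrite -rintegralE//; apply: eq_integral => y _; congr EFin.
  rewrite /f /lnZ; congr ln; rewrite /zeta.
  transitivity (\int[P0]_x' (expR (ham (Bx xv B1) v t (fun=> 0) y (codeX x')))).
    apply: eq_Rintegral => x' _; rewrite /lik /ham add0r; congr expR.
    apply: eq_bigr => r _; rewrite /Yof /= tnth_mktuple /v /linR exprMn sqr_sqrtr//.
    rewrite -[in X in _ = _ + X * _](sqr_sqrtr t0) expr2 -[in X in _ - X / 2](sqr_sqrtr t0) expr2.
    by field.
  exact: (Rintegral_fibers P0 measurable_codeX (fun s => expR (ham (Bx xv B1) v t (fun=> 0) y s))).
rewrite -(Rintegral_fibers P0 measurable_codeX) /Rintegral -(integral21_prod_meas1 fi).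
rewrite le_eqVlt; apply/orP; left; apply/eqP; congr fine.
by apply: eq_integral => x _; rewrite -inner.
Qed.

Lemma dotx_int : \sum_s wN s * dotx xv s s <= mom2.
Proof.
rewrite -(Rintegral_fibers P0 measurable_codeX (fun s => dotx xv s s)) /mom2.
rewrite -(Rintegral_sum _ P2); apply: le_rint.
- exact: (fiber_integrable P0 measurable_codeX (fun s => dotx xv s s)).
- exact: rintegrable_sum.
- move=> x; apply: ler_sum => c _; rewrite -expr2 xvE; apply: ler_sqr_abs; exact: le_rnd.
Qed.

(** The energy of the channel B x is the quadratic form of B^T B at the posterior mean of x, so an
    order between Gram matrices is an order between energies; the slack e |x|^2 is paid with the
    second moment of the prior. *)
Lemma D1_gram t B B' (e : R) : 0 <= t -> 0 <= e ->
  (forall v : 'I_k -> R, \sum_c \sum_d (B^T *m B) c d * (v c * v d) <=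
     \sum_c \sum_d (B'^T *m B') c d * (v c * v d) + e * \sum_c v c ^+ 2) ->
  D1 wN xv t B <= D1 wN xv t B' + t * (e / 2 * mom2).
Proof.
move=> t0 e0 le; have [s0 ws0] := w_pos wN_ge0 wN_sum.
have EE C H : energy wN (lin xv C) H = \sum_c \sum_d (C^T *m C) c d *
    (gibbs wN (xv^~ c) H * gibbs wN (xv^~ d) H).
  rewrite /energy big_map big_enum /=.
  transitivity (\sum_r \sum_c \sum_d
      (C r c * C r d) * (gibbs wN (xv^~ c) H * gibbs wN (xv^~ d) H)).
    apply: eq_bigr => r _.
    have -> : gibbs wN (Bx xv C r) H = \sum_c C r c * gibbs wN (xv^~ c) H.
      rewrite (_ : Bx xv C r = fun s => \sum_c C r c * xv s c)//.
      by rewrite (gibbs_sum wN_ge0 ws0); apply: eq_bigr => c _; rewrite gibbsZ.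
    rewrite expr2 mulr_suml; apply: eq_bigr => c _; rewrite mulr_sumr.
    by apply: eq_bigr => d _; ring.
  rewrite exchange_big /=; apply: eq_bigr => c _.
  rewrite exchange_big /=; apply: eq_bigr => d _.
  rewrite mxE mulr_suml; apply: eq_bigr => r _; rewrite mxE; ring.
have cmp H : energy wN (lin xv B) H <= energy wN (lin xv B') H +
    2 * gibbs wN (fun s => e / 2 * dotx xv s s) H.
  rewrite !EE; apply: le_trans (le _) _; rewrite lerD2l gibbsZ.
  have -> : 2 * (e / 2 * gibbs wN (fun s => dotx xv s s) H) =
    e * gibbs wN (fun s => dotx xv s s) H by field.
  apply: ler_wpM2l => //; rewrite /dotx (gibbs_sum wN_ge0 ws0); apply: ler_sum => c _.
  apply: le_trans (gibbs_sqr_le wN_ge0 ws0 _ _) _.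
  by rewrite le_eqVlt; apply/orP; left; apply/eqP; congr (gibbs _ _ H); apply/funext => s; rewrite expr2.
apply: le_trans (null_comparison wN_ge0 ws0 t0 cmp (fun=> 0)) _.
rewrite lerD2l; apply: ler_wpM2l => //.
under eq_bigr do rewrite expR0 mulr1 mulrCA.
by rewrite -mulr_sumr; apply: ler_wpM2l; [rewrite divr_ge0|exact: dotx_int].
Qed.

End rounded.

Let mS B t r : measurable_fun setT (fun x => Num.sqrt t * absS B r x).
Proof. by apply: measurable_funM => //; exact: measurable_absS. Qed.

Lemma cvg_DK t B : Dch P0 (linR N B t) @[N --> \oo] --> DK t B.
Proof.
apply: (@cvg_Dch _ _ _ _ _ _ _ (fun r x => Num.sqrt t * absS B r x)).
- by move=> r; apply: measurable_funM => //; exact: measurable_linS.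
- by move=> N r; exact: measurable_linR.
- move=> r; rewrite (_ : (fun x => _) = fun x => Num.sqrt t ^+ 2 * absS B r x ^+ 2).
    by apply: rintegrableZ; exact: absS_sqint.
  by apply/funext => x; rewrite exprMn.
- by move=> N r x; exact: le_linR.
- move=> r x; rewrite [leLHS]normrM [leRHS]normrM ler_wpM2l// [leRHS]ger0_norm ?absS_ge0//.
  exact: le_absS.
- move=> r x; apply: cvgM; first exact: cvg_cst.
  apply: rcvg_sum => c; apply: cvgM; first exact: cvg_cst.
  by under eq_fun do rewrite xvE; exact: rnd_cvg.
Qed.

Lemma DK_gram t B B' (e : R) : 0 <= t -> 0 <= e ->
  (forall v : 'I_k -> R, \sum_c \sum_d (B^T *m B) c d * (v c * v d) <=
     \sum_c \sum_d (B'^T *m B') c d * (v c * v d) + e * \sum_c v c ^+ 2) ->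
  DK t B <= DK t B' + t * (e / 2 * mom2).
Proof.
move=> t0 e0 le.
apply: (@ler_lim2 _ (fun N => Dch P0 (linR N B t)) (fun N => Dch P0 (linR N B' t) + t * (e / 2 * mom2))).
- exact: cvg_DK.
- by apply: cvgD; [exact: cvg_DK|exact: cvg_cst].
by move=> N; rewrite !DK_fiber//; exact: D1_gram.
Qed.

(** Any B with B^T B = q may thus stand for the positive semidefinite root of q. *)
Lemma DK_eq_gram t B B' : 0 <= t -> B^T *m B = B'^T *m B' -> DK t B = DK t B'.
Proof.
move=> t0 E; apply/eqP; rewrite eq_le; apply/andP; split.
  have := @DK_gram t B B' 0 t0 (lexx _); rewrite !mul0r mulr0 addr0; apply.
  by move=> v; rewrite E mul0r addr0.
have := @DK_gram t B' B 0 t0 (lexx _); rewrite !mul0r mulr0 addr0; apply.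
by move=> v; rewrite E mul0r addr0.
Qed.

Lemma DK0 t : DK t 0 = 0.
Proof.
rewrite /DK /Dch -[RHS](Rintegral_cst1 0 (prod_setT (std_gaussian R k) P0)).
apply: eq_Rintegral => u _; rewrite (_ : zeta _ _ _ = 1) ?ln1//.
rewrite /zeta -[RHS](Rintegral_prob_cst P0); apply: eq_Rintegral => x _.
rewrite /lik big1 ?expR0// => r _; rewrite /scaled /linS big1.
  by rewrite mulr0 mul0r expr0n mul0r subrr.
by move=> c _; rewrite mxE mul0r.
Qed.

End prior.

(** * Positive semidefinite matrices *)

Section psd_sqrt.
Import complex sesquilinear spectral.
Local Open Scope sesquilinear_scope.
Context (R : realType).
Local Notation C := (complex.complex R).
Local Notation toC := (@complex.real_complex_def R (Phant R)).
Local Notation MtoC := (map_mx toC).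

Lemma interpolation (f : R -> R) (s : seq R) :
  exists p : {poly R}, forall x, x \in s -> p.[x] = f x.
Proof.
elim: s => [|y s [p hp]]; first by exists 0.
have [ys|ys] := boolP (y \in s).
  by exists p => x; rewrite inE => /predU1P[->|]; exact: hp.
pose r := \prod_(z <- s) ('X - z%:P).
have ry : r.[y] != 0.
  rewrite horner_prod prodf_seq_neq0; apply/allP => z zs /=.
  by rewrite !hornerE subr_eq0; apply: contraNneq ys => ->.
exists (p + ((f y - p.[y]) / r.[y])%:P * r) => x; rewrite inE !hornerE.
move=> /predU1P[->|xs]; first by rewrite divfK// subrKC.
suff -> : r.[x] = 0 by rewrite mulr0 addr0 hp.
by apply/eqP; rewrite horner_prod prodf_seq_eq0; apply/hasP; exists x => //=;
  rewrite !hornerE subrr.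
Qed.

Lemma horner_mx_sym n (q : 'M[R]_n.+1) (p : {poly R}) : q^T = q ->
  (horner_mx q p)^T = horner_mx q p.
Proof.
move=> qs; elim/poly_ind: p => [|p c IH]; first by rewrite rmorph0 trmx0.
rewrite rmorphD rmorphM /= horner_mx_X horner_mx_C linearD /= trmx_mul.
rewrite IH qs tr_scalar_mx; congr (_ + _).
exact: (comm_mx_horner p (comm_mx_refl q)).
Qed.

Lemma horner_mx_conj n (P : 'M[C]_n.+1) (D : 'M[C]_n.+1) (p : {poly C}) :
  P \in unitmx ->
  horner_mx (invmx P *m D *m P) p = invmx P *m horner_mx D p *m P.
Proof.
move=> Pu; elim/poly_ind: p => [|p c IH]; first by rewrite !rmorph0 mulmx0 mul0mx.
rewrite !rmorphD !rmorphM /= !horner_mx_X !horner_mx_C IH.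
rewrite mulmxDr mulmxDl -!mulmxE; congr (_ + _).
  by rewrite -!mulmxA; congr (_ *m (_ *m _)); rewrite mulKVmx.
by rewrite mul_mx_scalar -scalemxAl mulVmx// scalemx1.
Qed.

(** The diagonalization is unitary, over the complex numbers. To return to real matrices, take r =
    p(q) for a real polynomial p interpolating the fourth root on the spectrum: r is real symmetric
    with r^4 = q, and r r = r^T r is positive semidefinite at once. *)
Lemma psd_sqrt_exists n (q : 'M[R]_n.+1) : psd q ->
  exists s : 'M[R]_n.+1, psd s /\ s *m s = q.
Proof.
move=> [qs qpos].
pose A : 'M[C]_n.+1 := MtoC q.
have Areal : A \is a mxOver Num.real.
  by apply/mxOverP => i j; rewrite mxE; apply/complex.complex_realP; exists (q i j).
have Asym : A \is symmetricmx.
  by apply/is_hermitianmxP; rewrite expr0 scale1r map_mx_id// /A map_trmx qs.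
have Aherm := realsym_hermsym Asym Areal.
have Anorm := hermitian_normalmx Aherm.
have [P [D [AE Puni Dreal]]] : exists P D,
    [/\ A = invmx P *m diag_mx D *m P, P \is unitarymx & D \is a mxOver Num.real].
  exists (spectralmx A), (spectral_diag A); split.
  - exact/orthomx_spectralP.
  - exact: spectral_unitarymx.
  - exact: hermitian_spectral_diag_real.
have Pu : P \in unitmx by exact: unitarymx_unit.
pose dR i := complex.Re (D 0 i).
have DE i : D 0 i = toC (dR i).
  by have /mxOverP/(_ 0 i)/complex.complex_realP[x xE] := Dreal; rewrite /dR xE.
have d0 i : 0 <= dR i.
  (* The eigenvalue is the diagonal entry of P A P^*, the sum of the quadratic form of q at the real
     and at the imaginary part of row i of P. *)
  pose x : 'cV[R]_n.+1 := \col_j complex.Re (P i j).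
  pose y : 'cV[R]_n.+1 := \col_j complex.Im (P i j).
  have E : D 0 i = (P *m A *m P ^t* ) i i.
    rewrite AE invmx_unitary// !mulmxA (unitarymxP _)// mul1mx -mulmxA.
    by rewrite (unitarymxP _)// mulmx1 mxE eqxx mulr1n.
  have -> : dR i = (x^T *m q *m x) 0 0 + (y^T *m q *m y) 0 0.
    rewrite /dR E !mxE -big_split /= (big_morph (@complex.Re R)
      (id1 := 0) (op1 := +%R))//; last by move=> [a b] [c e].
    apply: eq_bigr => j _; rewrite !mxE /=.
    rewrite 2!mulr_suml mulr_suml (big_morph (@complex.Re R)
      (id1 := 0) (op1 := +%R))//; last by move=> [a b] [c e].
    rewrite -big_split/=; apply: eq_bigr => l _; rewrite !mxE /=.
    case: (P i l) => a b; case: (P i j) => c e /=.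
    by ring.
  by rewrite addr_ge0.
have [p hp] := interpolation (fun x => Num.sqrt (Num.sqrt x)) [seq dR i | i : 'I_n.+1].
pose r := horner_mx q p.
have rs : r^T = r by exact: horner_mx_sym.
have rE : MtoC r = invmx P *m diag_mx (\row_i toC (Num.sqrt (Num.sqrt (dR i)))) *m P.
  rewrite /r map_horner_mx -/A AE (horner_mx_conj _ _ Pu) horner_mx_diag.
  set D' := map_mx _ D; suff -> : D' = \row_i toC (Num.sqrt (Num.sqrt (dR i))) by [].
  apply/rowP => i; rewrite !mxE DE horner_map.
  by rewrite hp//; apply/mapP; exists i => //; rewrite mem_enum.
have r4 : (r *m r) *m (r *m r) = q.
  apply: (map_mx_inj (f := toC)); rewrite !map_mxM /= rE.
  rewrite -/A AE !mulmxA.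
  have c (X Y : 'M[C]_n.+1) : X *m P *m invmx P *m Y = X *m Y.
    by rewrite (mulmxK Pu).
  rewrite !c; set X := diag_mx (\row_i _); suff -> : diag_mx D = X *m X *m X *m X by rewrite !mulmxA.
  rewrite /X !mulmx_diag; congr diag_mx; apply/rowP => i; rewrite !mxE DE -!rmorphM/=.
  congr toC; rewrite -!expr2 -mulrA -expr2.
  by rewrite sqr_sqrtr ?sqrtr_ge0// -expr2 sqr_sqrtr.
exists (r *m r); split => //; split; first by rewrite trmx_mul rs.
move=> v; rewrite mulmxA -mulmxA -{1}rs -trmx_mul !mxE sumr_ge0// => i _.
by rewrite mxE -expr2 sqr_ge0.
Qed.

End psd_sqrt.

Section polar.
Context (R : realType).

Lemma fsq_tr k (q : 'M[R]_k) : fsq q = \tr (q^T *m q).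
Proof.
rewrite /fsq /mxtrace exchange_big /=; apply: eq_bigr => d _; rewrite mxE.
by apply: eq_bigr => c _; rewrite mxE expr2.
Qed.

Lemma psd_gram k (m : 'M[R]_k) : psd (m^T *m m).
Proof.
split; first by rewrite trmx_mul trmxK.
move=> v; rewrite mulmxA -mulmxA -trmx_mul mxE; apply: sumr_ge0 => i _.
by rewrite mxE -expr2 sqr_ge0.
Qed.

(** Let p be the root of m^T m and V = m p^-1, which is orthogonal. With s the root of p, take B1 =
    s V^T and B2 = s: then B1^T B2 = V p = m, while B1^T B1 = V p V^T and B2^T B2 = p both have the
    norm of m. *)
Lemma polar k (m : 'M[R]_k.+1) : m \in unitmx ->
  exists B1 B2 : 'M[R]_k.+1, [/\ B1^T *m B2 = m, fsq (B1^T *m B1) = fsq m &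
    fsq (B2^T *m B2) = fsq m].
Proof.
move=> um.
have [p [pp p2]] := psd_sqrt_exists (psd_gram m).
have [s [ps s2]] := psd_sqrt_exists pp.
have up : p \in unitmx.
  rewrite unitmxE; have : \det (p *m p) \is a GRing.unit.
    by rewrite p2 det_mulmx det_tr unitrM -unitmxE um.
  by rewrite det_mulmx unitrM => /andP[].
have pT : p^T = p by case: pp.
have sT : s^T = s by case: ps.
pose V := m *m invmx p.
have Vp : V *m p = m by rewrite /V -mulmxA mulVmx// mulmx1.
have VV : V^T *m V = 1%:M.
  rewrite /V trmx_mul trmx_inv pT -mulmxA [m^T *m _]mulmxA -p2 !mulmxA.
  by rewrite mulVmx// mul1mx mulmxV.
clearbody V; exists (s *m V^T), s; split.
- by rewrite trmx_mul trmxK sT -mulmxA s2.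
- rewrite trmx_mul trmxK sT -!mulmxA [s *m (s *m _)]mulmxA s2 !fsq_tr.
  rewrite !trmx_mul trmxK pT -!mulmxA [V^T *m (V *m _)]mulmxA VV mul1mx.
  by rewrite mxtrace_mulC -!mulmxA VV mulmx1 p2.
- by rewrite sT s2 !fsq_tr pT p2.
Qed.

(** The determinant of g + dl is the characteristic polynomial of - g at dl, with at most k roots;
    one of the k + 1 points eta / (j + 1) avoids them. *)
Lemma unit_perturbation k (g : 'M[R]_k) (eta : R) : 0 < eta ->
  exists2 dl, 0 <= dl <= eta & g + dl%:M \in unitmx.
Proof.
move=> eta0; apply: contrapT => H.
pose p := char_poly (- g).
have sp : size p = k.+1 by rewrite size_char_poly.
have p0 : p != 0 by rewrite -size_poly_eq0 sp.
pose s := [seq eta / j.+1%:R | j <- iota 0 k.+1].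
have us : uniq s.
  rewrite map_inj_uniq ?iota_uniq// => i j /(mulfI (lt0r_neq0 eta0)) /invr_inj /eqP.
  by rewrite eqr_nat => /eqP [].
have rs : all (root p) s.
  apply/allP => z /mapP[j _ ->]; apply: contrapT => nr; apply: H.
  exists (eta / j.+1%:R).
    apply/andP; split; first by rewrite divr_ge0// ltW.
    by rewrite ler_pdivrMr ?ltr0n// ler_peMr ?ler1n// ltW.
  rewrite unitmxE unitfE; apply/negP => d0; apply: nr.
  rewrite /root /p /char_poly -horner_evalE -det_map_mx.
  rewrite (_ : map_mx _ _ = g + (eta / j.+1%:R)%:M)//.
  apply/matrixP => a b; rewrite !mxE /=.
  by rewrite horner_evalE !hornerE hornerMn hornerX; ring.
have := max_poly_roots p0 rs us.
by rewrite sp size_map size_iota ltnn.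
Qed.

Lemma unit_net k (Y e : R) : 0 < e ->
  exists (J : finType) (m : J -> 'M[R]_k), (forall b, m b \in unitmx) /\
    forall A : 'I_k -> 'I_k -> R, (forall c d, `|A c d| <= Y) ->
      exists b, \sum_c \sum_d (A c d - m b c d) ^+ 2 <= e.
Proof.
move=> e0.
(* Rounding and the diagonal shift each move an entry by at most eta, so the k k entries contribute
   at most 4 eta^2 each; the successor keeps K positive when k = 0. *)
pose K : R := 4 * (k * k).+1%:R.
have K0 : 0 < K by rewrite mulr_gt0.
pose eta := Num.min 1 (e / K).
have eta0 : 0 < eta by rewrite lt_min ltr01 divr_gt0.
have eta2 : K * eta ^+ 2 <= e.
  rewrite -ler_pdivlMl// mulrC expr2; apply: (@le_trans _ _ (1 * eta)).
    by rewrite ler_pM2r// ge_min lexx.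
  by rewrite mul1r ge_min lexx orbT.
pose N := Num.truncn (`|Y| + eta^-1).
have hN : `|Y| + eta^-1 <= N.+1%:R.
  have /truncn_itv /andP[_ /ltW//] : 0 <= `|Y| + eta^-1 by rewrite addr_ge0// invr_ge0 ltW.
pose J := {ffun 'I_k * 'I_k -> rcode N}.
pose g (b : J) : 'M[R]_k := \matrix_(c, d) rval R (b (c, d)).
have [m hm] := choice (fun b => (let: ex_intro2 dl h1 h2 := unit_perturbation (g b) eta0 in ex_intro (fun dl => 0 <= dl <= eta /\ g b + dl%:M \in unitmx) dl (conj h1 h2))).
exists J, (fun b => g b + (m b)%:M); split.
  by move=> b; have [] := hm b.
move=> A AY; exists [ffun p => @ridx R N (A p.1 p.2)].
set b := [ffun _ => _]; have [/andP[m0 m1] _] := hm b.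
apply: (@le_trans _ _ (\sum_(c < k) \sum_(d < k) 4 * eta ^+ 2)).
  apply: ler_sum => c _; apply: ler_sum => d _.
  rewrite !mxE ffunE /= -/(rnd N (A c d)) opprD addrA.
  apply: le_trans (sqrB_le _ _) _.
  have -> : 4 * eta ^+ 2 = 2 * eta ^+ 2 + 2 * eta ^+ 2 by ring.
  apply: lerD; rewrite ler_pM2l//; apply: ler_sqr_abs; rewrite [leRHS]gtr0_norm//.
    apply: le_trans (rnd_close _) _.
      apply: le_trans (AY c d) _; apply: le_trans (ler_norm _) _.
      by apply: le_trans hN; rewrite lerDl invr_ge0 ltW.
    by rewrite invf_ple ?posrE ?ltr0n//; apply: le_trans hN; rewrite lerDr.
  by case: (c == d); rewrite ?mulr1n ?mulr0n ?normr0 ?ger0_norm// ltW.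
rewrite sumr_const card_ord sumr_const card_ord -mulrnA -[leLHS]mulr_natr.
apply: le_trans eta2; rewrite /K.
have kk : (k * k)%:R <= (k * k).+1%:R :> R by rewrite ler_nat.
have := ler_wpM2l (mulr_ge0 (ler0n R 4) (sqr_ge0 eta)) kk.
by move: (k * k)%:R (k * k).+1%:R => a0 b0; lra.
Qed.

End polar.

(** * Limit of the free energy *)

Section iid_pair.
Context (R : realType) d (T : measurableType d) (P : probability T R) (n : nat).
Variables (f h : T -> R) (i j : 'I_n).
Hypotheses (ij : i != j) (mf : measurable_fun setT f) (mh : measurable_fun setT h).
Hypotheses (f0 : forall x, 0 <= f x) (h0 : forall x, 0 <= h x).
Hypotheses (fi : P.-integrable setT (EFin \o f)) (hi : P.-integrable setT (EFin \o h)).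

Let prodE : (\int[iid_law P n]_t (f (tnth t i) * h (tnth t j))%:E =
  (\int[P]_x f x * \int[P]_x h x)%:E)%E.
Proof.
rewrite EFinM -!rintegralE// -(@ge0_integral_iid_tnth2 _ _ _ _ _ _ _ (EFin \o f) (EFin \o h) ij)//;
  exact/measurable_EFinP.
Qed.

Lemma iid_pair_measurable : measurable_fun setT (fun t : n.-tuple T => f (tnth t i) * h (tnth t j)).
Proof.
apply: measurable_funM.
  exact: (measurableT_comp mf (measurable_tnth i)).
exact: (measurableT_comp mh (measurable_tnth j)).
Qed.

Lemma iid_pair_integrable :
  (iid_law P n).-integrable setT (EFin \o (fun t : n.-tuple T => f (tnth t i) * h (tnth t j))).
Proof.
apply/integrableP; split; first by apply/measurable_EFinP; exact: iid_pair_measurable.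
rewrite (eq_integral (fun t : n.-tuple T => (f (tnth t i) * h (tnth t j))%:E)).
  by rewrite prodE ltry.
by move=> t _ /=; rewrite ger0_norm// mulr_ge0.
Qed.

Lemma Rintegral_iid_pair :
  \int[iid_law P n]_t (f (tnth t i) * h (tnth t j)) = \int[P]_x f x * \int[P]_x h x.
Proof. by rewrite /Rintegral prodE. Qed.

End iid_pair.

Section nmodel.
Context (R : realType) (k : nat) (P0 : probability (k.-tuple R) R).
Hypothesis P2 : forall c, P0.-integrable setT (EFin \o (fun x => tnth x c ^+ 2)).
Implicit Types (B : 'M[R]_k) (t : R).
Local Notation mom2 := (mom2 P0).

Definition nsq (x : k.-tuple R) : R := \sum_c tnth x c ^+ 2.

Lemma measurable_nsq : measurable_fun setT nsq.
Proof. by apply: measurable_sum => c; apply: measurable_funX; exact: measurable_tnth. Qed.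

Lemma nsq_ge0 x : 0 <= nsq x. Proof. by apply: sumr_ge0 => c _; exact: sqr_ge0. Qed.

Lemma nsq_integrable : P0.-integrable setT (EFin \o nsq).
Proof. exact: rintegrable_sum. Qed.

Lemma nsq_int : \int[P0]_x nsq x = mom2. Proof. exact: Rintegral_sum. Qed.

Definition dsq N (x : k.-tuple R) : R := \sum_c (tnth x c - rnd N (tnth x c)) ^+ 2.
Definition eps N : R := \int[P0]_x dsq N x.

Lemma measurable_rnd N c : measurable_fun setT (fun x : k.-tuple R => rnd N (tnth x c)).
Proof.
rewrite (_ : (fun x => _) = fun x => xv R (codeX N x) c); last first.
  by apply/funext => x; rewrite xvE.
exact: (measurable_fibers (@measurable_codeX R k N) (fun s => xv R s c)).
Qed.

Lemma measurable_dsq N : measurable_fun setT (dsq N).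
Proof.
apply: measurable_sum => c; apply: measurable_funX; apply: measurable_funB.
  exact: measurable_tnth.
exact: measurable_rnd.
Qed.

Lemma dsq_ge0 N x : 0 <= dsq N x. Proof. by apply: sumr_ge0 => c _; exact: sqr_ge0. Qed.

Lemma dsq_le N x : dsq N x <= 4 * nsq x.
Proof.
rewrite mulr_sumr; apply: ler_sum => c _; apply: le_trans (sqrB_le _ _) _.
by have := ler_sqr_abs (le_rnd N (tnth x c)); lra.
Qed.

Lemma dsq_integrable N : P0.-integrable setT (EFin \o dsq N).
Proof.
apply: (le_rintegrable _ _ (rintegrableZ 4 nsq_integrable)); first exact: measurable_dsq.
by move=> x; rewrite ger0_norm ?dsq_ge0//; exact: dsq_le.
Qed.

Lemma eps_ge0 N : 0 <= eps N.
Proof. by apply: Rintegral_ge0 => x _; exact: dsq_ge0. Qed.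

Lemma eps_cvg0 : eps N @[N --> \oo] --> (0 : R).
Proof.
rewrite -(Rintegral_prob_cst P0 0).
apply: (@rint_dominated _ _ _ _ _ _ (fun x => 4 * nsq x)).
- by move=> N; exact: measurable_dsq.
- exact: measurable_cst.
- move=> x; rewrite -[X in _ --> X](_ : \sum_(c < k) (tnth x c - tnth x c) * (tnth x c - tnth x c) = 0).
    apply: rcvg_sum => c; apply: cvgM; apply: cvgB; try exact: cvg_cst; exact: rnd_cvg.
  by apply: big1 => c _; rewrite subrr mulr0.
- exact: rintegrableZ nsq_integrable.
- by move=> N x; rewrite ger0_norm ?dsq_ge0//; exact: dsq_le.
Qed.

Lemma quad_le (q : 'M[R]_k) (v : 'I_k -> R) :
  \sum_c \sum_d q c d * (v c * v d) <= Num.sqrt (fsq q) * \sum_c v c ^+ 2.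
Proof.
set A := \sum_c _; set V := \sum_c _.
have V0 : 0 <= V by apply: sumr_ge0 => c _; exact: sqr_ge0.
apply: le_trans (ler_norm A) _.
rewrite -(ger0_norm (mulr_ge0 (sqrtr_ge0 (fsq q)) V0)) -ler_sqr ?nnegrE//.
rewrite !real_normK ?num_real// exprMn sqr_sqrtr; last first.
  by apply: sumr_ge0 => c _; apply: sumr_ge0 => d _; exact: sqr_ge0.
have := sum_CS (fun p : 'I_k * 'I_k => q p.1 p.2) (fun p => v p.1 * v p.2).
rewrite -(pair_bigA _ (fun c d => q c d * (v c * v d))) /=.
rewrite -(pair_bigA _ (fun c d => q c d ^+ 2)) /=.
rewrite -(pair_bigA _ (fun c d => (v c * v d) ^+ 2)) /=.
move=> /le_trans; apply; rewrite /fsq.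
apply: ler_wpM2l; first by do 2 (apply: sumr_ge0 => ? _); exact: sqr_ge0.
rewrite le_eqVlt; apply/orP; left; apply/eqP; rewrite expr2 /V mulr_suml.
by apply: eq_bigr => c _; rewrite mulr_sumr; apply: eq_bigr => d _; rewrite exprMn.
Qed.

Lemma sum_linear_sqr B (v : 'I_k -> R) :
  \sum_r (\sum_c B r c * v c) ^+ 2 <= Num.sqrt (fsq (B^T *m B)) * \sum_c v c ^+ 2.
Proof.
apply: le_trans (quad_le _ _); rewrite le_eqVlt; apply/orP; left; apply/eqP.
transitivity (\sum_r \sum_c \sum_d (B r c * B r d) * (v c * v d)).
  apply: eq_bigr => r _; rewrite expr2 mulr_suml; apply: eq_bigr => c _.
  by rewrite mulr_sumr; apply: eq_bigr => d _; ring.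
rewrite exchange_big /=; apply: eq_bigr => c _.
rewrite exchange_big /=; apply: eq_bigr => d _.
by rewrite mxE mulr_suml; apply: eq_bigr => r _; rewrite mxE; ring.
Qed.

(** The bound sees B only through |B^T B|, so one rounding serves all matrices. The upper bound
    relies on this, as its net is chosen after the rounding. *)
Lemma DK_approx t B N (c : R) : 0 <= t -> 0 < c ->
  `|DK P0 t B - D1 (@wN R k P0 N) (@xv R k N) t B| <=
  t * Num.sqrt (fsq (B^T *m B)) * (c / 2 * eps N + mom2 / c).
Proof.
move=> t0 c0; set F := Num.sqrt _; rewrite -(DK_fiber P0 _ _ t0).
have mS r : measurable_fun setT (scaled (linS B) t r).
  by apply: measurable_funM => //; exact: measurable_linS.
have mR := @measurable_linR R k N B t; have iR := linR_sqint P0 N B t.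
have iS r : P0.-integrable setT (EFin \o (fun x => scaled (linS B) t r x ^+ 2)).
  exact: (scaled_sqint (linS_sqint P2 B)).
apply: le_trans (Dch_close mS mR iS iR c0) _.
have tF : 0 <= t * F by rewrite mulr_ge0 ?sqrtr_ge0.
have bound (a : 'I_k -> k.-tuple R -> R) (V : 'I_k -> k.-tuple R -> R) (g : k.-tuple R -> R) :
    (forall r x, a r x = Num.sqrt t * \sum_c B r c * V c x) ->
    (forall x, \sum_c V c x ^+ 2 <= g x) ->
    (forall r, P0.-integrable setT (EFin \o (fun x => a r x ^+ 2))) ->
    P0.-integrable setT (EFin \o g) ->
    \sum_r \int[P0]_x a r x ^+ 2 <= t * F * \int[P0]_x g x.
  move=> aE Vg ai gi; rewrite -(Rintegral_sum _ ai) -(rintZ _ gi); apply: le_rint.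
  - exact: rintegrable_sum.
  - exact: rintegrableZ.
  move=> x; rewrite (eq_bigr (fun r => t * (\sum_c B r c * V c x) ^+ 2)); last first.
    by move=> r _; rewrite aE exprMn sqr_sqrtr.
  rewrite -mulr_sumr -mulrA; apply: ler_wpM2l => //.
  apply: le_trans (sum_linear_sqr _ _) _; apply: ler_wpM2l => //; exact: sqrtr_ge0.
have b1 : \sum_r \int[P0]_x (scaled (linS B) t r x - linR N B t r x) ^+ 2 <= t * F * eps N.
  apply: (bound (fun r x => scaled (linS B) t r x - linR N B t r x)
    (fun c x => tnth x c - rnd N (tnth x c))) => //.
  - move=> r x; rewrite /scaled /linR -mulrBr; congr (_ * _); rewrite /linS /Bx -sumrB.
    by apply: eq_bigr => a _; rewrite xvE mulrBr.
  - move=> r; apply: (@le_rintegrable _ _ _ _ _ (fun x => 2 * scaled (linS B) t r x ^+ 2 + 2 * linR N B t r x ^+ 2)).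
    + by apply: measurable_funX; exact: measurable_funB.
    + by move=> x; rewrite ger0_norm ?sqr_ge0//; exact: sqrB_le.
    + by apply: rintegrableD; exact: rintegrableZ.
  - exact: dsq_integrable.
have b2 : \sum_r \int[P0]_x scaled (linS B) t r x ^+ 2 <= t * F * mom2.
  rewrite -nsq_int; apply: (bound _ (fun c x => tnth x c)) => //; exact: nsq_integrable.
have b3 : \sum_r \int[P0]_x linR N B t r x ^+ 2 <= t * F * mom2.
  rewrite -nsq_int; apply: (bound _ (fun c x => rnd N (tnth x c))) => //.
  - move=> r x; congr (_ * _); apply: eq_bigr => a _; by rewrite xvE.
  - by move=> x; apply: ler_sum => a _; apply: ler_sqr_abs; exact: le_rnd.
  - exact: nsq_integrable.
move: b1 b2 b3; set X1 := \sum_r _; set X2 := \sum_r _; set X3 := \sum_r _ => b1 b2 b3.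
have -> : t * F * (c / 2 * eps N + mom2 / c) = c / 2 * (t * F * eps N) + (t * F * mom2 + t * F * mom2) / (2 * c).
  by field; rewrite gt_eqF.
apply: lerD; first by apply: ler_wpM2l => //; rewrite divr_ge0// ltW.
apply: ler_wpM2r; first by rewrite invr_ge0 mulr_ge0// ltW.
exact: lerD.
Qed.

Section size_n.
Variable n : nat.
Hypothesis n0 : (0 < n)%N.
Local Notation Pn := (iid_law P0 n).
Local Notation E := #|{: edge n}|.

Definition edgeS (e : 'I_E) (xs : n.-tuple (k.-tuple R)) : R :=
  (Num.sqrt n%:R)^-1 * \sum_c tnth (tnth xs (val (enum_val e)).1) c * tnth (tnth xs (val (enum_val e)).2) c.
Definition DN t := Dch Pn (scaled edgeS t).

Lemma edge_neq (e : edge n) : (val e).1 != (val e).2.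
Proof. by apply/negP => /eqP h; have := valP e; rewrite /= h ltnn. Qed.

Lemma measurable_edgeS e : measurable_fun setT (edgeS e).
Proof.
apply: measurable_funM => //; apply: measurable_sum => c.
by apply: measurable_funM; exact: (measurableT_comp (measurable_tnth c) (measurable_tnth _)).
Qed.

Let nR : 0 < n%:R :> R. Proof. by rewrite ltr0n. Qed.

(** The endpoints of an edge are independent, so a product over them is square integrable although
    the prior has two moments only; the symmetric right-hand side suits a rounding error that can
    fall on either endpoint. *)
Lemma edge_bound (e : edge n) (a : n.-tuple (k.-tuple R) -> R) (C : R) (f g : k.-tuple R -> R) :
  measurable_fun setT a -> measurable_fun setT f -> measurable_fun setT g ->
  (forall x, 0 <= f x) -> (forall x, 0 <= g x) ->
  P0.-integrable setT (EFin \o f) -> P0.-integrable setT (EFin \o g) ->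
  (forall xs, a xs ^+ 2 <= C * (f (tnth xs (val e).1) * g (tnth xs (val e).2) +
                               g (tnth xs (val e).1) * f (tnth xs (val e).2))) ->
  Pn.-integrable setT (EFin \o (fun xs => a xs ^+ 2)) /\
  \int[Pn]_xs a xs ^+ 2 <= 2 * C * (\int[P0]_x f x * \int[P0]_x g x).
Proof.
move=> ma mf mg f0 g0 fi gi le; have ne := edge_neq e.
have i1 := iid_pair_integrable ne mf mg f0 g0 fi gi.
have i2 := iid_pair_integrable ne mg mf g0 f0 gi fi.
have iC := rintegrableZ C (rintegrableD i1 i2).
have ia : Pn.-integrable setT (EFin \o (fun xs => a xs ^+ 2)).
  apply: (le_rintegrable _ _ iC); first exact: measurable_funX.
  by move=> xs; rewrite ger0_norm ?sqr_ge0.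
split => //; apply: le_trans (le_rint ia iC le) _.
rewrite (rintZ _ (rintegrableD i1 i2)) (rintD i1 i2).
rewrite (Rintegral_iid_pair ne mf mg f0 g0 fi gi) (Rintegral_iid_pair ne mg mf g0 f0 gi fi).
by rewrite le_eqVlt; apply/orP; left; apply/eqP; ring.
Qed.

Lemma edgeS_sqint t e : Pn.-integrable setT (EFin \o (fun xs => scaled edgeS t e xs ^+ 2)) /\
  (0 <= t -> \int[Pn]_xs scaled edgeS t e xs ^+ 2 <= t / n%:R * mom2 ^+ 2).
Proof.
have H : forall t, 0 <= t -> Pn.-integrable setT (EFin \o (fun xs => scaled edgeS t e xs ^+ 2)) /\
  \int[Pn]_xs scaled edgeS t e xs ^+ 2 <= t / n%:R * mom2 ^+ 2.
  move=> s s0.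
  have -> : s / n%:R * mom2 ^+ 2 = 2 * (2^-1 * (s / n%:R)) * (\int[P0]_x nsq x * \int[P0]_x nsq x).
    by rewrite nsq_int; field; rewrite gt_eqF.
  apply: (edge_bound (e := enum_val e)) => //; try exact: measurable_nsq;
    try exact: nsq_ge0; try exact: nsq_integrable.
    by apply: measurable_funM => //; exact: measurable_edgeS.
  move=> xs; rewrite /scaled /edgeS !exprMn exprVn (sqr_sqrtr s0) (sqr_sqrtr (ltW nR)).
  set x := tnth xs _; set y := tnth xs _.
  have := sum_CS (fun c => tnth x c) (fun c => tnth y c); rewrite -/(nsq x) -/(nsq y).
  set d := (_ ^+ 2) => h.
  have -> : 2^-1 * (s / n%:R) * (nsq x * nsq y + nsq x * nsq y) = s * (n%:R^-1 * (nsq x * nsq y)).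
    by field; rewrite gt_eqF.
  by apply: ler_wpM2l => //; apply: ler_wpM2l => //; rewrite invr_ge0 ltW.
have [t0|t0] := leP 0 t; first by have [] := H t t0.
split; last by [].
rewrite (_ : (fun xs => _) = fun xs => scaled edgeS 0 e xs ^+ 2); first by have [] := H 0 (lexx _).
by apply/funext => xs; rewrite /scaled sqrtr0 ltr0_sqrtr.
Qed.

Definition codeN N (xs : n.-tuple (k.-tuple R)) : {ffun 'I_n -> {ffun 'I_k -> rcode N}} :=
  [ffun i => codeX N (tnth xs i)].

Lemma measurable_codeN N s : measurable (codeN N @^-1` [set s]).
Proof.
rewrite (_ : _ @^-1` _ = \big[setI/setT]_r ((fun xs : n.-tuple (k.-tuple R) => tnth xs r)
    @^-1` (codeX N @^-1` [set s r]))).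
  apply: bigsetI_measurable => r _; rewrite -[X in measurable X]setTI.
  by apply: measurable_tnth => //; exact: measurable_codeX.
apply/seteqP; split => w.
  by move=> /= <-; rewrite -bigcap_seq => r _ /=; rewrite ffunE.
rewrite -bigcap_seq => H /=; apply/ffunP => r; rewrite ffunE.
by have := H r; rewrite /= mem_index_enum => /(_ isT).
Qed.

Lemma codeN_weight N : fiber_weight Pn (codeN N) = @prodw R _ (@wN R k P0 N) n.
Proof.
apply/funext => s; rewrite /fiber_weight /prodw /wN.
have mc c := @measurable_codeX R k N c.
rewrite -[X in Pn X]setIT -(integral_indic Pn)//; last exact: measurable_codeN.
pose f (i : 'I_n) (x : k.-tuple R) : \bar R := (\1_(codeX N @^-1` [set s i]) x)%:E.
have mf i : measurable_fun setT (f i).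
  by apply/measurable_EFinP; exact: measurable_indic.
have f0 i x : (0 <= f i x)%E by rewrite lee_fin.
rewrite (eq_integral (fun xs => \prod_(i < n) f i (tnth xs i))%E).
  rewrite (ge0_integral_iid_prod P0 mf f0).
  rewrite (eq_bigr (fun i => (fine (P0 (codeX N @^-1` [set s i])))%:E)).
    by rewrite prodEFin.
  move=> i _; rewrite fineK ?fin_num_measure// /f integral_indic// setIT//.
move=> xs _; rewrite /f prodEFin; congr EFin.
rewrite indicE; case: (boolP (xs \in codeN N @^-1` [set s])) => [|].
  rewrite inE /= => <-; rewrite big1// => i _; rewrite indicE mem_set//=.
  by rewrite ffunE.
move=> /negP nin; apply/esym/eqP/prodf_eq0.
apply: contrapT => H; apply: nin; rewrite inE /=; apply/ffunP => i; rewrite ffunE.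
by apply: contrapT => ne; apply: H; exists i => //; rewrite indicE memNset.
Qed.

Definition edgeR N t (e : 'I_E) xs : R := Num.sqrt t * edot (@xv R k N) (enum_val e) (codeN N xs).

Lemma DN_fiber N t : 0 <= t -> Dch Pn (edgeR N t) = Dn (@wN R k P0 N) n (@xv R k N) t.
Proof.
move=> t0.
by rewrite (Dch_fiber Pn (@measurable_codeN N) (fun e : 'I_E => edot (@xv R k N) (enum_val e)) t0) codeN_weight.
Qed.

(** There are at most n^2 edges, each with a signal of second moment O(1 / n): the error is n times
    a quantity free of n, hence negligible after division by n, uniformly in n. *)
Lemma DN_approx t N (c : R) : 0 <= t -> 0 < c ->
  `|DN t - Dn (@wN R k P0 N) n (@xv R k N) t| <=
  n%:R * t * (2 * c * eps N * mom2 + mom2 ^+ 2 / c).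
Proof.
move=> t0 c0; rewrite -(DN_fiber _ t0).
have mS e : measurable_fun setT (scaled edgeS t e).
  by apply: measurable_funM => //; exact: measurable_edgeS.
have mR e : measurable_fun setT (edgeR N t e).
  exact: (measurable_fiber_signal (@measurable_codeN N) (fun e : 'I_E => edot (@xv R k N) (enum_val e)) t e).
have iR (e : 'I_E) : Pn.-integrable setT (EFin \o (fun xs => edgeR N t e xs ^+ 2)) :=
  fiber_signal_sqr Pn (@measurable_codeN N) (fun e : 'I_E => edot (@xv R k N) (enum_val e)) t e.
have iS e := (edgeS_sqint t e).1.
apply: le_trans (Dch_close mS mR iS iR c0) _.
have card (f : 'I_E -> R) (C : R) : 0 <= C -> (forall e, f e <= t / n%:R * C) -> \sum_e f e <= n%:R * t * C.
  move=> C0 fC; apply: (@le_trans _ _ (\sum_(e : 'I_E) t / n%:R * C)); first exact: ler_sum.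
  rewrite sumr_const card_ord -[leLHS]mulr_natl.
  have -> : n%:R * t * C = (n * n)%:R * (t / n%:R * C) by rewrite natrM; field; rewrite gt_eqF.
  apply: ler_wpM2r; first by rewrite !mulr_ge0// invr_ge0 ltW.
  by rewrite ler_nat; exact: card_edge_le.
have rE (xs : n.-tuple (k.-tuple R)) i c' : xv R (codeN N xs i) c' = rnd N (tnth (tnth xs i) c').
  by rewrite ffunE xvE.
have m20 := mom2_ge0 P0; have e0 := eps_ge0 N.
have b1 : \sum_e \int[Pn]_xs (scaled edgeS t e xs - edgeR N t e xs) ^+ 2 <= n%:R * t * (4 * eps N * mom2).
  apply: card; first by rewrite !mulr_ge0.
  move=> e.
  have -> : t / n%:R * (4 * eps N * mom2) = 2 * (2 * (t / n%:R)) * (\int[P0]_x dsq N x * \int[P0]_x nsq x).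
    by rewrite nsq_int /eps; ring.
  apply: (edge_bound (e := enum_val e) _ (measurable_dsq N) measurable_nsq (@dsq_ge0 N) nsq_ge0
     (dsq_integrable N) nsq_integrable _).2; first exact: measurable_funB.
  move=> xs; rewrite /scaled /edgeR /edgeS /edot /dotx -!mulrBr !exprMn exprVn (sqr_sqrtr t0) (sqr_sqrtr (ltW nR)).
  set i := (val _).1; set j := (val _).2; set x := tnth xs i; set y := tnth xs j.
  (* With x', y' the rounded vectors: x . y - x' . y' = (x - x') . y + x' . (y - y'). *)
  have -> : \sum_c tnth x c * tnth y c - \sum_c xv R (codeN N xs i) c * xv R (codeN N xs j) c =
      \sum_c (tnth x c - rnd N (tnth x c)) * tnth y c + \sum_c rnd N (tnth x c) * (tnth y c - rnd N (tnth y c)).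
    by rewrite -sumrB -big_split /=; apply: eq_bigr => a _; rewrite !rE; ring.
  have h1 := sum_CS (fun a => tnth x a - rnd N (tnth x a)) (fun a => tnth y a).
  have h2 := sum_CS (fun a => rnd N (tnth x a)) (fun a => tnth y a - rnd N (tnth y a)).
  rewrite -/(dsq N x) -/(nsq y) in h1; rewrite -/(dsq N y) in h2.
  set U := \sum_c _ in h1 *; set V := \sum_c _ in h2 *.
  have h3 : \sum_a rnd N (tnth x a) ^+ 2 <= nsq x.
    by apply: ler_sum => a _; apply: ler_sqr_abs; exact: le_rnd.
  have h4 : V ^+ 2 <= nsq x * dsq N y.
    by apply: le_trans h2 _; apply: ler_wpM2r => //; exact: dsq_ge0.
  have -> : 2 * (t / n%:R) * (dsq N x * nsq y + nsq x * dsq N y) =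
     t * (n%:R^-1 * (2 * (dsq N x * nsq y) + 2 * (nsq x * dsq N y))) by ring.
  apply: ler_wpM2l => //; apply: ler_wpM2l; first by rewrite invr_ge0 ltW.
  by apply: le_trans (sqrD_le _ _) _; apply: lerD; rewrite ler_pM2l.
have b2 : \sum_e \int[Pn]_xs scaled edgeS t e xs ^+ 2 <= n%:R * t * mom2 ^+ 2.
  by apply: card; [exact: sqr_ge0|move=> e; exact: (edgeS_sqint t e).2].
have b3 : \sum_e \int[Pn]_xs edgeR N t e xs ^+ 2 <= n%:R * t * mom2 ^+ 2.
  apply: card; first exact: sqr_ge0.
  move=> e.
  have -> : t / n%:R * mom2 ^+ 2 = 2 * (2^-1 * (t / n%:R)) * (\int[P0]_x nsq x * \int[P0]_x nsq x).
    by rewrite nsq_int; field; rewrite gt_eqF.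
  apply: (edge_bound (e := enum_val e) _ measurable_nsq measurable_nsq nsq_ge0 nsq_ge0
     nsq_integrable nsq_integrable _).2; first exact: mR.
  move=> xs; rewrite /edgeR /edot /dotx !exprMn exprVn (sqr_sqrtr t0) (sqr_sqrtr (ltW nR)).
  set i := (val _).1; set j := (val _).2; set x := tnth xs i; set y := tnth xs j.
  have h := sum_CS (fun c => xv R (codeN N xs i) c) (fun c => xv R (codeN N xs j) c).
  have hx (z : 'I_n) : \sum_c xv R (codeN N xs z) c ^+ 2 <= nsq (tnth xs z).
    by apply: ler_sum => a _; rewrite rE; apply: ler_sqr_abs; exact: le_rnd.
  have s0 (z : 'I_n) : 0 <= \sum_c xv R (codeN N xs z) c ^+ 2.
    by apply: sumr_ge0 => a _; exact: sqr_ge0.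
  have -> : 2^-1 * (t / n%:R) * (nsq x * nsq y + nsq x * nsq y) = t * (n%:R^-1 * (nsq x * nsq y)).
    by field; rewrite gt_eqF.
  apply: ler_wpM2l => //; apply: ler_wpM2l; first by rewrite invr_ge0 ltW.
  by apply: le_trans h _; apply: ler_pM => //; exact: hx.
move: b1 b2 b3; set X1 := \sum_e _; set X2 := \sum_e _; set X3 := \sum_e _ => b1 b2 b3.
have -> : n%:R * t * (2 * c * eps N * mom2 + mom2 ^+ 2 / c) =
   c / 2 * (n%:R * t * (4 * eps N * mom2)) + (n%:R * t * mom2 ^+ 2 + n%:R * t * mom2 ^+ 2) / (2 * c).
  by field; rewrite gt_eqF.
apply: lerD; first by apply: ler_wpM2l => //; rewrite divr_ge0// ltW.
apply: ler_wpM2r; first by rewrite invr_ge0 mulr_ge0// ltW.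
exact: lerD.
Qed.

End size_n.
End nmodel.

Lemma sqrt_eventually (R : realType) (C e : R) : 0 <= C -> 0 < e ->
  exists n1, forall n, (n1 <= n)%N -> C * Num.sqrt n%:R <= n%:R * e.
Proof.
move=> C0 e0; exists (Num.truncn ((C / e) ^+ 2)).+1 => n hn.
set r := Num.sqrt n%:R; have r0 : 0 <= r by exact: sqrtr_ge0.
have rr : n%:R = r * r by rewrite -expr2 sqr_sqrtr.
rewrite rr -mulrA mulrC; apply: ler_wpM2l => //.
rewrite -ler_pdivrMr// -ler_sqr ?nnegrE//; last exact: divr_ge0 C0 (ltW e0).
rewrite [leRHS]expr2 -rr.
have /truncn_itv /andP[_ h] : 0 <= (C / e) ^+ 2 by exact: sqr_ge0.
by apply: le_trans (ltW h) _; rewrite ler_nat.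
Qed.

Section limit.
Context (R : realType) (k : nat) (P0 : probability (k.-tuple R) R).
Hypothesis P2 : forall c, P0.-integrable setT (EFin \o (fun x => tnth x c ^+ 2)).
Implicit Types (B : 'M[R]_k) (t : R).
Local Notation mom2 := (mom2 P0).

Lemma approximation (dl : R) : 0 < dl -> exists N, forall t, 0 <= t ->
  (forall n, (0 < n)%N -> `|DN P0 n t - Dn (@wN R k P0 N) n (@xv R k N) t| <= n%:R * t * dl) /\
  forall B, `|DK P0 t B - D1 (@wN R k P0 N) (@xv R k N) t B| <=
    t * Num.sqrt (fsq (B^T *m B)) * dl.
Proof.
move=> d0; have m0 := mom2_ge0 P0.
(* First c makes the terms in 1 / c small, then N makes c [eps] N small. *)
pose c := 2 * (mom2 ^+ 2 + mom2 + 1) / dl.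
have c0 : 0 < c.
  by rewrite divr_gt0// mulr_gt0// ltr_wpDl// addr_ge0// sqr_ge0.
have mc : mom2 ^+ 2 / c + mom2 / c <= dl / 2.
  rewrite -mulrDl ler_pdivrMr//.
  have -> : dl / 2 * c = mom2 ^+ 2 + mom2 + 1 by rewrite /c; field; rewrite gt_eqF.
  by rewrite lerDl.
pose e := dl / (4 * c * (mom2 + 1)).
have m1 : 0 < mom2 + 1 by rewrite ltr_wpDl.
have e0 : 0 < e by apply: divr_gt0 => //; apply: mulr_gt0 m1; exact: mulr_gt0.
move/cvgrPdist_le : (eps_cvg0 P2) => /(_ e e0)[N _ HN].
have := HN N (leqnn N); rewrite sub0r normrN ger0_norm ?eps_ge0// => eN.
have m2c : 0 <= mom2 ^+ 2 / c by rewrite divr_ge0 ?sqr_ge0// ltW.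
have m1c : 0 <= mom2 / c by rewrite divr_ge0// ltW.
have E0 := eps_ge0 P0 N.
have h : 2 * c * eps P0 N * (mom2 + 1) <= dl / 2.
  have -> : dl / 2 = 2 * c * e * (mom2 + 1).
    by rewrite /e; field; rewrite !gt_eqF.
  apply: ler_wpM2r; first by rewrite addr_ge0.
  by apply: ler_wpM2l => //; rewrite mulr_ge0// ltW.
have cE : 0 <= c * eps P0 N by rewrite mulr_ge0// ltW.
have cEm : 0 <= c * eps P0 N * mom2 by rewrite mulr_ge0.
have hh : 2 * c * eps P0 N * (mom2 + 1) = 2 * (c * eps P0 N * mom2) + 2 * (c * eps P0 N) by ring.
exists N => t t0; split.
  move=> n n0; apply: le_trans (DN_approx P2 n0 N t0 c0) _.
  apply: ler_wpM2l; first by rewrite mulr_ge0.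
  have -> : 2 * c * eps P0 N * mom2 = 2 * (c * eps P0 N * mom2) by ring.
  lra.
move=> B; apply: le_trans (DK_approx P2 B N t0 c0) _.
apply: ler_wpM2l; first by rewrite mulr_ge0// sqrtr_ge0.
have -> : c / 2 * eps P0 N = 2^-1 * (c * eps P0 N) by ring.
lra.
Qed.

(** The rounded prior has bounded support; this crude bound depends on N alone and is fixed before n
    grows. *)
Definition Xmax N : R := \sum_s dotx (@xv R k N) s s.

Lemma dotx_ge0 N s : 0 <= dotx (@xv R k N) s s.
Proof. by apply: sumr_ge0 => c _; rewrite -expr2 sqr_ge0. Qed.

Lemma Xmax_ge N s : dotx (@xv R k N) s s <= Xmax N.
Proof. by rewrite /Xmax (bigD1 s)//= lerDl sumr_ge0// => s' _; exact: dotx_ge0. Qed.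

Lemma abs_ovl N n (s s' : {ffun 'I_n -> {ffun 'I_k -> rcode N}}) c d : (0 < n)%N ->
  `|ovl (@xv R k N) s s' c d| <= Xmax N.
Proof.
move=> n0; have nR : 0 < n%:R :> R by rewrite ltr0n.
rewrite /ovl normrM ger0_norm ?invr_ge0 ?ler0n// ler_pdivrMl//.
apply: le_trans (ler_norm_sum _ _ _) _.
have -> : n%:R * Xmax N = \sum_(i < n) Xmax N by rewrite sumr_const card_ord mulr_natl.
apply: ler_sum => i _; set x := @xv R k N.
have hx u a : x u a ^+ 2 <= Xmax N.
  apply: le_trans (Xmax_ge u); rewrite /dotx (bigD1 a)//= -expr2 lerDl.
  by apply: sumr_ge0 => b _; rewrite -expr2 sqr_ge0.
have := hx (s i) c; have := hx (s' i) d; rewrite normrM.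
rewrite -(real_normK (num_real (x (s i) c))) -(real_normK (num_real (x (s' i) d))).
set a := `|_|; set b := `|_|; have := sqr_ge0 (a - b); rewrite sqrrB; lra.
Qed.

Lemma DN_eventually_ge t B (e : R) : 0 <= t -> 0 < e ->
  exists n1, forall n, (0 < n)%N -> (n1 <= n)%N ->
    n%:R * (DK P0 t B - t * fsq (B^T *m B) / 4 - e) <= DN P0 n t.
Proof.
move=> t0 e0; set F := Num.sqrt (fsq (B^T *m B)).
have F0 : 0 <= F by exact: sqrtr_ge0.
pose dl := e / (2 * ((t + 1) * (F + 1))).
have t1 : 0 < t + 1 by rewrite ltr_wpDl.
have F1 : 0 < F + 1 by rewrite ltr_wpDl.
have tF : 0 < (t + 1) * (F + 1) by exact: mulr_gt0.
have dl0 : 0 < dl by rewrite divr_gt0// mulr_gt0.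
have [N /(_ t t0)[aN aK]] := approximation dl0.
have [n1 hn1] := @sqrt_eventually R (t * (Xmax N ^+ 2 / 4)) (e / 2)
  (mulr_ge0 t0 (divr_ge0 (sqr_ge0 _) (ler0n _ 4))) (divr_gt0 e0 (ltr0Sn _ 1)).
exists n1 => n n0 hn.
have nR : 1 <= n%:R :> R by rewrite ler1n.
have := aN n n0; rewrite ler_norml => /andP[h1 _].
have := aK B; rewrite -/F ler_norml => /andP[_ h2].
have h3 := Dn_lower (@wN_ge0 R k P0 N) (@wN_sum R k P0 N) n0 (@Xmax_ge N) t0 B.
have h4 := hn1 n hn.
have h5 : t * (Xmax N ^+ 2 / 4) <= t * (Xmax N ^+ 2 / 4) * Num.sqrt n%:R.
  rewrite ler_peMr//; first by rewrite mulr_ge0// divr_ge0// sqr_ge0.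
  by rewrite -[leLHS]sqrtr1 ler_wsqrtr.
have h6 : t * dl + t * F * dl <= e / 2.
  have -> : e / 2 = (t + 1) * (F + 1) * dl by rewrite /dl; field; rewrite !gt_eqF.
  have := mulr_ge0 F0 (ltW dl0); have -> : (t + 1) * (F + 1) * dl = t * dl + t * F * dl + F * dl + dl by ring.
  lra.
have n0R : 0 <= n%:R :> R by [].
have h7 := ler_wpM2l n0R h6; have h8 := ler_wpM2l n0R h2.
move: h1 h3 h5 h4 h7 h8; set a := DN _ _ _; set b := Dn _ _ _ _; set c := DK _ _ _.
set d := D1 _ _ _ _; set f := fsq _; set r := Num.sqrt _; set m := n%:R.
clearbody a b c d f r m F dl => h1 h3 h5 h4 h7 h8.
have : m * (c - t * f / 4 - e) = m * (c - d) + m * d - m * t * f / 4 - m * e by ring.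
lra.
Qed.

End limit.

Section limit_upper.
Context (R : realType) (k' : nat).
Local Notation k := k'.+1.
Context (P0 : probability (k.-tuple R) R).
Hypothesis P2 : forall c, P0.-integrable setT (EFin \o (fun x => tnth x c ^+ 2)).
Implicit Types (B : 'M[R]_k) (t : R).
Local Notation mom2 := (mom2 P0).

(** Comparison with B = 0. The entropy grows at most linearly in |B^T B| against a quadratic
    penalty, which confines the maximization. *)
Lemma DK_le t B : 0 <= t -> DK P0 t B <= t * (Num.sqrt (fsq (B^T *m B)) / 2 * mom2).
Proof.
move=> t0; have := @DK_gram R k P0 P2 t B 0 _ t0 (sqrtr_ge0 (fsq (B^T *m B))).
rewrite (DK0 P0) add0r; apply => v; apply: le_trans (quad_le _ _) _.
by rewrite lerDr mulmx0 big1// => c _; rewrite big1// => d _; rewrite mxE mul0r.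
Qed.

Lemma DN_eventually_le t (G e : R) : 0 <= t -> 0 < e ->
  (forall B, DK P0 t B - t * fsq (B^T *m B) / 4 <= G) ->
  exists n1, forall n, (0 < n)%N -> (n1 <= n)%N -> DN P0 n t <= n%:R * (G + e).
Proof.
move=> t0 e0 hG; have m0 := mom2_ge0 P0.
have G0 : 0 <= G.
  have := hG 0; rewrite (DK0 P0) mulmx0 /fsq big1; first by rewrite mulr0 mul0r subrr.
  by move=> c _; rewrite big1// => d _; rewrite mxE expr0n.
(* The rounding error at a point m of the net is proportional to |m|. Up to F0 it is at most t F0
   dl; beyond F0 the quadratic penalty exceeds the linear growth of the entropy, error included,
   since dl <= 1. *)
pose F0 := 2 * mom2 + 4.
have F00 : 0 < F0 by rewrite ltr_wpDl// mulr_ge0.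
pose dl := Num.min 1 (e / (4 * ((t + 1) * (F0 + 1)))).
have t1 : 0 < t + 1 by rewrite ltr_wpDl.
have F1 : 0 < F0 + 1 by rewrite addr_gt0.
have dl0 : 0 < dl by rewrite lt_min ltr01 divr_gt0// !mulr_gt0.
have dl1 : dl <= 1 by rewrite ge_min lexx.
have dle : (t + 1) * (F0 + 1) * dl <= e / 4.
  have -> : e / 4 = (t + 1) * (F0 + 1) * (e / (4 * ((t + 1) * (F0 + 1)))).
    by field; rewrite !gt_eqF.
  by apply: ler_wpM2l; [rewrite mulr_ge0// ltW|rewrite ge_min lexx orbT].
have [N /(_ t t0)[aN aK]] := approximation P2 dl0.
pose e1 := e / (2 * (t + 1)).
have e10 : 0 < e1 by rewrite divr_gt0// mulr_gt0.
have te1 : t * e1 / 2 <= e / 4.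
  have -> : e / 4 = (t + 1) * e1 / 2 by rewrite /e1; field; rewrite gt_eqF.
  by have := ltW e10; rewrite mulrDl mul1r; lra.
have [J [m [um cov]]] := @unit_net R k (Xmax R k N) e1 e10.
have HB b : exists f : 'M[R]_k * 'M[R]_k, [/\ f.1^T *m f.2 = m b,
    fsq (f.1^T *m f.1) = fsq (m b) & fsq (f.2^T *m f.2) = fsq (m b)].
  by have [B1 [B2 H]] := polar (um b); exists (B1, B2).
have [B12 hB] := choice HB.
pose B1 b := (B12 b).1; pose B2 b := (B12 b).2.
pose w := @wN R k P0 N; pose x := @xv R k N.
pose C := t * (Xmax R k N ^+ 2 / 4) + `|ln #|J|%:R| + `|dev_const w x (Xmax R k N) t B1 B2|.
have tX0 : 0 <= t * (Xmax R k N ^+ 2 / 4) by rewrite mulr_ge0// divr_ge0// sqr_ge0.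
have C0 : 0 <= C by rewrite !addr_ge0.
have [n1 hn1] := @sqrt_eventually R C (e / 4) C0 (divr_gt0 e0 (ltr0Sn _ 3)).
exists n1 => n n0 hn.
have nR : 1 <= n%:R :> R by rewrite ler1n.
have n0R : 0 <= n%:R :> R by [].
have hb b : \sum_s w s * hmix w x t (B1 b) (B2 b) s - t * fsq (m b) / 4 <= G + t * F0 * dl.
  have h1 := hmix_le P0 N (B1 b) (B2 b) t0; rewrite (DK_fiber P0 _ _ t0) in h1.
  have [_ _ f2] := hB b; have := aK (B2 b); rewrite f2.
  have h2 := hG (B2 b); rewrite f2 in h2.
  have h3 := DK_le (B2 b) t0; rewrite f2 in h3.
  rewrite ler_norml => /andP[h4 _].
  have fF : fsq (m b) = Num.sqrt (fsq (m b)) * Num.sqrt (fsq (m b)).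
    rewrite -expr2 sqr_sqrtr//; do 2 (apply: sumr_ge0 => ? _); exact: sqr_ge0.
  move: fF h1 h2 h3 h4; rewrite -/w -/x.
  set F := Num.sqrt _; have : 0 <= F by exact: sqrtr_ge0.
  clearbody F; set f := fsq (m b); clearbody f => Fp ->.
  set p := \sum_s _; set q := D1 _ _ _ _; set u := DK _ _ _.
  clearbody p q u; move=> h1 h2 h3 h4.
  have [FF|FF] := leP F F0.
    have : t * F * dl <= t * F0 * dl.
      by apply: ler_wpM2r; [exact: ltW|exact: ler_wpM2l].
    lra.
  have h5 : t * F * (mom2 / 2 + dl - F / 4) <= 0.
    apply: mulr_ge0_le0; first exact: mulr_ge0.
    by rewrite /F0 in FF; lra.
  have h6 : 0 <= t * F0 * dl by rewrite !mulr_ge0// ltW.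
  have E : t * F * (mom2 / 2 + dl - F / 4) = t * (F / 2 * mom2) + t * F * dl - t * (F * F) / 4 by ring.
  rewrite E in h5; lra.
pose U := n%:R * (G + t * F0 * dl + t * e1 / 2) + t * (Xmax R k N ^+ 2 / 4).
have cover (s s' : {ffun 'I_n -> {ffun 'I_k -> rcode N}}) : exists b : J,
    \sum_c \sum_d (ovl x s s' c d - ((B1 b)^T *m B2 b) c d) ^+ 2 <= e1.
  have [b Hb] := cov (ovl x s s') (fun c d => abs_ovl R s s' c d n0).
  by exists b; have [-> _ _] := hB b.
have hU b : n%:R * (\sum_s w s * hmix w x t (B1 b) (B2 b) s) +
    t * (n%:R * (e1 / 2 - fsq ((B1 b)^T *m B2 b) / 2 + fsq ((B1 b)^T *m B1 b) / 4) +
      Xmax R k N ^+ 2 / 4) <= U.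
  have [-> f1 _] := hB b; rewrite f1 /U.
  have := ler_wpM2l n0R (hb b).
  set p := \sum_s _; set f := fsq _; set X := Xmax R k N; clearbody p f X => h.
  have -> : n%:R * p + t * (n%:R * (e1 / 2 - f / 2 + f / 4) + X ^+ 2 / 4) =
    n%:R * (p - t * f / 4) + n%:R * (t * e1 / 2) + t * (X ^+ 2 / 4) by field.
  rewrite mulrDr; lra.
have := Dn_upper (@wN_ge0 R k P0 N) (@wN_sum R k P0 N) n0 (@Xmax_ge R k N) t0 cover hU.
have := aN n n0; rewrite ler_norml => /andP[_ h1] h2.
have r1 : 1 <= Num.sqrt n%:R :> R by rewrite -[leLHS]sqrtr1 ler_wsqrtr.
have hC := hn1 n hn.
have hl := ler_norm (ln #|J|%:R : R).
have hd := ler_norm (dev_const w x (Xmax R k N) t B1 B2).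
have hrd : Num.sqrt n%:R * dev_const w x (Xmax R k N) t B1 B2 <=
    Num.sqrt n%:R * `|dev_const w x (Xmax R k N) t B1 B2|.
  by apply: ler_wpM2l => //; exact: sqrtr_ge0.
have hr1 : t * (Xmax R k N ^+ 2 / 4) + `|ln #|J|%:R| <=
    Num.sqrt n%:R * (t * (Xmax R k N ^+ 2 / 4) + `|ln #|J|%:R|).
  by rewrite ler_peMl// addr_ge0.
have h7 := ler_wpM2l n0R dle; have h8 := ler_wpM2l n0R te1.
have h9' : t * F0 * dl + t * dl <= (t + 1) * (F0 + 1) * dl.
  by have := mulr_ge0 (ltW F00) (ltW dl0); have := ltW dl0; lra.
have h9 := ler_wpM2l n0R h9'.
have h10 := mulr_ge0 n0R (ltW e0).
move: h1 h2 hC hl hrd hr1; rewrite /C /U.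
set a := DN _ _ _; set b := Dn _ _ _ _; set r := Num.sqrt _; set L := ln _.
set V := dev_const _ _ _ _ _ _; set Y := t * (_ / 4).
move: h7 h8 h9 h10; set mm := n%:R.
clearbody a b r L V Y mm => h7 h8 h9 h10 h1 h2 hC hl hrd hr1.
have E1 : (Y + `|L| + `|V|) * r = r * (Y + `|L|) + r * `|V| by ring.
rewrite E1 in hC; move: h7 h8 h9 h1 h2; clear -hC hl hrd hr1 h10.
by move: (t * F0 * dl) (t * e1 / 2) ((t + 1) * (F0 + 1) * dl) => T1 T2 T3; lra.
Qed.

End limit_upper.

(** * The variational problem *)

Lemma fcvg_sum (R : realType) (T : Type) (F : set_system T) (FF : Filter F)
    (J : Type) (s : seq J) (f : J -> T -> R) (l : J -> R) :
  (forall j, f j x @[x --> F] --> l j) ->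
  \sum_(j <- s) f j x @[x --> F] --> \sum_(j <- s) l j.
Proof.
move=> fl; elim: s => [|j s IH].
  by under eq_fun do rewrite big_nil; rewrite big_nil; exact: cvg_cst.
by under eq_fun do rewrite big_cons; rewrite big_cons; exact: cvgD.
Qed.

Section jumps.
Context (R : realType) (N : R -> R).

(* The rational r picks out the jump, whence countability. *)
Definition jumps : set R := [set l | exists r : rat, forall x, 0 < x ->
    (x < l -> N x < ratr r) /\ (l < x -> ratr r < N x)].

(** Jumps l < l' cannot share their rational: at the midpoint N would be both above and below it. So
    the positive jumps inject into the rationals. *)
Lemma ae_no_jump : {ae lebesgue_measure, forall l : R, 0 < l -> ~ jumps l}.
Proof.
suff C : countable [set l | 0 < l /\ jumps l].
  exists [set l | 0 < l /\ jumps l]; split.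
  - exact: countable_measurable.
  - exact: countable_lebesgue_measure0.
  - move=> l /= /not_implyP[l0 /contrapT jl]; by split.
apply/countable_injP.
pose rr l := xget 0 [set r : rat | forall x, 0 < x ->
    (x < l -> N x < ratr r) /\ (l < x -> ratr r < N x)].
have rrP l : jumps l -> forall x, 0 < x ->
    (x < l -> N x < ratr (rr l)) /\ (l < x -> ratr (rr l) < N x).
  by move=> jl; have := xgetPex 0 jl.
have no l l' : 0 < l -> jumps l -> jumps l' -> rr l = rr l' -> ~ l < l'.
  move=> l0 jl jl' E ll'; pose m := (l + l') / 2.
  have [lm ml'] := midf_lt ll'.
  have m0 : 0 < m by exact: lt_trans lm.
  have [_ /(_ lm)] := rrP _ jl m m0; have [/(_ ml') + _] := rrP _ jl' m m0.
  by rewrite E => h /lt_trans /(_ h); rewrite ltxx.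
exists (fun l => pickle (rr l)) => l l'; rewrite !inE => -[l0 jl] [l'0 jl'] /(pcan_inj pickleK) E.
have := no _ _ l0 jl jl' E; have := no _ _ l'0 jl' jl (esym E).
by move=> /negP; rewrite -leNgt => a /negP; rewrite -leNgt => b; apply/eqP; rewrite eq_le a b.
Qed.

(** If N rose by more than e across l at every scale, any rational between the supremum of N over
    (0, l) and that supremum plus e would make l a jump. *)
Lemma no_jump l : 0 < l -> ~ jumps l -> forall e, 0 < e ->
  exists l1 l2, [/\ 0 < l1, l1 < l, l < l2 & N l2 - N l1 <= e].
Proof.
move=> l0 nj e e0; apply: contrapT => H; apply: nj.
have gap l1 l2 : 0 < l1 -> l1 < l -> l < l2 -> N l1 + e < N l2.
  by move=> a b c; rewrite addrC -ltrBrDr ltNge; apply/negP => d; apply: H; exists l1, l2.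
pose S := [set N x | x in [set x | 0 < x < l]].
have half : 0 < l / 2 < l by rewrite divr_gt0//= ltr_pdivrMr// ltr_pMr// ltr1n.
have hS : has_sup S.
  split; first by exists (N (l / 2)), (l / 2).
  exists (N (l + 1)) => _ [x /= /andP[x0 xl] <-].
  apply: ltW; apply: lt_trans (gap x (l + 1) x0 xl _); first by rewrite ltrDl.
  by rewrite ltrDl.
have [r] := @rat_in_itvoo R (sup S) (sup S + e) (ltac:(by rewrite ltrDl)).
rewrite in_itv /= => /andP[r1 r2]; exists r => x x0; split=> xl.
  by apply: le_lt_trans r1; apply: (sup_upper_bound hS); exists x => //=; rewrite x0.
apply: lt_le_trans r2 _; rewrite -lerBrDr; apply: ge_sup; first by case: hS.
by move=> _ [y /= /andP[y0 yl] <-]; rewrite lerBrDr ltW// gap.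
Qed.

End jumps.

Lemma sandwiched (R : realFieldType) (e x y z : R) :
  x - y <= e -> y <= z -> z <= x -> z - e <= y /\ x <= z + e.
Proof. by move=> h1 h2 h3; split; lra. Qed.

(** Here n stands for x^2 |q|^2 with q a maximizer at x = l + d, and the last premise is its
    rescaling to l. The margin 4 l^2 e becomes d e because 1 / l - 1 / (l + d) <= d / l^2. *)
Lemma right_slope (R : realFieldType) (l d Q e n p p' : R) :
  0 < l -> 0 < d -> 0 <= Q -> 0 < e -> n <= l ^+ 2 * Q + 4 * l ^+ 2 * e ->
  n / 4 * ((l + d)^-1 - l^-1) <= p - p' -> p' - p <= d * (Q / 4 + e).
Proof.
move=> l0 d0 Q0 e0 nQ; rewrite -[leRHS]opprB lerNr => /le_trans; apply.
have ld1 : 0 < l + d by exact: addr_gt0.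
have -> : - (n / 4 * ((l + d)^-1 - l^-1)) = n * (d / (4 * l * (l + d))).
  by field; rewrite (gt_eqF l0) (gt_eqF ld1).
have c0 : 0 <= d / (4 * l * (l + d)) by rewrite divr_ge0// ?ltW// !mulr_gt0.
apply: le_trans (ler_wpM2r c0 nQ) _.
have -> : (l ^+ 2 * Q + 4 * l ^+ 2 * e) * (d / (4 * l * (l + d))) =
    (d * (Q / 4 + e)) * (l / (l + d)) by field; rewrite (gt_eqF l0) (gt_eqF ld1).
rewrite ler_piMr//; last by rewrite ler_pdivrMr// mul1r lerDl ltW.
by rewrite mulr_ge0 ?ltW// ltr_wpDl// divr_ge0.
Qed.

Lemma left_slope (R : realFieldType) (l d Q e n r : R) :
  0 < l -> 0 < d -> 0 < l - d -> 0 <= n -> l ^+ 2 * Q - 4 * l ^+ 2 * e <= n ->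
  n / 4 * ((l - d)^-1 - l^-1) <= r -> d * (Q / 4 - e) <= r.
Proof.
move=> l0 d0 ld0 n0 nQ; apply: le_trans.
have -> : n / 4 * ((l - d)^-1 - l^-1) = n * (d / (4 * l * (l - d))).
  by field; rewrite (gt_eqF l0) (gt_eqF ld0).
have c0 : 0 <= d / (4 * l * (l - d)) by rewrite divr_ge0 ?mulr_ge0 ?ltW.
have [neg|pos] := leP (Q / 4 - e) 0.
  by apply: (@le_trans _ _ 0); [rewrite mulr_ge0_le0// ltW|rewrite mulr_ge0].
apply: le_trans (ler_wpM2r c0 nQ).
have -> : (l ^+ 2 * Q - 4 * l ^+ 2 * e) * (d / (4 * l * (l - d))) =
    (d * (Q / 4 - e)) * (l / (l - d)) by field; rewrite (gt_eqF l0) (gt_eqF ld0).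
rewrite ler_peMr//; first by rewrite mulr_ge0 ?ltW.
by rewrite ler_pdivlMr// mul1r lerBlDr lerDl ltW.
Qed.

Section free_energy.
Context (R : realType) (k' : nat).
Local Notation k := k'.+1.
Context (P0 : probability (k.-tuple R) R).
Hypothesis P2 : forall c, P0.-integrable setT (EFin \o (fun x => tnth x c ^+ 2)).
Implicit Types (q B : 'M[R]_k) (l t : R).
Local Notation mom2 := (mom2 P0).

Lemma fsq_ge0 q : 0 <= fsq q.
Proof. by do 2 (apply: sumr_ge0 => ? _); exact: sqr_ge0. Qed.

Lemma mxnorm_sqr q : mxnorm q ^+ 2 = fsq q.
Proof. by rewrite /mxnorm sqr_sqrtr -fsq_tr// fsq_ge0. Qed.

Lemma sqrtmxP q : psd q -> psd (sqrtmx q) /\ sqrtmx q *m sqrtmx q = q.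
Proof. by move=> /psd_sqrt_exists[s hs]; exact: (@xgetPex _ 0 [set s | psd s /\ s *m s = q] (ex_intro _ s hs)). Qed.

Lemma sqrtmx_gram q : psd q -> (sqrtmx q)^T *m sqrtmx q = q.
Proof. by move=> /sqrtmxP[[-> _] ->]. Qed.

Definition fe l q := DK P0 l (sqrtmx q) - l / 4 * fsq q.

(** The exponent is the log-likelihood of x for the observation Z + sqrt l q^(1/2) X of the signal
    sqrt l q^(1/2) x, so the logarithmic term of F is the relative entropy of a k-dimensional
    channel. *)
Lemma free_energyE l q : 0 <= l -> psd q -> free_energy P0 l q = (fe l q)%:E.
Proof.
move=> l0 pq; have [[sT _] ss] := sqrtmxP pq; set s := sqrtmx q in sT ss *.
have mS r : measurable_fun setT (scaled (linS s) l r).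
  by apply: measurable_funM => //; exact: measurable_linS.
have iS := scaled_sqint (linS_sqint P2 s) l.
rewrite /free_energy /fe mxnorm_sqr -/s [X in _ = X%:E]addrC EFinD; congr (_ + _)%E.
rewrite /DK /Dch -rintegralE; last exact: (lnzeta_integrable mS mS iS).
apply: eq_integral => u _.
rewrite -lne_EFin ?zeta_gt0//; congr lne.
rewrite -zetaE//; apply: eq_integral => x _; congr (expR _)%:E.
have bil (A : 'M[R]_k) (y z : k.-tuple R) :
    bilin A y z = \sum_r tnth y r * linS A r z.
  rewrite /bilin -mulmxA mxE; apply: eq_bigr => r _; rewrite !mxE; congr (_ * _).
  by apply: eq_bigr => c _; rewrite mxE.
have bilq (y z : k.-tuple R) : bilin q y z = \sum_r linS s r y * linS s r z.
  rewrite /bilin -ss mulmxA -{1}sT -trmx_mul -mulmxA mxE; apply: eq_bigr => r _.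
  by rewrite !mxE; congr (_ * _); apply: eq_bigr => c _; rewrite mxE.
rewrite bil !bilq !mulr_sumr -sumrN -!big_split /=; apply: eq_bigr => r _.
rewrite /Yof tnth_mktuple /scaled exprMn sqr_sqrtr//.
have sl : Num.sqrt l * Num.sqrt l = l by rewrite -expr2 sqr_sqrtr.
rewrite -[in X in _ + X - _](sl); ring.
Qed.

Lemma fsq_gram_le B (i j : 'I_k) : B i j ^+ 2 <= Num.sqrt (fsq (B^T *m B)).
Proof.
have h1 : B i j ^+ 2 <= (B^T *m B) j j.
  rewrite mxE (bigD1 i)//= mxE -expr2 lerDl; apply: sumr_ge0 => a _.
  by rewrite mxE -expr2 sqr_ge0.
apply: le_trans h1 _; rewrite -[leLHS]ger0_norm; last first.
  by rewrite mxE; apply: sumr_ge0 => a _; rewrite mxE -expr2 sqr_ge0.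
rewrite -sqrtr_sqr; apply: ler_wsqrtr.
rewrite /fsq (bigD1 j)//= (bigD1 j)//= -addrA lerDl addr_ge0//.
  by apply: sumr_ge0 => a _; exact: sqr_ge0.
by do 2 (apply: sumr_ge0 => ? _); exact: sqr_ge0.
Qed.

Lemma DK_lip t B B' : 0 <= t ->
  DK P0 t B <= DK P0 t B' + t * (Num.sqrt (fsq (B^T *m B - B'^T *m B')) / 2 * mom2).
Proof.
move=> t0; apply: (DK_gram P2 t0 (sqrtr_ge0 _)) => v.
have := quad_le (B^T *m B - B'^T *m B') v; rewrite -lerBlDl; apply: le_trans.
rewrite -sumrN -big_split /= le_eqVlt; apply/orP; left; apply/eqP.
apply: eq_bigr => c _; rewrite -sumrN -big_split /=; apply: eq_bigr => d _.
by rewrite !mxE; ring.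
Qed.

(** F at q = B^T B. Parametrized by B, the maximization runs over all matrices instead of a cone. *)
Definition gB l B := DK P0 l B - l / 4 * fsq (B^T *m B).

Lemma gB_le0 l B : 0 <= l -> 2 * mom2 <= Num.sqrt (fsq (B^T *m B)) -> gB l B <= 0.
Proof.
move=> l0; have := DK_le P2 B l0; rewrite /gB.
have -> : fsq (B^T *m B) = Num.sqrt (fsq (B^T *m B)) * Num.sqrt (fsq (B^T *m B)).
  by rewrite -expr2 sqr_sqrtr// fsq_ge0.
have : 0 <= Num.sqrt (fsq (B^T *m B)) by exact: sqrtr_ge0.
rewrite sqrtr_sqr; set F := Num.sqrt _; clearbody F => F0; rewrite ger0_norm// => h1 h2.
have := mulr_ge0 (mulr_ge0 l0 F0) (_ : 0 <= F - 2 * mom2); rewrite subr_ge0 => /(_ h2).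
have -> : l * F * (F - 2 * mom2) = l * (F * F) - 4 * (l * (F / 2 * mom2)) by field.
lra.
Qed.

Lemma gB0 l : gB l 0 = 0.
Proof.
rewrite /gB (DK0 P0) mulmx0 /fsq big1 ?mulr0 ?subrr// => c _.
by rewrite big1// => d _; rewrite mxE expr0n.
Qed.

Lemma cvg_gB (T : Type) (F : set_system T) (FF : Filter F) (B : T -> 'M[R]_k) B0 l : 0 <= l ->
  (forall i j, B v i j @[v --> F] --> B0 i j) -> gB l (B v) @[v --> F] --> gB l B0.
Proof.
move=> l0 coord.
have rsum (J : Type) (s : seq J) (f : J -> T -> R) (c : J -> R) :
    (forall j, f j v @[v --> F] --> c j) ->
    \sum_(j <- s) f j v @[v --> F] --> \sum_(j <- s) c j.
  exact: fcvg_sum.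
have gram i j : ((B v)^T *m B v) i j @[v --> F] --> (B0^T *m B0) i j.
  under eq_fun do rewrite mxE; rewrite mxE; apply: rsum => r.
  by under eq_fun do rewrite mxE; rewrite mxE; apply: cvgM; exact: coord.
pose D v := fsq ((B v)^T *m B v - B0^T *m B0).
have cD : D v @[v --> F] --> (0 : R).
  rewrite /D /fsq [X in _ --> X](_ : 0 = \sum_(c < k) \sum_(d < k)
     ((B0^T *m B0) c d - (B0^T *m B0) c d) * ((B0^T *m B0) c d - (B0^T *m B0) c d) :> R).
    apply: (rsum _ _ (fun c v => \sum_d ((B v)^T *m B v - B0^T *m B0) c d ^+ 2)).
    move=> c; apply: (rsum _ _ (fun d v => ((B v)^T *m B v - B0^T *m B0) c d ^+ 2)).
    move=> d; have E v : ((B v)^T *m B v - B0^T *m B0) c d =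
        ((B v)^T *m B v) c d - (B0^T *m B0) c d.
      by rewrite [LHS]mxE [X in _ + X]mxE.
    under eq_fun do rewrite E; apply: cvgM; apply: cvgB; by [exact: gram|exact: cvg_cst].
  by apply/esym/big1 => c _; apply: big1 => d _; rewrite subrr mulr0.
have cf : fsq ((B v)^T *m B v) @[v --> F] --> fsq (B0^T *m B0).
  apply: (rsum _ _ (fun c v => \sum_d ((B v)^T *m B v) c d ^+ 2)) => c.
  apply: (rsum _ _ (fun d v => ((B v)^T *m B v) c d ^+ 2)) => d.
  by apply: cvgM; exact: gram.
apply: cvgB; last by apply: cvgM; [exact: cvg_cst|exact: cf].
have ch : l * (Num.sqrt (D v) / 2 * mom2) @[v --> F] --> (0 : R).
  rewrite [X in _ --> X](_ : _ = l * (Num.sqrt 0 / 2 * mom2)); last by rewrite sqrtr0 mul0r mul0r mulr0.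
  apply: cvgM; first exact: cvg_cst.
  apply: cvgM; last exact: cvg_cst.
  apply: cvgM; last exact: cvg_cst.
  by apply: continuous_cvg; [exact: sqrt_continuous|exact: cD].
apply/cvgrPdist_le => e e0; move/cvgrPdist_le : ch => /(_ e e0).
apply: filterS => v; rewrite sub0r normrN => h.
have h1 := DK_lip (B v) B0 l0; have h2 := DK_lip B0 (B v) l0.
have sym : fsq (B0^T *m B0 - (B v)^T *m B v) = D v.
  rewrite /D /fsq; apply: eq_bigr => c _; apply: eq_bigr => d _.
  by rewrite -sqrrN -opprB; congr (_ ^+ 2); rewrite [X in - X]mxE opprK.
rewrite sym in h2; rewrite -/(D v) in h1.
apply: le_trans h; apply: le_trans (ler_norm _); rewrite ler_norml.
set z := l * _ in h1 h2 *; clearbody z; move: h1 h2; set a := DK _ _ _; set b := DK _ _ _.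
by clearbody a b => h1 h2; apply/andP; split; lra.
Qed.

Lemma continuous_gB l : 0 <= l -> continuous (fun v : 'rV[R]_(k * k) => gB l (vec_mx v)).
Proof.
move=> l0 v0; apply: (@cvg_gB _ (nbhs v0) (nbhs_filter v0) (fun v => vec_mx v) (vec_mx v0)) => // i j.
by under eq_fun do rewrite mxE; rewrite mxE; exact: (@coord_continuous _ 1 (k * k) 0 (mxvec_index i j)).
Qed.

(** An entry of B beyond r = sqrt (2 mom2) forces |B^T B| > 2 mom2, where [gB] is at most 0, its
    value at B = 0. It suffices to maximize over a compact box. *)
Lemma maximizer_exists l : 0 <= l -> exists B, forall B', gB l B' <= gB l B.
Proof.
move=> l0; have m0 := mom2_ge0 P0.
pose r := Num.sqrt (2 * mom2).
pose A := [set v : 'rV[R]_(k * k) | forall i, `[- r, r]%classic (v ord0 i)].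
have cA : compact A.
  by apply: (@rV_compact R (k * k) (fun=> `[- r, r]%classic)) => i; exact: segment_compact.
have r0 : 0 <= r by exact: sqrtr_ge0.
have A0 : A 0 by move=> i /=; rewrite mxE in_itv /= oppr_le0 r0.
have cont : {within A, continuous (fun v : 'rV[R]_(k * k) => gB l (vec_mx v))}.
  by apply: continuous_subspaceT; exact: continuous_gB.
have [c cA' hc] := EVT_max_rV (ex_intro _ 0 A0) cA cont.
exists (vec_mx c) => B'.
have [inA|ninA] := pselect (A (mxvec B')).
  by have := hc (mxvec B'); rewrite mxvecK; apply; rewrite inE.
apply: (@le_trans _ _ 0); last first.
  by have := hc 0; rewrite linear0 gB0; apply; rewrite inE.
apply: gB_le0 => //; apply: contrapT => /negP; rewrite -ltNge => lt; apply: ninA.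
move=> i /=; case/mxvec_indexP : i => i j; rewrite mxvecE in_itv /= -ler_norml.
rewrite -sqrtr_sqr; apply: ler_wsqrtr; apply: le_trans (fsq_gram_le B' i j) _.
exact: ltW.
Qed.

Lemma feE l q : 0 <= l -> psd q -> fe l q = gB l (sqrtmx q).
Proof. by move=> l0 pq; rewrite /gB sqrtmx_gram. Qed.

Lemma gB_fe l B : 0 <= l -> gB l B = fe l (B^T *m B).
Proof.
move=> l0; rewrite /fe /gB.
have G : B^T *m B = (sqrtmx (B^T *m B))^T *m sqrtmx (B^T *m B).
  by rewrite sqrtmx_gram//; exact: psd_gram.
by have -> : DK P0 l B = DK P0 l (sqrtmx (B^T *m B)) by exact: (DK_eq_gram P2 l0 G).
Qed.

Lemma fe_maximizer l : 0 <= l -> exists2 q, psd q & forall q', psd q' -> fe l q' <= fe l q.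
Proof.
move=> l0; have [B hB] := maximizer_exists l0.
exists (B^T *m B); first exact: psd_gram.
by move=> q' pq'; rewrite -gB_fe// feE.
Qed.

Lemma is_maximizerP l q : 0 <= l -> is_maximizer P0 l q <->
  psd q /\ forall q', psd q' -> fe l q' <= fe l q.
Proof.
move=> l0; split=> -[pq H].
  split; first exact: pq.
  by move=> q' pq'; have := H q' pq'; rewrite (free_energyE l0 pq) (free_energyE l0 pq') lee_fin.
split; first exact: pq.
by move=> q' pq'; have := H q' pq'; rewrite (free_energyE l0 pq) (free_energyE l0 pq') lee_fin.
Qed.

Lemma DK_scale l (c : R) B : 0 <= l -> 0 <= c -> DK P0 l (Num.sqrt c *: B) = DK P0 (l * c) B.
Proof.
move=> l0 c0; rewrite /DK; congr (Dch P0 _); apply/funext => r; apply/funext => x.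
rewrite /scaled /linS sqrtrM// -mulrA; congr (_ * _); rewrite mulr_sumr.
by apply: eq_bigr => a _; rewrite mxE mulrA.
Qed.

(* The free energy depends on (l, q) only through l q, up to the quadratic term:
   replace q by (l / l') q at l'. *)
Lemma fe_rescale l l' q : 0 < l -> 0 < l' -> psd q -> exists2 q', psd q' &
  fe l' q' = fe l q + l ^+ 2 * fsq q / 4 * (l^-1 - l'^-1).
Proof.
move=> l0 l'0 pq; set s := sqrtmx q; pose c := l / l'.
have c0 : 0 <= c by rewrite divr_ge0// ltW.
exists ((Num.sqrt c *: s)^T *m (Num.sqrt c *: s)); first exact: psd_gram.
rewrite -gB_fe; last exact: ltW.
rewrite /gB (DK_scale _ (ltW l'0) c0).
have -> : l' * c = l by rewrite /c mulrC divfK// gt_eqF.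
have -> : (Num.sqrt c *: s)^T *m (Num.sqrt c *: s) = c *: q.
  have -> : (Num.sqrt c *: s)^T = Num.sqrt c *: s^T by apply/matrixP => i j; rewrite !mxE.
  rewrite -scalemxAl -scalemxAr scalerA /s sqrtmx_gram//.
  by rewrite -expr2 sqr_sqrtr.
have -> : fsq (c *: q) = c ^+ 2 * fsq q.
  rewrite /fsq mulr_sumr; apply: eq_bigr => a _; rewrite mulr_sumr.
  by apply: eq_bigr => b _; rewrite mxE exprMn.
rewrite /fe -/s /c; field.
by rewrite (gt_eqF l0) (gt_eqF l'0).
Qed.

Definition qmax l : 'M[R]_k := xget 0 [set q | is_maximizer P0 l q].

Definition max_fe l := fe l (qmax l).

Lemma qmaxP l : 0 <= l -> psd (qmax l) /\ forall q, psd q -> fe l q <= max_fe l.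
Proof.
move=> l0; have [q pq hq] := fe_maximizer l0.
have mq : [set q | is_maximizer P0 l q] q by apply/(is_maximizerP _ l0); split.
exact: (proj1 (is_maximizerP _ l0) (@xgetPex _ 0 [set q | is_maximizer P0 l q] (ex_intro _ q mq))).
Qed.

Lemma is_maximizer_max_fe l q : 0 <= l -> is_maximizer P0 l q <-> psd q /\ fe l q = max_fe l.
Proof.
move=> l0; have [pm hm] := qmaxP l0; split.
  move=> /(is_maximizerP q l0)[pq hq]; split; first exact: pq.
  by apply/eqP; rewrite eq_le hm// /max_fe hq.
move=> [pq hq]; apply/(is_maximizerP q l0); split; first exact: pq.
by move=> q' pq'; rewrite hq; exact: hm.
Qed.

Lemma ereal_sup_free_energy l : 0 <= l ->
  ereal_sup [set free_energy P0 l q | q in @psd R k] = (max_fe l)%:E.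
Proof.
move=> l0; have [pm hm] := qmaxP l0; apply/eqP; rewrite eq_le; apply/andP; split.
  by apply: ge_ereal_sup => _ [q pq <-]; rewrite free_energyE// lee_fin; exact: hm.
by apply: ereal_sup_ubound; exists (qmax l) => //; rewrite free_energyE.
Qed.

(** The maximizer at l, rescaled by [fe_rescale], is a competitor at l'. *)
Lemma max_fe_increment l l' q : 0 < l -> 0 < l' -> is_maximizer P0 l q ->
  l ^+ 2 * fsq q / 4 * (l^-1 - l'^-1) <= max_fe l' - max_fe l.
Proof.
move=> l0 l'0 /(is_maximizer_max_fe q (ltW l0))[pq hq].
have [q' pq' hq'] := fe_rescale l0 l'0 pq.
have [_ /(_ q' pq')] := qmaxP (ltW l'0).
rewrite hq' hq; move: (max_fe l') (max_fe l) (_ * (_ - _)) => x y z; lra.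
Qed.

(** Adding the increments from l to l' and back cancels [max_fe] and leaves an inequality between
    the two coefficients of 1 / l - 1 / l'. *)
Lemma maximizer_fsq_le l l' q q' : 0 < l -> l < l' ->
  is_maximizer P0 l q -> is_maximizer P0 l' q' -> l ^+ 2 * fsq q <= l' ^+ 2 * fsq q'.
Proof.
move=> l0 ll' mq mq'; have l'0 := lt_trans l0 ll'.
have := lerD (max_fe_increment l0 l'0 mq) (max_fe_increment l'0 l0 mq').
rewrite addrC addrA subrK subrr.
have : 0 < l^-1 - l'^-1 by rewrite subr_gt0 ltf_pV2.
set d := _ - _; move: (l ^+ 2 * _) (l' ^+ 2 * _) => a b d0.
have -> : b / 4 * (l'^-1 - l^-1) + a / 4 * d = (a - b) * (d / 4) by rewrite /d; field; rewrite !gt_eqF.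
by rewrite pmulr_lle0 ?subr_le0// divr_gt0.
Qed.

(** Monotonicity squeezes l^2 |q|^2, for every maximizer q at l, between the values at nearby l1 < l
    < l2, which are arbitrarily close off the jumps. A single scale d for each e is enough
    afterwards, since the I-MMSE inequalities hold for difference quotients at any scale. *)
Lemma max_fe_slope l : 0 < l -> ~ jumps (fun x => x ^+ 2 * fsq (qmax x)) l -> exists Q, [/\
  forall q, is_maximizer P0 l q -> fsq q = Q &
  forall e, 0 < e -> exists d, [/\ 0 < d, d < l,
     max_fe (l + d) - max_fe l <= d * (Q / 4 + e) & d * (Q / 4 - e) <= max_fe l - max_fe (l - d)]].
Proof.
move=> l0 nj; pose N x : R := x ^+ 2 * fsq (qmax x).
have mx x : 0 < x -> is_maximizer P0 x (qmax x).
  by move=> x0; apply/(is_maximizer_max_fe (qmax x) (ltW x0)); split => //; case: (qmaxP (ltW x0)).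
have mono x y : 0 < x -> x <= y -> N x <= N y.
  move=> x0; rewrite le_eqVlt => /orP[/eqP->|xy]; first exact: lexx.
  exact: (maximizer_fsq_le x0 xy (mx _ x0) (mx _ (lt_trans x0 xy))).
have gap := no_jump l0 nj.
have l20 : 0 < l ^+ 2 by exact: exprn_gt0.
have near q e : is_maximizer P0 l q -> 0 < e -> exists l1 l2, [/\ 0 < l1, l1 < l, l < l2,
    l ^+ 2 * fsq q - e <= N l1 & N l2 <= l ^+ 2 * fsq q + e].
  move=> mq e0; have [l1 [l2 [l10 l1l ll2 h]]] := gap e e0.
  have h1 := maximizer_fsq_le l10 l1l (mx _ l10) mq.
  have h2 := maximizer_fsq_le l0 ll2 mq (mx _ (lt_trans l0 ll2)).
  have [a b] := @sandwiched R e (N l2) (N l1) (l ^+ 2 * fsq q) h h1 h2.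
  by exists l1, l2; split.
have uniq q q' : is_maximizer P0 l q -> is_maximizer P0 l q' -> fsq q <= fsq q'.
  move=> mq mq'; rewrite -(ler_pM2l l20); apply/ler_addgt0Pr => e e0.
  have [l1 [l2 [l10 l1l ll2 _ h]]] := near q' e mq' e0.
  exact: le_trans (maximizer_fsq_le l0 ll2 mq (mx _ (lt_trans l0 ll2))) h.
exists (fsq (qmax l)); split.
  have mm := mx l l0.
  by move=> q mq; apply/le_anti/andP; split; [exact: (uniq q _ mq mm)|exact: (uniq _ q mm mq)].
move=> e e0; set Q := fsq _.
have ep : 0 < 4 * l ^+ 2 * e by rewrite !mulr_gt0.
have [l1 [l2 [l10 l1l ll2 h1 h2]]] := near _ _ (mx l l0) ep; rewrite -/Q in h1 h2.
pose d := Num.min (l - l1) (l2 - l).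
have d0 : 0 < d by rewrite lt_min !subr_gt0 l1l.
have dl1 : d <= l - l1 by rewrite ge_min lexx.
have dl2 : d <= l2 - l by rewrite ge_min lexx orbT.
have ld0 : 0 < l - d by rewrite subr_gt0; apply: le_lt_trans dl1 _; rewrite ltrBlDr ltrDl.
have lld : l < l + d by rewrite ltrDl.
have ld1 : 0 < l + d by exact: lt_trans lld.
have N1 : l ^+ 2 * Q - 4 * l ^+ 2 * e <= N (l - d).
  apply: (le_trans h1); apply: mono; first exact: l10.
  by rewrite lerBrDr -lerBrDl.
have N2 : N (l + d) <= l ^+ 2 * Q + 4 * l ^+ 2 * e.
  apply: le_trans h2; apply: mono; first exact: ld1.
  by rewrite -lerBrDl.
have Q0 : 0 <= Q by exact: fsq_ge0.
have N0 : 0 <= N (l - d) by rewrite mulr_ge0 ?fsq_ge0 ?sqr_ge0.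
exists d; split; first exact: d0.
- by rewrite -subr_gt0.
- exact: (right_slope l0 d0 Q0 e0 N2 (max_fe_increment ld1 l0 (mx _ ld1))).
- exact: (left_slope l0 d0 ld0 N0 N1 (max_fe_increment ld0 l0 (mx _ ld0))).
Qed.

End free_energy.

(** * Mutual information and error of the model *)

Section independent_product.
Context d d1 d2 (T : measurableType d) (T1 : measurableType d1) (T2 : measurableType d2).
Context (R : realType) (mu : probability T R) (m1 : probability T1 R) (m2 : probability T2 R).
Context (p : T -> T1) (q : T -> T2).
Hypotheses (mp : measurable_fun setT p) (mq : measurable_fun setT q).
Hypothesis pq : forall (f : T1 -> \bar R) (h : T2 -> \bar R),
  measurable_fun setT f -> (forall x, 0 <= f x)%E ->
  measurable_fun setT h -> (forall x, 0 <= h x)%E ->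
  (\int[mu]_x (f (p x) * h (q x)) = \int[m1]_x f x * \int[m2]_x h x)%E.

Let ge0_prod (f : T1 -> R) (h : T2 -> R) :
  measurable_fun setT f -> m1.-integrable setT (EFin \o f) -> (forall x, 0 <= f x) ->
  measurable_fun setT h -> m2.-integrable setT (EFin \o h) -> (forall x, 0 <= h x) ->
  mu.-integrable setT (EFin \o (fun x => f (p x) * h (q x))) /\
  \int[mu]_x (f (p x) * h (q x)) = \int[m1]_x f x * \int[m2]_x h x.
Proof.
move=> mf fi f0 mh hi h0.
have E : (\int[mu]_x (f (p x) * h (q x))%:E = (\int[m1]_x f x * \int[m2]_x h x)%R%:E)%E.
  rewrite EFinM -!rintegralE// -pq//; do ?exact/measurable_EFinP.
have I : mu.-integrable setT (EFin \o (fun x => f (p x) * h (q x))).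
  apply/integrableP; split.
    apply/measurable_EFinP; apply: measurable_funM; first exact: (measurableT_comp mf mp).
    exact: (measurableT_comp mh mq).
  rewrite (eq_integral (fun x => (f (p x) * h (q x))%:E)); first by rewrite E ltry.
  by move=> x _ /=; rewrite ger0_norm// mulr_ge0.
by split=> //; rewrite /Rintegral E.
Qed.

Lemma independent_Rintegral (f : T1 -> R) (h : T2 -> R) :
  measurable_fun setT f -> m1.-integrable setT (EFin \o f) ->
  measurable_fun setT h -> m2.-integrable setT (EFin \o h) ->
  mu.-integrable setT (EFin \o (fun x => f (p x) * h (q x))) /\
  \int[mu]_x (f (p x) * h (q x)) = \int[m1]_x f x * \int[m2]_x h x.
Proof.
have parts d' (S : measurableType d') (m : probability S R) (g : S -> R) :
    measurable_fun setT g -> m.-integrable setT (EFin \o g) ->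
    exists gp gm : S -> R, [/\ measurable_fun setT gp, m.-integrable setT (EFin \o gp),
      (forall x, 0 <= gp x), measurable_fun setT gm & [/\ m.-integrable setT (EFin \o gm),
      (forall x, 0 <= gm x), g = (fun x => gp x - gm x) &
      \int[m]_x g x = \int[m]_x gp x - \int[m]_x gm x]].
  move=> mg gi.
  have [mgp mgm] : measurable_fun setT (fun x => Num.max (g x) 0) /\ measurable_fun setT (fun x => Num.max (- g x) 0).
    by split; apply: measurable_maxr => //; exact: measurable_funN.
  have ip : m.-integrable setT (EFin \o (fun x => Num.max (g x) 0)).
    apply: (le_rintegrable mgp _ (integrable_norm gi)) => x /=.
    by rewrite ger0_norm ?le_max ?lexx ?orbT// ge_max ler_norm normr_ge0.
  have im : m.-integrable setT (EFin \o (fun x => Num.max (- g x) 0)).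
    apply: (le_rintegrable mgm _ (integrable_norm gi)) => x /=.
    by rewrite ger0_norm ?le_max ?lexx ?orbT// ge_max normr_ge0 andbT -normrN ler_norm.
  have gE : g = (fun x => Num.max (g x) 0 - Num.max (- g x) 0).
    apply/funext => x; have [x0|x0] := leP (g x) 0.
      by rewrite max_l ?oppr_ge0// sub0r opprK.
    by rewrite max_r ?oppr_le0 ?ltW// subr0.
  exists (fun x => Num.max (g x) 0), (fun x => Num.max (- g x) 0); split=> //.
  - by move=> x; rewrite le_max lexx orbT.
  - split=> //; first by move=> x; rewrite le_max lexx orbT.
    by rewrite -rintB// -gE.
move=> mf fi mh hi.
have [fp [fm [mfp ifp fp0 mfm [ifm fm0 fE Ef]]]] := parts _ _ _ _ mf fi.
have [hp [hm [mhp ihp hp0 mhm [ihm hm0 hE Eh]]]] := parts _ _ _ _ mh hi.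
have [I1 E1] := ge0_prod mfp ifp fp0 mhp ihp hp0.
have [I2 E2] := ge0_prod mfp ifp fp0 mhm ihm hm0.
have [I3 E3] := ge0_prod mfm ifm fm0 mhp ihp hp0.
have [I4 E4] := ge0_prod mfm ifm fm0 mhm ihm hm0.
rewrite Ef Eh fE hE (_ : (fun x => (fp (p x) - fm (p x)) * (hp (q x) - hm (q x))) =
  (fun x => (fp (p x) * hp (q x) - fp (p x) * hm (q x)) - (fm (p x) * hp (q x) - fm (p x) * hm (q x)))); last first.
  by apply/funext => x; ring.
have I12 := rintegrableB I1 I2; have I34 := rintegrableB I3 I4.
split; first exact: (rintegrableB I12 I34).
by rewrite (rintB I12 I34) (rintB I1 I2) (rintB I3 I4) E1 E2 E3 E4; ring.
Qed.

End independent_product.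

Lemma iid_Rintegral_tnth2 d (T : measurableType d) (R : realType) (P : probability T R)
    n (i j : 'I_n) (f h : T -> R) : i != j ->
  measurable_fun setT f -> P.-integrable setT (EFin \o f) ->
  measurable_fun setT h -> P.-integrable setT (EFin \o h) ->
  (iid_law P n).-integrable setT (EFin \o (fun t => f (tnth t i) * h (tnth t j))) /\
  \int[iid_law P n]_t (f (tnth t i) * h (tnth t j)) = \int[P]_x f x * \int[P]_x h x.
Proof.
move=> ij; apply: (@independent_Rintegral _ _ _ _ _ _ _ (iid_law P n) P P
  (fun t => tnth t i) (fun t => tnth t j)) => [||f' h' mf f0 mh h0].
- exact: measurable_tnth.
- exact: measurable_tnth.
- exact: ge0_integral_iid_tnth2.
Qed.

Lemma gauss_signal_Rintegral d (Om : measurableType d) (R : realType) (P : probability Om R)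
    n (r : 'I_n) (a : Om -> R) : measurable_fun setT a -> P.-integrable setT (EFin \o a) ->
  (std_gaussian R n \x P)%E.-integrable setT (EFin \o (fun u => tnth u.1 r * a u.2)) /\
  \int[(std_gaussian R n \x P)%E]_u (tnth u.1 r * a u.2) = 0.
Proof.
move=> ma ai; have [g1 _] := gauss_mean_var R.
have gi := @gauss_integrableX R 1.
have [] := @independent_Rintegral _ _ _ _ _ _ R (std_gaussian R n \x P)%E (std_normal R) P
  (fun u => tnth u.1 r) snd _ _ _ (fun x => x) a _ _ ma ai.
- exact: (measurableT_comp (measurable_tnth r) measurable_fst).
- exact: measurable_snd.
- move=> f h mf f0 mh h0.
  rewrite (@fubini_tonelli1 _ _ _ _ _ (std_gaussian R n) P (fun u => f (tnth u.1 r) * h u.2)%E); last first.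
  + by move=> u; exact: mule_ge0.
  + apply: emeasurable_funM; last exact: (measurableT_comp mh measurable_snd).
    exact: (measurableT_comp mf (measurableT_comp (measurable_tnth r) measurable_fst)).
  rewrite -(ge0_integral_iid_tnth (std_normal R) r mf f0) -ge0_integralZr//.
  + by apply: eq_integral => y _; rewrite /fubini_F /= ge0_integralZl.
  + exact: (measurableT_comp mf (measurable_tnth r)).
  + by apply: integral_ge0.
- exact: measurable_id.
- exact: gi.
- by move=> I ->; rewrite g1 mul0r.
Qed.

Lemma card_edge (R : realType) n : (#|{: edge n}|%:R : R) * 2 = n%:R * (n%:R - 1).
Proof.
have := sum_edges (fun _ _ : 'I_n => 1 : R).
rewrite !sumr_const card_ord /= -natrM => h.
have -> : n%:R * (n%:R - 1) = \sum_(i < n) \sum_(j < n) (1 : R) - \sum_(i < n) (1 : R).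
  by rewrite !sumr_const card_ord; rewrite -[_ *+ n]mulr_natr; ring.
rewrite sum_edges addrK sumr_const; rewrite -[in RHS]mulr_natr; ring.
Qed.

Section second_moment.
Context (R : realType) (k : nat) (P0 : probability (k.-tuple R) R).
Hypothesis P2 : forall c, P0.-integrable setT (EFin \o (fun x => tnth x c ^+ 2)).

Lemma coord_prod_integrable c d :
  measurable_fun setT (fun x : k.-tuple R => tnth x c * tnth x d) /\
  P0.-integrable setT (EFin \o (fun x => tnth x c * tnth x d)).
Proof.
have m : measurable_fun setT (fun x : k.-tuple R => tnth x c * tnth x d).
  by apply: measurable_funM; exact: measurable_tnth.
split=> //; apply: (le_rintegrable m _ (rintegrableD (P2 c) (P2 d))) => x.
rewrite ler_norml; apply/andP; split.
  have := sqr_ge0 (tnth x c + tnth x d); have := sqr_ge0 (tnth x c); have := sqr_ge0 (tnth x d).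
  by move: (tnth x c) (tnth x d) => u v *; nra.
have := sqr_ge0 (tnth x c - tnth x d); have := sqr_ge0 (tnth x c); have := sqr_ge0 (tnth x d).
by move: (tnth x c) (tnth x d) => u v *; nra.
Qed.

(** Expanding the square gives products x_c x_d y_c y_d, and independence turns each mean into the
    square of an entry of the second moment matrix. *)
Lemma overlap_sqr_integral n (i j : 'I_n) : i != j ->
  \int[iid_law P0 n]_xs (\sum_c tnth (tnth xs i) c * tnth (tnth xs j) c) ^+ 2 =
  fsq (second_moment P0).
Proof.
move=> ij.
have E (xs : n.-tuple (k.-tuple R)) : (\sum_c tnth (tnth xs i) c * tnth (tnth xs j) c) ^+ 2 =
   \sum_c \sum_d (tnth (tnth xs i) c * tnth (tnth xs i) d) *
      (tnth (tnth xs j) c * tnth (tnth xs j) d) :> R.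
  rewrite expr2 big_distrl /=; apply: eq_bigr => c _; rewrite big_distrr /=.
  by apply: eq_bigr => d _; ring.
rewrite (_ : \int[_]_xs _ = \int[iid_law P0 n]_xs (\sum_c \sum_d (tnth (tnth xs i) c * tnth (tnth xs i) d) *
      (tnth (tnth xs j) c * tnth (tnth xs j) d))); last by apply: eq_Rintegral => xs _; exact: E.
have I c d := iid_Rintegral_tnth2 ij (coord_prod_integrable c d).1 (coord_prod_integrable c d).2
  (coord_prod_integrable c d).1 (coord_prod_integrable c d).2.
rewrite Rintegral_sum; last by move=> c; apply: rintegrable_sum => d; exact: (I c d).1.
apply: eq_bigr => c _; rewrite Rintegral_sum; last by move=> d; exact: (I c d).1.
by apply: eq_bigr => d _; rewrite (I c d).2 mxE expr2.
Qed.

Lemma edge_signal_energy n t : (0 < n)%N -> 0 <= t ->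
  (forall e, \int[iid_law P0 n]_xs (scaled (@edgeS R k n) t e xs) ^+ 2 =
     t / n%:R * fsq (second_moment P0)) /\
  \sum_e \int[iid_law P0 n]_xs (scaled (@edgeS R k n) t e xs) ^+ 2 =
     t * (n%:R - 1) / 2 * fsq (second_moment P0).
Proof.
move=> n0 t0.
have A e : \int[iid_law P0 n]_xs (scaled (@edgeS R k n) t e xs) ^+ 2 =
     t / n%:R * fsq (second_moment P0).
  rewrite -(overlap_sqr_integral (edge_neq (enum_val e))).
  have ij := edge_neq (enum_val e).
  rewrite -rintZ.
    apply: eq_Rintegral => xs _; rewrite /scaled /edgeS !exprMn sqr_sqrtr// exprVn sqr_sqrtr// ?ler0n//.
    by rewrite mulrA.
  have nn : n%:R != 0 :> R by rewrite pnatr_eq0 -lt0n.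
  have [I _] := edgeS_sqint P2 n0 1 e.
  have := rintegrableZ n%:R I; congr (_.-integrable setT (EFin \o _)).
  apply/funext => xs; rewrite /scaled /edgeS sqrtr1 mul1r exprMn exprVn sqr_sqrtr ?ler0n//.
  by rewrite mulrA mulfV// mul1r.
split=> //; rewrite (eq_bigr (fun=> t / n%:R * fsq (second_moment P0))); last by move=> e _; exact: A.
rewrite sumr_const card_ord -[_ *+ #|_|]mulr_natr.
have nn : n%:R != 0 :> R by rewrite pnatr_eq0 -lt0n.
have := card_edge R n; set m := _%:R => h.
have -> : m = n%:R * (n%:R - 1) / 2 by rewrite -h mulfK// pnatr_eq0.
by field.
Qed.

End second_moment.

Section boxes.
Context d1 d2 (T1 : measurableType d1) (T2 : measurableType d2) (R : realType) (m n : nat).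
Context (m1 m2 : {measure set (m.-tuple T1 * n.-tuple T2) -> \bar R}).

Definition box (A : 'I_m -> set T1) (B : 'I_n -> set T2) : set (m.-tuple T1 * n.-tuple T2) :=
  [set u | (forall i, A i (tnth u.1 i)) /\ (forall j, B j (tnth u.2 j))].

Hypothesis m1fin : (m1 setT < +oo)%E.
Hypothesis m12 : forall A B, (forall i, measurable (A i)) -> (forall j, measurable (B j)) ->
  m1 (box A B) = m2 (box A B).

(** Boxes are stable under intersection and generate the product sigma-algebra, because preimages
    under single coordinates are boxes. *)
Lemma box_measure_unique C : measurable C -> m1 C = m2 C.
Proof.
pose G := [set C | exists A B, [/\ (forall i, measurable (A i)), (forall j, measurable (B j)) & C = box A B]].
have mtn1 (i : 'I_m) (A : set T1) : measurable A ->
    measurable [set u : m.-tuple T1 * n.-tuple T2 | A (tnth u.1 i)].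
  move=> mA; rewrite -[X in measurable X]setTI.
  exact: (measurableT_comp (measurable_tnth i) measurable_fst measurableT mA).
have mtn2 (j : 'I_n) (B : set T2) : measurable B ->
    measurable [set u : m.-tuple T1 * n.-tuple T2 | B (tnth u.2 j)].
  move=> mB; rewrite -[X in measurable X]setTI.
  exact: (measurableT_comp (measurable_tnth j) measurable_snd measurableT mB).
have GT : G setT.
  exists (fun=> setT), (fun=> setT); split=> //.
  by apply/seteqP; split.
have single1 (i : 'I_m) (A : set T1) : measurable A ->
    G [set u : m.-tuple T1 * n.-tuple T2 | A (tnth u.1 i)].
  move=> mA; exists (fun i' => if i' == i then A else setT), (fun=> setT); split=> //.
    by move=> i'; case: ifP.
  apply/seteqP; split=> u /=.
    by move=> Au; split=> // i'; case: eqP => [->|].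
  by move=> -[/(_ i) + _]; rewrite eqxx.
have single2 (j : 'I_n) (B : set T2) : measurable B ->
    G [set u : m.-tuple T1 * n.-tuple T2 | B (tnth u.2 j)].
  move=> mB; exists (fun=> setT), (fun j' => if j' == j then B else setT); split=> //.
    by move=> j'; case: ifP.
  apply/seteqP; split=> u /=.
    by move=> Bu; split=> // j'; case: eqP => [->|].
  by move=> -[_ /(_ j)]; rewrite eqxx.
have mG : measurable = <<s G >>.
  apply/seteqP; split; last first.
    apply: smallest_sub; first exact: sigma_algebra_measurable.
    move=> _ [A [B [mA mB ->]]].
    rewrite (_ : box A B = (\bigcap_(i in [set: 'I_m]) [set u | A i (tnth u.1 i)]) `&`
       (\bigcap_(j in [set: 'I_n]) [set u | B j (tnth u.2 j)])); last first.
      apply/seteqP; split=> u /=.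
        by move=> [h1 h2]; split=> i _; [exact: h1|exact: h2].
      by move=> [h1 h2]; split=> i; [exact: h1|exact: h2].
    by apply: measurableI; apply: fin_bigcap_measurable => // i _; [exact: mtn1|exact: mtn2].
  pose I := g_sigma_algebraType G.
  have : measurable_fun [set: I] (fun u : I => u : m.-tuple T1 * n.-tuple T2).
    apply/measurable_fun_pairP; split; apply/measurable_fun_tnthP => i _ A mA; rewrite setTI;
      apply: sub_sigma_algebra; by [exact: single1|exact: single2].
  by move=> mid C' mC'; have := mid measurableT C' mC'; rewrite setTI.
apply: (measure_unique G (fun=> setT) mG) => //.
- move=> _ _ [A [B [mA mB ->]]] [A' [B' [mA' mB' ->]]].
  exists (fun i => A i `&` A' i), (fun j => B j `&` B' j); split.
  + by move=> i; exact: measurableI.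
  + by move=> j; exact: measurableI.
  + apply/seteqP; split=> u /=.
      by move=> [[h1 h2] [h3 h4]]; split=> i; split.
    by move=> [h1 h2]; split; split=> i; by [case: (h1 i)|case: (h2 i)].
- by apply/seteqP; split=> // x _; exists 0%N.
- by move=> _ [A [B [mA mB ->]]]; exact: m12.
Qed.

End boxes.

Lemma iid_law_box d (T : measurableType d) (R : realType) (P : probability T R) n
    (A : 'I_n -> set T) : (forall i, measurable (A i)) ->
  iid_law P n [set t | forall i, A i (tnth t i)] = (\prod_(i < n) P (A i))%E.
Proof.
move=> mA; set C := [set t | _].
have mC : measurable C.
  rewrite (_ : C = \bigcap_(i in [set: 'I_n]) ((fun t => tnth t i) @^-1` A i)).
    apply: fin_bigcap_measurable => // i _; rewrite -[X in measurable X]setTI.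
    exact: (measurable_tnth i measurableT).
  by apply/seteqP; split=> t /= h i; [move=> _; exact: h|exact: (h i)].
rewrite -(setIT C) -integral_indic//.
transitivity (\int[iid_law P n]_t \prod_(i < n) (\1_(A i) (tnth t i))%:E)%E.
  apply: eq_integral => t _; rewrite prodEFin; congr _%:E.
  rewrite indicE; case: (boolP (t \in C)) => tC.
    rewrite inE in tC; rewrite big1// => i _; rewrite indicE mem_set//; exact: tC.
  have [i Ai] : exists i, ~ A i (tnth t i).
    by apply/existsNP => h; move: tC; rewrite notin_setE; apply.
  by rewrite (bigD1 i)//= indicE memNset// mul0r.
rewrite (@ge0_integral_iid_prod _ _ _ _ _ (fun i x => (\1_(A i) x)%:E)).
- by apply: eq_bigr => i _; rewrite integral_indic// setIT.
- by move=> i; apply/measurable_EFinP; exact: measurable_indic.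
- by move=> i x; rewrite lee_fin.
Qed.

Section model.
Context (R : realType) (k : nat) (P0 : probability (k.-tuple R) R) (n : nat).
Context (M : spiked_model P0 n).
Local Notation P := (sm_prob M).
Local Notation m := #|{: edge n}|.
Local Notation gam := (std_gaussian R m).
Local Notation Pn := (iid_law P0 n).

Definition Zvec (w : sm_space M) : m.-tuple R := [tuple sm_Z M (enum_val a) w | a < m].

Lemma measurable_Zvec : measurable_fun setT Zvec.
Proof.
apply/measurable_fun_tnthP => a.
rewrite (_ : _ \o _ = sm_Z M (enum_val a))//.
by apply/funext => w /=; rewrite tnth_mktuple.
Qed.

Definition ZX (w : sm_space M) := (Zvec w, Xvec w).

Lemma measurable_ZX : measurable_fun setT ZX.
Proof.
by apply: measurable_fun_pair; [exact: measurable_Zvec|exact: measurable_Xvec].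
Qed.

HB.instance Definition _ := isMeasurableFun.Build _ _ _ _ ZX measurable_ZX.

(** On a box, mutual independence of all the X_i and Z_e gives the product of the marginals, which
    is also the product measure of the box. *)
Lemma joint_law C : measurable C -> distribution P ZX C = (gam \x Pn)%E C.
Proof.
move=> mC; apply: (@box_measure_unique _ _ _ _ R m n (distribution P ZX) (gam \x Pn)%E _ _ C mC).
  exact: le_lt_trans (probability_le1 (distribution P ZX) measurableT) (ltry 1).
move=> A B mA mB.
have -> : box A B = [set t | forall i, A i (tnth t i)] `*` [set t | forall i, B i (tnth t i)].
  by apply/seteqP; split.
have mbox d (T : measurableType d) p (C' : 'I_p -> set T) : (forall i, measurable (C' i)) ->
    measurable [set t | forall i, C' i (tnth t i)].
  move=> mC'; rewrite (_ : mkset _ = \bigcap_(i in [set: 'I_p]) ((fun t => tnth t i) @^-1` C' i)).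
    apply: fin_bigcap_measurable => // i _; rewrite -[X in measurable X]setTI.
    exact: (measurable_tnth i measurableT).
  by apply/seteqP; split=> t /= h i; [move=> _; exact: h|exact: (h i)].
apply: (@etrans _ _ _ _ _ (esym (product_measure1E gam Pn (mbox _ _ _ A mA) (mbox _ _ _ B mB)))).
apply: (@etrans _ _ _ _ _ (esym (congr2 (fun x y => (x * y)%E) (iid_law_box (std_normal R) mA) (iid_law_box P0 mB)))).
pose F (v : 'I_n + edge n) : set (sm_space M) := match v with
  | inl i => sm_X M i @^-1` B i | inr e => sm_Z M e @^-1` A (enum_rank e) end.
have ind := @sm_indep _ _ _ _ M (index_enum ('I_n + edge n)%type) F (index_enum_uniq _).
transitivity (P (\bigcap_(v in [set` index_enum ('I_n + edge n)%type]) F v)).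
  rewrite /distribution /pushforward; congr (P _).
  apply/seteqP; split=> w /=.
    move=> [h1 h2] [i|e] _ /=.
      by have := h2 i; rewrite tnth_mktuple.
    by have := h1 (enum_rank e); rewrite tnth_mktuple enum_rankK.
  move=> h; split=> i; rewrite tnth_mktuple.
    by have := h (inr (enum_val i)) (mem_index_enum _); rewrite /F /= enum_valK.
  exact: (h (inl i) (mem_index_enum _)).
rewrite ind; last first.
  by move=> [i|e] _ /=; [exists (B i)|exists (A (enum_rank e))] => //; rewrite setTI.
rewrite big_sumType muleC; congr (_ * _)%E.
  by apply: eq_bigr => i _; rewrite -(sm_X_law M i).
pose ev (a : 'I_m) : edge n := enum_val a.
have bev : bijective ev by exists (fun e => enum_rank e); [exact: enum_valK|exact: enum_rankK].
transitivity (\prod_(e : edge n) P (F (inr e)))%E; first by [].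
rewrite (reindex ev); last exact: onW_bij.
by apply: eq_bigr => a _; rewrite /F enum_valK -(sm_Z_law M (ev a)).
Qed.

Lemma ge0_integral_ZX (f : m.-tuple R * n.-tuple (k.-tuple R) -> \bar R) :
  measurable_fun setT f -> (forall u, 0 <= f u)%E ->
  (\int[P]_w f (ZX w) = \int[gam \x Pn]_u f u)%E.
Proof.
move=> mf f0; rewrite -(ge0_integral_distribution ZX mf f0).
by apply: eq_measure_integral => C mC _; exact: joint_law.
Qed.

Lemma YvecE l w : 0 <= l -> Yvec l w = Yof (scaled (@edgeS R k n) l) (ZX w).
Proof.
move=> l0; apply: eq_from_tnth => a; rewrite !tnth_mktuple /obs addrC; congr (_ + _).
rewrite /scaled /edgeS sqrtrM// sqrtrV ?ler0n// -mulrA; congr (_ * (_ * _)).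
rewrite /overlap /dotp mxE; apply: eq_bigr => c _.
by rewrite !mxE !tnth_mktuple.
Qed.

End model.

Section transfer.
Context d d' (S : measurableType d) (T : measurableType d') (R : realType).
Context (P : probability S R) (mu : {measure set T -> \bar R}) (p : S -> T).
Hypothesis H : forall f : T -> \bar R, measurable_fun setT f -> (forall x, 0 <= f x)%E ->
  (\int[mu]_x f x = \int[P]_s f (p s))%E.

(* Both sides split into positive and negative parts, so that no integrability
   is required. *)
Lemma transfer_integral (f : T -> \bar R) : measurable_fun setT f ->
  (\int[mu]_x f x = \int[P]_s f (p s))%E.
Proof.
move=> mf; rewrite integralE [RHS]integralE; congr (_ - _)%E.
  rewrite H//; last exact: measurable_funepos.
  by apply: eq_integral => s _; exact: (esym (congr1 (@^~ s) (funepos_comp f p))).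
rewrite H//; last exact: measurable_funeneg.
by apply: eq_integral => s _; exact: (esym (congr1 (@^~ s) (funeneg_comp f p))).
Qed.

End transfer.

Lemma measurable_lne_fin d2 (T : measurableType d2) (R : realType) (f : T -> \bar R) :
  measurable_fun setT f -> (forall x, f x \is a fin_num) -> measurable_fun setT (fun x => lne (f x)).
Proof.
move=> mf ff.
rewrite (_ : (fun x => _) = fun x => if (0 < fine (f x))%R then (ln (fine (f x)))%:E else -oo%E).
  have mff : measurable_fun setT (fun x => fine (f x)) by exact: (measurableT_comp _ mf).
  apply: measurable_fun_ifT => //; first exact: measurable_fun_ltr.
  by apply/measurable_EFinP; exact: (measurableT_comp (@measurable_ln R) mff).
apply/funext => x; rewrite -{1}(fineK (ff x)); case: ifPn => h; first by rewrite lne_EFin.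
by rewrite /= leNgt h.
Qed.

Section kl_density.
Context d (T : measurableType d) (R : realType) (mu nu : probability T R) (g : T -> R).
Hypotheses (mg : measurable_fun setT g) (g0 : forall x, 0 < g x).
Hypothesis mu_g : forall E, measurable E -> (mu E = \int[nu]_(x in E) (g x)%:E)%E.

Lemma density_dominated : mu `<< nu.
Proof.
apply/null_content_dominatesP => A mA A0; rewrite mu_g//.
by rewrite null_set_integral//; apply: measurable_funTS; exact/measurable_EFinP.
Qed.

Lemma Radon_Nikodym_density :
  ae_eq nu setT (Radon_Nikodym (charge_of_finite_measure mu) nu) (EFin \o g).
Proof.
have dom := density_dominated.
apply: integral_ae_eq => //.
- exact: Radon_Nikodym_integrable.
- exact/measurable_EFinP.
by move=> E _ mE; rewrite -Radon_Nikodym_integral//; exact: mu_g.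
Qed.

(** The Radon-Nikodym derivative equals g only up to a [nu]-null set; domination makes this set
    [mu]-null as well, which suffices for an integral against [mu]. *)
Lemma kl_density : kl_divergence mu nu = (\int[mu]_x (ln (g x))%:E)%E.
Proof.
have dom := density_dominated.
rewrite /kl_divergence asboolT//.
have /integrableP[mRN _] : nu.-integrable setT (Radon_Nikodym (charge_of_finite_measure mu) nu).
  exact: Radon_Nikodym_integrable.
apply: ae_eq_integral => //.
- by apply: measurable_lne_fin => // x; exact: Radon_Nikodym_fin_num.
- by apply/measurable_EFinP; exact: (measurableT_comp (@measurable_ln R) mg).
- apply: (null_dominates_ae_eq _ dom) => //.
  by apply: filterS Radon_Nikodym_density => v h _; rewrite -(lne_EFin (g0 v)) (h Logic.I).
Qed.

End kl_density.

Section channel_information.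
Context (R : realType) d (Om : measurableType d) (P : probability Om R) (m : nat).
Context (a : 'I_m -> Om -> R).
Hypothesis ma : forall r, measurable_fun setT (a r).
Hypothesis a2 : forall r, P.-integrable setT (EFin \o (fun w => a r w ^+ 2)).
Context d' (S : measurableType d') (Pr : probability S R).
Context (X : {mfun S >-> Om}) (Y : {mfun S >-> m.-tuple R}).
Local Notation gam := (std_gaussian R m).
Hypothesis H : forall f : m.-tuple R * Om -> \bar R, measurable_fun setT f -> (forall u, 0 <= f u)%E ->
  (\int[Pr]_s f (Y s, X s) = \int[(gam \x P)%E]_u f (Yof a u, u.2))%E.
Local Notation mu := (distribution Pr (pair_rv X Y)).
Local Notation nu := (distribution Pr X \x distribution Pr Y)%E.

(** With respect to the noise, Y given X has density [lik] and Y alone has density [zeta]; their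
    ratio is the density of the joint law with respect to the product of the marginals. *)
Definition density (v : Om * m.-tuple R) : R := lik a v.1 v.2 / zeta P a v.2.

Lemma density_gt0 v : 0 < density v.
Proof. by rewrite divr_gt0 ?expR_gt0// zeta_gt0. Qed.

Lemma measurable_density : measurable_fun setT density.
Proof.
apply: measurable_funM; first exact: (measurable_likT ma measurable_fst measurable_snd).
rewrite (_ : (fun x => _) = fun y : Om * m.-tuple R => expR (- ln (zeta P a y.2))).
  apply: measurableT_comp => //; apply: measurable_funN.
  apply: (measurableT_comp (@measurable_ln R)).
  exact: (measurableT_comp (measurable_zeta P ma) measurable_snd).
by apply/funext => y; rewrite expRN lnK// posrE zeta_gt0.
Qed.

Lemma law_X f : measurable_fun setT f -> (forall x, 0 <= f x)%E ->
  (\int[distribution Pr X]_x f x = \int[P]_x f x)%E.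
Proof.
move=> mf f0; rewrite ge0_integral_distribution//.
rewrite (H (f := fun u => f u.2))//; last exact: (measurableT_comp mf measurable_snd).
exact: ge0_integral_marg2.
Qed.

Lemma law_Y f : measurable_fun setT f -> (forall y, 0 <= f y)%E ->
  (\int[distribution Pr Y]_y f y = \int[gam]_y ((zeta P a y)%:E * f y))%E.
Proof.
move=> mf f0; rewrite ge0_integral_distribution//.
rewrite (H (f := fun u => f u.1))//; last exact: (measurableT_comp mf measurable_fst).
exact: plantedY.
Qed.

Lemma joint_density f : measurable_fun setT f -> (forall v, 0 <= f v)%E ->
  (\int[mu]_v f v = \int[nu]_v ((density v)%:E * f v))%E.
Proof.
move=> mf f0; rewrite ge0_integral_distribution//=.
rewrite (H (f := fun u => f (u.2, u.1)))//; last first.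
  by apply: (measurableT_comp mf); apply: measurable_fun_pair; [exact: measurable_snd|exact: measurable_fst].
rewrite (@planted_joint _ _ _ _ _ _ ma (fun u => f (u.2, u.1)))//; last first.
  by apply: (measurableT_comp mf); apply: measurable_fun_pair; [exact: measurable_snd|exact: measurable_fst].
have mdf : measurable_fun setT (fun v => (density v)%:E * f v)%E.
  by apply: emeasurable_funM => //; apply/measurable_EFinP; exact: measurable_density.
have df0 v : (0 <= (density v)%:E * f v)%E by rewrite mule_ge0// lee_fin ltW ?density_gt0.
have mfy y : measurable_fun setT (fun x => f (x, y)) 
  by apply: (measurableT_comp mf); apply: measurable_fun_pair; [exact: measurable_id|exact: measurable_cst].
have mdfy y : measurable_fun setT (fun x => (density (x, y))%:E * f (x, y))%E.
  by apply: (measurableT_comp mdf); apply: measurable_fun_pair; [exact: measurable_id|exact: measurable_cst].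
rewrite (@fubini_tonelli2 _ _ _ _ _ (distribution Pr X) (distribution Pr Y) _ mdf df0).
rewrite law_Y; last 2 first.
- exact: (@measurable_fun_fubini_tonelli_G _ _ _ _ _ (distribution Pr X) _ mdf df0).
- by move=> y; apply: integral_ge0 => x _; exact: df0.
apply: eq_integral => y _; rewrite /fubini_G law_X//.
have z0 : 0 < zeta P a y by exact: zeta_gt0.
rewrite -ge0_integralZl//; last by rewrite lee_fin ltW.
by apply: eq_integral => x _; rewrite muleA -EFinM /density /= mulrC divfK// gt_eqF.
Qed.

(** At the observation Z + a, the log-likelihood is the sum of Z a + a^2 / 2: the term in Z is
    centred and independent of a, the other gives half the energy of the signal, and ln zeta gives
    [Dch]. *)
Lemma channel_mutual_information :
  mutual_information Pr X Y = ((\sum_r \int[P]_w (a r w ^+ 2)) / 2 - Dch P a)%:E.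
Proof.
have mld : measurable_fun setT (fun v => ln (density v)) by exact: (measurableT_comp (@measurable_ln R) measurable_density).
rewrite /mutual_information (kl_density measurable_density density_gt0); last first.
  move=> E mE; have := joint_density (f := fun v => (\1_E v)%:E).
  rewrite integral_indic// setIT => ->//; last by apply/measurable_EFinP; exact: measurable_indic.
  by rewrite [RHS]integral_mkcond; apply: eq_integral => v _; rewrite epatch_indic.
rewrite (@transfer_integral _ _ _ _ _ (gam \x P)%E mu (fun u => (u.2, Yof a u))); last 2 first.
- move=> f mf f0; rewrite ge0_integral_distribution//=.
  rewrite (H (f := fun u => f (u.2, u.1)))//.
  by apply: (measurableT_comp mf); apply: measurable_fun_pair; [exact: measurable_snd|exact: measurable_fst].
- exact/measurable_EFinP.
have ia r := a_integrable ma a2 r.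
have gs r := gauss_signal_Rintegral r (ma r) (ia r).
have ia2 r := rintegrable_marg2 gam (measurable_funX 2 (ma r)) (a2 r).
have E u : ln (density (u.2, Yof a u)) =
    \sum_r (tnth u.1 r * a r u.2 + 2^-1 * a r u.2 ^+ 2) - ln (zeta P a (Yof a u)).
  rewrite /density lnM ?posrE ?invr_gt0 ?expR_gt0 ?zeta_gt0// lnV ?posrE ?zeta_gt0// expRK; congr (_ - _).
  by apply: eq_bigr => r _; rewrite tnth_mktuple /=; field.
rewrite (eq_integral (fun u : m.-tuple R * Om => (\sum_r (tnth u.1 r * a r u.2 + 2^-1 * a r u.2 ^+ 2) - ln (zeta P a (Yof a u)))%:E)); last first.
  by move=> u _; rewrite E.
have i1 r := rintegrableD (gs r).1 (rintegrableZ 2^-1 (ia2 r)).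
have i2 := lnzeta_integrable ma ma a2.
rewrite rintegralE; last by apply: rintegrableB => //; exact: rintegrable_sum.
rewrite rintB//; last exact: rintegrable_sum.
congr (_ - _)%:E; rewrite Rintegral_sum// mulr_suml; apply: eq_bigr => r _.
rewrite rintD//; [|exact: (gs r).1|exact: (rintegrableZ 2^-1 (ia2 r))].
rewrite (gs r).2 add0r rintZ// mulrC; congr (_ * _).
exact: (@Rintegral_marg2 _ _ _ _ _ gam P (fun w => a r w ^+ 2) (measurable_funX 2 (ma r))).
Qed.

End channel_information.

Section channel_estimation.
Context (R : realType) d (Om : measurableType d) (P : probability Om R) (m : nat).
Context (a : 'I_m -> Om -> R).
Hypothesis ma : forall r, measurable_fun setT (a r).
Hypothesis a2 : forall r, P.-integrable setT (EFin \o (fun w => a r w ^+ 2)).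
Local Notation gam := (std_gaussian R m).
Local Notation Q := (gam \x P)%E.

Lemma sqr_lik_integrable r y t :
  P.-integrable setT (EFin \o (fun w => (a r w - t) ^+ 2 * lik a w y)).
Proof.
apply: lik_rintegrable => //.
  by apply: measurable_funX; apply: measurable_funB => //; exact: measurable_cst.
rewrite (_ : (fun w => (a r w - t) ^+ 2) = fun w => a r w ^+ 2 - (2 * t) * a r w + t ^+ 2); last first.
  by apply/funext => w; ring.
apply: rintegrableD; last exact: (rintegrable_cst _ (probability_setT P)).
by apply: rintegrableB => //; apply: rintegrableZ; exact: (a_integrable ma a2).
Qed.

(** At each y the posterior quadratic error is minimal at the posterior mean, the excess being zeta
    (th - post)^2. *)
Lemma channel_error_ge r (th : m.-tuple R -> R) : measurable_fun setT th ->
  ((\int[P]_w (a r w ^+ 2) - Mch P a r)%:E <=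
   \int[Q]_u ((a r u.2 - th (Yof a u)) ^+ 2)%:E)%E.
Proof.
move=> mth.
rewrite (@planted_joint _ _ _ P _ _ ma (fun u => ((a r u.2 - th u.1) ^+ 2)%:E)); last 2 first.
- apply/measurable_EFinP; apply: measurable_funX; apply: measurable_funB.
    exact: (measurableT_comp (ma r) measurable_snd).
  exact: (measurableT_comp mth measurable_fst).
- by move=> u; rewrite lee_fin sqr_ge0.
rewrite -(variance_integral r ma a2).
have mF (t : m.-tuple R -> R) : measurable_fun setT t ->
    measurable_fun setT (fun y => \int[P]_w ((a r w - t y) ^+ 2 * lik a w y)%:E)%E.
  move=> mt; apply: (@measurable_fun_fubini_tonelli_F _ _ _ _ _ P
    (fun u : m.-tuple R * Om => ((a r u.2 - t u.1) ^+ 2 * lik a u.2 u.1)%:E)).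
    apply/measurable_EFinP; apply: measurable_funM; last exact: measurable_lik2.
    apply: measurable_funX; apply: measurable_funB.
      exact: (measurableT_comp (ma r) measurable_snd).
    exact: (measurableT_comp mt measurable_fst).
  by move=> u; rewrite lee_fin mulr_ge0 ?sqr_ge0 ?expR_ge0.
have F0 (t : m.-tuple R -> R) y : (0 <= \int[P]_w ((a r w - t y) ^+ 2 * lik a w y)%:E)%E.
  by apply: integral_ge0 => w _; rewrite lee_fin mulr_ge0 ?sqr_ge0 ?expR_ge0.
have -> : (\int[gam]_y \int[P]_w ((lik a w y)%:E * ((a r (y, w).2 - th (y, w).1) ^+ 2)%:E) =
    \int[gam]_y \int[P]_w ((a r w - th y) ^+ 2 * lik a w y)%:E)%E.
  by apply: eq_integral => y _; apply: eq_integral => w _; rewrite -EFinM mulrC.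
apply: ge0_le_integral => //; do ?[by apply: mF|by move=> y _; exact: F0].
  by apply: mF; exact: measurable_post.
move=> y _.
rewrite !rintegralE; [|exact: sqr_lik_integrable|exact: sqr_lik_integrable].
rewrite lee_fin !(post_variance ma a2).
rewrite -subr_ge0.
set A := \int[P]_w _; set p := post _ _ _ _; set z := zeta _ _ _.
have -> : A - 2 * th y * (p * z) + th y ^+ 2 * z - (A - 2 * p * (p * z) + p ^+ 2 * z) = z * (th y - p) ^+ 2 by ring.
by rewrite mulr_ge0 ?sqr_ge0// ltW// zeta_gt0.
Qed.

Lemma channel_error_post r :
  (\int[Q]_u ((a r u.2 - post P a r (Yof a u)) ^+ 2)%:E)%E =
  (\int[P]_w (a r w ^+ 2) - Mch P a r)%:E.
Proof.
rewrite (@planted_joint _ _ _ P _ _ ma (fun u => ((a r u.2 - post P a r u.1) ^+ 2)%:E)); last 2 first.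
- apply/measurable_EFinP; apply: measurable_funX; apply: measurable_funB.
    exact: (measurableT_comp (ma r) measurable_snd).
  exact: (measurableT_comp (measurable_post P ma r) measurable_fst).
- by move=> u; rewrite lee_fin sqr_ge0.
rewrite -(variance_integral r ma a2); apply: eq_integral => y _; apply: eq_integral => w _.
by rewrite -EFinM mulrC.
Qed.

End channel_estimation.

Section model_quantities.
Context (R : realType) (k : nat) (P0 : probability (k.-tuple R) R).
Hypothesis P2 : forall c, P0.-integrable setT (EFin \o (fun x => tnth x c ^+ 2)).
Context (n : nat) (M : spiked_model P0 n) (l : R).
Hypotheses (n0 : (0 < n)%N) (l0 : 0 < l).
Local Notation P := (sm_prob M).
Local Notation m := #|{: edge n}|.
Local Notation gam := (std_gaussian R m).
Local Notation Pn := (iid_law P0 n).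
Local Notation a := (scaled (@edgeS R k n) l).

Let ma r : measurable_fun setT (a r).
Proof. by apply: measurable_funM => //; exact: measurable_edgeS. Qed.

Let a2 r : Pn.-integrable setT (EFin \o (fun w => a r w ^+ 2)).
Proof. by have [] := edgeS_sqint P2 n0 l r. Qed.

Let transfer (f : m.-tuple R * n.-tuple (k.-tuple R) -> \bar R) :
  measurable_fun setT f -> (forall u, 0 <= f u)%E ->
  (\int[P]_s f (Yvec l s, Xvec s) = \int[(gam \x Pn)%E]_u f (Yof a u, u.2))%E.
Proof.
move=> mf f0; rewrite -(@ge0_integral_ZX _ _ _ _ M (fun u => f (Yof a u, u.2))).
- by apply: eq_integral => s _; rewrite YvecE// ltW.
- apply: (measurableT_comp mf); apply: measurable_fun_pair; [exact: measurable_Yof|exact: measurable_snd].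
- by move=> u; exact: f0.
Qed.

Lemma MI_eq : MI M l = (l * (n%:R - 1) / 4 * fsq (second_moment P0) - DN P0 n l)%:E.
Proof.
rewrite /MI (channel_mutual_information ma a2 transfer); congr (_ - _)%:E.
by rewrite (edge_signal_energy P2 n0 (ltW l0)).2; field.
Qed.

(** The edge signal is sqrt (l / n) times the overlap; [kap] undoes this factor, so that errors on
    the overlap are n / l times errors on the signal. *)
Let kap : R := Num.sqrt n%:R / Num.sqrt l.

Let nR : 0 < n%:R :> R. Proof. by rewrite ltr0n. Qed.

Let kap0 : 0 < kap. Proof. by rewrite divr_gt0// sqrtr_gt0. Qed.

Let kap2 : kap ^+ 2 = n%:R / l.
Proof. by rewrite exprMn exprVn !sqr_sqrtr ?ltW. Qed.

Let overlapE (r : 'I_m) (s : sm_space M) : overlap (enum_val r) s = kap * a r (Xvec s).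
Proof.
rewrite /scaled /edgeS /kap.
have sn : Num.sqrt n%:R != 0 :> R by rewrite gt_eqF// sqrtr_gt0.
have sl : Num.sqrt l != 0 by rewrite gt_eqF// sqrtr_gt0.
rewrite mulrA divfK// mulrA mulfV// mul1r /overlap /dotp mxE.
by apply: eq_bigr => c _; rewrite !mxE !tnth_mktuple.
Qed.

Let errorE (r : 'I_m) (th : m.-tuple R -> R) : measurable_fun setT th ->
  ('E_P[fun w : sm_space M => ((overlap (enum_val r) w - th (Yvec l w)) ^+ 2)%R] =
  (n%:R / l)%:E * \int[(gam \x Pn)%E]_u ((a r u.2 - kap^-1 * th (Yof a u)) ^+ 2)%:E)%E.
Proof.
move=> mth; rewrite unlock.
have mf : measurable_fun setT (fun u : m.-tuple R * n.-tuple (k.-tuple R) =>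
    ((a r u.2 - kap^-1 * th u.1) ^+ 2)%:E).
  apply/measurable_EFinP; apply: measurable_funX; apply: measurable_funB.
    exact: (measurableT_comp (ma r) measurable_snd).
  by apply: measurable_funM => //; exact: (measurableT_comp mth measurable_fst).
rewrite -ge0_integralZl//; last 3 first.
- exact: (measurableT_comp mf (measurable_fun_pair (measurable_Yof ma) measurable_snd)).
- by move=> u _; rewrite lee_fin sqr_ge0.
- by rewrite lee_fin divr_ge0// ltW.
rewrite -(transfer (f := fun u => (n%:R / l)%:E * ((a r u.2 - kap^-1 * th u.1) ^+ 2)%:E)%E).
- apply: eq_integral => w _; rewrite -EFinM -kap2 -exprMn mulrBr (mulrA kap kap^-1) mulfV ?gt_eqF// mul1r.
  by rewrite overlapE.
- by apply: emeasurable_funM.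
- by move=> u; rewrite -EFinM lee_fin mulr_ge0 ?sqr_ge0// divr_ge0// ltW.
Qed.

Lemma MMSE_eq : (1 < n)%N -> MMSE M l =
  (fsq (second_moment P0) - 2 / (l * (n%:R - 1)) * \sum_r Mch Pn a r)%:E.
Proof.
move=> n1.
have n1R : 0 < n%:R - 1 :> R by rewrite subr_gt0 ltr1n.
have nn1 : (n * n.-1)%:R = n%:R * (n%:R - 1) :> R.
  by rewrite natrM -subn1 natrB.
pose V r := n%:R / l * (\int[Pn]_w (a r w ^+ 2) - Mch Pn a r).
have VE : fsq (second_moment P0) - 2 / (l * (n%:R - 1)) * \sum_r Mch Pn a r =
    2 / (n * n.-1)%:R * \sum_r V r.
  rewrite /V -mulr_sumr sumrB (edge_signal_energy P2 n0 (ltW l0)).2 nn1.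
  by move: (\sum_r _) (fsq _) => S F; field; rewrite !gt_eqF.
have reind (F : edge n -> \bar R) : (\sum_(e : edge n) F e = \sum_(r < m) F (enum_val r))%E.
  pose ev (r : 'I_m) : edge n := enum_val r.
  have bev : bijective ev by exists (fun e => enum_rank e); [exact: enum_valK|exact: enum_rankK].
  by rewrite (reindex ev)//; exact: onW_bij.
rewrite VE EFinM -sumEFin; apply/eqP; rewrite eq_le; apply/andP; split.
  have mth e : measurable_fun setT (fun y => kap * post Pn a (enum_rank e) y).
    by apply: measurable_funM => //; exact: measurable_post.
  apply: ereal_inf_lbound; exists (fun e => mfun_Sub (mem_set (mth e))) => //.
  congr (_ * _)%E; rewrite reind; apply: eq_bigr => r _.
  apply: etrans (errorE r (mth (enum_val r))) _.
  rewrite [in RHS]/V [RHS]EFinM -(channel_error_post ma a2 r); congr (_ * _)%E.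
  by apply: eq_integral => u _; rewrite enum_valK mulKf// gt_eqF.
apply: le_ereal_inf_tmp => _ [th _ <-].
apply: lee_wpmul2l; first by rewrite lee_fin divr_ge0.
rewrite reind; apply: lee_sum => r _.
have mt : measurable_fun setT (th (enum_val r)) by [].
rewrite (errorE r mt) /V [leLHS]EFinM; apply: lee_wpmul2l; first by rewrite lee_fin divr_ge0// ltW.
apply: (@channel_error_ge _ _ _ _ _ _ ma a2 r (fun y => kap^-1 * th (enum_val r) y)).
by apply: measurable_funM.
Qed.

End model_quantities.

(** The slack e splits evenly: one half from the slope error e / (4 l), the other from the two
    approximations within e d / (8 l). *)
Lemma slope_upper (R : realFieldType) (l d Q e s x1 x0 p1 p0 : R) : 0 < l -> 0 < d ->
  d / 2 * s <= l * (x1 - x0) -> `|p1 - x1| <= e * d / (8 * l) -> `|p0 - x0| <= e * d / (8 * l) ->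
  p1 - p0 <= d * (Q / 4 + e / (4 * l)) -> s <= l * Q / 2 + e.
Proof.
move=> l0 d0 h; rewrite !ler_norml => /andP[h1 _] /andP[_ h2] h3.
have d2 : 0 < d / 2 by rewrite divr_gt0.
rewrite -(ler_pM2l d2); apply: le_trans h _.
have -> : d / 2 * (l * Q / 2 + e) = l * (d * (Q / 4 + e / (4 * l)) + 2 * (e * d / (8 * l))).
  by field; rewrite gt_eqF.
rewrite ler_pM2l//; move: (e * d / (8 * l)) (d * _) h1 h2 h3 => eta z h1 h2 h3; lra.
Qed.

Lemma slope_lower (R : realFieldType) (l d Q e s x1 x0 p1 p0 : R) : 0 < l -> 0 < d ->
  l * (x1 - x0) <= d / 2 * s -> `|p1 - x1| <= e * d / (8 * l) -> `|p0 - x0| <= e * d / (8 * l) ->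
  d * (Q / 4 - e / (4 * l)) <= p1 - p0 -> l * Q / 2 - e <= s.
Proof.
move=> l0 d0 h; rewrite !ler_norml => /andP[_ h1] /andP[h2 _] h3.
have d2 : 0 < d / 2 by rewrite divr_gt0.
rewrite -(ler_pM2l d2); apply: le_trans h.
have -> : d / 2 * (l * Q / 2 - e) = l * (d * (Q / 4 - e / (4 * l)) - 2 * (e * d / (8 * l))).
  by field; rewrite gt_eqF.
rewrite ler_pM2l//; move: (e * d / (8 * l)) (d * _) h1 h2 h3 => eta z h1 h2 h3; lra.
Qed.

(** * Limits of the information and of the error *)

Section limits.
Context (R : realType) (k' : nat).
Local Notation k := k'.+1.
Context (P0 : probability (k.-tuple R) R).
Hypothesis P2 : forall c, P0.-integrable setT (EFin \o (fun x => tnth x c ^+ 2)).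
Local Notation F2 := (fsq (second_moment P0)).

Lemma DN_cvg l : 0 <= l -> (n%:R^-1 * DN P0 n l) @[n --> \oo] --> max_fe P0 l.
Proof.
move=> l0; apply/cvgrPdist_le => e e0.
have [pq hq] := qmaxP P2 l0.
have [n1 h1] := DN_eventually_ge P2 (sqrtmx (qmax P0 l)) l0 e0.
have G B : DK P0 l B - l * fsq (B^T *m B) / 4 <= max_fe P0 l.
  have := hq _ (psd_gram B); rewrite -(gB_fe P2 B l0) /gB.
  by rewrite [l / 4 * _]mulrAC.
have [n2 h2] := DN_eventually_le P2 l0 e0 G.
exists (maxn 1 (maxn n1 n2)) => // n /=; rewrite !geq_max => /andP[n0 /andP[nn1 nn2]].
have nR : 0 < n%:R :> R by rewrite ltr0n.
have := h1 n n0 nn1; have := h2 n n0 nn2; rewrite sqrtmx_gram//.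
have -> : DK P0 l (sqrtmx (qmax P0 l)) - l * fsq (qmax P0 l) / 4 = max_fe P0 l.
  by rewrite /max_fe /fe [l / 4 * _]mulrAC.
move: (max_fe P0 l) (DN P0 n l) => p D; rewrite -(ler_pdivrMl _ _ nR) -(ler_pdivlMl _ _ nR) => a b.
by rewrite ler_norml; apply/andP; split; lra.
Qed.

(** At a fixed scale d the normalized entropies converge at l - d, l and l + d, and the two I-MMSE
    inequalities pinch the second moment between difference quotients of the limit; limit and
    derivative are never exchanged. *)
Lemma Mch_cvg l Q : 0 < l ->
  (forall e, 0 < e -> exists d, [/\ 0 < d, d < l,
     max_fe P0 (l + d) - max_fe P0 l <= d * (Q / 4 + e) &
     d * (Q / 4 - e) <= max_fe P0 l - max_fe P0 (l - d)]) ->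
  n%:R^-1 * (\sum_r Mch (iid_law P0 n) (scaled (@edgeS R k n) l) r) @[n --> \oo] --> l * Q / 2.
Proof.
move=> l0 H; apply/cvgrPdist_le => e e0.
have [|d [d0 dl up lo]] := H (e / (4 * l)); first by rewrite divr_gt0// mulr_gt0.
have eta0 : 0 < e * d / (8 * l) by rewrite divr_gt0// mulr_gt0.
have ld : 0 <= l - d by rewrite subr_ge0 ltW.
have ld' : 0 <= l + d by rewrite addr_ge0// ltW.
have c0 := DN_cvg (ltW l0); have c1 := DN_cvg ld'; have c2 := DN_cvg ld.
move/cvgrPdist_le : c0 => /(_ _ eta0) c0; move/cvgrPdist_le : c1 => /(_ _ eta0) c1.
move/cvgrPdist_le : c2 => /(_ _ eta0) c2.
have [[N0 _ h0] [N1 _ h1] [N2 _ h2]] := And3 c0 c1 c2.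
exists (maxn 1 (maxn N0 (maxn N1 N2))) => // n /=; rewrite !geq_max => /and4P[n0 n00 n01 n02].
have nR : 0 <= n%:R^-1 :> R by rewrite invr_ge0.
have a0 := h0 n n00; have a1 := h1 n n01; have a2 := h2 n n02; rewrite /= in a0 a1 a2.
have ms r : measurable_fun setT (@edgeS R k n r) by exact: measurable_edgeS.
have s2 r : (iid_law P0 n).-integrable setT (EFin \o (fun w => @edgeS R k n r w ^+ 2)).
  have [I _] := edgeS_sqint P2 n0 1 r; move: I; rewrite /scaled sqrtr1.
  by under eq_fun do rewrite mul1r.
have dle : 0 <= d <= l by rewrite !ltW.
have g1 := Dch_increment_ge ms s2 (ltW l0) (ltW d0).
have g2 := Dch_increment_le ms s2 dle.
rewrite -!/(DN P0 n _) in g1 g2.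
have {}g1 := ler_wpM2l nR g1; have {}g2 := ler_wpM2l nR g2.
set S := \sum_r _ in g1 g2 *.
have u : n%:R^-1 * S <= l * Q / 2 + e.
  apply: (slope_upper l0 d0 _ a1 a0 up).
  by rewrite -mulrBr mulrCA [leRHS]mulrCA.
have v : l * Q / 2 - e <= n%:R^-1 * S.
  apply: (slope_lower l0 d0 _ a0 a2 lo).
  by rewrite -mulrBr mulrCA [leRHS]mulrCA.
by rewrite ler_distlC v u.
Qed.

Lemma MI_cvg (M : forall n, spiked_model P0 n) l : 0 < l ->
  ((n%:R^-1)%:E * MI (M n) l)%E @[n --> \oo] --> (l * F2 / 4 - max_fe P0 l)%:E.
Proof.
move=> l0; rewrite -cvg_shiftS /=.
rewrite (_ : (fun n => _) = EFin \o (fun n => (l * F2 / 4 * (1 - n.+1%:R^-1) - n.+1%:R^-1 * DN P0 n.+1 l))); last first.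
  apply/funext => n /=; rewrite (MI_eq P2) ?ltr0n// -EFinM; congr EFin.
  by move: (DN _ _ _) F2 => D F; field; rewrite addrC natr1 pnatr_eq0.
apply: cvg_EFin; first exact: nearW.
apply: cvgB; last by have := DN_cvg (ltW l0); rewrite -cvg_shiftS.
rewrite -[X in _ --> X]mulr1; apply: cvgM; first exact: cvg_cst.
rewrite -[X in _ --> X]subr0; apply: cvgB; first exact: cvg_cst.
exact: cvg_harmonic.
Qed.

Lemma MMSE_cvg (M : forall n, spiked_model P0 n) l Q : 0 < l ->
  (forall e, 0 < e -> exists d, [/\ 0 < d, d < l,
     max_fe P0 (l + d) - max_fe P0 l <= d * (Q / 4 + e) &
     d * (Q / 4 - e) <= max_fe P0 l - max_fe P0 (l - d)]) ->
  MMSE (M n) l @[n --> \oo] --> (F2 - Q)%:E.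
Proof.
(* Sizes 0 and 1 have no pairs, and [MMSE_eq] asks for n > 1. *)
move=> l0 H; rewrite -(cvg_shiftn 2) /=.
pose S n := n%:R^-1 * (\sum_r Mch (iid_law P0 n) (scaled (@edgeS R k n) l) r).
(* At size n + 2 the ratio of the size to the size minus one is 1 + 1 / (n + 1). *)
rewrite (_ : (fun n => _) = EFin \o (fun n => F2 - 2 / l * (1 + n.+1%:R^-1) * S (n + 2)%N)); last first.
  apply/funext => n /=; rewrite (MMSE_eq P2) ?addn2//; congr EFin; rewrite /S.
  move: (\sum_r _) F2 => D F; rewrite -!natr1.
  by field; rewrite (gt_eqF l0) !natr1 !pnatr_eq0.
apply: cvg_EFin; first exact: nearW.
apply: cvgB; first exact: cvg_cst.
rewrite (_ : Q = 2 / l * (1 + 0) * (l * Q / 2)); last by field; rewrite gt_eqF.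
apply: cvgM; last by have := Mch_cvg l0 H; rewrite -(cvg_shiftn 2).
apply: cvgM; first exact: cvg_cst.
by apply: cvgD; [exact: cvg_cst|exact: cvg_harmonic].
Qed.

End limits.

Lemma finite_second_moment_coord (R : realType) (k : nat) (P0 : probability (k.-tuple R) R) :
  finite_second_moment P0 ->
  forall c, P0.-integrable setT (EFin \o (fun x => tnth x c ^+ 2)).
Proof.
move=> fin c; apply/integrableP; split.
  by apply/measurable_EFinP; apply: measurable_funX; exact: measurable_tnth.
apply: le_lt_trans fin; apply: ge0_le_integral => //.
- by apply: measurableT_comp => //; apply/measurable_EFinP; apply: measurable_funX; exact: measurable_tnth.
- apply/measurable_EFinP; rewrite (_ : (fun x => _) = fun x : k.-tuple R => \sum_i tnth x i * tnth x i).
    by apply: measurable_sum => i; apply: measurable_funM; exact: measurable_tnth.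
  by apply/funext => x; rewrite /dotp mxE; apply: eq_bigr => i _; rewrite !mxE.
move=> x _ /=; rewrite lee_fin ger0_norm ?sqr_ge0// /dotp mxE (bigD1 c)//= !mxE -expr2 lerDl.
by apply: sumr_ge0 => i _; rewrite !mxE -expr2 sqr_ge0.
Qed.

Theorem theorem12 (R : realType) (k : nat) (k_ge1 : (1 <= k)%N)
    (P0 : probability (k.-tuple R) R) (P0_L2 : finite_second_moment P0)
    (M : forall n : nat, spiked_model P0 n) :
  (forall l : R, 0 < l ->
     ((n%:R^-1)%:E * MI (M n) l)%E @[n --> \oo] -->
       ((l * mxnorm (second_moment P0) ^+ 2 / 4)%:E
        - ereal_sup [set free_energy P0 l q | q in @psd R k])%E)
  /\
  {ae lebesgue_measure, forall l : R, 0 < l ->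
     exists qstar : R,
       [/\ exists q, is_maximizer P0 l q,
           forall q, is_maximizer P0 l q -> mxnorm q ^+ 2 = qstar ^+ 2
         & MMSE (M n) l @[n --> \oo] -->
             (mxnorm (second_moment P0) ^+ 2 - qstar ^+ 2)%:E]}.
Proof.
have P2 := finite_second_moment_coord P0_L2.
case: k k_ge1 P0 P0_L2 M P2 => [//|k'] _ P0 _ M P2.
split=> [l l0|].
  rewrite (ereal_sup_free_energy P2 (ltW l0)) mxnorm_sqr -EFinB.
  exact: MI_cvg.
(* The exceptional set is built from one chosen maximizer at each l; off it, [max_fe_slope] covers
   all maximizers, so the choice is immaterial. *)
have [A [mA A0 jA]] := ae_no_jump (fun l => l ^+ 2 * fsq (qmax P0 l)).
exists A; split=> // l /= nl; apply: jA => /= nj; apply: nl => l0.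
have [Q [hQ dQ]] := max_fe_slope P2 l0 (nj l0).
have mq : is_maximizer P0 l (qmax P0 l).
  by apply/(is_maximizer_max_fe P2 _ (ltW l0)); split => //; case: (qmaxP P2 (ltW l0)).
exists (mxnorm (qmax P0 l)); split.
- by exists (qmax P0 l).
- by move=> q mq'; rewrite !mxnorm_sqr (hQ _ mq') (hQ _ mq).
- by rewrite !mxnorm_sqr (hQ _ mq); exact: MMSE_cvg.
Qed.
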